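(* There is a non-decreasing function $f:(0,1]\to(0,1]$ such that the following holds. For every $\alpha>0$ there exists $\tau=\tau(\alpha)$ with $0<\tau<1$ such that, for every $\nu$ with $0<\nu\le\tau$, there exists $n_0=n_0(\alpha,\nu,\tau)\in\mathbb{N}$ for which the following holds. Suppose that $G$ is a (simple, finite) graph on $n\ge n_0$ vertices satisfying: (i) $\Delta(G)\ge \alpha n$ and $d_G(u)+d_G(v)\ge \Delta(G)+2$ for every edge $uv\in E(G)$; (ii) for some $\eta$ with $0<\eta\le f(\nu)$, we have $|U_\eta(G)|<\eta^2 n$, where $U_\eta(G)=\{v\in V(G): \Delta(G)-|N_G(v)|>\eta n\}$; (iii) $G$ is a robust $(\nu,\tau)$-expander. Then $\chi'(G)=\Delta(G)$ if and only if $G$ contains no $\Delta(G)$-overfull subgraph.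
   Context: All graphs are finite and simple. $\Delta(G)$ is the maximum degree, $d_G(v)$ the degree and $N_G(v)$ the set of neighbors of $v$. $\chi'(G)$ is the chromatic index of $G$ (least number of colors in a proper edge coloring). A subgraph $H$ of $G$ is $\Delta(G)$-overfull if $|E(H)|>\Delta(G)\lfloor |V(H)|/2\rfloor$. For $0<\nu\le\tau<1$, a graph $G$ on $n$ vertices is a robust $(\nu,\tau)$-expander if, for every $S\subseteq V(G)$ with $\tau n\le |S|\le (1-\tau)n$, the number of vertices of $G$ that have at least $\nu n$ neighbors in $S$ is at least $|S|+\nu n$. *)

(* Defs.v *)
From HB Require Import structures.
From mathcomp Require Import all_boot all_order all_algebra.
From mathcomp Require Import reals.
Set Implicit Arguments.
Unset Strict Implicit.
Unset Printing Implicit Defensive.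
Import Order.TTheory GRing.Theory Num.Theory.

Record sgraph := SGraph {
  vertex :> finType;
  adj : rel vertex;
  adj_sym : symmetric adj;
  adj_irrefl : irreflexive adj }.

Section Graph.
Variable G : sgraph.

Definition nbrs (v : G) : {set G} := [set w | adj v w].
Definition deg (v : G) : nat := #|nbrs v|.
Definition max_deg : nat := \max_(v : G) deg v.

Definition edges : {set {set G}} := [set [set p.1; p.2] | p : G * G & adj p.1 p.2].

(* Colorings are defined on the type of edges only, so that an edgeless graph
   has a coloring with 0 colors. *)
Definition edge : finType := {e : {set G} | e \in edges}.

Definition proper_edge_coloring (k : nat) (c : {ffun edge -> 'I_k}) : bool :=
  [forall e1 : edge, forall e2 : edge,
    (e1 != e2) && (val e1 :&: val e2 != set0) ==> (c e1 != c e2)].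

Definition edge_colorable (k : nat) : bool :=
  [exists c : {ffun edge -> 'I_k}, proper_edge_coloring c].

Lemma ex_edge_colorable : exists k, edge_colorable k.
Proof.
exists #|{: edge}|; apply/existsP; exists [ffun e => enum_rank e].
apply/forallP=> e1; apply/forallP=> e2; apply/implyP=> /andP[ne _].
by rewrite !ffunE (inj_eq enum_rank_inj).
Qed.

Definition chromatic_index : nat := ex_minn ex_edge_colorable.

(* The subgraph with vertex set W and edge set F, not necessarily induced. *)
Definition is_subgraph (W : {set G}) (F : {set {set G}}) : bool :=
  (F \subset edges) && [forall e in F, e \subset W].

Definition overfull (k : nat) (W : {set G}) (F : {set {set G}}) : bool :=
  k * #|W|./2 < #|F|.

Definition has_overfull_subgraph (k : nat) : Prop :=
  exists (W : {set G}) (F : {set {set G}}), is_subgraph W F /\ overfull k W F.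

Variable R : realType.
Local Open Scope ring_scope.

Definition low_deg (eta : R) : {set G} :=
  [set v | eta * #|G|%:R < (max_deg)%:R - #|nbrs v|%:R].

Definition robust_nbrs (nu : R) (S : {set G}) : {set G} :=
  [set v | nu * #|G|%:R <= #|nbrs v :&: S|%:R].

Definition robust_expander (nu tau : R) : Prop :=
  forall S : {set G},
    tau * #|G|%:R <= #|S|%:R <= (1 - tau) * #|G|%:R ->
    #|S|%:R + nu * #|G|%:R <= #|robust_nbrs nu S|%:R.

End Graph.

(* Main.v *)
(* Let D be the maximum degree. If the graph is D-edge-coloured then every
   colour class has at most |W|/2 edges inside W, so there is no D-overfull
   subgraph; the rest concerns the converse.

   The vertices of degree well below D/2 form an independent set U, by (i). A
   vertex w outside U carries one token for each edge to U and one for each of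
   the D - d(w) missing edges. Since no subgraph is overfull, there are enough
   tokens to colour them with D colours so that every colour class is small and
   has the parity of the complement of U; it then remains to find, for every
   colour, a perfect matching of the vertices without a token of this colour,
   all of them disjoint and covering every edge outside U. The few other
   vertices of small degree are precoloured greedily and by Hall's theorem.

   The remaining vertices, all of nearly full degree, are split at random into
   halves A and B, and both into blocks A_a, B_b with a, b in (Z/m)^2. All but
   r colours are designed so as to use up the edges inside A and inside B; what
   is left is bipartite of maximum degree r and is coloured by Koenig's theorem.
   For a designed colour one takes a round: the edges between blocks a and a'
   of the same half with (a + a')/2 = c, together with part of the edges between
   A_a and B_{a+k}, form bipartite graphs which are nearly regular outside a
   single block, so that Koenig's theorem yields matchings that are nearly
   perfect outside A_c and B_d. The vertices missed by such a matching are
   matched into A_c and B_d by randomly reserved edges, and the rest of the two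
   blocks is matched by Hall's theorem in a random sparse graph. The latter
   needs every large S in A_c and T in B_d with |S| + |T| not much below
   |A_c| to span many edges. In the whole graph this is what robust expansion
   gives; weak regularity carries it over to random subsets, because S and T
   can be enlarged by the factor n/|A_c| inside the cells of a weakly regular
   partition. The edges left inside the halves are equally many on both sides
   and are finally coloured in pairs. *)
Require Import Defs.
From HB Require Import structures.
From mathcomp Require Import all_boot all_order all_algebra.
From mathcomp Require Import reals sequences exp zify ring lra.
Set Implicit Arguments.
Unset Strict Implicit.
Unset Printing Implicit Defensive.

(** * Bipartite edge colouring and the theorem of Hall *)

(** How many edges a colour takes inside each half is not free: their difference is the difference
    of the numbers of vertices it covers in [A] and [B] ([pmatch_balance]). Summed over all colours,
    the edges left inside the halves are equally many on both sides exactly when one linear identity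
    between degrees, tokens and sizes holds. With X the other vertices of small degree, this
    identity dictates |A| + |X| = |B| + g, where g is the parity of the complement of U, that tokens
    of the last r colours lie only at A and X, and that x in X keeps r - s(x) edges to B, where s(x)
    counts its tokens in these colours. The same choices make the rest bipartite between A with X
    and B with U.

    All errors are measured in units m^k q, with n about m^26 q, so that comparisons of products
    become comparisons of exponents. About n/m^2 edges per vertex stay inside the halves; spreading
    them evenly takes about n/m colours with n/m edges each. This is why the number of blocks is a
    square, and n/m is harmless to the expansion because m is chosen larger than 4000/nu^2. *)

Lemma missing_color (E : finType) (c : E -> nat) (G : {set E}) D :
  #|G| < D -> exists2 i, i < D & forall g, g \in G -> c g != i.
Proof.
move=> ltGD; pose s := [seq c g | g <- enum G].
have /allPn[i] : ~~ all (mem s) (iota 0 D).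
  apply/negP => /allP sub; have := uniq_leq_size (iota_uniq 0 D) sub.
  by rewrite size_map size_iota -cardE leqNgt ltGD.
rewrite mem_iota /= add0n => iD /negP nis; exists i => // g gG.
by apply/eqP => ci; apply: nis; apply/mapP; exists g; rewrite ?mem_enum.
Qed.

(* The fibres of [a] and [b] are the stars at the two sides of a bipartite
   multigraph with edge set [F]. *)
Lemma konig (E X Y : finType) (a : E -> X) (b : E -> Y) D (F : {set E}) :
    (forall x, #|[set g in F | a g == x]| <= D) ->
    (forall y, #|[set g in F | b g == y]| <= D) ->
  exists c : E -> nat,
    [/\ forall g, g \in F -> c g < D,
        {in F &, forall g h, c g = c h -> a g = a h -> g = h} &
        {in F &, forall g h, c g = c h -> b g = b h -> g = h}].
Proof.
move: {2}#|F| (erefl #|F|) => n; elim: n F => [|n IHn] F cardF degA degB.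
  exists (fun=> 0); have F0 g : g \in F = false.
    by rewrite (cards0_eq cardF) inE.
  by split=> g *; move: (F0 g) => /negP.
have /card_gt0P[e eF] : 0 < #|F| by rewrite cardF.
have [|||c [cD cA cB]] := IHn (F :\ e).
- by move: (cardsD1 e F); rewrite eF cardF => -[].
- move=> x; apply: leq_trans (degA x); apply: subset_leq_card.
  by apply/subsetP => g; rewrite !inE => /andP[/andP[_ ->]].
- move=> x; apply: leq_trans (degB x); apply: subset_leq_card.
  by apply/subsetP => g; rewrite !inE => /andP[/andP[_ ->]].
pose F' := F :\ e; rewrite -/F' in cD cA cB.
have F'F g : g \in F' -> g \in F by rewrite !inE => /andP[].
have inF' g : g \in F -> g != e -> g \in F' by rewrite !inE => -> ->.
(* [al] is free at the left end of [e] (its [a]-end), [be] at its right end (its [b]-end). *)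
have [al alD alP] : exists2 i, i < D &
    forall g, g \in [set g in F' | a g == a e] -> c g != i.
  apply: missing_color; apply: leq_trans (degA (a e)); apply: proper_card.
  apply/properP; split; last by exists e; rewrite !inE ?eqxx ?eF.
  by apply/subsetP => g; rewrite !inE => /andP[/andP[_ ->]].
have [be beD beP] : exists2 i, i < D &
    forall g, g \in [set g in F' | b g == b e] -> c g != i.
  apply: missing_color; apply: leq_trans (degB (b e)); apply: proper_card.
  apply/properP; split; last by exists e; rewrite !inE ?eqxx ?eF.
  by apply/subsetP => g; rewrite !inE => /andP[/andP[_ ->]].
have {}alP g : g \in F' -> a g = a e -> c g != al.
  by move=> gF ag; apply: alP; rewrite inE gF ag eqxx.
have {}beP g : g \in F' -> b g = b e -> c g != be.
  by move=> gF ag; apply: beP; rewrite inE gF ag eqxx.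
(* If [be] is free at the left end too, [e] takes it at once; otherwise a swap along a chain frees
   it. *)
have [/existsP[g0 /and3P[g0F /eqP g0a /eqP g0c]]|/existsPn nstart] :=
    boolP [exists g, [&& g \in F', a g == a e & c g == be]]; last first.
  exists (fun g => if g == e then be else c g); split.
  - by move=> g gF; case: eqP => // /eqP ge; apply/cD/inF'.
  - move=> g h gF hF; case: eqP => [->|/eqP ge]; case: eqP => [->//|/eqP he].
    + move=> ch ah; move: (nstart h); rewrite (inF' h hF he) -ah -ch !eqxx //.
    + by move=> cg ag; move: (nstart g); rewrite (inF' g gF ge) ag cg !eqxx.
    + by apply: cA; apply: inF'.
  - move=> g h gF hF; case: eqP => [->|/eqP ge]; case: eqP => [->//|/eqP he].
    + by move=> ch ah; move: (beP h (inF' h hF he) (esym ah)); rewrite ch eqxx.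
    + by move=> cg ag; move: (beP g (inF' g gF ge) ag); rewrite cg eqxx.
    + by apply: cB; apply: inF'.
have ab : al != be by move: (alP g0 g0F g0a); rewrite g0c eq_sym.
(* The Kempe chain from [g0], oriented: a [be]-edge passes to an [al]-edge at its right end, an
   [al]-edge to a [be]-edge at its left end. So every [al]-edge of the chain shares its right end
   with a [be]-edge, and the swap cannot create a [be]-edge at the right end of [e]. *)
pose r := [rel g h | [&& g \in F', h \in F' &
   [&& c g == be, c h == al & b g == b h] ||
   [&& c g == al, c h == be & a g == a h]]].
pose K := [set h | connect r g0 h].
have K0 : g0 \in K by rewrite in_set connect0.
have Kstep g h : g \in K -> r g h -> h \in K.
  rewrite !in_set => gK rgh.
  exact: (connect_trans gK (@connect1 _ r g h rgh)).
have Kpred h : h \in K -> h = g0 \/ exists2 g, g \in K & r g h.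
  rewrite in_set => /connectP[p]; case/lastP: p => [|p x] /=; first by left.
  rewrite rcons_path last_rcons => /andP[pp rx] ->; right.
  by exists (last g0 p) => //; rewrite in_set; apply/connectP; exists p.
have KF h : h \in K -> h \in F' /\ ((c h = al) \/ (c h = be)).
  case/Kpred=> [->|[g _]]; first by split; [|right].
  by case/and3P=> _ -> /orP[]/and3P[_ /eqP-> _]; split; auto.
have Kbe h : h \in K -> c h = be -> h = g0 \/
    exists g, [/\ g \in K, c g = al & a g = a h].
  move=> /Kpred[->|[g gK]]; first by left.
  case/and3P=> _ _ /orP[]/and3P[/eqP cg /eqP ch /eqP ag] ch'.
    by move: ab; rewrite -ch ch' eqxx.
  by right; exists g.
have Kal h : h \in K -> c h = al -> exists g, [/\ g \in K, c g = be & b g = b h].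
  move=> /Kpred[->|[g gK]]; first by rewrite g0c => /eqP; rewrite eq_sym (negPf ab).
  case/and3P=> _ _ /orP[]/and3P[/eqP cg /eqP ch /eqP ag] ch'; first by exists g.
  by move: ab; rewrite -ch' ch eqxx.
have Kab g h : g \in K -> c g = be -> h \in F' -> c h = al -> b h = b g -> h \in K.
  move=> gK cg hF ch bh; apply: (Kstep g) => //=.
  by rewrite (KF g gK).1 hF cg ch bh !eqxx.
have Kba g h : g \in K -> c g = al -> h \in F' -> c h = be -> a h = a g -> h \in K.
  move=> gK cg hF ch bh; apply: (Kstep g) => //=.
  by rewrite (KF g gK).1 hF cg ch bh !eqxx orbT.
pose sw i := if i == al then be else al.
pose c' g := if g == e then be else if g \in K then sw (c g) else c g.
have swbe : sw be = al by rewrite /sw eq_sym (negPf ab).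
have swal : sw al = be by rewrite /sw eqxx.
have KA g h : g \in K -> h \in F' -> h \notin K -> a g = a h -> sw (c g) <> c h.
  move=> gK hF hK ag; have [gF [cg|cg]] := KF g gK; rewrite cg ?swbe ?swal => ch.
    by move/negP: hK; apply; apply: (Kba g).
  case: (Kbe g gK cg) => [gg0|[k [kK ck ak]]].
    by move: (alP h hF); rewrite -ag gg0 -ch eqxx => /(_ g0a).
  have hk : h = k by apply: cA => //; [apply: (KF k kK).1|rewrite ck|rewrite ak].
  by rewrite hk kK in hK.
have KB g h : g \in K -> h \in F' -> h \notin K -> b g = b h -> sw (c g) <> c h.
  move=> gK hF hK ag; have [gF [cg|cg]] := KF g gK; rewrite cg ?swbe ?swal => ch.
    have [k [kK ck ak]] := Kal g gK cg.
    have hk : h = k by apply: cB => //; [apply: (KF k kK).1|rewrite ck|rewrite ak].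
    by rewrite hk kK in hK.
  by move/negP: hK; apply; apply: (Kab g).
have swI g h : g \in K -> h \in K -> sw (c g) = sw (c h) -> c g = c h.
  move=> /KF[_ [->|->]] /KF[_ [->|->]] //; rewrite swal swbe => abE;
  by rewrite abE eqxx in ab.
have eA h : h \in F' -> a h = a e -> c' h <> be.
  move=> hF ah; rewrite /c'; case: eqP => [he|_]; first by rewrite he !inE eqxx in hF.
  case: ifP => hK; last first.
    move=> ch; have hg : h = g0 by apply: cA => //; rewrite ?ch ?g0c ?ah ?g0a.
    by rewrite hg K0 in hK.
  have [_ [ch|->]] := KF h hK; last by rewrite swbe => /eqP; rewrite (negPf ab).
  by move: (alP h hF ah); rewrite ch eqxx.
have eB h : h \in F' -> b h = b e -> c' h <> be.
  move=> hF bh; rewrite /c'; case: eqP => [he|_]; first by rewrite he !inE eqxx in hF.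
  case: ifP => hK; last by apply/eqP/beP.
  have [_ [ch|->]] := KF h hK; last by rewrite swbe => /eqP; rewrite (negPf ab).
  have [k [kK ck bk]] := Kal h hK ch.
  by move: (beP k (KF k kK).1); rewrite bk ck eqxx => /(_ bh).
have c'e : c' e = be by rewrite /c' eqxx.
exists c'; split.
- move=> g gF; rewrite /c'; case: eqP => // /eqP ge.
  by case: ifP => _; [rewrite /sw; case: ifP|apply/cD/inF'].
- move=> g h gF hF ch ah.
  have [ge|ge] := eqVneq g e; have [he|he] := eqVneq h e; first by rewrite ge he.
  + by case: (eA h (inF' h hF he)); rewrite -?ah -?ch ge.
  + by case: (eA g (inF' g gF ge)); rewrite ?ah ?ch he.
  move: ch (inF' g gF ge) (inF' h hF he).
  rewrite /c' (negPf ge) (negPf he) => ch gF' hF'.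
  case: ifP ch => gK; case: ifP => hK ch.
  + by apply: cA => //; apply: swI.
  + by case: (KA g h) => //; rewrite hK.
  + by case: (KA h g) => //; rewrite gK.
  + exact: cA.
- move=> g h gF hF ch ah.
  have [ge|ge] := eqVneq g e; have [he|he] := eqVneq h e; first by rewrite ge he.
  + by case: (eB h (inF' h hF he)); rewrite -?ah -?ch ge.
  + by case: (eB g (inF' g gF ge)); rewrite ?ah ?ch he.
  move: ch (inF' g gF ge) (inF' h hF he).
  rewrite /c' (negPf ge) (negPf he) => ch gF' hF'.
  case: ifP ch => gK; case: ifP => hK ch.
  + by apply: cB => //; apply: swI.
  + by case: (KB g h) => //; rewrite hK.
  + by case: (KB h g) => //; rewrite gK.
  + exact: cB.
Qed.

Lemma card_set_sum (T : finType) (A : {set T}) (P : pred T) :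
  #|[set x in A | P x]| = \sum_(x in A) P x.
Proof.
rewrite -sum1_card (eq_bigl (fun x => (x \in A) && P x)); last first.
  by move=> x; rewrite inE.
by rewrite big_mkcondr; apply: eq_bigr => x _; case: (P x).
Qed.

Section Hall.
Variables (T S : finType) (q : T -> S -> bool).
Let nb (B : {set S}) (X : {set T}) := [set y in B | [exists x in X, q x y]].

(** Induction on [#|A|]. A tight non-empty proper subset is matched into its own neighbourhood, and
    the rest of [A] into the rest of [B]. If there is none, any edge may be fixed, since every
    non-empty proper subset has a surplus of one. [s0] only provides values outside [A]. *)
Lemma hall (s0 : S) (A : {set T}) (B : {set S}) :
    (forall X : {set T}, X \subset A -> #|X| <= #|nb B X|) ->
  exists f : T -> S, {in A, forall x, (f x \in B) && q x (f x)} /\ {in A &, injective f}.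
Proof.
move: {2}#|A| (leqnn #|A|) => n; elim: n A B => [|n IHn] A B cardA HA.
  have A0 x : x \in A = false.
    by have /eqP -> : A == set0; [rewrite -cards_eq0 -leqn0|rewrite inE].
  by exists (fun=> s0); split=> x; rewrite A0.
have [/eqP|[x xA]] := set_0Vmem A.
  by rewrite -cards_eq0 => /eqP A0; apply: IHn => //; rewrite A0.
have [/existsP[X /and4P[XA X0 XnA /eqP NX]]|/existsPn noX] :=
    boolP [exists X : {set T}, [&& X \subset A, X != set0, X != A & #|nb B X| == #|X|]].
  have XltA : #|X| < #|A| by apply: proper_card; rewrite properEneq XnA.
  have [|Z ZX|f [fB fI]] := IHn X (nb B X).
  - by rewrite -ltnS; apply: leq_trans XltA cardA.
  - apply: leq_trans (HA Z (subset_trans ZX XA)) _; apply: subset_leq_card.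
    apply/subsetP => y; rewrite !inE => /andP[-> /existsP[z /andP[zZ qzy]]] /=.
    apply/andP; split; apply/existsP; exists z; rewrite ?zZ ?qzy // andbT.
    exact: (subsetP ZX).
  have [|Z ZX|h [hB hI]] := IHn (A :\: X) (B :\: nb B X).
  - move: X0; rewrite -card_gt0 => X0; move: (cardsID X A).
    by rewrite (setIidPr XA); lia.
  - have ZA : Z :|: X \subset A.
      by rewrite subUset XA andbT; apply: subset_trans ZX (subsetDl _ _).
    have := HA _ ZA; rewrite cardsU.
    have -> : Z :&: X = set0.
      apply/setP => y; rewrite !inE; case yZ: (y \in Z) => //=.
      by move: (subsetP ZX y yZ); rewrite inE => /andP[/negPf].
    rewrite cards0 subn0 => HZX.
    have : nb B (Z :|: X) \subset nb B X :|: nb (B :\: nb B X) Z.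
      apply/subsetP => y; rewrite !inE => /andP[yB].
      case yX: [exists x0 in X, q x0 y]; first by rewrite yB.
      case/existsP => z /andP[]; rewrite inE => /orP[zZ|zX] qzy.
        rewrite yB /=; apply/existsP; exists z; by rewrite zZ.
      by move/existsP: yX => []; exists z; rewrite zX.
    by move/subset_leq_card/leq_trans => /(_ _ (leq_card_setU _ _)); lia.
  exists (fun z => if z \in X then f z else h z); split.
    move=> z zA; case: ifP => zX.
      by move: (fB z zX); rewrite inE => /andP[/andP[-> _] ->].
    have /hB : z \in A :\: X by rewrite inE zX.
    by rewrite inE => /andP[/andP[_ ->] ->].
  move=> z w zA wA; case: ifP => zX; case: ifP => wX.
  - exact: fI.
  - move=> fh; have /hB : w \in A :\: X by rewrite inE wX.
    by rewrite -fh inE; move: (fB z zX) => /andP[->].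
  - move=> fh; have /hB : z \in A :\: X by rewrite inE zX.
    by rewrite fh inE; move: (fB w wX) => /andP[->].
  - by apply: hI; rewrite inE ?zX ?wX.
have /card_gt0P[y] : 0 < #|nb B [set x]|.
  by rewrite (leq_trans _ (HA [set x] _)) ?cards1 // sub1set.
rewrite inE => /andP[yB /existsP[x' /andP[]]]; rewrite inE => /eqP-> qxy.
have [|Z ZA|f [fB fI]] := IHn (A :\ x) (B :\ y).
- by move: cardA; rewrite (cardsD1 x) xA.
- have [->|Z0] := eqVneq Z set0; first by rewrite cards0.
  have ZA' : Z \subset A by apply: subset_trans ZA (subsetDl _ _).
  have ZnA : Z != A.
    by apply/eqP => ZE; move: (subsetP ZA x); rewrite ZE xA !inE eqxx => /(_ isT).
  have := noX Z; rewrite ZA' Z0 ZnA /= => NZ; have := HA Z ZA'.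
  rewrite leq_eqVlt eq_sym (negPf NZ) /= => ltZ.
  have : nb B Z \subset y |: nb (B :\ y) Z.
    by apply/subsetP => w; rewrite !inE => /andP[-> ->]; rewrite !andbT; case: eqP.
  by move/subset_leq_card; rewrite cardsU1; case: (y \notin _) => /=; lia.
exists (fun z => if z == x then y else f z); split.
  move=> z zA; case: eqP => [->|/eqP zx]; first by rewrite yB.
  by have /fB : z \in A :\ x; rewrite !inE ?zx // => /andP[/andP[_ ->] ->].
move=> z w zA wA; case: eqP => [->|/eqP zx]; case: eqP => [->|/eqP wx] //.
- by move=> yf; have /fB : w \in A :\ x; rewrite !inE ?wx // -yf eqxx.
- by move=> yf; have /fB : z \in A :\ x; rewrite !inE ?zx // yf eqxx.
- by apply: fI; rewrite !inE ?zx ?wx.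
Qed.

End Hall.

Lemma greedy_coloring (E : finType) (F : {set E}) (cf : rel E)
    (forb : E -> nat -> bool) K Y C :
    {in F, forall e, #|[set h in F | cf e h]| + #|[set i : 'I_K | forb e i]| <= C} ->
    #|F| <= (K - C) * Y -> symmetric cf ->
  exists c : E -> nat,
    [/\ {in F, forall e, c e < K /\ ~~ forb e (c e)},
        {in F &, forall e h, e != h -> cf e h -> c e != c h} &
        forall i, #|[set e in F | c e == i]| <= Y].
Proof.
move=> HC HF cfC.
suff: forall n (G : {set E}), #|G| = n -> G \subset F -> exists c : E -> nat,
    [/\ {in G, forall e, c e < K /\ ~~ forb e (c e)},
        {in G &, forall e h, e != h -> cf e h -> c e != c h} &
        forall i, #|[set e in G | c e == i]| <= Y] by move/(_ _ F erefl (subxx _)).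
elim=> [|n IHn] G cardG GF.
  have G0 x : x \in G = false by rewrite (cards0_eq cardG) inE.
  exists (fun=> 0); split=> [x|x y|i]; rewrite ?G0 //.
  by rewrite (_ : [set _ in _ | _] = set0) ?cards0 //; apply/setP=> x; rewrite !inE G0.
have /card_gt0P[e eG] : 0 < #|G| by rewrite cardG.
have eF : e \in F by apply: (subsetP GF).
have cardG' : #|G :\ e| = n by move: (cardsD1 e G); rewrite eG cardG; lia.
have [c [c1 c2 c3]] := IHn _ cardG' (subset_trans (subsetDl _ _) GF).
pose bad1 := [set i : 'I_K | forb e i].
pose bad2 := [set i : 'I_K | [exists h in G :\ e, cf e h && (c h == i)]].
pose bad3 := [set i : 'I_K | #|[set h in G :\ e | c h == i]| == Y].
have b2 : #|bad2| <= #|[set h in F | cf e h]|.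
  have [->|/set0Pn[k0 _]] := eqVneq bad2 set0; first by rewrite cards0.
  have sub : bad2 \subset [set (insubd k0 (c h) : 'I_K) | h in [set h in F | cf e h]].
    apply/subsetP => i; rewrite inE => /existsP[h /and3P[hG cfh /eqP ci]].
    apply/imsetP; exists h; first by rewrite inE cfh (subsetP GF) //; move: hG; rewrite inE => /andP[].
    by apply/val_inj; rewrite val_insubd ci ltn_ord.
  exact: leq_trans (subset_leq_card sub) (leq_imset_card _ _).
have b3 : #|bad3| * Y <= n.
  rewrite -cardG' -sum_nat_const.
  rewrite (eq_bigr (fun i : 'I_K => #|[set h in G :\ e | c h == i]|)); last first.
    by move=> i; rewrite inE => /eqP.
  rewrite (eq_bigr (fun i : 'I_K => \sum_(h in G :\ e) (c h == i))); last first.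
    by move=> i _; rewrite card_set_sum.
  rewrite exchange_big -sum1_card; apply: leq_sum => h _.
  apply: leq_trans (_ : \sum_(i < K) (c h == i) <= 1).
    by rewrite big_mkcond; apply: leq_sum => i _; case: ifP.
  have [/existsP[i0 /eqP ci]|/existsPn no] := boolP [exists i : 'I_K, c h == i].
    rewrite (bigD1 i0) //= big1 ?addn0 ?leq_b1 // => i.
    by rewrite -val_eqE /= ci eq_sym => /negPf->.
  by rewrite big1 // => i _; rewrite (negPf (no i)).
have [i inb] : exists i : 'I_K, i \notin bad1 :|: bad2 :|: bad3.
  apply/existsP; rewrite -negb_forall; apply/negP => /forallP all.
  have : #|'I_K| <= #|bad1 :|: bad2 :|: bad3|.
    by apply: subset_leq_card; apply/subsetP => i _; apply: all.
  rewrite card_ord => le1.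
  have le2 : K <= #|bad1| + #|bad2| + #|bad3|.
    apply: leq_trans le1 _; apply: leq_trans (leq_card_setU _ _) _.
    by rewrite leq_add2r leq_card_setU.
  have := HC e eF; rewrite -/bad1 => le3.
  have le5 : K - C <= #|bad3| by lia.
  have le4 : n < #|F| by rewrite -cardG; apply: subset_leq_card.
  have : n < #|bad3| * Y by apply: leq_trans le4 (leq_trans HF _); rewrite leq_mul2r le5 orbT.
  lia.
move: inb; rewrite !inE !negb_or => /andP[/andP[nb1 /existsPn nb2] nb3].
exists (fun h => if h == e then nat_of_ord i else c h); split.
- move=> h hG; case: eqP => [->|/eqP he]; first by rewrite ltn_ord.
  by apply: c1; rewrite !inE he.
- move=> h k hG kG; have [he|he] := eqVneq h e; have [ke|ke] := eqVneq k e.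
  + by rewrite he ke eqxx.
  + move=> _ cfk; move: (nb2 k); rewrite !inE ke kG -he cfk /= => ck.
    by rewrite eq_sym.
  + by move=> _; rewrite cfC ke => cfk; move: (nb2 h); rewrite !inE he hG cfk.
  + by apply: c2; rewrite !inE ?he ?ke.
- move=> j; have [ji|ji] := eqVneq j (nat_of_ord i); last first.
    apply: leq_trans (c3 j); apply: subset_leq_card; apply/subsetP => h.
    rewrite !inE; case: ifP => he /andP[hG]; last by rewrite hG.
    by rewrite eq_sym (negPf ji).
  have := c3 j; rewrite leq_eqVlt ji => /orP[|lt]; first by rewrite (negPf nb3).
  have : [set e0 in G | (if e0 == e then nat_of_ord i else c e0) == i] \subset
     e |: [set h in G :\ e | c h == i].
    by apply/subsetP => h; rewrite !inE; case: ifP => //= _ /andP[-> ->].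
  move/subset_leq_card/leq_trans; apply; rewrite cardsU1; apply: leq_trans lt.
  by case: (e \notin _); rewrite //= add0n.
Qed.

(** * Random selection and weak regularity *)

Section Selection.
Import Order.TTheory GRing.Theory Num.Theory.
Local Open Scope ring_scope.

Section Derandomize.
Variable R : realType.

Lemma exists_le_average (C : finType) (A : {pred C}) (F : C -> R) (B : R) :
  (0 < #|A|)%N -> \sum_(c in A) F c <= #|A|%:R * B -> exists2 c, c \in A & F c <= B.
Proof.
move=> /card_gt0P[c0 c0A] le; apply/exists_inP; rewrite -[X in is_true X]negbK negb_exists_in.
apply/negP => /forall_inP lt; move: le; apply/negP; rewrite -ltNge.
rewrite mulr_natl -sumr_const; apply: ltr_sum; last by move=> c cA; rewrite ltNge lt.
by apply/hasP; exists c0; rewrite ?mem_index_enum.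
Qed.

(** From [1 + z <= expR z] at [z = - (y / (1 + y))]. It turns the products of the potential below
    back into exponential moments. *)
Lemma expR_le_1D (y : R) : `|y| <= 1 / 2 -> expR (y - 2 * y ^+ 2) <= 1 + y.
Proof.
rewrite ler_norml => /andP[y1 y2]; have y0 : 0 < 1 + y by lra.
apply: le_trans (_ : expR (y / (1 + y)) <= _).
  rewrite ler_expR ler_pdivlMr //.
  have -> : (y - 2 * y ^+ 2) * (1 + y) = y - y ^+ 2 * (1 + 2 * y) by ring.
  by rewrite gerBl mulr_ge0 ?sqr_ge0 //; lra.
have : 1 + - (y / (1 + y)) <= expR (- (y / (1 + y))) by exact: expR_ge1Dx.
have -> : 1 + - (y / (1 + y)) = (1 + y)^-1 by field; lra.
by rewrite expRN lef_pV2 // posrE ?expR_gt0.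
Qed.

Variables (I C J : finType) (Is : J -> {set I}) (Cs : J -> {set C}) (M : J -> nat).

Let p j : R := #|Cs j|%:R / #|C|%:R.
Let x j c : R := (c \in Cs j)%:R - p j.

(* The potential is the sum over the events of the two exponential moments,
   with [1 + y] in place of [exp y] so that its mean over one choice is
   exactly preserved. *)
Let phi (d : R) (w : J -> R) (s : seq I) (f : I -> C) : R :=
  \sum_j w j * (\prod_(i <- s | i \in Is j) (1 + d * x j (f i)) +
                \prod_(i <- s | i \in Is j) (1 + - d * x j (f i))).

(** A Chernoff bound by conditional expectations: the two-sided potential starts at
    [\sum_j 2 * w j < 1] and does not increase for a suitable next value, so at the end no single
    term reaches 1. Deviations are measured against a bound [M j] for [#|Is j|], so that small index
    sets need no separate treatment. *)
Lemma select (xi : R) : 0 < xi <= 1 -> (0 < #|C|)%N ->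
    (forall j, #|Is j| <= M j)%N ->
    \sum_j 2 * expR (- (xi ^+ 2 / 8 * (M j)%:R)) < 1 ->
  exists f : I -> C, forall j,
    `|#|[set i in Is j | f i \in Cs j]|%:R - #|Is j|%:R * (#|Cs j|%:R / #|C|%:R)|
      <= xi * (M j)%:R.
Proof.
move=> /andP[xi0 xi1] C0 IM small; have /card_gt0P[c0 _] := C0.
have C0R : 0 < (#|C|%:R : R) by rewrite ltr0n.
(* [d = xi / 4] maximises [d * xi - 2 * d ^+ 2]; the maximum [xi ^+ 2 / 8] is the exponent in
   [w]. *)
pose w j := expR (- (xi ^+ 2 / 8 * (M j)%:R)) : R; pose d := xi / 4.
have sumx j : \sum_c x j c = 0.
  rewrite /x sumrB sumr_const -[X in _ - X]mulr_natl mulrC divfK ?gt_eqF //.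
  rewrite -sum1_card natr_sum [X in _ - X]big_mkcond /= -sumrB big1 // => c _.
  by case: (_ \in _); rewrite /= subrr.
have [f Hf] : exists f, phi d w (enum I) f <= \sum_j 2 * w j.
  elim: (enum I) (enum_uniq I) => [_|i s IHs /andP[nis us]].
    exists (fun=> c0); rewrite /phi; apply: ler_sum => j _.
    by rewrite !big_nil mulrC.
  have {IHs us} [f Hf] := IHs us.
  have [||c _ Hc] := @exists_le_average C xpredT
    (fun c => phi d w (i :: s) (fun k => if k == i then c else f k)) (\sum_j 2 * w j) => //.
    apply: le_trans (_ : #|C|%:R * phi d w s f <= _); last by rewrite ler_pM2l.
    rewrite /phi exchange_big mulr_sumr; apply: ler_sum => j _ /=.
    have E (e : R) c : \prod_(k <- i :: s | k \in Is j)
        (1 + e * x j (if k == i then c else f k)) =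
        (if i \in Is j then 1 + e * x j c else 1) *
        \prod_(k <- s | k \in Is j) (1 + e * x j (f k)).
      rewrite big_cons eqxx.
      have -> : \prod_(k <- s | k \in Is j) (1 + e * x j (if k == i then c else f k)) =
                \prod_(k <- s | k \in Is j) (1 + e * x j (f k)).
        rewrite !(big_seq_cond (fun k => k \in Is j)); apply: eq_bigr => k /andP[ks _].
        by case: eqP => // ki; rewrite -ki ks in nis.
      by case: ifP; rewrite ?mul1r.
    have S (e : R) : \sum_c (if i \in Is j then 1 + e * x j c else 1) = #|C|%:R.
      case: (i \in Is j); last by rewrite sumr_const.
      by rewrite big_split /= -mulr_sumr sumx mulr0 addr0 sumr_const.
    have S' (e : R) : \sum_c \prod_(k <- i :: s | k \in Is j)
        (1 + e * x j (if k == i then c else f k)) =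
        #|C|%:R * \prod_(k <- s | k \in Is j) (1 + e * x j (f k)).
      by rewrite (eq_bigr _ (fun c _ => E e c)) -mulr_suml S.
    by rewrite -mulr_sumr big_split /= !S' -mulrDr mulrCA.
  by exists (fun k => if k == i then c else f k).
exists f => j.
pose X := \sum_(i in Is j) x j (f i).
have -> : #|[set i in Is j | f i \in Cs j]|%:R - #|Is j|%:R * (#|Cs j|%:R / #|C|%:R) = X.
  rewrite /X /x sumrB sumr_const mulr_natl; congr (_ - _).
  rewrite -sum1_card natr_sum big_mkcond [RHS]big_mkcond /=; apply: eq_bigr => i _.
  by rewrite inE; case: (i \in Is j); case: (f i \in Cs j).
have p01 : 0 <= p j <= 1.
  by rewrite divr_ge0 ?ler0n //= ler_pdivrMr // mul1r ler_nat max_card.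
have x1 c : `|x j c| <= 1.
  rewrite /x ler_norml; case: (_ \in _) => /=; lra.
have prod0 (e : R) : `|e| <= 1 / 2 ->
    expR (e * X - 2 * e ^+ 2 * (M j)%:R) <= \prod_(i <- enum I | i \in Is j) (1 + e * x j (f i)).
  move=> e12; rewrite big_enum_cond /=.
  apply: le_trans (_ : \prod_(i in Is j) expR (e * x j (f i) - 2 * (e * x j (f i)) ^+ 2) <= _); last first.
    apply: ler_prod => i _; rewrite expR_ge0 expR_le_1D // normrM.
    by rewrite -[1 / 2]mulr1 ler_pM.
  rewrite -expR_sum ler_expR sumrB -mulr_sumr -/X lerB //.
  apply: le_trans (_ : \sum_(i in Is j) 2 * e ^+ 2 <= _).
    apply: ler_sum => i _; rewrite exprMn mulrA ler_piMr //; last first.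
      by rewrite -real_normK ?num_real // exprn_ile1.
    by rewrite mulr_ge0 // sqr_ge0.
  rewrite sumr_const -[X in X <= _]mulr_natr ler_wpM2l ?ler_nat //.
  by rewrite mulr_ge0 // sqr_ge0.
have prodpos (e : R) : `|e| <= 1 / 2 ->
    0 <= \prod_(i <- enum I | i \in Is j) (1 + e * x j (f i)).
  by move=> e12; apply: le_trans (prod0 _ e12); rewrite expR_ge0.
have d12 : `|d| <= 1 / 2 by rewrite /d ger0_norm; lra.
have d12' : `|- d| <= 1 / 2 by rewrite normrN.
have phipos j' : 0 <= w j' * (\prod_(i <- enum I | i \in Is j') (1 + d * x j' (f i)) +
                \prod_(i <- enum I | i \in Is j') (1 + - d * x j' (f i))).
  have p01' : 0 <= p j' <= 1.
    by rewrite divr_ge0 ?ler0n //= ler_pdivrMr // mul1r ler_nat max_card.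
  have dx c : `|d * x j' c| <= 1.
    rewrite normrM -[1]mulr1 ler_pM //; first lra.
    by rewrite /x ler_norml; case: (_ \in _) => /=; lra.
  apply: mulr_ge0; first by rewrite expR_ge0.
  apply: addr_ge0; apply: prodr_ge0 => i _; move: (dx (f i)); rewrite ler_norml; lra.
have key : \prod_(i <- enum I | i \in Is j) (1 + d * x j (f i)) +
           \prod_(i <- enum I | i \in Is j) (1 + - d * x j (f i)) < (w j)^-1.
  rewrite -[(w j)^-1]mul1r ltr_pdivlMr ?expR_gt0 // mulrC.
  apply: le_lt_trans small; apply: le_trans Hf.
  by rewrite /phi (bigD1 j) //= lerDl sumr_ge0.
have dX (e : R) : `|e| <= 1 / 2 -> e ^+ 2 = d ^+ 2 ->
    \prod_(i <- enum I | i \in Is j) (1 + e * x j (f i)) < (w j)^-1 ->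
    e * X <= d * (xi * (M j)%:R).
  move=> e12 ed lt; have := le_lt_trans (prod0 _ e12) lt.
  rewrite -expRN ltr_expR opprK ed ltrBlDr => /ltW.
  move/le_trans; apply; rewrite /d le_eqVlt; apply/orP; left; apply/eqP; by field.
rewrite ler_norml; have d0 : 0 < d by rewrite /d; lra.
apply/andP; split.
  rewrite -(ler_pM2l d0) mulrN lerNl -mulNr; apply: dX => //; first by rewrite sqrrN.
  by apply: le_lt_trans key; rewrite lerDr; apply: prodpos.
rewrite -(ler_pM2l d0); apply: dX => //.
by apply: le_lt_trans key; rewrite lerDl; apply: prodpos.
Qed.

End Derandomize.

End Selection.

(** * Weak regularity, and bijections with few conflicts at every vertex *)

Section Regularity.
Import Order.TTheory GRing.Theory Num.Theory.
Local Open Scope ring_scope.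

Section WeakRegularity.
Variables (R : realType) (V : finType).
Implicit Types (W : V -> V -> R) (S T : {set V}).

Definition cut_sum W S T : R := \sum_(x in S) \sum_(y in T) W x y.

Lemma cut_sum_indicator W S T :
  \sum_x \sum_y W x y * ((x \in S) && (y \in T))%:R = cut_sum W S T.
Proof.
rewrite /cut_sum [RHS]big_mkcond; apply: eq_bigr => x _.
case: (x \in S) => /=; last by rewrite big1 // => y _; rewrite mulr0.
rewrite [RHS]big_mkcond; apply: eq_bigr => y _.
by case: (y \in T); rewrite ?mulr1 ?mulr0.
Qed.

Lemma cut_sum_rectangle S T S' T' :
  cut_sum (fun x y => ((x \in S) && (y \in T))%:R) S' T' =
  #|S' :&: S|%:R * #|T' :&: T|%:R.
Proof.
rewrite /cut_sum -[#|S' :&: S|]sum1_card natr_sum mulr_suml.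
rewrite big_mkcond [RHS]big_mkcond; apply: eq_bigr => x _; rewrite inE.
case: (x \in S') => //=; case: (x \in S); rewrite ?mul1r /=; last by rewrite big1.
rewrite -sum1_card natr_sum big_mkcond [RHS]big_mkcond.
by apply: eq_bigr => y _; rewrite inE; case: (y \in T') => //=; case: (y \in T).
Qed.

(* Frieze-Kannan: subtracting from [W] its mean over a rectangle on which its
   sum is large decreases the [l2] norm of [W]. *)
Lemma energy_decrement (eps : R) W S T : 0 < eps ->
    eps * #|V|%:R ^+ 2 < `|cut_sum W S T| ->
  exists d : R,
    \sum_x \sum_y (W x y - d * ((x \in S) && (y \in T))%:R) ^+ 2
      + eps ^+ 2 * #|V|%:R ^+ 2 <= \sum_x \sum_y W x y ^+ 2.
Proof.
move=> eps0 big; pose m : R := #|S|%:R * #|T|%:R; pose c := cut_sum W S T.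
have m0 : 0 < m.
  rewrite /m -natrM ltr0n muln_gt0 !card_gt0; apply/andP.
  split; apply/eqP => E; move: big; apply/negP; rewrite -leNgt /cut_sum E.
    by rewrite big_set0 normr0 mulr_ge0 ?sqr_ge0 // ltW.
  under eq_bigr do rewrite big_set0.
  by rewrite sumr_const mul0rn normr0 mulr_ge0 ?sqr_ge0 // ltW.
have mV : m <= #|V|%:R ^+ 2 by rewrite expr2 ler_pM ?ler_nat ?max_card.
exists (c / m).
have -> : \sum_x \sum_y (W x y - c / m * ((x \in S) && (y \in T))%:R) ^+ 2 =
    \sum_x \sum_y W x y ^+ 2 - c ^+ 2 / m.
  rewrite (eq_bigr (fun x => \sum_y W x y ^+ 2 + \sum_y
       (- (2 * (c / m)) * W x y + (c / m) ^+ 2 * 1) * ((x \in S) && (y \in T))%:R)).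
    rewrite big_split /= cut_sum_indicator; congr (_ + _); rewrite /cut_sum.
    under eq_bigr do rewrite big_split /= -!mulr_sumr sumr_const.
    rewrite big_split /= -!mulr_sumr -/(cut_sum W S T) sumr_const -/c.
    by rewrite -[_ *+ #|S|]mulr_natl -/m; field; rewrite gt_eqF.
  move=> x _; rewrite -big_split /=; apply: eq_bigr => y _.
  by case: (_ && _) => /=; ring.
rewrite addrAC -addrA gerDl subr_le0 ler_pdivlMr //.
apply: le_trans (_ : (eps * #|V|%:R ^+ 2) ^+ 2 <= _).
  by rewrite exprMn -mulrA ler_wpM2l ?sqr_ge0 // [X in _ <= X]expr2 ler_wpM2l ?sqr_ge0.
have e0 : 0 <= eps * #|V|%:R ^+ 2 by rewrite mulr_ge0 ?sqr_ge0 // ltW.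
rewrite -[X in _ <= X]real_normK ?num_real //.
by rewrite ler_pXn2r ?nnegrE ?normr_ge0 //; exact: ltW.
Qed.

(** Each subtracted rectangle lowers the squared [l2] norm by [eps ^+ 2 * #|V|%:R ^+ 2], so the
    process stops after at most [k] of them. *)
Lemma weak_regularity (eps : R) k W : 0 < eps ->
    \sum_x \sum_y W x y ^+ 2 <= k%:R * eps ^+ 2 * #|V|%:R ^+ 2 ->
  exists2 s : seq (R * ({set V} * {set V})), (size s <= k)%N & forall S T,
    `|cut_sum W S T - \sum_(p <- s) p.1 * (#|S :&: p.2.1|%:R * #|T :&: p.2.2|%:R)|
      <= eps * #|V|%:R ^+ 2.
Proof.
move=> eps0; elim: k W => [|k IHk] W normW;
  have [/forallP good|/forallPn[S /forallPn[T]]] := boolP [forall S : {set V},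
    [forall T : {set V}, `|cut_sum W S T| <= eps * #|V|%:R ^+ 2]];
  try by exists [::] => // S T; rewrite big_nil subr0; move/forallP: (good S); apply.
all: rewrite -ltNge => big; have [d Hd] := energy_decrement eps0 big.
  have V0 : 0 < (#|V|%:R : R) ^+ 2.
    rewrite exprn_gt0 // ltr0n lt0n; apply/eqP => V0; move: big; apply/negP.
    rewrite -leNgt /cut_sum big1 => [|x _]; last by move: (card0_eq V0 x); rewrite inE.
    by rewrite normr0 mulr_ge0 ?sqr_ge0 // ltW.
  have : 0 < eps ^+ 2 * #|V|%:R ^+ 2 by rewrite mulr_gt0 // exprn_gt0.
  have : 0 <= \sum_x \sum_y (W x y - d * ((x \in S) && (y \in T))%:R) ^+ 2.
    by apply: sumr_ge0 => x _; apply: sumr_ge0 => y _; apply: sqr_ge0.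
  move: normW; rewrite !mul0r; lra.
pose W' x y := W x y - d * ((x \in S) && (y \in T))%:R.
have [|s sk Hs] := IHk W'.
  by move: normW; rewrite -(natr1 k) mulrDl mul1r mulrDl; move: Hd; rewrite /W'; lra.
exists ((d, (S, T)) :: s) => // S' T'; rewrite big_cons /=.
have -> : cut_sum W S' T' = cut_sum W' S' T' + d * (#|S' :&: S|%:R * #|T' :&: T|%:R).
  rewrite -cut_sum_rectangle /cut_sum mulr_sumr -big_split /=.
  apply: eq_bigr => x _; rewrite mulr_sumr -big_split /=.
  by apply: eq_bigr => y _; rewrite /W' subrK.
by rewrite opprD addrA addrK.
Qed.

End WeakRegularity.

Lemma extend_inj (I K : finType) (f : I -> K) (A : {set I}) :
    (#|I| <= #|K|)%N -> {in A &, injective f} ->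
  exists2 g : I -> K, injective g & {in A, g =1 f}.
Proof.
move=> IK; move: {2}#|~: A| (erefl #|~: A|) => n.
elim: n A f => [|n IHn] A f cardA fI.
  exists f => // x y; have AT z : z \in A.
    by move/cards0_eq: cardA => /setP/(_ z); rewrite !inE => /negbFE.
  by apply: fI.
have /card_gt0P[i] : (0 < #|~: A|)%N by rewrite cardA.
rewrite inE => iA; have /card_gt0P[k] : (0 < #|~: (f @: A)|)%N.
  by move: (cardsC A) (cardsC (f @: A)) (card_in_imset fI); lia.
rewrite inE => kA; pose f' j := if j == i then k else f j.
have f'A j : j \in A -> f' j = f j.
  by rewrite /f'; case: eqP => // -> ; rewrite (negPf iA).
have [||g gI gf] := IHn (i |: A) f'.
- have := cardsC (i |: A); have := cardsC A; rewrite cardsU1 iA; lia.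
- have f'i : f' i = k by rewrite /f' eqxx.
  move=> x y; rewrite !inE => /orP[/eqP->|xA] /orP[/eqP->|yA] //.
  + by rewrite f'i f'A // => kf; rewrite kf imset_f in kA.
  + by rewrite f'i f'A // => kf; rewrite -kf imset_f in kA.
  + by rewrite !f'A //; apply: fI.
- by exists g => // x xA; rewrite gf ?inE ?xA ?orbT // f'A.
Qed.

(* The colours are matched one by one with the remaining classes; the mean of
   [sum_w exp (load w / 2)] over the next choice is multiplied by at most
   [1 + kap / b] as long as [b] classes remain. *)
Lemma low_conflict (R : realType) (I K W : finType) (conf : I -> K -> W -> bool) kap b L :
    (#|I| <= #|K|)%N -> (0 < b)%N ->
    (forall i w, #|[set k | conf i k w]| <= kap)%N ->
    (#|W|%:R * expR (#|K|%:R * (kap%:R / b%:R)) < expR ((L.+1)%:R / 2) :> R) ->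
  exists2 f : I -> K, injective f & forall w, (#|[set i | conf i (f i) w]| <= L + b)%N.
Proof.
move=> IK b0 kapP small; have b0R : 0 < (b%:R : R) by rewrite ltr0n.
have e2 : expR (1 / 2 : R) <= 2.
  have := expR_ge1Dx (- (1 / 2) : R); rewrite expRN => h.
  have e0 : 0 < expR (1 / 2) :> R by exact: expR_gt0.
  have : expR (1 / 2) * (1 / 2) <= expR (1 / 2) * (expR (1 / 2))^-1 :> R.
    by rewrite ler_pM2l //; lra.
  by rewrite mulfV ?gt_eqF //; lra.
pose load (f : I -> K) (s : seq I) w : nat := count (fun i => conf i (f i) w) s.
pose growth : R := kap%:R / b%:R.
have step (f : I -> K) (s : seq I) i : i \notin s -> (size s + b <= #|K|)%N ->
    {in s &, injective f} -> exists k, [/\ k \notin [seq f j | j <- s] &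
    \sum_w expR ((load (fun j => if j == i then k else f j) (i :: s) w)%:R / 2) <=
    expR growth * \sum_w expR ((load f s w)%:R / 2) :> R].
  move=> nis sK fI; pose A := [pred k | k \notin [seq f j | j <- s]].
  have cardA : (b <= #|A|)%N.
    have := cardC (mem [seq f j | j <- s]).
    have -> : #|[predC mem [seq f j | j <- s]]| = #|A| by apply: eq_card => k; rewrite !inE.
    move=> cardK; rewrite -(leq_add2l (size s)); apply: leq_trans sK _.
    by rewrite -cardK leq_add2r -(size_map f) card_size.
  have [||k kA Hk] := @exists_le_average R K A (fun k => \sum_w
      expR ((load (fun j => if j == i then k else f j) (i :: s) w)%:R / 2))
      (expR growth * \sum_w expR ((load f s w)%:R / 2)).
  - exact: leq_trans cardA.
  - rewrite exchange_big mulrA mulr_sumr; apply: ler_sum => w _ /=.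
    apply: le_trans (_ : \sum_(k in A) (1 + (conf i k w)%:R) *
        expR ((load f s w)%:R / 2) <= _).
      apply: ler_sum => k _; rewrite /load /= eqxx natrD mulrDl expRD.
      have -> : count (fun j => conf j (if j == i then k else f j) w) s =
          count (fun j => conf j (f j) w) s.
        by apply: eq_in_count => j js; case: eqP => // ji; rewrite -ji js in nis.
      rewrite ler_wpM2r ?expR_ge0 //; case: (conf i k w) => //=.
      by rewrite mul0r expR0 addr0.
    rewrite -mulr_suml ler_wpM2r ?expR_ge0 // big_split /= sumr_const.
    apply: le_trans (_ : #|A|%:R * (1 + growth) <= _); last first.
      by rewrite ler_wpM2l ?ler0n // expR_ge1Dx.
    rewrite mulrDr mulr1 lerD2l -natr_sum.
    apply: le_trans (_ : kap%:R <= _).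
      rewrite ler_nat; apply: leq_trans (kapP i w); rewrite -sum1_card.
      rewrite big_mkcond [X in (_ <= X)%N]big_mkcond; apply: leq_sum => k _.
      by rewrite inE; case: (k \in A); case: (conf i k w).
    rewrite /growth mulrCA ler_peMr ?ler0n // ler_pdivlMr // mul1r.
    by rewrite ler_nat.
  by exists k.
have [I0|[i0 _]] := set_0Vmem [set: I].
  have noI (i : I) : False by move/setP/(_ i): I0; rewrite !inE.
  by exists (fun i => False_rect K (noI i)) => [i|w]; [case: (noI i)|
     rewrite (_ : [set i | _] = set0) ?cards0 //; apply/setP => i; case: (noI i)].
have [k0 _] : exists k : K, true.
  have /card_gt0P[k _] : (0 < #|K|)%N by apply: leq_trans IK; apply/card_gt0P; exists i0.
  by exists k.
have ge0 (s : seq I) (f : I -> K) : 0 <= \sum_w expR ((load f s w)%:R / 2) :> R.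
  by apply: sumr_ge0 => w _; exact: expR_ge0.
have build (s : seq I) : uniq s -> (size s + b <= #|K|)%N ->
    exists2 f : I -> K, {in s &, injective f} &
      \sum_w expR ((load f s w)%:R / 2) <= #|W|%:R * expR ((size s)%:R * growth) :> R.
  elim: s => [_ _|i s IHs /= /andP[nis us] sK].
    exists (fun=> k0) => //.
    have -> : \sum_w expR ((load (fun=> k0) [::] w)%:R / 2) = #|W|%:R :> R.
      by rewrite -sumr_const; apply: eq_bigr => w _; rewrite mul0r expR0.
    by rewrite mul0r expR0 mulr1.
  have [|f fI Hf] := IHs us; first exact: ltnW.
  have [|k [kA Hk]] := step f s i nis _ fI; first exact: ltnW.
  exists (fun j => if j == i then k else f j).
    move=> j l; rewrite !inE => /orP[/eqP->|js] /orP[/eqP->|ls] //.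
    + rewrite eqxx; case: eqP => [-> //|_] kf.
      by case/negP: kA; rewrite kf map_f.
    + rewrite eqxx; case: eqP => [-> //|_] kf.
      by case/negP: kA; rewrite -kf map_f.
    + case: eqP => [ji|_]; first by rewrite -ji js in nis.
      by case: eqP => [li|_]; [rewrite -li ls in nis|exact: fI].
  apply: le_trans Hk _; rewrite -(natr1 (size s)) mulrDl mul1r expRD mulrA mulrC.
  by rewrite ler_wpM2r ?expR_ge0.
(* Averaging stops while [b] classes are still free. The elements of [I] beyond these number at most
   [b]; they get arbitrary images and add at most [b] to any load. *)
pose s := take (#|K| - b) (enum I).
have ss : (size s <= #|K| - b)%N by rewrite size_take; case: ltnP.
have [Kb|bK] := leqP #|K| b.
  have /card_gt0P[i _] : (0 < #|I|)%N by apply/card_gt0P; exists i0.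
  have [f fI _] := @extend_inj I K (fun=> k0) set0 IK (fun i j h => match notF (eq_ind _ is_true h _ (in_set0 i)) with end).
  exists f => // w; apply: leq_trans (max_card _) _; lia.
have [||f fI Hf] := build s; first by rewrite take_uniq ?enum_uniq.
  by move: ss; lia.
have [||g gI gf] := @extend_inj I K f [set i in s] => //.
  by move=> i j; rewrite !inE; exact: fI.
exists g => // w.
have -> : [set i | conf i (g i) w] =
    [set i in s | conf i (g i) w] :|: [set i in ~: [set i in s] | conf i (g i) w].
  by apply/setP => i; rewrite !inE; case: (i \in s); rewrite /= ?orbF.
apply: leq_trans (leq_card_setU _ _) _; apply: leq_add; last first.
  apply: leq_trans (subset_leq_card (_ : _ \subset ~: [set i in s])) _.
    by apply/subsetP => i; rewrite !inE => /andP[].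
  have : size s = minn (#|K| - b) #|I| by rewrite size_take_min -cardE.
  have : (#|I| = size s + #|~: [set i in s]|)%N.
    by rewrite -(cardsC [set i in s]) cardsE (card_uniqP _) ?take_uniq ?enum_uniq.
  move: IK b0 bK; move: #|_| #|_| (size s) #|_| => x y z u; lia.
have -> : #|[set i in s | conf i (g i) w]| = load f s w.
  rewrite /load -size_filter -(card_uniqP _) ?filter_uniq ?take_uniq ?enum_uniq //.
  apply: eq_card => i; rewrite !inE mem_filter andbC.
  by case: (boolP (i \in s)) => [si|]; rewrite ?andbF // gf ?inE.
rewrite -ltnS -(ltr_nat R) -(@ltr_pM2r _ (1 / 2)) //; last lra.
rewrite !mul1r -ltr_expR; apply: le_lt_trans small.
apply: le_trans (_ : \sum_w expR ((load f s w)%:R / 2) <= _).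
  by rewrite (bigD1 w) //= lerDl sumr_ge0 // => *; exact: expR_ge0.
apply: le_trans Hf _; rewrite ler_wpM2l ?ler0n // ler_expR ler_wpM2r //.
  by rewrite divr_ge0.
by rewrite ler_nat; apply: leq_trans ss (leq_subr _ _).
Qed.

End Regularity.

(** * Perfect matchings as relations *)

Section Matchings.
Variable V : finType.
Implicit Types (M : rel V) (S A B X : {set V}).

(** A loop [M w w] is not excluded here; it is excluded wherever [M] lies in an irreflexive
    relation, as needed for [pmatch_even]. *)
Definition pmatch S M :=
  [/\ symmetric M, forall w v, M w v -> w \in S,
      forall w v1 v2, M w v1 -> M w v2 -> v1 = v2 &
      forall w, w \in S -> exists v, M w v].

(* Edges are counted as ordered pairs, hence twice. *)
Definition inner M A := #|[set p : V * V | [&& p.1 \in A, p.2 \in A & M p.1 p.2]]|.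

Lemma pmatchU S1 S2 M1 M2 : pmatch S1 M1 -> pmatch S2 M2 -> [disjoint S1 & S2] ->
  pmatch (S1 :|: S2) [rel w v | M1 w v || M2 w v].
Proof.
move=> [sy1 in1 fu1 ex1] [sy2 in2 fu2 ex2] dis.
have no w v1 v2 : M1 w v1 -> M2 w v2 -> False.
  by move=> /in1 w1 /in2 w2; rewrite (disjointFr dis w1) in w2.
split=> [w v|w v|w v1 v2|w] /=.
- by rewrite sy1 sy2.
- by rewrite inE => /orP[/in1|/in2] ->; rewrite ?orbT.
- by case/orP=> h1 /orP[h2|h2]; [exact: fu1 h1 h2|case: (no _ _ _ h1 h2)|case: (no _ _ _ h2 h1)|exact: fu2 h1 h2].
- by rewrite inE => /orP[/ex1|/ex2] [v h]; exists v; rewrite h ?orbT.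
Qed.

Lemma pmatch_inj X (f : V -> V) : {in X &, injective f} -> [disjoint X & f @: X] ->
  pmatch (X :|: f @: X) [rel w v | (w \in X) && (v == f w) || (v \in X) && (w == f v)].
Proof.
move=> fI dis.
have no w v : w \in X -> v \in X -> w <> f v.
  by move=> wX vX wf; have := imset_f f vX; rewrite -wf (disjointFr dis wX).
split=> [w v|w v|w v1 v2|w] /=.
- by rewrite orbC.
- by rewrite inE => /orP[/andP[-> //]|/andP[vX /eqP->]]; rewrite imset_f ?orbT.
- case/orP=> /andP[h1 /eqP e1] /orP[]/andP[h2 /eqP e2].
  + by rewrite e1 e2.
  + by case: (no w v2).
  + by case: (no w v1).
  + by apply: fI => //; rewrite -e1 -e2.
- rewrite inE => /orP[wX|/imsetP[v vX ->]].
    by exists (f w); rewrite wX eqxx.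
  by exists v; rewrite vX eqxx orbT.
Qed.

Lemma pmatch0 : pmatch set0 (fun _ _ => false).
Proof. by split=> // w; rewrite inE. Qed.

Lemma pmatch_eq S S' M M' : S = S' -> M =2 M' -> pmatch S M -> pmatch S' M'.
Proof.
move=> <- eqM [sy in1 fu ex]; split=> [w v|w v|w v1 v2|w].
- by rewrite -!eqM sy.
- by rewrite -eqM; apply: in1.
- by rewrite -!eqM; apply: fu.
- by move/ex => [v Mv]; exists v; rewrite -eqM.
Qed.

Lemma pmatch_cover S M A : pmatch S M ->
  #|[set p : V * V | (p.1 \in A) && M p.1 p.2]| = #|S :&: A|.
Proof.
move=> [sy in1 fu ex]; rewrite -(@card_in_imset _ _ (fun p : V * V => p.1)).
  apply: eq_card => w; rewrite inE; apply/imsetP/andP.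
    by case=> -[x y]; rewrite inE /= => /andP[xA Mxy] ->; split=> //; apply: in1 Mxy.
  by case=> /ex[v Mwv] wA; exists (w, v); rewrite ?inE //= wA.
move=> [x1 y1] [x2 y2]; rewrite !inE /= => /andP[_ M1] /andP[_ M2] xx.
by rewrite -xx in M2 *; rewrite (fu _ _ _ M1 M2).
Qed.

(** The cross edges are equally many seen from [A] and from [B]; what remains of [#|S :&: A|] and
    [#|S :&: B|] is matched inside the halves. The balance counts below rest on this equation. *)
Lemma pmatch_balance S M A B : pmatch S M -> [disjoint A & B] -> S \subset A :|: B ->
  inner M A + #|S :&: B| = inner M B + #|S :&: A|.
Proof.
move=> pm dis SAB; have [sy in1 fu ex] := pm.
pose X (A B : {set V}) := [set p : V * V | [&& p.1 \in A, p.2 \in B & M p.1 p.2]].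
have split1 (A' B' : {set V}) : [disjoint A' & B'] -> S \subset A' :|: B' ->
    #|S :&: A'| = inner M A' + #|X A' B'|.
  move=> dis' sub; rewrite -(pmatch_cover A' pm) /inner.
  have -> : [set p : V * V | (p.1 \in A') && M p.1 p.2] = X A' A' :|: X A' B'.
    apply/setP => -[x y]; rewrite !inE /=; case: (x \in A') => //=.
    case Mxy: (M x y); rewrite ?andbF //= !andbT.
    have yS : y \in S by apply: (in1 _ x); rewrite sy.
    by have := subsetP sub y yS; rewrite inE.
  rewrite cardsU; have -> : X A' A' :&: X A' B' = set0.
    apply/setP => -[x y]; rewrite !inE /=.
    by case yA: (y \in A'); rewrite ?andbF //= (disjointFr dis' yA) !andbF.
  by rewrite cards0 subn0.
rewrite (split1 A B) // (split1 B A) 1?disjoint_sym 1?setUC //.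
have -> : #|X A B| = #|X B A|; last lia.
rewrite -(@card_in_imset _ _ (fun p : V * V => (p.2, p.1))); last first.
  by move=> [a b] [a' b'] _ _ [-> ->].
apply: eq_card => -[x y]; apply/imsetP/idP.
  case=> -[a b]; rewrite inE /= => /and3P[aA bB Mab] [-> ->].
  by rewrite inE /= aA bB sy.
rewrite !inE /= => /and3P[xB yA Mxy]; exists (y, x) => //.
by rewrite !inE /= xB yA sy.
Qed.

Lemma inner_sub M A A' : A \subset A' -> inner M A <= inner M A'.
Proof.
move=> sub; apply: subset_leq_card; apply/subsetP => p; rewrite !inE.
by case/and3P=> /(subsetP sub)-> /(subsetP sub)->.
Qed.

Lemma inner_le M M' A : subrel M M' -> inner M A <= inner M' A.
Proof.
move=> sub; apply: subset_leq_card; apply/subsetP => p; rewrite !inE.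
by case/and3P=> -> -> /sub.
Qed.

Lemma inner_setD M A D : inner M A <= inner M (A :\: D) + #|D| * (2 * #|V|).
Proof.
apply: leq_trans (_ : #|[set p : V * V | [&& p.1 \in A :\: D, p.2 \in A :\: D & M p.1 p.2]]
    :|: (setX D setT :|: setX setT D)| <= _).
  apply: subset_leq_card; apply/subsetP => -[x y]; rewrite !inE /= !andbT.
  by case/and3P=> -> -> ->; rewrite !andbT; case: (x \in D); case: (y \in D).
apply: leq_trans (leq_card_setU _ _) _; rewrite leq_add2l.
apply: leq_trans (leq_card_setU _ _) _; rewrite !cardsX cardsT; lia.
Qed.

(** Greedy: deleting both ends of a chosen edge destroys at most [4 * #|V|] ordered pairs. *)
Lemma matching_exists (g : rel V) X k : symmetric g -> irreflexive g ->
    0 < #|V| -> k * (4 * #|V|) <= inner g X ->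
  exists P M, [/\ pmatch P M, P \subset X, #|P| = 2 * k & subrel M g].
Proof.
move=> gs gi V0; elim: k X => [|k IHk] X le.
  exists set0, (fun _ _ => false); split=> //; rewrite ?sub0set ?cards0 //.
  exact: pmatch0.
have /card_gt0P[[a b]] : 0 < inner g X by apply: leq_trans le; rewrite muln_gt0; lia.
rewrite inE /= => /and3P[aX bX gab].
have ab : a != b by apply/eqP => ab; rewrite ab gi in gab.
have [|P [M [pm PX cP Mg]]] := IHk (X :\: [set a; b]).
  rewrite -(leq_add2l (4 * #|V|)) -mulSn; apply: leq_trans le _.
  apply: leq_trans (inner_setD g X [set a; b]) _.
  by rewrite cards2 ab mulnA addnC.
have [dis pmab] : [disjoint P & [set a; b]] /\ pmatch [set a; b]
    [rel w v | (w \in [set a]) && (v == b) || (v \in [set a]) && (w == b)].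
  split.
    rewrite disjoint_subset; apply/subsetP => x /(subsetP PX).
    by rewrite !inE => /andP[].
  apply: (pmatch_eq _ _ (@pmatch_inj [set a] (fun=> b) _ _)).
  - by apply/setP => x; rewrite !inE imset_set1 inE.
  - by move=> w v.
  - by move=> x y; rewrite !inE => /eqP-> /eqP->.
  - by rewrite disjoints1; apply/imsetP => -[x _ abE]; rewrite abE eqxx in ab.
exists (P :|: [set a; b]), [rel w v | M w v || (w \in [set a]) && (v == b) || (v \in [set a]) && (w == b)].
split.
- apply: (pmatch_eq _ _ (pmatchU pm pmab dis)) => // w v /=; by rewrite orbA.
- rewrite subUset (subset_trans PX (subsetDl _ _)).
  by apply/subsetP => x; rewrite !inE => /orP[]/eqP->.
- rewrite cardsU cP cards2 ab; have -> : P :&: [set a; b] = set0.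
    by apply/eqP; rewrite setI_eq0.
  by rewrite cards0; lia.
- move=> w v /= /orP[/orP[/Mg //|]|]; rewrite inE => /andP[/eqP-> /eqP->] //.
  by rewrite gs.
Qed.

End Matchings.

Lemma disjointI (V : finType) (S T : {set V}) :
  (forall x, x \in S -> x \in T -> False) -> [disjoint S & T].
Proof.
move=> H; rewrite disjoint_subset; apply/subsetP => x xS; rewrite inE.
by apply/negP => xT; exact: H xS xT.
Qed.

Lemma card_split (V : finType) (S T : {set V}) : S \subset T -> #|T| = #|S| + #|T :\: S|.
Proof. by move=> ST; rewrite -(cardsID S T) (setIidPr ST). Qed.

Lemma card_disjointU (V : finType) (S T : {set V}) : [disjoint S & T] ->
  #|S :|: T| = #|S| + #|T|.
Proof. by move=> dis; rewrite cardsU (disjoint_setI0 dis) cards0 subn0. Qed.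

(** The counting principle used throughout in place of explicit injections: every counted element
    has a witness in [Gm], and a witness determines its element. *)
Lemma card_le_rel (Y G : finType) (S : {set Y}) (Gm : {set G}) (F : G -> Y -> bool) :
    (forall y, y \in S -> exists2 g, g \in Gm & F g y) ->
    (forall g y y', F g y -> F g y' -> y = y') -> #|S| <= #|Gm|.
Proof.
move=> HS HF; have [->|[y0 y0S]] := set_0Vmem S; first by rewrite cards0.
have [g0 _ _] := HS y0 y0S; pose f y := odflt g0 [pick g in Gm | F g y].
have fP y : y \in S -> (f y \in Gm) && F (f y) y.
  move=> yS; rewrite /f; case: pickP => [g //|no].
  by have [g gG Fgy] := HS y yS; move: (no g); rewrite /= gG Fgy.
rewrite -(@card_in_imset _ _ f S) => [|y y' /fP/andP[_ h] /fP/andP[_ h'] yy].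
  by apply: subset_leq_card; apply/subsetP => _ /imsetP[y /fP/andP[h _] ->].
by apply: HF h _; rewrite yy.
Qed.

Lemma inj_inverse (V : finType) (f : V -> V) (S T : {set V}) :
    {in S &, injective f} -> f @: S = T ->
  exists h : V -> V, [/\ {in T &, injective h}, h @: T = S &
    {in T, forall y, h y \in S /\ f (h y) = y}].
Proof.
move=> fI ST; pose h y := odflt y [pick x in S | f x == y].
have hP y : y \in T -> h y \in S /\ f (h y) = y.
  rewrite -ST => /imsetP[x xS ->]; rewrite /h; case: pickP => [z /andP[zS /eqP] //|no].
  by move: (no x); rewrite /= xS eqxx.
exists h; split=> //.
- by move=> y y' /hP[_ h1] /hP[_ h2] hh; rewrite -h1 -h2 hh.
- apply/setP => x; apply/imsetP/idP => [[y /hP[hS _] -> //]|xS].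
  have fT : f x \in T by rewrite -ST imset_f.
  by exists (f x) => //; apply: fI => //; have [] := hP _ fT.
Qed.

(** With [#|S|] candidates for every single vertex, one vertex of a set already provides Hall's
    condition for the set. *)
Lemma inj_choice (V : finType) (q : rel V) (S T : {set V}) :
    (forall x, x \in S -> #|S| <= #|[set y in T | q x y]|) ->
  exists f : V -> V, {in S, forall x, (f x \in T) && q x (f x)} /\ {in S &, injective f}.
Proof.
move=> HS; have [->|[x0 x0S]] := set_0Vmem S.
  by exists id; split=> x; rewrite inE.
apply: (@hall V V q x0) => X XS; have [->|[x xX]] := set_0Vmem X; first by rewrite cards0.
apply: leq_trans (subset_leq_card XS) (leq_trans (HS x (subsetP XS x xX)) _).
apply: subset_leq_card; apply/subsetP => y; rewrite !inE => /andP[-> qxy].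
by apply/existsP; exists x; rewrite xX.
Qed.

(** * Completing one colour class to a perfect matching *)

Section GroupStep.
Variables (V : finType) (e : rel V).
Hypotheses (es : symmetric e) (ei : irreflexive e).

(* A pair outside the class of a colour is either an edge inside one of the
   two blocks [C], [D] left uncovered by the class, or an edge of the reserved
   graphs: [Qa] from a stray vertex of [A] to [D], [Qb] from a stray vertex of
   [B] to [C], and [Qh] between the blocks. *)
Definition extra_cross (C D OA OB : {set V}) (Qa Qb Qh : rel V) (x y : V) :=
  [|| [&& x \in OA, y \in D & Qa x y], [&& x \in C, y \in OB & Qb x y]
    | [&& x \in C, y \in D & Qh x y]].

Definition extra_edge (C D OA OB : {set V}) (Qa Qb Qh used : rel V) (w v : V) :=
  ~~ used w v && [|| ((w \in C) && (v \in C) || (w \in D) && (v \in D)) && e w v,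
     extra_cross C D OA OB Qa Qb Qh w v | extra_cross C D OA OB Qa Qb Qh v w].

(** Here [A] has [2 * k] more uncovered vertices than [B]; a matching [P] of [k] edges inside [C]
    removes the excess. The stray vertices of [A] are then matched into [D], those of [B] into [C]
    away from [P] (hence [u0 + 2 * k] candidates), and the rest of the two blocks has equal sizes
    and is left to [hallH]. *)
Lemma group_step_half (A B C D Bad Cov : {set V}) (cl used Qa Qb Qh : rel V) u0 k del :
    [disjoint A & B] -> C \subset A -> D \subset B -> 0 < #|V| ->
    symmetric used -> pmatch Cov cl ->
    (forall x, x \in Cov -> [&& x \in A :|: B, x \notin C, x \notin D & x \notin Bad]) ->
    let OA := A :\: C :\: Bad :\: Cov in
    let OB := B :\: D :\: Bad :\: Cov in
    #|OA| + #|OB| <= u0 ->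
    #|A :\: Bad :\: Cov| = #|B :\: Bad :\: Cov| + 2 * k ->
    k * (4 * #|V|) <= inner [rel w v | e w v && ~~ used w v] (C :\: Bad) ->
    (forall w, w \in OA -> u0 <= #|[set y in D :\: Bad | Qa w y && ~~ used w y]|) ->
    (forall y, y \in OB -> u0 + 2 * k <= #|[set w in C :\: Bad | Qb w y && ~~ used w y]|) ->
    (forall A' B' : {set V}, A' \subset C -> B' \subset D -> #|A'| = #|B'| ->
       #|C :\: A'| <= del -> #|D :\: B'| <= del -> exists f : V -> V,
       [/\ {in A' &, injective f}, f @: A' = B' & {in A', forall x, Qh x (f x) && ~~ used x (f x)}]) ->
    #|Bad| + 2 * k + u0 <= del ->
  exists ex : rel V, [/\ pmatch ((A :|: B) :\: Bad :\: Cov) ex,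
    subrel ex (extra_edge C D OA OB Qa Qb Qh used) & inner ex C = 2 * k /\ inner ex D = 0].
Proof.
move=> dis CA DB V0 us pmC covP OA OB cardO cardU priv qa qb hallH dle.
have AB x : x \in A -> x \in B -> False by move=> xA; rewrite (disjointFr dis xA).
have CAx x : x \in C -> x \in A := subsetP CA x.
have DBx x : x \in D -> x \in B := subsetP DB x.
have gs : symmetric [rel w v | e w v && ~~ used w v] by move=> w v; rewrite /= es us.
have gi : irreflexive [rel w v | e w v && ~~ used w v] by move=> w; rewrite /= ei.
have [P [MP [pmP PC cP MPe]]] := matching_exists gs gi V0 priv.
have PCx x : x \in P -> (x \in C) /\ (x \notin Bad).
  by move/(subsetP PC); rewrite inE => /andP[].
have [f [fD fI]] : exists f : V -> V,
    {in OA, forall x, (f x \in D :\: Bad) && (Qa x (f x) && ~~ used x (f x))} /\ {in OA &, injective f}.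
  apply: (@inj_choice _ [rel x y | Qa x y && ~~ used x y]) => x xO /=.
  by apply: leq_trans (qa x xO); lia.
have [f' [fC fI']] : exists f : V -> V,
    {in OB, forall x, (f x \in C :\: Bad :\: P) && (Qb (f x) x && ~~ used (f x) x)} /\ {in OB &, injective f}.
  apply: (@inj_choice _ [rel y x | Qb x y && ~~ used x y]) => y yO /=.
  have := qb y yO; set Y := [set w in _ | _] => le.
  have : Y \subset [set y0 in C :\: Bad :\: P | Qb y0 y && ~~ used y0 y] :|: P.
    by apply/subsetP => x; rewrite !inE; case: (x \in P); rewrite ?orbT //= orbF.
  move/subset_leq_card/leq_trans => /(_ _ (leq_card_setU _ _)); rewrite cP; lia.
pose A' := C :\: Bad :\: P :\: f' @: OB; pose B' := D :\: Bad :\: f @: OA.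
have fOA x : x \in f @: OA -> (x \in D) /\ (x \notin Bad).
  by case/imsetP=> y yO ->; have /andP[] := fD y yO; rewrite inE => /andP[].
have fOB x : x \in f' @: OB -> [/\ x \in C, x \notin Bad & x \notin P].
  case/imsetP=> y yO ->; have /andP[] := fC y yO; rewrite !inE => /and3P[? ? ?] _.
  by split.
have cardC : #|A :\: Bad :\: Cov| = #|OA| + (2 * k + (#|OB| + #|A'|)).
  have -> : A :\: Bad :\: Cov = OA :|: (C :\: Bad).
    apply/setP => x; rewrite !inE; case xC: (x \in C); last by rewrite !andbF orbF.
    rewrite CAx // /= !andbF !andbT; case xCov: (x \in Cov) => //=.
    by have /and4P[_] := covP x xCov; rewrite xC.
  rewrite card_disjointU; last first.
    by apply: disjointI => x; rewrite !inE; case: (x \in C); rewrite /= ?andbF.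
  rewrite (card_split PC) cP -(card_in_imset fI') -card_split //.
  by apply/subsetP => x /fOB[xC xB xP]; rewrite !inE xC xB xP.
have cardD : #|B :\: Bad :\: Cov| = #|OB| + (#|OA| + #|B'|).
  have -> : B :\: Bad :\: Cov = OB :|: (D :\: Bad).
    apply/setP => x; rewrite !inE; case xC: (x \in D); last by rewrite !andbF orbF.
    rewrite DBx // /= !andbF !andbT; case xCov: (x \in Cov) => //=.
    by have /and4P[_ _] := covP x xCov; rewrite xC.
  rewrite card_disjointU; last first.
    by apply: disjointI => x; rewrite !inE; case: (x \in D); rewrite /= ?andbF.
  rewrite -(card_in_imset fI) -card_split //.
  by apply/subsetP => x /fOA[xC xB]; rewrite !inE xC xB.
have [|||||h [hI hB hQ]] := hallH A' B'.
- by apply/subsetP => x; rewrite !inE => /and4P[_ _ _].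
- by apply/subsetP => x; rewrite !inE => /and3P[_ _].
- lia.
- apply: leq_trans (_ : #|Bad :|: (P :|: f' @: OB)| <= _).
    apply: subset_leq_card; apply/subsetP => x; rewrite !inE => /andP[] /=.
    by case: (x \in Bad) => //=; case: (x \in P) => //=; case: (x \in f' @: OB) => //= /negP.
  apply: leq_trans (leq_card_setU _ _) _; rewrite -leq_subRL; last lia.
  apply: leq_trans (leq_card_setU _ _) _; rewrite cP (card_in_imset fI'); lia.
- apply: leq_trans (_ : #|Bad :|: f @: OA| <= _).
    apply: subset_leq_card; apply/subsetP => x; rewrite !inE => /andP[] /=.
    by case: (x \in Bad) => //=; case: (x \in f @: OA) => //= /negP.
  apply: leq_trans (leq_card_setU _ _) _; rewrite (card_in_imset fI); lia.
have OAx x : x \in OA -> [/\ x \in A, x \notin C, x \notin Bad & x \notin Cov].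
  by rewrite !inE => /and4P[-> -> -> ->].
have OBx x : x \in OB -> [/\ x \in B, x \notin D, x \notin Bad & x \notin Cov].
  by rewrite !inE => /and4P[-> -> -> ->].
have A'x x : x \in A' -> [/\ x \in C, x \notin Bad, x \notin P & x \notin f' @: OB].
  by rewrite !inE => /and4P[-> -> -> ->].
have B'x x : x \in B' -> [/\ x \in D, x \notin Bad & x \notin f @: OA].
  by rewrite !inE => /and3P[-> -> ->].
have dis1 : [disjoint OA & f @: OA].
  by apply: disjointI => x /OAx[xA _ _ _] /fOA[/DBx xB _]; exact: AB xA xB.
have dis2 : [disjoint OB & f' @: OB].
  by apply: disjointI => x /OBx[xB _ _ _] /fOB[/CAx xA _ _]; exact: AB xA xB.
have dis3 : [disjoint A' & h @: A'].
  by rewrite hB; apply: disjointI => x /A'x[/CAx xA _ _ _] /B'x[/DBx xB _ _]; exact: AB xA xB.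
have pm1 := pmatch_inj fI dis1; have pm2 := pmatch_inj fI' dis2.
have pm3 := pmatch_inj hI dis3; rewrite hB in pm3.
have dis4 : [disjoint OA :|: f @: OA & OB :|: f' @: OB].
  apply: disjointI => x; rewrite !in_setU => /orP[/OAx[xA xC _ _]|/fOA[xD _]] /orP[/OBx[xB xD' _ _]|/fOB[xC' _ _]].
  - exact: AB xA xB.
  - by rewrite xC' in xC.
  - by rewrite xD in xD'.
  - exact: AB (CAx _ xC') (DBx _ xD).
have pm12 := pmatchU pm1 pm2 dis4.
have dis5 : [disjoint P & A' :|: B'].
  apply: disjointI => x xP; have [xC _] := PCx x xP; rewrite in_setU => /orP[].
    by case/A'x=> _ _; rewrite xP.
  by case/B'x=> xD _ _; exact: AB (CAx _ xC) (DBx _ xD).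
have pmP3 := pmatchU pmP pm3 dis5.
have dis6 : [disjoint P :|: (A' :|: B') & OA :|: f @: OA :|: (OB :|: f' @: OB)].
  apply: disjointI => x; rewrite !in_setU => /or3P[xP|xA'|xB'] /orP[/orP[xO|xf]|/orP[xO|xf]].
  - by have [_] := OAx x xO; rewrite (PCx x xP).1.
  - exact: AB (CAx _ (PCx x xP).1) (DBx _ (fOA x xf).1).
  - by have [xB _ _ _] := OBx x xO; exact: AB (CAx _ (PCx x xP).1) xB.
  - by have [_ _] := fOB x xf; rewrite xP.
  - by have [_] := OAx x xO; have [->] := A'x x xA'.
  - by have [xC _ _ _] := A'x x xA'; exact: AB (CAx _ xC) (DBx _ (fOA x xf).1).
  - have [xC _ _ _] := A'x x xA'; have [xB _ _ _] := OBx x xO.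
    exact: AB (CAx _ xC) xB.
  - by have [_ _ _] := A'x x xA'; rewrite xf.
  - have [xD _ _] := B'x x xB'; have [xA _ _ _] := OAx x xO.
    exact: AB xA (DBx _ xD).
  - by have [_ _] := B'x x xB'; rewrite xf.
  - by have [_] := OBx x xO; have [->] := B'x x xB'.
  - have [xD _ _] := B'x x xB'; have [xC _ _] := fOB x xf.
    exact: AB (CAx _ xC) (DBx _ xD).
have pm := pmatchU pmP3 pm12 dis6.
set ex := SimplRel _ in pm; have exP w v : ex w v ->
    [\/ MP w v, extra_cross C D OA OB Qa Qb Qh w v && ~~ used w v
      | extra_cross C D OA OB Qa Qb Qh v w && ~~ used v w].
  have h_ x : x \in A' -> extra_cross C D OA OB Qa Qb Qh x (h x) && ~~ used x (h x).
    move=> xA'; have [xC _ _ _] := A'x x xA'; have := hQ x xA'.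
    have [hD _ _] : [/\ h x \in D, h x \notin Bad & h x \notin f @: OA].
      by apply: B'x; rewrite -hB imset_f.
    by rewrite /extra_cross xC hD => /andP[-> ->]; rewrite !orbT.
  have f_ x : x \in OA -> extra_cross C D OA OB Qa Qb Qh x (f x) && ~~ used x (f x).
    move=> xO; have /andP[_ /andP[Q u]] := fD x xO.
    by rewrite /extra_cross xO (fOA (f x) (imset_f f xO)).1 Q u.
  have f'_ x : x \in OB -> extra_cross C D OA OB Qa Qb Qh (f' x) x && ~~ used (f' x) x.
    move=> xO; have /andP[_ /andP[Q u]] := fC x xO.
    have [xC _ _] := fOB _ (imset_f f' xO).
    by rewrite /extra_cross xO xC Q u /= !orbT.
  case/orP=> [/orP[|/orP[]/andP[+ /eqP->]]|/orP[/orP[]/andP[+ /eqP->]|/orP[]/andP[+ /eqP->]]].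
  - by constructor 1.
  - by move/h_; constructor 2.
  - by move/h_; constructor 3.
  - by move/f_; constructor 2.
  - by move/f_; constructor 3.
  - by move/f'_; constructor 3.
  - by move/f'_; constructor 2.
have noCC w v : extra_cross C D OA OB Qa Qb Qh w v -> (w \in A) && (v \in B).
  case/or3P=> /and3P[h1 h2 _].
  - by have [-> _ _ _] := OAx w h1; rewrite DBx.
  - by have [-> _ _ _] := OBx v h2; rewrite CAx.
  - by rewrite CAx ?DBx.
have exC : [set p : V * V | [&& p.1 \in C, p.2 \in C & ex p.1 p.2]] =
    [set p : V * V | (p.1 \in C) && MP p.1 p.2].
  apply/setP => -[w v]; rewrite !inE /=; apply/and3P/andP.
    case=> wC vC /exP[Mwv //|/andP[/noCC/andP[_ vB] _]|/andP[/noCC/andP[_ wB] _]].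
      by case: (AB v (CAx _ vC) vB).
    by case: (AB w (CAx _ wC) wB).
  case=> wC Mwv; split=> //; last by rewrite Mwv.
  have [sy in1 _ _] := pmP; rewrite sy in Mwv.
  by have [] := PCx v (in1 _ _ Mwv).
exists ex; split.
- apply: (pmatch_eq _ _ pm) => //; apply/setP => x.
  have -> : (x \in (A :|: B) :\: Bad :\: Cov) =
      [&& x \notin Cov, x \notin Bad & (x \in A) || (x \in B)].
    by rewrite !in_setD in_setU.
  rewrite !in_setU.
  have PCx' := PCx x; have fOA' := fOA x; have fOB' := fOB x.
  apply/idP/idP.
    case/orP=> [/or3P[xP|xA'|xB']|/orP[/orP[xO|xf]|/orP[xO|xf]]].
    + have [xC xBad] := PCx x xP; rewrite (CAx _ xC) xBad /= andbT.
      by apply/negP => /covP; rewrite xC !andbF.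
    + have [xC xBad _ _] := A'x x xA'; rewrite (CAx _ xC) xBad /= andbT.
      by apply/negP => /covP; rewrite xC !andbF.
    + have [xC xBad _] := B'x x xB'; rewrite (DBx _ xC) xBad /= orbT !andbT.
      by apply/negP => /covP; rewrite xC !andbF.
    + by have [-> _ -> ->] := OAx x xO.
    + have [xC xBad] := fOA x xf; rewrite (DBx _ xC) xBad /= orbT !andbT.
      by apply/negP => /covP; rewrite xC !andbF.
    + by have [-> _ -> ->] := OBx x xO; rewrite orbT.
    + have [xC xBad _] := fOB x xf; rewrite (CAx _ xC) xBad /= andbT.
      by apply/negP => /covP; rewrite xC !andbF.
  case/and3P=> xCov xBad /orP[xA|xB].
    have [xC|xC] := boolP (x \in C); last by rewrite !inE xA xC xBad xCov !orbT.
    have [xP|xP] := boolP (x \in P); first by rewrite /= ?orbT.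
    have [xf|xf] := boolP (x \in f' @: OB); first by rewrite /= ?orbT.
    by rewrite !in_setD xf xP xBad xC.
  have [xC|xC] := boolP (x \in D); last by rewrite !inE xB xC xBad xCov !orbT.
  have [xf|xf] := boolP (x \in f @: OA); first by rewrite /= ?orbT.
  by rewrite !in_setD xf xBad xC /= !orbT.
- move=> w v /exP[Mwv|/andP[ec u]|/andP[ec u]]; rewrite /extra_edge.
  + have /andP[ewv ->] := MPe _ _ Mwv; have [sy in1 _ _] := pmP.
    have [wC _] := PCx w (in1 _ _ Mwv); have [|vC _] := PCx v; first by apply: (in1 _ w); rewrite sy.
    by rewrite wC vC ewv.
  + by rewrite u ec orbT.
  + by rewrite us u ec !orbT.
- split.
    rewrite /inner exC (pmatch_cover _ pmP) -cP; apply: eq_card => x.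
    by rewrite inE andbC; case xP: (x \in P); rewrite ?andbF // (PCx x xP).1.
  apply/eqP; rewrite cards_eq0; apply/eqP/setP => -[w v]; rewrite !inE /=.
  apply/negP => /and3P[wD vD /exP[Mwv|/andP[/noCC/andP[wA _] _]|/andP[/noCC/andP[vA _] _]]].
  + have [_ in1 _ _] := pmP; have [wC _] := PCx w (in1 _ _ Mwv).
    exact: AB (CAx _ wC) (DBx _ wD).
  + exact: AB wA (DBx _ wD).
  + exact: AB vA (DBx _ vD).
Qed.

(** The side with more uncovered vertices plays the part of [A], and the parity hypothesis makes the
    excess even. In the mirrored case the reserved graphs are transposed and the bijection given by
    [hallH] is inverted. *)
Lemma group_step (A B C D Bad Cov : {set V}) (cl used Qa Qb Qh : rel V) u0 kmax del :
    [disjoint A & B] -> C \subset A -> D \subset B -> 0 < #|V| ->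
    symmetric used -> pmatch Cov cl ->
    (forall x, x \in Cov -> [&& x \in A :|: B, x \notin C, x \notin D & x \notin Bad]) ->
    let OA := A :\: C :\: Bad :\: Cov in
    let OB := B :\: D :\: Bad :\: Cov in
    #|OA| + #|OB| <= u0 ->
    ~~ odd (#|A :\: Bad :\: Cov| + #|B :\: Bad :\: Cov|) ->
    #|A :\: Bad :\: Cov| <= #|B :\: Bad :\: Cov| + 2 * kmax ->
    #|B :\: Bad :\: Cov| <= #|A :\: Bad :\: Cov| + 2 * kmax ->
    kmax * (4 * #|V|) <= inner [rel w v | e w v && ~~ used w v] (C :\: Bad) ->
    kmax * (4 * #|V|) <= inner [rel w v | e w v && ~~ used w v] (D :\: Bad) ->
    (forall w, w \in OA -> u0 + 2 * kmax <= #|[set y in D :\: Bad | Qa w y && ~~ used w y]|) ->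
    (forall y, y \in OB -> u0 + 2 * kmax <= #|[set w in C :\: Bad | Qb w y && ~~ used w y]|) ->
    (forall A' B' : {set V}, A' \subset C -> B' \subset D -> #|A'| = #|B'| ->
       #|C :\: A'| <= del -> #|D :\: B'| <= del -> exists f : V -> V,
       [/\ {in A' &, injective f}, f @: A' = B' & {in A', forall x, Qh x (f x) && ~~ used x (f x)}]) ->
    #|Bad| + 2 * kmax + u0 <= del ->
  exists ex : rel V, [/\ pmatch ((A :|: B) :\: Bad :\: Cov) ex,
    subrel ex (extra_edge C D OA OB Qa Qb Qh used) &
    inner ex A <= 2 * kmax /\ inner ex B <= 2 * kmax].
Proof.
move=> dis CA DB V0 us pmC covP OA OB cardO par cAB cBA privC privD qa qb hallH dle.
have AB x : x \in A -> x \in B -> False by move=> xA; rewrite (disjointFr dis xA).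
have CAx x : x \in C -> x \in A := subsetP CA x.
have DBx x : x \in D -> x \in B := subsetP DB x.
have noCC w v : extra_cross C D OA OB Qa Qb Qh w v -> (w \in A) && (v \in B).
  case/or3P=> /and3P[h1 h2 _].
  - by move: h1; rewrite !inE => /and4P[_ _ _ ->]; rewrite DBx.
  - by move: h2; rewrite !inE => /and4P[_ _ _ ->]; rewrite CAx.
  - by rewrite CAx ?DBx.
have innerE (ex : rel V) : subrel ex (extra_edge C D OA OB Qa Qb Qh used) ->
    inner ex A <= inner ex C /\ inner ex B <= inner ex D.
  move=> exP; split; apply: subset_leq_card; apply/subsetP => -[w v]; rewrite !inE /=.
  - case/and3P=> wA vA exwv; have /andP[_ /or3P[|/noCC/andP[_ vB]|/noCC/andP[_ wB]]] := exP _ _ exwv.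
    + case/andP=> /orP[]/andP[h1 h2] _; first by rewrite h1 h2.
      by case: (AB w wA (DBx _ h1)).
    + by case: (AB v).
    + by case: (AB w).
  - case/and3P=> wA vA exwv; have /andP[_ /or3P[|/noCC/andP[wB _]|/noCC/andP[vB _]]] := exP _ _ exwv.
    + case/andP=> /orP[]/andP[h1 h2] _; last by rewrite h1 h2.
      by case: (AB w (CAx _ h1) wA).
    + by case: (AB w).
    + by case: (AB v).
have [leBA|/ltnW leAB] := leqP #|B :\: Bad :\: Cov| #|A :\: Bad :\: Cov|.
  pose k := (#|A :\: Bad :\: Cov| - #|B :\: Bad :\: Cov|)./2.
  have kE : #|A :\: Bad :\: Cov| = #|B :\: Bad :\: Cov| + 2 * k.
    rewrite -[LHS](subnKC leBA); congr (_ + _); rewrite mul2n even_halfK //.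
    by rewrite oddB // -oddD.
  have kk : k <= kmax by move: cAB kE; move: #|_| #|_| => x y; lia.
  have [|||||ex [pm exP [iC iD]]] := @group_step_half A B C D Bad Cov cl used Qa Qb Qh u0 k del
    dis CA DB V0 us pmC covP cardO kE => //.
  - by apply: leq_trans privC; rewrite leq_mul2r kk orbT.
  - by move=> w /qa; apply: leq_trans; rewrite leq_addr.
  - by move=> w /qb; apply: leq_trans; rewrite leq_add2l leq_mul2l kk.
  - by apply: leq_trans dle; rewrite leq_add2r leq_add2l leq_mul2l kk.
  have [le1 le2] := innerE _ exP; exists ex; split=> //; split.
    by apply: leq_trans le1 _; rewrite iC leq_mul2l kk.
  by apply: leq_trans le2 _; rewrite iD.
pose k := (#|B :\: Bad :\: Cov| - #|A :\: Bad :\: Cov|)./2.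
have kE : #|B :\: Bad :\: Cov| = #|A :\: Bad :\: Cov| + 2 * k.
  rewrite -[LHS](subnKC leAB); congr (_ + _); rewrite mul2n even_halfK //.
  by rewrite oddB // -oddD addnC.
have kk : k <= kmax by move: cBA kE; move: #|_| #|_| => x y; lia.
have dis' : [disjoint B & A] by rewrite disjoint_sym.
have [||||||||ex [pm exP [iC iD]]] := @group_step_half B A D C Bad Cov cl used
   [rel y w | Qb w y] [rel y w | Qa w y] [rel y w | Qh w y] u0 k del dis' DB CA V0 us pmC.
- by move=> x /covP; rewrite setUC => /and4P[-> -> -> ->].
- by rewrite addnC.
- exact: kE.
- by apply: leq_trans privD; rewrite leq_mul2r kk orbT.
- move=> w wO; apply: leq_trans (_ : u0 + 2 * kmax <= _); first exact: leq_addr.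
  apply: leq_trans (qb w wO) _; apply: subset_leq_card; apply/subsetP => y.
  by rewrite !inE us.
- move=> w wO; apply: leq_trans (_ : u0 + 2 * kmax <= _).
    by rewrite leq_add2l leq_mul2l kk.
  apply: leq_trans (qa w wO) _; apply: subset_leq_card; apply/subsetP => y.
  by rewrite !inE us.
- move=> B' A' B'D A'C cardBA leB leA.
  have [f [fI fA fQ]] := hallH A' B' A'C B'D (esym cardBA) leA leB.
  have [h [hI hB hP]] := inj_inverse fI fA; exists h; split=> // y /hP[hA fh].
  by have := fQ _ hA; rewrite fh /= us.
- by apply: leq_trans dle; rewrite leq_add2r leq_add2l leq_mul2l kk.
have exP' : subrel ex (extra_edge C D OA OB Qa Qb Qh used).
  move=> w v /exP /andP[u]; rewrite /extra_edge u /= orbC.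
  have E x y : extra_cross D C OB OA [rel y w | Qb w y] [rel y w | Qa w y]
      [rel y w | Qh w y] x y -> extra_cross C D OA OB Qa Qb Qh y x.
    by rewrite /extra_cross /=; case/or3P=> /and3P[-> -> ->]; rewrite ?orbT.
  case/orP=> [/orP[/E->|/E->]|/andP[+ ->]]; rewrite ?orbT //.
  by rewrite orbC => ->.
have [le1 le2] := innerE _ exP'; exists ex; split.
- by rewrite (setUC A B).
- exact: exP'.
- split; last by apply: leq_trans le2 _; rewrite iC leq_mul2l kk.
  by apply: leq_trans le1 _; rewrite iD.
Qed.

End GroupStep.

Lemma pmatch_even (V : finType) (S : {set V}) (M : rel V) :
  pmatch S M -> irreflexive M -> ~~ odd #|S|.
Proof.
move: {2}#|S| (leqnn #|S|) => n; elim: n S M => [|n IHn] S M le pm Mi.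
  by move: le; rewrite leqn0 => /eqP->.
have [sy in1 fu ex] := pm; have [->|[w wS]] := set_0Vmem S; first by rewrite cards0.
have [v Mwv] := ex w wS; have vS : v \in S by apply: (in1 _ w); rewrite sy.
have wv : w != v by apply/eqP => wv; rewrite wv Mi in Mwv.
have cS : #|S| = 2 + #|S :\: [set w; v]|.
  have -> : 2 = #|[set w; v]| by rewrite cards2 wv.
  by apply: card_split; apply/subsetP => x; rewrite !inE => /orP[]/eqP->.
rewrite cS oddD /=; apply: (IHn _ [rel x y | M x y && (x \in S :\: [set w; v])]).
- by move: le; rewrite cS; lia.
- have stay x y : M x y -> x \in S :\: [set w; v] -> y \in S :\: [set w; v].
    move=> Mxy; rewrite !inE !negb_or => /andP[/andP[xw xv] _].
    rewrite (in1 y x) 1?sy // andbT; apply/andP; split.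
      by apply: contraNneq xv => yw; apply/eqP; apply: (fu w) => //; rewrite sy -yw.
    by apply: contraNneq xw => yv; apply/eqP; apply: (fu v); rewrite sy // -yv.
  split=> [x y|x y|x y y'|x] /=.
  + rewrite sy; case Myx: (M y x) => //=; apply/idP/idP; apply: stay => //; by rewrite sy.
  + by case/andP.
  + by move=> /andP[h1 _] /andP[h2 _]; exact: fu h1 h2.
  + move=> xS; have [|y Mxy] := ex x; first by move: xS; rewrite inE => /andP[].
    by exists y; rewrite Mxy xS.
- by move=> x /=; rewrite Mi.
Qed.

Lemma inner_used (V H : finType) (s : {pred H}) (g : rel V) (ex : H -> rel V) (X : {set V}) :
  inner g X <= inner [rel w v | g w v && ~~ [exists h, (h \in s) && ex h w v]] X +
    \sum_(h in s) inner (ex h) X.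
Proof.
rewrite /inner; set S1 := [set p | _]; set S2 := [set p | _].
apply: leq_trans (_ : #|S2 :|: \bigcup_(h in s) [set p : V * V |
   [&& p.1 \in X, p.2 \in X & ex h p.1 p.2]]| <= _).
  apply: subset_leq_card; apply/subsetP => -[w v]; rewrite !inE /=.
  case/and3P=> wX vX ->; rewrite wX vX /=; case: existsP => //= -[h /andP[hs exh]].
  by apply/bigcupP; exists h; rewrite // inE /= wX vX.
apply: leq_trans (leq_card_setU _ _) _; rewrite leq_add2l.
elim/big_rec2: _ => [|h n S hs le]; first by rewrite cards0.
by apply: leq_trans (leq_card_setU _ _) _; rewrite leq_add2l.
Qed.

Lemma card_cover3 (Y : finType) (S S1 S2 S3 : {set Y}) m b c :
  S \subset S1 :|: S2 :|: S3 -> #|S2| <= b -> #|S3| <= c -> m + b + c <= #|S| -> m <= #|S1|.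
Proof.
move=> sub le2 le3 le; have := leq_trans le (leq_trans (subset_leq_card sub) (leq_card_setU _ _)).
move=> h1; have := leq_trans h1 (leq_add (leq_trans (leq_card_setU _ _) (leq_add (leqnn _) le2)) le3).
by rewrite !leq_add2r.
Qed.

(** * Completing all classes one after another *)

Section GroupStage.
Variables (V T G : finType) (e : rel V) (A B : {set V}) (blk : V -> T).
Variables (Qa Qb Qh : rel V) (gA gB : G -> T) (Bad Cov : G -> {set V}) (cl : G -> rel V).
Variables (u0 kmax del kap zeta q E0 qm : nat).

Definition blkA c := [set w in A | blk w == c].
Definition blkB d := [set w in B | blk w == d].
Definition strayA g := A :\: blkA (gA g) :\: Bad g :\: Cov g.
Definition strayB g := B :\: blkB (gB g) :\: Bad g :\: Cov g.
Definition group_edge g :=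
  extra_edge e (blkA (gA g)) (blkB (gB g)) (strayA g) (strayB g) Qa Qb Qh (fun _ _ => false).

(** The reserved graphs are disjoint, so an added edge of [Qa] reveals that its end in [A] was
    stray. This and the two analogues below bound how many colours can use reserved edges at one
    vertex. *)
Lemma group_edge_Qa g w y : [disjoint A & B] ->
    (forall w v, Qa w v -> Qb w v || Qh w v -> False) ->
  group_edge g w y -> w \in A -> y \in B -> Qa w y -> w \in strayA g.
Proof.
move=> dis Qex exw wA yB Qw; have yA : y \in A = false by rewrite (disjointFl dis yB).
have wB : w \in B = false by rewrite (disjointFr dis wA).
have := Qex _ _ Qw; move: exw.
rewrite /group_edge /extra_edge /extra_cross !inE Qw wA yB yA wB /= ?andbF ?andbT ?orbF /=.
case: (Qb w y) => [_ /(_ erefl)//|]; case: (Qh w y) => [_ /(_ erefl)//|].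
by rewrite ?andbF ?orbF => /andP[].
Qed.

Lemma group_edge_Qb g w y : [disjoint A & B] ->
    (forall w v, Qb w v -> Qa w v || Qh w v -> False) ->
  group_edge g w y -> w \in A -> y \in B -> Qb w y -> y \in strayB g.
Proof.
move=> dis Qex exw wA yB Qw; have yA : y \in A = false by rewrite (disjointFl dis yB).
have wB : w \in B = false by rewrite (disjointFr dis wA).
have := Qex _ _ Qw; move: exw.
rewrite /group_edge /extra_edge /extra_cross !inE Qw wA yB yA wB /= ?andbF ?andbT ?orbF /=.
case: (Qa w y) => [_ /(_ erefl)//|]; case: (Qh w y) => [_ /(_ erefl)//|].
by rewrite ?andbF ?orbF => /andP[].
Qed.

Lemma group_edge_Qh g w y : [disjoint A & B] ->
    (forall w v, Qh w v -> Qa w v || Qb w v -> False) ->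
  group_edge g w y -> w \in A -> y \in B -> Qh w y -> (blk w == gA g) && (blk y == gB g).
Proof.
move=> dis Qex exw wA yB Qw; have yA : y \in A = false by rewrite (disjointFl dis yB).
have wB : w \in B = false by rewrite (disjointFr dis wA).
have := Qex _ _ Qw; move: exw.
rewrite /group_edge /extra_edge /extra_cross !inE Qw wA yB yA wB /= ?andbF ?andbT ?orbF /=.
case: (Qa w y) => [_ /(_ erefl)//|]; case: (Qb w y) => [_ /(_ erefl)//|].
by rewrite ?andbF ?orbF.
Qed.

(** The colours are completed in turn, avoiding the edges already [used]. At a vertex at most [zeta]
    edges of [Qa] or of [Qb] are used, as many as the times it is stray. Between two blocks at most
    [q] edges of [Qh] are used at a vertex, one for each colour with this pair of blocks. Inside a
    block [E0] ordered pairs outlast all the balancing matchings. *)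
Lemma group_stage :
    symmetric e -> irreflexive e -> [disjoint A & B] -> 0 < #|V| ->
    (forall w v, [&& ~~ (Qa w v && Qb w v), ~~ (Qa w v && Qh w v) & ~~ (Qb w v && Qh w v)]) ->
    (forall g, pmatch (Cov g) (cl g)) ->
    (forall g x, x \in Cov g -> [&& x \in A :|: B, x \notin blkA (gA g), x \notin blkB (gB g)
       & x \notin Bad g]) ->
    (forall g, #|strayA g| + #|strayB g| <= u0) ->
    (forall g, ~~ odd (#|A :\: Bad g :\: Cov g| + #|B :\: Bad g :\: Cov g|)) ->
    (forall g, #|A :\: Bad g :\: Cov g| <= #|B :\: Bad g :\: Cov g| + 2 * kmax) ->
    (forall g, #|B :\: Bad g :\: Cov g| <= #|A :\: Bad g :\: Cov g| + 2 * kmax) ->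
    (forall g, #|Bad g| <= kap) ->
    (forall c, E0 <= inner e (blkA c)) -> (forall d, E0 <= inner e (blkB d)) ->
    kmax * (4 * #|V|) + kap * (2 * #|V|) + #|G| * (2 * kmax) <= E0 ->
    (forall w d, w \in A -> qm <= #|[set y in blkB d | Qa w y]|) ->
    (forall y c, y \in B -> qm <= #|[set w in blkA c | Qb w y]|) ->
    u0 + 2 * kmax + kap + zeta <= qm ->
    (forall w, #|[set g | w \in strayA g]| <= zeta) ->
    (forall w, #|[set g | w \in strayB g]| <= zeta) ->
    (forall c d, #|[set g | (gA g == c) && (gB g == d)]| <= q) ->
    (forall c d (used : rel V), symmetric used ->
       (forall x, x \in blkA c -> #|[set y in blkB d | Qh x y && used x y]| <= q) ->
       (forall y, y \in blkB d -> #|[set x in blkA c | Qh x y && used x y]| <= q) ->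
       forall A' B' : {set V}, A' \subset blkA c -> B' \subset blkB d -> #|A'| = #|B'| ->
       #|blkA c :\: A'| <= del -> #|blkB d :\: B'| <= del -> exists f : V -> V,
       [/\ {in A' &, injective f}, f @: A' = B' & {in A', forall x, Qh x (f x) && ~~ used x (f x)}]) ->
    kap + 2 * kmax + u0 <= del ->
  exists ex : G -> rel V,
    [/\ forall g, pmatch ((A :|: B) :\: Bad g :\: Cov g) (ex g),
        forall g, subrel (ex g) (group_edge g),
        forall g h w v, ex g w v -> ex h w v -> g = h &
        forall g, inner (ex g) A <= 2 * kmax /\ inner (ex g) B <= 2 * kmax].
Proof.
move=> es ei dis V0 Qex pmC covP cardO par iAB iBA badk EA EB E0P qa qb qmP zA zB gq hallH delP.
suff H (s : seq G) : uniq s -> exists ex : G -> rel V,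
    [/\ forall g, g \in s -> pmatch ((A :|: B) :\: Bad g :\: Cov g) (ex g),
        forall g, g \in s -> subrel (ex g) (group_edge g),
        forall g h w v, g \in s -> h \in s -> ex g w v -> ex h w v -> g = h &
        forall g, g \in s -> inner (ex g) A <= 2 * kmax /\ inner (ex g) B <= 2 * kmax].
  have [ex [h1 h2 h3 h4]] := H (enum G) (enum_uniq _).
  by exists ex; split=> [g|g|g h w v|g]; [apply: h1|apply: h2|apply: h3|apply: h4]; rewrite mem_enum.
elim: s => [|g s IHs] /=; first by exists (fun _ _ _ => false).
case/andP=> gs /IHs[ex [h1 h2 h3 h4]].
pose used : rel V := fun w v => [exists h, (h \in s) && ex h w v].
have us : symmetric used.
  move=> w v; rewrite /used; apply: eq_existsb => h; case hs: (h \in s) => //=.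
  by have [sy _ _ _] := h1 h hs; apply: sy.
have QaE w v : Qa w v -> Qb w v || Qh w v -> False.
  by move=> Q1; have := Qex w v; rewrite Q1; case: (Qb w v); case: (Qh w v).
have QbE w v : Qb w v -> Qa w v || Qh w v -> False.
  by move=> Q1; have := Qex w v; rewrite Q1; case: (Qa w v); case: (Qh w v).
have QhE w v : Qh w v -> Qa w v || Qb w v -> False.
  by move=> Q1; have := Qex w v; rewrite Q1; case: (Qa w v); case: (Qb w v).
have fun_ex h w v1 v2 : h \in s -> ex h w v1 -> ex h w v2 -> v1 = v2.
  by move=> /h1[_ _ + _]; apply.
have fun_ex' h w1 w2 v : h \in s -> ex h w1 v -> ex h w2 v -> w1 = w2.
  by move=> hs; have [sy _ fu _] := h1 _ hs; rewrite !(sy _ v); apply: fu.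
have priv (X : {set V}) : X \subset A \/ X \subset B -> E0 <= inner e X ->
    kmax * (4 * #|V|) <= inner [rel w v | e w v && ~~ used w v] (X :\: Bad g).
  move=> XAB EX; have le1 := inner_setD e X (Bad g).
  have le2 := inner_used (mem s) e ex (X :\: Bad g).
  have le3 : \sum_(h in mem s) inner (ex h) (X :\: Bad g) <= #|G| * (2 * kmax).
    apply: leq_trans (_ : \sum_(h in mem s) 2 * kmax <= _); last first.
      by rewrite sum_nat_const leq_mul2r max_card orbT.
    apply: leq_sum => h hs; have [lA lB] := h4 h hs; case: XAB => sub.
      by apply: leq_trans lA; apply: inner_sub; apply: subset_trans (subsetDl _ _) sub.
    by apply: leq_trans lB; apply: inner_sub; apply: subset_trans (subsetDl _ _) sub.
  have le4 : #|Bad g| * (2 * #|V|) <= kap * (2 * #|V|) by rewrite leq_mul2r badk orbT.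
  move: le1 le2 le3 le4 E0P EX; rewrite -/used.
  move: (inner _ _) (inner _ _) (inner _ _) (_ * _) (_ * _) (_ * _) (_ * _) (\sum_(_ in _) _).
  by move=> a b c x y z w l; lia.
have [||||||||ex0 [pm0 sub0 [in0A in0B]]] := @group_step V e es ei A B (blkA (gA g)) (blkB (gB g)) (Bad g) (Cov g)
  (cl g) used Qa Qb Qh u0 kmax del dis _ _ V0 us (pmC g) (covP g) (cardO g) (par g) (iAB g) (iBA g).
- by apply/subsetP => x; rewrite inE => /andP[].
- by apply/subsetP => x; rewrite inE => /andP[].
- by apply: priv; [left; apply/subsetP => x; rewrite inE => /andP[]|apply: EA].
- by apply: priv; [right; apply/subsetP => x; rewrite inE => /andP[]|apply: EB].
- move=> w; rewrite -/(strayA g) => wO; have wA : w \in A by move: wO; rewrite !inE => /and4P[].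
  pose Z := [set y in blkB (gB g) | Qa w y && used w y].
  have cZ : #|Z| <= zeta.
    apply: leq_trans (zA w); apply: (@card_le_rel _ _ _ _ (fun h y => (h \in s) && ex h w y)).
      move=> y; rewrite inE => /and3P[yD Qw /existsP[h /andP[hs exh]]]; exists h; last by rewrite hs.
      move: yD; rewrite !in_set => /andP[yB _].
      by have := group_edge_Qa dis QaE (h2 h hs _ _ exh) wA yB Qw; rewrite !in_set.
    by move=> h y y' /andP[hs h5] /andP[_]; apply: fun_ex hs h5.
  have sub : [set y in blkB (gB g) | Qa w y] \subset
     [set y in blkB (gB g) :\: Bad g | Qa w y && ~~ used w y] :|: Bad g :|: Z.
    apply/subsetP => y; rewrite !inE => /andP[-> ->] /=; rewrite andbT.
    by case: (y \in Bad g); case: (used w y).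
  by apply: (card_cover3 sub (badk g) cZ); exact: leq_trans qmP (qa w _ wA).
- move=> y; rewrite -/(strayB g) => yO; have yB : y \in B by move: yO; rewrite !inE => /and4P[].
  pose Z := [set w in blkA (gA g) | Qb w y && used w y].
  have cZ : #|Z| <= zeta.
    apply: leq_trans (zB y); apply: (@card_le_rel _ _ _ _ (fun h w => (h \in s) && ex h w y)).
      move=> w; rewrite inE => /and3P[wD Qw /existsP[h /andP[hs exh]]]; exists h; last by rewrite hs.
      move: wD; rewrite !in_set => /andP[wA _].
      by have := group_edge_Qb dis QbE (h2 h hs _ _ exh) wA yB Qw; rewrite !in_set.
    by move=> h w w' /andP[hs h5] /andP[_]; apply: fun_ex' hs h5.
  have sub : [set w in blkA (gA g) | Qb w y] \subset
     [set w in blkA (gA g) :\: Bad g | Qb w y && ~~ used w y] :|: Bad g :|: Z.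
    apply/subsetP => w; rewrite !inE => /andP[-> ->] /=; rewrite andbT.
    by case: (w \in Bad g); case: (used w y).
  by apply: (card_cover3 sub (badk g) cZ); exact: leq_trans qmP (qb y _ yB).
- apply: hallH => //.
    move=> x xC; apply: leq_trans (gq (gA g) (gB g)).
    apply: (@card_le_rel _ _ _ _ (fun h y => (h \in s) && ex h x y)).
      move=> y; rewrite inE => /and3P[yD Qw /existsP[h /andP[hs exh]]]; exists h; last by rewrite hs.
      move: xC yD; rewrite !in_set => /andP[xA /eqP<-] /andP[yB /eqP<-].
      by have := group_edge_Qh dis QhE (h2 h hs _ _ exh) xA yB Qw; rewrite !(eq_sym (blk _)).
    by move=> h y y' /andP[hs h5] /andP[_]; apply: fun_ex hs h5.
  move=> y yD; apply: leq_trans (gq (gA g) (gB g)).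
  apply: (@card_le_rel _ _ _ _ (fun h x => (h \in s) && ex h x y)).
    move=> x; rewrite inE => /and3P[xC Qw /existsP[h /andP[hs exh]]]; exists h; last by rewrite hs.
    move: xC yD; rewrite !in_set => /andP[xA /eqP<-] /andP[yB /eqP<-].
    by have := group_edge_Qh dis QhE (h2 h hs _ _ exh) xA yB Qw; rewrite !(eq_sym (blk _)).
  by move=> h x x' /andP[hs h5] /andP[_]; apply: fun_ex' hs h5.
- by apply: leq_trans delP; rewrite -!addnA leq_add2r.
have sE h : h \in s -> (h == g) = false by move=> hs; apply: contraNF gs => /eqP <-.
exists (fun h => if h == g then ex0 else ex h); split.
- move=> h; rewrite inE; case: eqVneq => [->//|_ /=]; exact: h1.
- move=> h; rewrite inE; case: eqVneq => [-> _|_ /=]; last exact: h2.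
  by move=> w v /sub0 /andP[_ h5]; rewrite /group_edge /extra_edge /= h5.
- move=> h h' w v; rewrite !inE; case: eqVneq => [->|_ /=]; case: eqVneq => [->//|_ /=].
  + move=> _ hs /sub0 /andP[/negP nu _] exh; case: nu.
    by apply/existsP; exists h'; rewrite hs.
  + move=> hs _ exh /sub0 /andP[/negP nu _]; case: nu.
    by apply/existsP; exists h; rewrite hs.
  + exact: h3.
- move=> h; rewrite inE; case: eqVneq => [->//|_ /=]; exact: h4.
Qed.

End GroupStage.

(** * Rounds of matchings between blocks *)

Lemma inj_into (J K : finType) (S : {set K}) : #|J| <= #|S| ->
  exists f : J -> K, injective f /\ forall x, f x \in S.
Proof.
move=> le; exists (fun x => enum_val (widen_ord le (enum_rank x))); split=> [x y|x].
  by move/enum_val_inj => /(congr1 val) /= xy; apply: enum_rank_inj; apply: ord_inj.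
exact: enum_valP.
Qed.

Lemma double_count (X Y : finType) (S : {set X}) (P : X -> Y -> bool) z m :
    (forall x, x \in S -> #|[set y | P x y]| <= z) ->
  #|[set y | m < #|[set x in S | P x y]|]| * m.+1 <= #|S| * z.
Proof.
move=> Sz; apply: leq_trans (_ : \sum_y #|[set x in S | P x y]| <= _).
  rewrite -sum_nat_const big_mkcond; apply: leq_sum => y _; rewrite inE.
  by case: (ltnP m).
under eq_bigr do rewrite card_set_sum; rewrite exchange_big /= -sum_nat_const.
apply: leq_sum => x /Sz; rewrite -sum1_card big_mkcond; apply: leq_trans.
by apply: leq_sum => y _; rewrite inE; case: (P x y).
Qed.

Section RoundClasses.
Variables (V T J : finType) (H o : rel V) (m : V -> V -> T) (Dom : T -> {set V}).
Variables (D sg s z : nat).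

(** Koenig's theorem colours the graphs of all values [mu] of [m] at once, because the ends of an
    edge are paired with [mu]; [o] tells the two sides apart. A vertex of [Dom mu] has degree at
    least [D - sg], so it misses at most [sg] colours; by double counting at most [s] colours miss
    more than [z] vertices, and [J] is injected into the others. *)
Lemma round_classes :
    symmetric H -> (forall w v, m w v = m v w) ->
    (forall w v, H w v -> o w v = ~~ o v w) ->
    (forall w v v', H w v -> H w v' -> m w v = m w v' -> o w v = o w v') ->
    (forall w mu, #|[set v | H w v && (m w v == mu)]| <= D) ->
    (forall w mu, w \in Dom mu -> D <= #|[set v | H w v && (m w v == mu)]| + sg) ->
    (forall mu, #|Dom mu| * sg <= s * z) -> #|J| + s <= D ->
  exists M : T -> J -> rel V,
    [/\ [/\ forall mu j, symmetric (M mu j),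
            forall mu j w v v', M mu j w v -> M mu j w v' -> v = v' &
            forall mu j w v, M mu j w v -> H w v && (m w v == mu)],
        forall mu j mu' j' w v, M mu j w v -> M mu' j' w v -> (mu, j) = (mu', j'),
        forall mu j, #|[set w in Dom mu | ~~ [exists v, M mu j w v]]| <= z,
        forall w mu, w \in Dom mu -> #|[set j | ~~ [exists v, M mu j w v]]| <= sg &
        forall w, #|[set v | H w v && ~~ [exists mu, exists j, M mu j w v]]| <= #|T| * (D - #|J|)].
Proof.
move=> Hs ms oH om degD degs Dsz JsD.
pose F : {set V * V} := [set p | H p.1 p.2 && o p.1 p.2].
have [||c [cD ca cb]] := @konig _ _ _ (fun p : V * V => (p.1, m p.1 p.2)) (fun p => (p.2, m p.1 p.2)) D F.
- move=> [w mu]; apply: leq_trans (degD w mu).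
  rewrite -(@card_in_imset _ _ (fun p : V * V => p.2)); last first.
    move=> [w1 v1] [w2 v2]; rewrite !inE /= !xpair_eqE => /andP[_ /andP[/eqP-> _]].
    by move=> /andP[_ /andP[/eqP-> _]] ->.
  apply: subset_leq_card; apply/subsetP => _ /imsetP[[w1 v1] + ->].
  by rewrite !inE /= xpair_eqE => /andP[/andP[h _] /andP[/eqP<- /eqP<-]]; rewrite h eqxx.
- move=> [w mu]; apply: leq_trans (degD w mu).
  rewrite -(@card_in_imset _ _ (fun p : V * V => p.1)); last first.
    move=> [w1 v1] [w2 v2]; rewrite !inE /= !xpair_eqE => /andP[_ /andP[/eqP-> _]].
    by move=> /andP[_ /andP[/eqP-> _]] ->.
  apply: subset_leq_card; apply/subsetP => _ /imsetP[[w1 v1] + ->].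
  by rewrite !inE /= xpair_eqE => /andP[/andP[h _] /andP[/eqP<- /eqP<-]]; rewrite Hs h ms eqxx.
pose k w v := if o w v then c (w, v) else c (v, w).
have kD w v : H w v -> k w v < D.
  move=> h; rewrite /k; case: ifP => ow; apply: cD; rewrite inE /= ?h ?ow //.
  by rewrite Hs h /= -[o v w]negbK -oH ?ow.
have ks w v : H w v -> k w v = k v w by move=> h; rewrite /k oH //; case: (o v w).
have kP w v v' : H w v -> H w v' -> m w v = m w v' -> k w v = k w v' -> v = v'.
  move=> h h' mm; have oE := om _ _ _ h h' mm; rewrite /k -oE; case: ifP => ow cc.
    by have [] : (w, v) = (w, v') by apply: ca; rewrite ?inE /= ?h ?h' -?oE ?ow ?mm.
  have o1 : o v w by rewrite -[o v w]negbK -oH ?ow.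
  have o2 : o v' w by rewrite -[o v' w]negbK -oH // -oE ow.
  have [] // : (v, w) = (v', w).
  by apply: cb; rewrite ?inE /= ?(Hs v) ?(Hs v') ?h ?h' ?o1 ?o2 ?(ms v) ?(ms v') ?mm.
pose hit mu w (i : 'I_D) := [exists v, [&& H w v, m w v == mu & k w v == i]].
have missD w mu : w \in Dom mu -> #|[set i : 'I_D | ~~ hit mu w i]| <= sg.
  move=> wD; have := degs _ _ wD; have := cardsC [set i : 'I_D | ~~ hit mu w i].
  have : #|[set v | H w v && (m w v == mu)]| <= #|~: [set i : 'I_D | ~~ hit mu w i]|.
    apply: (@card_le_rel _ _ _ _ (fun (i : 'I_D) v => [&& H w v, m w v == mu & k w v == i])).
      move=> v; rewrite inE => /andP[h mm]; exists (Ordinal (kD _ _ h)); last by rewrite h mm /=.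
      by rewrite !inE negbK; apply/existsP; exists v; rewrite h mm /=.
    by move=> i v v' /and3P[h /eqP mm /eqP kk] /and3P[h' /eqP mm' /eqP kk']; apply: (@kP w); rewrite ?mm ?kk.
  rewrite card_ord; move: #|_| #|_| #|_| => x y x0; lia.
pose bad mu := [set i : 'I_D | z < #|[set w in Dom mu | ~~ hit mu w i]|].
have cbad mu : #|bad mu| <= s.
  have := leq_trans (@double_count _ _ (Dom mu) (fun w i => ~~ hit mu w i) sg z (fun w => @missD w mu)) (Dsz mu).
  rewrite -/(bad mu); move: #|_| => x; nia.
have /fin_all_exists[j jP] : forall mu, exists f : J -> 'I_D, injective f /\ forall x, f x \in ~: bad mu.
  move=> mu; apply: inj_into; have := cbad mu; have := cardsC (bad mu); rewrite card_ord.
  move: #|_| #|_| #|_| JsD => x y x0; lia.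
have jI mu : injective (j mu) by have [] := jP mu.
exists (fun mu x w v => [&& H w v, m w v == mu & k w v == j mu x]).
have exE mu x w : [exists v, [&& H w v, m w v == mu & k w v == j mu x]] = hit mu w (j mu x) by [].
split; first split.
- by move=> mu x w v; rewrite Hs ms; case h: (H v w) => //=; rewrite ks // Hs.
- move=> mu x w v v' /and3P[h /eqP mm /eqP kk] /and3P[h' /eqP mm' /eqP kk'].
  by apply: (@kP w); rewrite ?mm ?kk.
- by move=> mu x w v /and3P[-> ->].
- move=> mu x mu' x' w v /and3P[_ /eqP<- /eqP kk] /and3P[_ /eqP<- /eqP kk'].
  by congr (_, _); apply: (jI (m w v)); apply: ord_inj; rewrite -kk.
- move=> mu x; have [_ /(_ x)] := jP mu; rewrite !inE -leqNgt; apply: leq_trans.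
  by apply: subset_leq_card; apply/subsetP => w; rewrite !inE exE.
- move=> w mu wD; apply: leq_trans (missD _ _ wD).
  rewrite -(card_imset _ (jI mu)); apply: subset_leq_card; apply/subsetP => _ /imsetP[x + ->].
  by rewrite !inE exE.
- move=> w; pose out := [set p : T * 'I_D | p.2 \notin [set j p.1 x | x in J]].
  apply: leq_trans (_ : #|out| <= _).
    apply: (@card_le_rel _ _ _ _ (fun (p : T * 'I_D) v => [&& H w v, m w v == p.1 & k w v == p.2])).
      move=> v; rewrite inE => /andP[h /negP no]; exists (m w v, Ordinal (kD _ _ h)); last by rewrite h /= !eqxx.
      rewrite inE /=; apply/negP => /imsetP[x _ xE]; apply: no.
      by apply/existsP; exists (m w v); apply/existsP; exists x; rewrite h eqxx -xE /=.
    by move=> i v v' /and3P[h /eqP mm /eqP kk] /and3P[h' /eqP mm' /eqP kk']; apply: (@kP w); rewrite ?mm ?kk.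
  have -> : out = \bigcup_mu setX [set mu] (~: [set j mu x | x in J]).
    apply/setP => -[mu i]; rewrite inE /=; apply/idP/bigcupP => [h|[mu' _]].
      by exists mu; rewrite // !inE eqxx /=.
    by rewrite !inE /= => /andP[/eqP->].
  apply: leq_trans (_ : \sum_(mu : T) (D - #|J|) <= _); last by rewrite sum_nat_const.
  elim/big_rec2: _ => [|mu n S hs le]; first by rewrite cards0.
  apply: leq_trans (leq_card_setU _ _) (leq_add _ le).
  by rewrite cardsX cards1 mul1n cardsCs setCK card_ord card_imset.
Qed.

End RoundClasses.

Lemma card_fibers (X Y : finType) (S : {set X}) (pr : X -> Y) k :
  (forall y, #|[set x in S | pr x == y]| <= k) -> #|S| <= #|Y| * k.
Proof.
move=> le; apply: leq_trans (_ : \sum_(y : Y) #|[set x in S | pr x == y]| <= _).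
  under eq_bigr do rewrite card_set_sum; rewrite exchange_big /=.
  rewrite -sum1_card; apply: leq_sum => x xS.
  by rewrite (bigD1 (pr x)) //= eqxx.
by rewrite -sum_nat_const; apply: leq_sum.
Qed.

Section DesignClasses.
Variables (V T : finType) (e Rs : rel V) (A B : {set V}) (blk : V -> T) (mid : T -> T -> T).
Variables (D D' sg s z qi qc : nat).
Let blkA := blkA A blk.
Let blkB := blkB B blk.
Let G := (T * T * ('I_qi + 'I_qc))%type.

Definition same_side w v := (w \in A) && (v \in A) || (w \in B) && (v \in B).

(* With [mid] the midpoint in an abelian group of odd order, the edges of round
   [c] join the blocks [a] and [a'] with [mid a a' = c], so that [c] itself is
   the only block left out. *)
Lemma design_classes :
    symmetric e -> symmetric Rs -> [disjoint A & B] ->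
    (forall w v, Rs w v -> (w \in A) && (v \in B) || (w \in B) && (v \in A)) ->
    (forall a b, mid a b = mid b a) -> (forall a, mid a a = a) -> (forall a, injective (mid a)) ->
    (forall w b, w \in A -> D - sg <= #|[set v in blkA b | e w v]| <= D) ->
    (forall w b, w \in B -> D - sg <= #|[set v in blkB b | e w v]| <= D) ->
    (forall w b, w \in A -> D' - sg <= #|[set v in blkB b | Rs w v]| <= D') ->
    (forall w b, w \in B -> D' - sg <= #|[set v in blkA b | Rs w v]| <= D') ->
    #|A :|: B| * sg <= s * z -> #|T| * qi + s <= D -> #|T| * qc + s <= D' ->
  exists cl : G -> rel V,
    [/\ [/\ forall g, symmetric (cl g),
        forall g w v v', cl g w v -> cl g w v' -> v = v' &
        forall g w v, cl g w v ->
          [&& same_side w v, e w v & blk w != blk v] || Rs w v],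
        forall g h w v, cl g w v -> cl h w v -> g = h,
        forall g w v, cl g w v -> (w \notin blkA g.1.1) && (w \notin blkB g.1.2),
        [/\ forall g, #|[set w in A :|: B | [&& w \notin blkA g.1.1, w \notin blkB g.1.2 &
          ~~ [exists v, cl g w v]]]| <= 2 * z &
        forall w, #|[set g : G | [&& w \in A :|: B, w \notin blkA g.1.1, w \notin blkB g.1.2 &
          ~~ [exists v, cl g w v]]]| <= 2 * #|T| * sg] &
        forall w, #|[set v | [&& same_side w v, e w v & ~~ [exists g, cl g w v]]]|
          <= D + #|T| * (D - #|T| * qi)].
Proof.
move=> es Rss dis Rcr mC mx mI degA degB degRA degRB Dsz leD leD'.
have AB x : x \in A -> x \in B = false by move=> xA; rewrite (disjointFr dis xA).
have BA x : x \in B -> x \in A = false by move=> xA; rewrite (disjointFl dis xA).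
have bA x c : (x \in blkA c) = (x \in A) && (blk x == c) by rewrite inE.
have bB x c : (x \in blkB c) = (x \in B) && (blk x == c) by rewrite inE.
have partner a mu : exists b, mid a b = mu.
  by have /codomP[b ->] : mu \in codom (mid a); [apply: inj_card_onto|exists b].
pose m w v := mid (blk w) (blk v).
have ms w v : m w v = m v w by apply: mC.
pose H (S : {set V}) : rel V := fun w v => [&& w \in S, v \in S, e w v & blk w != blk v].
(* Inside a half the rank of the block orients an edge. By injectivity of [mid] all neighbours of a
   vertex in one round lie in a single block, so each round is bipartite with a consistent
   orientation. *)
pose o : rel V := fun w v => enum_rank (blk w) < enum_rank (blk v).
have HS (S : {set V}) : (forall w b, w \in S -> D - sg <= #|[set v in [set w in S | blk w == b] | e w v]| <= D) ->
    #|S| * sg <= s * z ->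
    exists M : T -> T * 'I_qi -> rel V,
    [/\ [/\ forall mu j, symmetric (M mu j),
            forall mu j w v v', M mu j w v -> M mu j w v' -> v = v' &
            forall mu j w v, M mu j w v -> H S w v && (m w v == mu)],
        forall mu j mu' j' w v, M mu j w v -> M mu' j' w v -> (mu, j) = (mu', j'),
        forall mu j, #|[set w in [set w in S | blk w != mu] | ~~ [exists v, M mu j w v]]| <= z,
        forall w mu, w \in [set w in S | blk w != mu] -> #|[set j | ~~ [exists v, M mu j w v]]| <= sg &
        forall w, #|[set v | H S w v && ~~ [exists mu, exists j, M mu j w v]]| <=
          #|T| * (D - #|{: T * 'I_qi}|)].
  move=> degS Ssz; apply: (@round_classes _ _ _ (H S) o m _ D sg s z) => //.
  - by move=> w v; rewrite /H es [_ == blk v]eq_sym; case: (w \in S); case: (v \in S).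
  - move=> w v /and4P[_ _ _ ne]; rewrite /o -leqNgt [RHS]leq_eqVlt.
    case: eqVneq => // eq; case/eqP: ne; apply: enum_rank_inj; exact: ord_inj.
  - by move=> w v v' _ _ /mI; rewrite /o => ->.
  - move=> w mu; have [wS|wS] := boolP (w \in S); last first.
      by rewrite eq_card0 // => v; rewrite !inE /H (negPf wS).
    have [b bE] := partner (blk w) mu; have /andP[_] := degS w b wS; apply: leq_trans.
    apply: subset_leq_card; apply/subsetP => v; rewrite !inE => /andP[/and4P[_ -> -> _]].
    by rewrite /m -bE => /eqP/mI->; rewrite eqxx.
  - move=> w mu; rewrite inE => /andP[wS ne].
    have [b bE] := partner (blk w) mu; have /andP[+ _] := degS w b wS; rewrite leq_subLR addnC.
    move/leq_trans; apply; rewrite leq_add2r.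
    apply: subset_leq_card; apply/subsetP => v; rewrite !inE => /andP[/andP[vS /eqP vb] ewv].
    rewrite /H wS vS ewv /m vb bE eqxx andbT /=; apply/eqP => wb.
    by move: ne; rewrite -bE wb mx eqxx.
  - move=> mu; apply: leq_trans Ssz; rewrite leq_mul2r subset_leq_card ?orbT //.
    by apply/subsetP => x; rewrite inE => /andP[].
  - by rewrite card_prod card_ord.
have szA : #|A| * sg <= s * z by apply: leq_trans Dsz; rewrite leq_mul2r subset_leq_card ?subsetUl ?orbT.
have szB : #|B| * sg <= s * z by apply: leq_trans Dsz; rewrite leq_mul2r subset_leq_card ?subsetUr ?orbT.
have [MA [[MAs MAf MAH] MAd MAz MAm MAl]] := HS A degA szA.
have [MB [[MBs MBf MBH] MBd MBz MBm MBl]] := HS B degB szB.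
have degR w mu : w \in A :|: B -> D' - sg <= #|[set v | Rs w v && (m w v == mu)]| <= D'.
  rewrite inE; have [b bE] := partner (blk w) mu; case/orP=> wS.
    have -> : #|[set v | Rs w v && (m w v == mu)]| = #|[set v in blkB b | Rs w v]|; last exact: degRA.
    apply: eq_card => v; rewrite !inE -bE /m (inj_eq (@mI _)).
    case h: (Rs w v); rewrite ?andbF //= andbT; have := Rcr _ _ h.
    by rewrite wS (AB _ wS) /= orbF => ->.
  have -> : #|[set v | Rs w v && (m w v == mu)]| = #|[set v in blkA b | Rs w v]|; last exact: degRB.
  apply: eq_card => v; rewrite !inE -bE /m (inj_eq (@mI _)).
  case h: (Rs w v); rewrite ?andbF //= andbT; have := Rcr _ _ h.
  by rewrite wS (BA _ wS) /= => ->.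
have [||||||||MR [[MRs MRf MRH] MRd MRz MRm _]] := @round_classes _ T (T * 'I_qc)%type Rs (fun w v => w \in A) m
  (fun=> A :|: B) D' sg s z => //.
- move=> w v /Rcr /orP[/andP[wA vB]|/andP[wB vA]]; first by rewrite wA (BA _ vB).
  by rewrite vA (BA _ wB).
- move=> w mu; have [wS|wS] := boolP (w \in A :|: B); first by have /andP[] := degR w mu wS.
  rewrite eq_card0 // => v; rewrite !inE; apply/negP => /andP[/Rcr h _]; move: wS; rewrite inE.
  by case/orP: h => /andP[-> _]; rewrite ?orbT.
- by move=> w mu wS; have /andP[+ _] := degR w mu wS; rewrite leq_subLR addnC.
- by rewrite card_prod card_ord.
(* A class of the first kind with blocks [c] and [d] joins a class of round [c] inside [A] with one
   of round [d] inside [B]; the other block of the pair serves to number the classes of a round. One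
   of the second kind runs between the halves in round [mid c d]. There block [c] of [A] and block
   [d] of [B] are joined only to each other ([RAB], [RBA]), so deleting the edges that meet them
   uncovers no other vertex. *)
pose cl (g : G) : rel V := fun w v => match g.2 with
  | inl k => MA g.1.1 (g.1.2, k) w v || MB g.1.2 (g.1.1, k) w v
  | inr k => MR (mid g.1.1 g.1.2) (g.1.1, k) w v &&
      ~~ [|| w \in blkA g.1.1, v \in blkA g.1.1, w \in blkB g.1.2 | v \in blkB g.1.2]
  end.
have MAA mu j w v : MA mu j w v -> [&& w \in A, v \in A, e w v, blk w != blk v, blk w != mu & blk v != mu].
  move/MAH=> /andP[/and4P[-> -> -> ne] /eqP<-] /=; rewrite ne /=.
  apply/andP; split; apply/eqP => h; case/eqP: ne; move: h.
    by rewrite /m -{1}[blk w]mx => /mI.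
  by rewrite ms /m -{1}[blk v]mx => /mI->.
have MBB mu j w v : MB mu j w v -> [&& w \in B, v \in B, e w v, blk w != blk v, blk w != mu & blk v != mu].
  move/MBH=> /andP[/and4P[-> -> -> ne] /eqP<-] /=; rewrite ne /=.
  apply/andP; split; apply/eqP => h; case/eqP: ne; move: h.
    by rewrite /m -{1}[blk w]mx => /mI.
  by rewrite ms /m -{1}[blk v]mx => /mI->.
have noAB mu j mu' j' w v : MA mu j w v -> MB mu' j' w v -> False.
  by move=> /MAA/and3P[wA _ _] /MBB/and3P[wB _ _]; rewrite AB in wB.
have noAR mu j mu' j' w v : MA mu j w v -> MR mu' j' w v -> False.
  by move=> /MAA/and3P[wA vA _] /MRH/andP[/Rcr]; rewrite (AB _ wA) (AB _ vA) ?andbF.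
have noBR mu j mu' j' w v : MB mu j w v -> MR mu' j' w v -> False.
  by move=> /MBB/and3P[wA vA _] /MRH/andP[/Rcr]; rewrite (BA _ wA) (BA _ vA) ?andbF.
have RAB (g : G) k w v : MR (mid g.1.1 g.1.2) k w v -> w \in blkA g.1.1 -> v \in blkB g.1.2.
  move=> /MRH/andP[/Rcr h /eqP mm]; rewrite bA bB => /andP[wA /eqP wc].
  move: h; rewrite wA (AB _ wA) /= orbF => ->; move: mm; rewrite /m wc => /mI->; exact: eqxx.
have RBA (g : G) k w v : MR (mid g.1.1 g.1.2) k w v -> w \in blkB g.1.2 -> v \in blkA g.1.1.
  move=> /MRH/andP[/Rcr h /eqP mm]; rewrite bA bB => /andP[wA /eqP wc].
  move: h; rewrite wA (BA _ wA) /= => ->; move: mm; rewrite /m wc [RHS]mC => /mI->; exact: eqxx.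
exists cl; split; [split| | |split|].
- move=> [[c d] [k|k]] w v; rewrite /cl /=; first by rewrite MAs MBs.
  by rewrite MRs; congr (_ && ~~ _); do !bool_congr.
- move=> [[c d] [k|k]] w v v'; rewrite /cl /=.
    case/orP=> h /orP[] h'; [exact: MAf h h'| | |exact: MBf h h'].
      by have /and3P[wA _ _] := MAA _ _ _ _ h; have /and3P[wB _ _] := MBB _ _ _ _ h'; rewrite AB in wB.
    by have /and3P[wA _ _] := MBB _ _ _ _ h; have /and3P[wB _ _] := MAA _ _ _ _ h'; rewrite AB in wA.
  by case/andP=> h _ /andP[h' _]; apply: MRf h h'.
- move=> [[c d] [k|k]] w v; rewrite /cl /=.
    by rewrite /same_side; case/orP=> [/MAA|/MBB] /and5P[-> -> -> -> _]; rewrite ?orbT.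
  by case/andP=> /MRH/andP[-> _]; rewrite orbT.
- move=> [[c d] [k|k]] [[c' d'] [k'|k']] w v; rewrite /cl /=.
  + case/orP=> h /orP[] h'.
    * by case: (MAd _ _ _ _ _ _ h h') => -> -> ->.
    * by case: (noAB _ _ _ _ _ _ h h').
    * by case: (noAB _ _ _ _ _ _ h' h).
    * by case: (MBd _ _ _ _ _ _ h h') => -> -> ->.
  + by case/orP=> h /andP[h' _]; [case: (noAR _ _ _ _ _ _ h h')|case: (noBR _ _ _ _ _ _ h h')].
  + by case/andP=> h _ /orP[] h'; [case: (noAR _ _ _ _ _ _ h' h)|case: (noBR _ _ _ _ _ _ h' h)].
  + by case/andP=> h _ /andP[h' _]; case: (MRd _ _ _ _ _ _ h h') => + cc kk; rewrite cc kk => /mI->.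
- move=> [[c d] [k|k]] w v; rewrite /cl /= bA bB.
    case/orP=> [/MAA/and5P[wA _ _ _ /andP[/negPf-> _]]|/MBB/and5P[wB _ _ _ /andP[/negPf-> _]]].
      by rewrite andbF (AB _ wA).
    by rewrite andbF (BA _ wB).
  by case/andP=> _; rewrite bA bB !negb_or => /and4P[-> _ -> _].
- move=> [[c d] [k|k]]; rewrite /cl /=.
    apply: leq_trans (_ : #|[set w in [set w in A | blk w != c] | ~~ [exists v, MA c (d, k) w v]] :|:
      [set w in [set w in B | blk w != d] | ~~ [exists v, MB d (c, k) w v]]| <= _); last first.
      by apply: leq_trans (leq_card_setU _ _) _; rewrite mul2n -addnn leq_add.
    apply: subset_leq_card; apply/subsetP => w; rewrite !in_set !negb_and.
    have noA : ~~ [exists v, MA c (d, k) w v || MB d (c, k) w v] ->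
        ~~ [exists v, MA c (d, k) w v] /\ ~~ [exists v, MB d (c, k) w v].
      move/existsPn => h; split; apply/existsPn => v; have := h v; rewrite negb_or; by case/andP.
    case/and4P=> wAB wc wd /noA[-> ->]; rewrite !andbT.
    by case/orP: wAB wc wd => -> //= h h'; rewrite ?h ?h' ?orbT.
  apply: leq_trans (_ : z <= _); last by rewrite mul2n -addnn leq_addr.
  apply: leq_trans (MRz (mid c d) (c, k)).
  apply: subset_leq_card; apply/subsetP => w; rewrite !in_set.
  case/and4P=> -> wc wd /existsPn no /=; apply/existsPn => v; have := no v; rewrite negb_and => /orP[//|].
  rewrite negbK => h; apply/negP => M; case/or4P: h => h.
  + by rewrite h in wc.
  + have Ms := M; rewrite MRs in Ms.
    by have := RAB (c, d, inr k) _ _ _ Ms h; rewrite bB => h2; rewrite h2 in wd.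
  + by rewrite h in wd.
  + have Ms := M; rewrite MRs in Ms.
    by have := RBA (c, d, inr k) _ _ _ Ms h; rewrite bA => h2; rewrite h2 in wc.
- move=> w; pose P (g : G) := [&& w \in A :|: B, w \notin blkA g.1.1, w \notin blkB g.1.2 &
    ~~ [exists v, cl g w v]].
  (* The classes that miss [w] are grouped by kind and round; each of the [2 * #|T|] groups contains
     at most [sg] of them. *)
  change (#|[set g | P g]| <= 2 * #|T| * sg); pose key (g : G) := match g.2 with
    | inl _ => (true, if w \in A then g.1.1 else g.1.2) | inr _ => (false, mid g.1.1 g.1.2) end.
  have -> : 2 * #|T| = #|{: bool * T}| by rewrite card_prod card_bool.
  apply: (card_fibers (pr := key)) => -[[] mu]; last first.
    have [wAB|wAB] := boolP (w \in A :|: B); last first.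
      by rewrite eq_card0 // => g; rewrite !in_set /P (negPf wAB).
    apply: leq_trans (MRm w mu wAB).
    apply: (@card_le_rel _ _ _ _ (fun (j : T * 'I_qc) (g : G) => (g.1.1 == j.1) && (key g == (false, mu)) && (g.2 == inr j.2))).
      move=> [[c d] [k|k]]; rewrite !in_set /P /key /cl /=; first by rewrite !andbF.
      case/andP=> /and4P[_ wc wd /existsPn no] /eqP[mu_]; exists (c, k); last by rewrite /= !eqxx mu_ eqxx.
      rewrite in_set; apply/existsPn => v; have := no v; rewrite -mu_ negb_and => /orP[//|].
      rewrite negbK => h; apply/negP => M; case/or4P: h => h.
      + by move: wc; rewrite h.
      + have Ms := M; rewrite MRs in Ms.
        by have h2 := RAB (c, d, inr k) _ _ _ Ms h; rewrite h2 in wd.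
      + by move: wd; rewrite h.
      + have Ms := M; rewrite MRs in Ms.
        by have h2 := RBA (c, d, inr k) _ _ _ Ms h; rewrite h2 in wc.
    move=> [c k] [[c1 d1] [k1|k1]] [[c2 d2] [k2|k2]]; rewrite /key /= ?andbF //.
    by case/andP=> /andP[/eqP-> /eqP[<-]] /eqP[->] /andP[/andP[/eqP-> /eqP[/mI ->]] /eqP[->]].
  have [wA|wA] := boolP (w \in A).
    have [wmu|wmu] := eqVneq (blk w) mu.
      rewrite eq_card0 // => -[[c d] [k|k]]; rewrite !in_set /P /key /= ?wA ?andbF //.
      rewrite bA wA /= wmu; apply/negP => /andP[/and4P[_ h _ _] /eqP[cc]].
      by rewrite cc eqxx in h.
    have wD : w \in [set w in A | blk w != mu] by rewrite inE wA.
    apply: leq_trans (MAm w mu wD).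
    apply: (@card_le_rel _ _ _ _ (fun (j : T * 'I_qi) (g : G) => g == (mu, j.1, inl j.2))).
      move=> [[c d] [k|k]]; rewrite !in_set /P /key /cl /= ?wA; last by rewrite !andbF.
      case/andP=> /and4P[_ wc wd /existsPn no] /eqP[mu_]; exists (d, k); last by rewrite /= mu_.
      by rewrite in_set; apply/existsPn => v; have := no v; rewrite -mu_ negb_or => /andP[].
    by move=> j g g' /eqP-> /eqP->.
  have [wB|wB] := boolP (w \in B); last first.
    by rewrite eq_card0 // => g; rewrite !in_set /P in_setU (negPf wA) (negPf wB).
  have [wmu|wmu] := eqVneq (blk w) mu.
    rewrite eq_card0 // => -[[c d] [k|k]]; rewrite !in_set /P /key /= ?(negPf wA) ?andbF //.
    rewrite bB wB /= wmu; apply/negP => /andP[/and4P[_ _ h _] /eqP[cc]].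
    by rewrite cc eqxx in h.
  have wD : w \in [set w in B | blk w != mu] by rewrite inE wB.
  apply: leq_trans (MBm w mu wD).
  apply: (@card_le_rel _ _ _ _ (fun (j : T * 'I_qi) (g : G) => g == (j.1, mu, inl j.2))).
    move=> [[c d] [k|k]]; rewrite !in_set /P /key /cl /= ?(negPf wA); last by rewrite !andbF.
    case/andP=> /and4P[_ wc wd /existsPn no] /eqP[mu_]; exists (c, k); last by rewrite /= mu_.
    by rewrite in_set; apply/existsPn => v; have := no v; rewrite -mu_ negb_or => /andP[].
  by move=> j g g' /eqP-> /eqP->.
- move=> w; have -> : #|T| * qi = #|{: T * 'I_qi}| by rewrite card_prod card_ord.
  have [wA|wA] := boolP (w \in A).
    have /andP[_ le1] := degA w (blk w) wA.
    apply: leq_trans (leq_add le1 (MAl w)); apply: leq_trans (leq_card_setU _ _).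
    apply: subset_leq_card; apply/subsetP => v; rewrite in_setU !in_set /same_side /H wA (AB _ wA) /= orbF.
    case/and3P=> vA ewv /existsPn no; rewrite vA ewv /= [blk w == _]eq_sym.
    case: eqVneq => //= _; apply/existsPn => mu; apply/existsPn => -[d k].
    by have := no (mu, d, inl k); rewrite /cl /= negb_or => /andP[].
  have [wB|wB] := boolP (w \in B); last first.
    by rewrite eq_card0 // => v; rewrite !in_set /same_side (negPf wA) (negPf wB).
  have /andP[_ le1] := degB w (blk w) wB.
  apply: leq_trans (leq_add le1 (MBl w)); apply: leq_trans (leq_card_setU _ _).
  apply: subset_leq_card; apply/subsetP => v; rewrite in_setU !in_set /same_side /H wB (negPf wA) /=.
  case/and3P=> vA ewv /existsPn no; rewrite vA ewv /= [blk w == _]eq_sym.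
  case: eqVneq => //= _; apply/existsPn => mu; apply/existsPn => -[d k].
  by have := no (d, mu, inl k); rewrite /cl /= negb_or => /andP[].
Qed.

End DesignClasses.

(** * Assigning the classes of the rounds to the designed colours *)

Section GroupMatchings.
Variables (R : realType) (V T : finType) (e Rs Qa Qb Qh : rel V) (A B : {set V}) (blk : V -> T) (mid : T -> T -> T).
Variables (D D' sg s z qi qc kap kapv b L dblk del E0 qm : nat).
Let bA := blkA A blk.
Let bB := blkB B blk.
Let G := (T * T * ('I_qi + 'I_qc))%type.
Variable Bad : G -> {set V}.

(** [u0] bounds the stray vertices of one colour: those missed by its class and the partners of bad
    vertices. [om0] bounds the imbalance of its two sides, [zeta] the number of colours in which one
    vertex is stray. *)
Let u0 := 2 * z + kap.
Let om0 := dblk + u0 + kap.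
Let zeta := 2 * #|T| * sg + (L + b).

Hypotheses (es : symmetric e) (ei : irreflexive e) (dis : [disjoint A & B]) (V0 : 0 < #|V|).
Hypothesis Qab : forall w v, Qa w v || Qb w v || Qh w v -> [&& w \in A, v \in B & e w v].
Hypothesis Qex : forall w v, [&& ~~ (Qa w v && Qb w v), ~~ (Qa w v && Qh w v) & ~~ (Qb w v && Qh w v)].
Hypotheses (Rss : symmetric Rs).
Hypothesis Rcr : forall w v, Rs w v -> ((w \in A) && (v \in B) || (w \in B) && (v \in A)) && e w v.
Hypothesis RQ : forall w v, Rs w v -> ~~ (Qa w v || Qb w v || Qh w v).
Hypotheses (mC : forall a b, mid a b = mid b a) (mx : forall a, mid a a = a)
  (mI : forall a, injective (mid a)).
Hypothesis degA : forall w c, w \in A -> D - sg <= #|[set v in bA c | e w v]| <= D.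
Hypothesis degB : forall w c, w \in B -> D - sg <= #|[set v in bB c | e w v]| <= D.
Hypothesis degRA : forall w c, w \in A -> D' - sg <= #|[set v in bB c | Rs w v]| <= D'.
Hypothesis degRB : forall w c, w \in B -> D' - sg <= #|[set v in bA c | Rs w v]| <= D'.
Hypotheses (Dsz : #|A :|: B| * sg <= s * z) (leD : #|T| * qi + s <= D) (leD' : #|T| * qc + s <= D').
Hypotheses (badk : forall i, #|Bad i| <= kap) (badv : forall w, #|[set i | w \in Bad i]| <= kapv).
Hypothesis par : forall i, ~~ odd #|(A :|: B) :\: Bad i|.
Hypothesis small : (#|V|%:R * expR (#|{: G}|%:R * (kap%:R / b%:R)) < expR ((L.+1)%:R / 2) :> R)%R.
Hypothesis b0 : 0 < b.
Hypothesis blks : forall c d, #|bA c| <= #|bB d| + dblk /\ #|bB d| <= #|bA c| + dblk.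
Hypotheses (EA : forall c, E0 <= inner e (bA c)) (EB : forall d, E0 <= inner e (bB d)).
Hypothesis E0P : om0 * (4 * #|V|) + kap * (2 * #|V|) + #|{: G}| * (2 * om0) <= E0.
Hypothesis qa : forall w d, w \in A -> qm <= #|[set y in bB d | Qa w y]|.
Hypothesis qb : forall y c, y \in B -> qm <= #|[set w in bA c | Qb w y]|.
Hypothesis qmP : u0 + 2 * om0 + kap + zeta <= qm.
Hypothesis hallH : forall c d (used : rel V), symmetric used ->
  (forall x, x \in bA c -> #|[set y in bB d | Qh x y && used x y]| <= qi + qc) ->
  (forall y, y \in bB d -> #|[set x in bA c | Qh x y && used x y]| <= qi + qc) ->
  forall A' B' : {set V}, A' \subset bA c -> B' \subset bB d -> #|A'| = #|B'| ->
  #|bA c :\: A'| <= del -> #|bB d :\: B'| <= del -> exists f : V -> V,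
  [/\ {in A' &, injective f}, f @: A' = B' & {in A', forall x, Qh x (f x) && ~~ used x (f x)}].
Hypothesis delP : kap + 2 * om0 + u0 <= del.

Lemma group_matchings : exists M : G -> rel V,
  [/\ forall i, pmatch ((A :|: B) :\: Bad i) (M i),
      forall i, subrel (M i) e,
      forall i j w v, M i w v -> M j w v -> i = j,
      forall w, #|[set v | [&& same_side A B w v, e w v & ~~ [exists i, M i w v]]]|
        <= D + #|T| * (D - #|T| * qi) + (kapv + (L + b)) &
      [/\ forall c, E0 <= inner [rel w v | e w v && ~~ [exists i, M i w v]] (bA c) + #|{: G}| * (2 * om0),
          forall c, E0 <= inner [rel w v | e w v && ~~ [exists i, M i w v]] (bB c) + #|{: G}| * (2 * om0),
          forall x, x \in A -> #|[set y in B | Qh x y && [exists i, M i x y]]| <= #|T| * (qi + qc) &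
          forall y, y \in B -> #|[set x in A | Qh x y && [exists i, M i x y]]| <= #|T| * (qi + qc)]].
Proof.
have AB x : x \in A -> x \in B = false by move=> xA; rewrite (disjointFr dis xA).
have BA x : x \in B -> x \in A = false by move=> xA; rewrite (disjointFl dis xA).
have Rcr' w v : Rs w v -> (w \in A) && (v \in B) || (w \in B) && (v \in A) by case/Rcr/andP.
have [cl [[cls clf cle] cld cla [clz clm] cll]] := @design_classes V T e Rs A B blk mid D D' sg s z qi qc
  es Rss dis Rcr' mC mx mI degA degB degRA degRB Dsz leD leD'.
pose conf (i k : G) (w : V) := [exists v, (v \in Bad i) && cl k w v].
have confk i w : #|[set k | conf i k w]| <= kap.
  apply: leq_trans (badk i); apply: (@card_le_rel _ _ _ _ (fun v k => cl k w v)).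
    by move=> k; rewrite inE => /existsP[v /andP[vB clv]]; exists v.
  by move=> v k k'; apply: cld.
have [f fI fconf] := @low_conflict R G G V conf kap b L (leqnn _) b0 confk small.
have fS k : exists i, f i = k.
  by have /codomP[i ->] : k \in codom f; [apply: inj_card_onto|exists i].
pose cl' i : rel V := fun w v => [&& cl (f i) w v, w \notin Bad i & v \notin Bad i].
pose Cov i := [set w | [exists v, cl' i w v]].
pose gA (i : G) := (f i).1.1; pose gB (i : G) := (f i).1.2.
have cl'e i w v : cl' i w v -> e w v.
  by case/and3P=> /cle /orP[/and3P[]//|/Rcr/andP[]].
have cl'N i w v : cl' i w v -> w \in A :|: B.
  by rewrite inE; case/and3P=> /cle /orP[/and3P[/orP[]/andP[-> _]]|/Rcr/andP[/orP[]/andP[-> _]]]; rewrite ?orbT.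
have pmC i : pmatch (Cov i) (cl' i).
  split=> [w v|w v|w v1 v2|w].
  - by rewrite /cl' cls; congr (_ && _); rewrite andbC.
  - by move=> h; rewrite inE; apply/existsP; exists v.
  - by case/and3P=> h _ _ /and3P[h' _ _]; apply: clf h h'.
  - by rewrite inE => /existsP.
have covP i x : x \in Cov i -> [&& x \in A :|: B, x \notin bA (gA i), x \notin bB (gB i) & x \notin Bad i].
  rewrite inE => /existsP[v clv]; rewrite (cl'N _ _ _ clv); case/and3P: clv => h -> _.
  by rewrite /bA /bB; case/andP: (cla _ _ _ h) => -> ->.
pose sA := strayA A blk gA Bad Cov; pose sB := strayB B blk gB Bad Cov.
have stray i x : x \in sA i :|: sB i -> [&& x \in A :|: B, x \notin bA (gA i), x \notin bB (gB i),
    x \notin Bad i & x \notin Cov i].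
  rewrite !in_setU /sA /sB /strayA /strayB !in_setD -/(bA _) -/(bB _).
  case/orP=> /and4P[-> -> h xA]; rewrite h xA ?orbT /=; first by rewrite !inE (AB _ xA).
  by rewrite !inE (BA _ xA).
have strayP i x : x \in sA i :|: sB i -> [&& x \in A :|: B, x \notin blkA A blk (f i).1.1, x \notin blkB B blk (f i).1.2 &
    ~~ [exists v, cl (f i) x v]] || conf i (f i) x.
  case/stray/and5P=> -> h1 h2 xBad; rewrite inE => /existsPn no; rewrite h1 h2 /=.
  rewrite -implybE; apply/implyP => /existsP[v clv]; apply/existsP; exists v; rewrite clv andbT.
  by have := no v; rewrite /cl' clv xBad /= negbK.
have cardO i : #|sA i| + #|sB i| <= u0.
  rewrite -card_disjointU; last first.
    apply: disjointI => x; rewrite /sA /sB /strayA /strayB !in_setD => /and4P[_ _ _ xA] /and4P[_ _ _].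
    by rewrite AB.
  have sub : sA i :|: sB i \subset [set w in A :|: B | [&& w \notin blkA A blk (f i).1.1, w \notin blkB B blk (f i).1.2 &
      ~~ [exists v, cl (f i) w v]]] :|: [set w | conf i (f i) w].
    by apply/subsetP => x /strayP h; rewrite in_setU [X in X || _]in_set [X in _ || X]in_set.
  apply: leq_trans (subset_leq_card sub) _; apply: leq_trans (leq_card_setU _ _) (leq_add (clz _) _).
  apply: leq_trans (badk i); apply: (@card_le_rel _ _ _ _ (fun v w => cl (f i) w v)).
    by move=> w; rewrite inE => /existsP[v /andP[vB clv]]; exists v.
  by move=> v w w'; rewrite !(cls _ _ v); apply: clf.
have cst w : #|[set i | w \in sA i :|: sB i]| <= zeta.
  apply: leq_trans (_ : #|[set i | [&& w \in A :|: B, w \notin blkA A blk (f i).1.1, w \notin blkB B blk (f i).1.2 &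
      ~~ [exists v, cl (f i) w v]]]| + #|[set i | conf i (f i) w]| <= _).
    apply: leq_trans (leq_card_setU _ _); apply: subset_leq_card; apply/subsetP => i.
    by rewrite in_set => /strayP; rewrite in_setU !in_set.
  apply: leq_add (fconf w); apply: leq_trans (clm w); rewrite -(card_imset _ fI).
  by apply: subset_leq_card; apply/subsetP => _ /imsetP[i + ->]; rewrite !in_set.
have NBC i : A :\: Bad i :\: Cov i :|: B :\: Bad i :\: Cov i = ((A :|: B) :\: Bad i) :\: Cov i.
  by apply/setP => x; rewrite !in_setU !in_setD !in_setU; case: (x \in Cov i); case: (x \in Bad i).
have CovSub i : Cov i \subset (A :|: B) :\: Bad i.
  by apply/subsetP => x /covP/and4P[h _ _ h']; rewrite in_setD h h'.
have disNBC i : [disjoint A :\: Bad i :\: Cov i & B :\: Bad i :\: Cov i].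
  by apply: disjointI => x; rewrite !in_setD => /and3P[_ _ xA] /and3P[_ _]; rewrite AB.
have parC i : ~~ odd (#|A :\: Bad i :\: Cov i| + #|B :\: Bad i :\: Cov i|).
  rewrite -card_disjointU // NBC; have := par i; rewrite (card_split (CovSub i)) oddD.
  have : ~~ odd #|Cov i|.
    by apply: pmatch_even (pmC i) _ => w; apply/negP => /cl'e; rewrite ei.
  by case: (odd _).
have imb i : #|A :\: Bad i :\: Cov i| <= #|bA (gA i)| + u0 /\ #|B :\: Bad i :\: Cov i| <= #|bB (gB i)| + u0 /\
    #|bA (gA i)| <= #|A :\: Bad i :\: Cov i| + kap /\ #|bB (gB i)| <= #|B :\: Bad i :\: Cov i| + kap.
  split; [|split; [|split]].
  - apply: leq_trans (_ : #|bA (gA i) :|: sA i| <= _).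
      apply: subset_leq_card; apply/subsetP => x; rewrite in_setU /sA /strayA !in_setD -/(bA _).
      by case/and3P=> -> -> ->; case: (_ \in _).
    by apply: leq_trans (leq_card_setU _ _) _; rewrite leq_add2l; apply: leq_trans (cardO i); rewrite leq_addr.
  - apply: leq_trans (_ : #|bB (gB i) :|: sB i| <= _).
      apply: subset_leq_card; apply/subsetP => x; rewrite in_setU /sB /strayB !in_setD -/(bB _).
      by case/and3P=> -> -> ->; case: (_ \in _).
    by apply: leq_trans (leq_card_setU _ _) _; rewrite leq_add2l; apply: leq_trans (cardO i); rewrite leq_addl.
  - apply: leq_trans (_ : #|A :\: Bad i :\: Cov i :|: Bad i| <= _).
      apply: subset_leq_card; apply/subsetP => x xb; rewrite in_setU !in_setD.
      case: (x \in Bad i); rewrite ?orbT //= orbF; apply/andP; split; last by move: xb; rewrite inE => /andP[].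
      by apply/negP => /covP/and4P[_ + _ _]; rewrite xb.
    by apply: leq_trans (leq_card_setU _ _) _; rewrite leq_add2l.
  - apply: leq_trans (_ : #|B :\: Bad i :\: Cov i :|: Bad i| <= _).
      apply: subset_leq_card; apply/subsetP => x xb; rewrite in_setU !in_setD.
      case: (x \in Bad i); rewrite ?orbT //= orbF; apply/andP; split; last by move: xb; rewrite inE => /andP[].
      by apply/negP => /covP/and4P[_ _ + _]; rewrite xb.
    by apply: leq_trans (leq_card_setU _ _) _; rewrite leq_add2l.
have [|||||ex [pmE exP exd exi]] := @group_stage V T G e A B blk Qa Qb Qh gA gB Bad Cov cl' u0 om0 del kap zeta (qi + qc) E0 qm
    es ei dis V0 Qex pmC covP cardO parC _ _ badk EA EB E0P qa qb qmP _ _ _ hallH delP.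
- move=> i; have [h1 [_ [_ h4]]] := imb i; have [h5 _] := blks (gA i) (gB i).
  apply: leq_trans h1 _; apply: leq_trans (leq_add (leq_trans h5 (leq_add h4 (leqnn _))) (leqnn _)) _.
  by rewrite -!addnA leq_add2l /om0; lia.
- move=> i; have [_ [h1 [h4 _]]] := imb i; have [_ h5] := blks (gA i) (gB i).
  apply: leq_trans h1 _; apply: leq_trans (leq_add (leq_trans h5 (leq_add h4 (leqnn _))) (leqnn _)) _.
  by rewrite -!addnA leq_add2l /om0; lia.
- move=> w; apply: leq_trans (cst w); apply: subset_leq_card; apply/subsetP => i.
  by rewrite in_set => h; rewrite in_set in_setU /sA h.
- move=> w; apply: leq_trans (cst w); apply: subset_leq_card; apply/subsetP => i.
  by rewrite in_set => h; rewrite in_set in_setU /sB h orbT.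
- move=> c d; rewrite -(card_imset _ fI).
  have -> : qi + qc = #|[set: 'I_qi + 'I_qc]| by rewrite cardsT fintype.card_sum !card_ord.
  apply: (@card_le_rel _ _ _ _ (fun x g => g == (c, d, x))).
    by move=> _ /imsetP[i + ->]; rewrite in_set => /andP[/eqP<- /eqP<-]; exists (f i).2; rewrite ?inE // /gA /gB -!surjective_pairing.
  by move=> x g g' /eqP-> /eqP->.
have Qsym i w v : ex i w v -> same_side A B w v && (blk w == blk v) || (Qa w v || Qb w v || Qh w v)
    || (Qa v w || Qb v w || Qh v w).
  move=> /exP /andP[_ /or3P[/andP[h _]|h|h]].
  - rewrite /same_side !inE in h *; by case/orP: h => /andP[/andP[w1 /eqP w2] /andP[v1 /eqP v2]]; rewrite w1 v1 w2 v2 eqxx ?orbT.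
  - by case/or3P: h => /and3P[_ _ ->]; rewrite ?orbT.
  - by case/or3P: h => /and3P[_ _ ->]; rewrite ?orbT.
have exe i w v : ex i w v -> e w v.
  move=> h; have /andP[_ /or3P[/andP[//]|h'|h']] := exP _ _ _ h.
    by case/or3P: h' => /and3P[_ _ q]; have /and3P[] // : [&& w \in A, v \in B & e w v]; apply: Qab; rewrite q ?orbT.
  by rewrite es; case/or3P: h' => /and3P[_ _ q]; have /and3P[] // : [&& v \in A, w \in B & e v w]; apply: Qab; rewrite q ?orbT.
have clex i j w v : cl' i w v -> ex j w v -> False.
  have sideQ x y : Qa x y || Qb x y || Qh x y -> same_side A B x y -> False.
    by move=> /Qab /and3P[xA yB _]; rewrite /same_side (AB _ xA) (BA _ yB) andbF.
  case/and3P=> /cle /orP[/and3P[sm _ ne]|rs] _ _ /Qsym /orP[/orP[/andP[sm' eq]|q]|q].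
  - by rewrite eq in ne.
  - exact: sideQ q sm.
  - by apply: sideQ q _; move: sm; rewrite /same_side [(v \in A) && _]andbC [(v \in B) && _]andbC.
  - move: sm' (Rcr' _ _ rs); rewrite /same_side.
    by case/orP=> /andP[h1 h2]; rewrite ?h1 ?h2 ?(AB _ h1) ?(AB _ h2) ?(BA _ h1) ?(BA _ h2) ?andbF.
  - by have := RQ rs; rewrite q.
  - by rewrite Rss in rs; have := RQ rs; rewrite q.
pose M i : rel V := fun w v => cl' i w v || ex i w v.
have inM i (X : {set V}) : (X \subset A \/ X \subset B) -> (forall x y, x \in X -> y \in X -> blk x = blk y) ->
    inner (M i) X <= 2 * om0.
  move=> XAB Xb; apply: leq_trans (_ : inner (ex i) X <= _); last first.
    by have [iA iB] := exi i; case: XAB => sub; [apply: leq_trans iA|apply: leq_trans iB]; apply: inner_sub.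
  apply: subset_leq_card; apply/subsetP => -[x y]; rewrite !in_set /= => /and3P[xX yX].
  rewrite xX yX /M; case/orP=> [|-> //]; case/and3P=> /cle /orP[/and3P[_ _ ne]|rs] _ _.
    by rewrite (Xb x y) ?eqxx in ne.
  move: (Rcr' _ _ rs); case: XAB => /subsetP sub; move: (sub x xX) (sub y yX) => h1 h2.
    by rewrite (AB _ h1) (AB _ h2) andbF.
  by rewrite (BA _ h1) (BA _ h2) andbF.
have privE (X : {set V}) : (X \subset A \/ X \subset B) -> (forall x y, x \in X -> y \in X -> blk x = blk y) ->
    E0 <= inner e X -> E0 <= inner [rel w v | e w v && ~~ [exists i, M i w v]] X + #|{: G}| * (2 * om0).
  move=> XAB Xb le; apply: leq_trans le _; apply: leq_trans (inner_used (mem [set: G]) e M X) _.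
  apply: leq_add.
    apply: inner_le => w v /= /andP[-> /existsPn no] /=; apply/existsPn => i; have := no i.
    by rewrite !inE.
  rewrite -cardsT -sum_nat_const; apply: leq_sum => i _; exact: inM.
have blkE (S : {set V}) c x y : x \in [set w in S | blk w == c] -> y \in [set w in S | blk w == c] -> blk x = blk y.
  by rewrite !inE => /andP[_ /eqP->] /andP[_ /eqP->].
have QhA w v : Qh w v -> w \in A /\ v \in B.
  by move=> h; have /and3P[] // : [&& w \in A, v \in B & e w v]; apply: Qab; rewrite h ?orbT.
have QhE w v : Qh w v -> Qa w v || Qb w v -> False.
  by move=> Q1; have := Qex w v; rewrite Q1; case: (Qa w v); case: (Qb w v).
have QhM i x y : Qh x y -> M i x y -> (blk x == gA i) && (blk y == gB i).
  move=> h; have [xA yB] := QhA _ _ h; case/orP; last first.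
    by move=> exi'; apply: group_edge_Qh (exP _ _ _ exi') xA yB h.
  case/and3P=> /cle /orP[/and3P[sm _ _]|rs] _ _.
    by move: sm; rewrite /same_side (AB _ xA) (BA _ yB) andbF.
  by have := RQ rs; rewrite h !orbT.
have cgA c : #|[set i | gA i == c]| <= #|T| * (qi + qc).
  rewrite -(card_imset _ fI).
  have -> : #|T| * (qi + qc) = #|[set: T * ('I_qi + 'I_qc)]| by rewrite cardsT card_prod fintype.card_sum !card_ord.
  apply: (@card_le_rel _ _ _ _ (fun x g => g == (c, x.1, x.2))).
    move=> _ /imsetP[i + ->]; rewrite in_set => /eqP<-; exists ((f i).1.2, (f i).2); rewrite ?inE //.
    by rewrite /gA /= -!surjective_pairing.
  by move=> x g g' /eqP-> /eqP->.
have cgB c : #|[set i | gB i == c]| <= #|T| * (qi + qc).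
  rewrite -(card_imset _ fI).
  have -> : #|T| * (qi + qc) = #|[set: T * ('I_qi + 'I_qc)]| by rewrite cardsT card_prod fintype.card_sum !card_ord.
  apply: (@card_le_rel _ _ _ _ (fun x g => g == (x.1, c, x.2))).
    move=> _ /imsetP[i + ->]; rewrite in_set => /eqP<-; exists ((f i).1.1, (f i).2); rewrite ?inE //.
    by rewrite /gB /= -!surjective_pairing.
  by move=> x g g' /eqP-> /eqP->.
have pmM i : pmatch ((A :|: B) :\: Bad i) (M i).
  apply: (pmatch_eq _ _ (pmatchU (pmC i) (pmE i) _)) => //.
    apply/setP => x; rewrite in_setU [X in _ || X]in_setD.
    by case xC: (x \in Cov i) => //=; rewrite (subsetP (CovSub i)).
  by apply: disjointI => x xC; rewrite in_setD xC.
exists M; split=> //.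
- by move=> i w v /orP[/cl'e|/exe].
- move=> i j w v /orP[h|h] /orP[h'|h'].
  + by apply: fI; case/and3P: h => h _ _; case/and3P: h' => h' _ _; apply: cld h h'.
  + by case: (clex _ _ _ _ h h').
  + by case: (clex _ _ _ _ h' h).
  + exact: exd h h'.
(* An edge of a class is lost only through a bad end: [w] itself is bad in at most [kapv] colours,
   its partner in at most [L + b]. *)
- move=> w; set S := [set v | _].
  have sub : S \subset [set v | [&& same_side A B w v, e w v & ~~ [exists g, cl g w v]]] :|:
      ([set v | [exists i, cl (f i) w v && (w \in Bad i)]] :|: [set v | [exists i, cl (f i) w v && (v \in Bad i)]]).
    apply/subsetP => v; rewrite !in_setU !in_set => /and3P[-> -> /existsPn no] /=.
    rewrite -implybE; apply/implyP => /existsP[k clk]; have [i fi] := fS k.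
    have := no i; rewrite negb_or /cl' fi clk /= negb_and !negbK => /andP[/orP[h|h] _].
      by apply/orP; left; apply/existsP; exists i; rewrite fi clk.
    by apply/orP; right; apply/existsP; exists i; rewrite fi clk.
  apply: leq_trans (subset_leq_card sub) _; apply: leq_trans (leq_card_setU _ _) (leq_add (cll w) _).
  apply: leq_trans (leq_card_setU _ _) (leq_add _ _).
    apply: leq_trans (badv w); apply: (@card_le_rel _ _ _ _ (fun i v => cl (f i) w v)).
      by move=> v; rewrite in_set => /existsP[i /andP[h1 h2]]; exists i; rewrite ?in_set.
    by move=> i v v'; apply: clf.
  apply: leq_trans (fconf w); apply: (@card_le_rel _ _ _ _ (fun i v => cl (f i) w v)).
    move=> v; rewrite in_set => /existsP[i /andP[h1 h2]]; exists i => //.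
    by rewrite in_set; apply/existsP; exists v; rewrite h2.
  by move=> i v v'; apply: clf.
- split.
  + by move=> c; apply: privE (EA c); [left; apply/subsetP => x; rewrite inE => /andP[]|apply: blkE].
  + by move=> c; apply: privE (EB c); [right; apply/subsetP => x; rewrite inE => /andP[]|apply: blkE].
  + move=> x xA; apply: leq_trans (cgA (blk x)); apply: (@card_le_rel _ _ _ _ (fun i y => M i x y)).
      move=> y; rewrite inE => /and3P[_ h /existsP[i Mi]]; exists i => //.
      by rewrite inE; have /andP[/eqP<-] := QhM _ _ _ h Mi.
    by move=> i y y'; have [_ _ fu _] := pmM i; apply: fu.
  + move=> y yB; apply: leq_trans (cgB (blk y)); apply: (@card_le_rel _ _ _ _ (fun i x => M i x y)).
      move=> x; rewrite inE => /and3P[_ h /existsP[i Mi]]; exists i => //.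
      by rewrite inE; have /andP[_ /eqP<-] := QhM _ _ _ h Mi.
    by move=> i x x'; have [sy _ fu _] := pmM i; rewrite !(sy _ y); apply: fu.
Qed.

End GroupMatchings.

(** * Edges left inside the halves *)

(** Greedy choice: it suffices that every compatible family on finitely many indices extends by one
    more. [x0] stands for values not yet chosen. *)
Lemma sequential (J : finType) (X : Type) (x0 : X) (P : J -> X -> Prop) (C : X -> X -> Prop) :
    (forall j (s : seq J) F, uniq s -> j \notin s -> (forall k, k \in s -> P k (F k)) ->
      {in s &, forall k l, k != l -> C (F k) (F l)} ->
      exists2 x, P j x & forall k, k \in s -> C (F k) x /\ C x (F k)) ->
  exists F, (forall k, P k (F k)) /\ forall k l, k != l -> C (F k) (F l).
Proof.
move=> step; suff H (s : seq J) : uniq s -> exists F, (forall k, k \in s -> P k (F k)) /\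
    {in s &, forall k l, k != l -> C (F k) (F l)}.
  have [F [FP FC]] := H (enum J) (enum_uniq _).
  by exists F; split=> [k|k l]; [apply: FP|apply: FC]; rewrite mem_enum.
elim: s => [|j s IHs] /=; first by exists (fun=> x0).
case/andP=> js us; have [F [FP FC]] := IHs us; have [x Px Cx] := step j s F us js FP FC.
exists (fun k => if k == j then x else F k); split=> [k|k l]; rewrite !inE.
  by case: eqVneq => [->|_ /=] //; exact: FP.
case: (eqVneq k j) => [->|kj] /=; case: (eqVneq l j) => [->|lj] //=.
- by move=> _ ls _; have [] := Cx l ls.
- by move=> ks _ _; have [] := Cx k ks.
- exact: FC.
Qed.

Lemma card_has (X Y : finType) (q : X -> pred Y) m (xs : seq X) :
  (forall x, #|[set y | q x y]| <= m) -> #|[set y | has (fun x => q x y) xs]| <= size xs * m.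
Proof.
move=> qm; elim: xs => [|x xs IHs]; first by rewrite eq_card0 // => y; rewrite inE.
rewrite mulSn; apply: leq_trans (leq_add (qm x) IHs); apply: leq_trans (leq_card_setU _ _).
by apply: subset_leq_card; apply/subsetP => y; rewrite !inE.
Qed.

Section Inner.
Variable V : finType.
Implicit Types (M : rel V) (X S : {set V}).

Lemma inner_decomp (H : finType) (e : rel V) (N : H -> rel V) X :
    (forall h, subrel (N h) e) -> (forall h k w v, N h w v -> N k w v -> h = k) ->
  inner e X = inner [rel w v | e w v && ~~ [exists h, N h w v]] X + \sum_h inner (N h) X.
Proof.
move=> Ne Nd; rewrite /inner; set S := [set p | _]; set S0 := [set p | _].
have S0S : S0 \subset S.
  by apply/subsetP => p; rewrite !inE /= => /and4P[-> -> ->].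
rewrite (card_split S0S); congr (_ + _).
have -> : \sum_h #|[set p : V * V | [&& p.1 \in X, p.2 \in X & N h p.1 p.2]]| =
    \sum_h \sum_(p in S :\: S0) N h p.1 p.2.
  apply: eq_bigr => h _; rewrite -card_set_sum; apply: eq_card => -[w v]; rewrite !inE /=.
  case: (w \in X); case: (v \in X); rewrite //= ?andbF //.
  case Nh: (N h w v); rewrite ?andbF //= (Ne _ _ _ Nh) /= negbK !andbT; symmetry.
  by apply/existsP; exists h.
rewrite exchange_big /= -sum1_card; apply: eq_bigr => -[w v]; rewrite !inE /=.
case/and4P=> + wX vX ewv; rewrite wX vX ewv /= negbK => /existsP[h Nh].
rewrite (bigD1 h) //= Nh big1 // => k; case Nk: (N k w v) => //.
by rewrite (Nd _ _ _ _ Nk Nh) eqxx.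
Qed.

Definition half M X := [set p : V * V | [&& p.1 \in X, p.2 \in X, M p.1 p.2 & enum_rank p.1 < enum_rank p.2]].

Lemma inner_half M X : symmetric M -> irreflexive M -> inner M X = 2 * #|half M X|.
Proof.
move=> Ms Mi; pose sw (p : V * V) := (p.2, p.1).
have swI : injective sw by move=> [a b] [c d] [-> ->].
have dis : [disjoint half M X & sw @: half M X].
  apply: disjointI => p h /imsetP[q]; rewrite !inE in h * => /and4P[_ _ _ lt] pq.
  by move: h; rewrite pq /= => /and4P[_ _ _]; rewrite ltnNge ltnW.
rewrite mul2n -addnn -{2}(card_imset _ swI) -card_disjointU // /inner; apply: eq_card => -[w v].
rewrite in_setU !inE /=; apply/idP/orP => [/and3P[wX vX Mwv]|[/and4P[-> -> ->]//|]].
  rewrite wX vX Mwv /=; case: ltngtP => h; [by left|right|].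
    by apply/imsetP; exists (v, w) => //; rewrite inE /= vX wX Ms Mwv h.
  by move: Mwv; rewrite (enum_rank_inj (ord_inj h)) Mi.
by case/imsetP=> -[a b]; rewrite inE /= => /and4P[aX bX h _] [-> ->]; rewrite aX bX Ms h.
Qed.

Lemma inner_pmatch M S X : pmatch S M -> inner M X <= #|S|.
Proof.
move=> pm; apply: leq_trans (subset_leq_card (subsetIl S X)); rewrite -(pmatch_cover X pm).
by apply: subset_leq_card; apply/subsetP => p; rewrite !inE => /and3P[-> _ ->].
Qed.

End Inner.

(** * Equalising the two sides in the remaining colours *)

Section PrivStage.
Variables (V : finType) (R : rel V) (A B : {set V}) (K : nat) (Bad : 'I_K -> {set V}).
Variables (dAB kap E1 : nat).
Let om1 := dAB + kap.

(** In each of these [K] colours a small matching inside the larger side makes the uncovered parts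
    of [A] and [B] equal in size. Only then can the colour be finished by balanced pairs of edges
    and a perfect matching across. *)
Lemma priv_stage : symmetric R -> irreflexive R -> [disjoint A & B] -> 0 < #|V| ->
    (forall j, ~~ odd #|(A :|: B) :\: Bad j|) -> (forall j, #|Bad j| <= kap) ->
    #|A| <= #|B| + dAB -> #|B| <= #|A| + dAB -> E1 <= inner R A -> E1 <= inner R B ->
    om1 * (4 * #|V|) + kap * (2 * #|V|) + K * om1 <= E1 ->
  exists (PS : 'I_K -> {set V}) (MP : 'I_K -> rel V),
    [/\ forall j, pmatch (PS j) (MP j), forall j, subrel (MP j) R,
        forall j, PS j \subset (A :|: B) :\: Bad j,
        forall j, #|PS j| <= om1 /\ #|A :\: Bad j :\: PS j| = #|B :\: Bad j :\: PS j| &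
        forall j k w v, MP j w v -> MP k w v -> j = k].
Proof.
move=> Rs Ri dis V0 par badk dA dB EA EB E1P.
pose P (j : 'I_K) (x : {set V} * rel V) := [/\ pmatch x.1 x.2, subrel x.2 R, x.1 \subset (A :|: B) :\: Bad j,
  #|x.1| <= om1 & #|A :\: Bad j :\: x.1| = #|B :\: Bad j :\: x.1|].
pose C (x y : {set V} * rel V) := forall w v, x.2 w v -> y.2 w v -> False.
have [|F [FP FC]] := @sequential 'I_K ({set V} * rel V) (set0, fun _ _ => false) P C; last first.
  exists (fun j => (F j).1), (fun j => (F j).2); split=> [j|j|j|j|j k w v h1 h2]; try by case: (FP j).
  by apply/eqP; apply: contraT => jk; case: (FC _ _ jk _ _ h1 h2).
move=> j s F us js FP FC.
pose used : rel V := fun w v => [exists k, (k \in s) && (F k).2 w v].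
have usym : symmetric used.
  move=> w v; apply: eq_existsb => k; case ks: (k \in s) => //=; case: (FP k ks) => -[sy _ _ _] _ _ _ _; exact: sy.
have half_step (A0 B0 : {set V}) k : [disjoint A0 & B0] -> (A0 :|: B0) = A :|: B -> E1 <= inner R A0 ->
    #|A0 :\: Bad j| = #|B0 :\: Bad j| + 2 * k -> 2 * k <= om1 ->
    exists S M, [/\ pmatch S M, subrel M [rel w v | R w v && ~~ used w v], S \subset (A0 :|: B0) :\: Bad j,
      #|S| <= om1 & #|A0 :\: Bad j :\: S| = #|B0 :\: Bad j :\: S|].
  move=> dis0 AB0 E0 kE kle.
  have [|||S [M [pm SA cS MR]]] := @matching_exists V [rel w v | R w v && ~~ used w v] (A0 :\: Bad j) k _ _ V0.
  - by move=> w v /=; rewrite Rs usym.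
  - by move=> w /=; rewrite Ri.
  - have le1 := inner_setD R A0 (Bad j).
    have le2 := inner_used (mem s) R (fun k => (F k).2) (A0 :\: Bad j).
    have le3 : \sum_(k in mem s) inner (F k).2 (A0 :\: Bad j) <= K * om1.
      apply: leq_trans (_ : \sum_(k in mem s) om1 <= _); last first.
        by rewrite sum_nat_const leq_mul2r (leq_trans (max_card _)) ?card_ord ?orbT.
      by apply: leq_sum => h hs; case: (FP h hs) => pm _ _ cle _; apply: leq_trans (inner_pmatch _ pm) cle.
    have le4 : #|Bad j| * (2 * #|V|) <= kap * (2 * #|V|) by rewrite leq_mul2r badk orbT.
    have le5 : k * (4 * #|V|) <= om1 * (4 * #|V|) by rewrite leq_mul2r (leq_trans _ kle) ?orbT // leq_pmull.
    move: le1 le2 le3 le4 le5 E1P E0; rewrite -/used.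
    move: (inner _ _) (inner _ _) (inner _ _) (_ * _) (_ * _) (_ * _) (_ * _) (_ * _) (\sum_(_ in _) _).
    by move=> a b c x y z w l m; lia.
  - exists S, M; split=> //; last 1 first.
    + have -> : B0 :\: Bad j :\: S = B0 :\: Bad j.
        apply/setP => x; rewrite [LHS]in_setD; case xS: (x \in S) => //=; symmetry.
        move/subsetP: SA => /(_ x xS); rewrite !in_setD => /andP[_ xA].
        by rewrite (disjointFr dis0 xA) andbF.
      by have := card_split SA; rewrite cS kE; lia.
    + by apply: subset_trans SA _; apply: setSD; apply: subsetUl.
    + by rewrite cS.
have NB0 : (A :|: B) :\: Bad j = A :\: Bad j :|: B :\: Bad j.
  by apply/setP => x; rewrite !inE; case: (x \in Bad j).
have disN : [disjoint A :\: Bad j & B :\: Bad j].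
  by apply: disjointI => x; rewrite !inE => /andP[_ xA] /andP[_]; rewrite (disjointFr dis xA).
have parj := par j; rewrite NB0 card_disjointU // in parj.
have leD (X : {set V}) : #|X| <= #|X :\: Bad j| + kap.
  apply: leq_trans (leq_add (leqnn _) (badk j)); apply: leq_trans (leq_card_setU _ _).
  by apply: subset_leq_card; apply/subsetP => x xX; rewrite !inE xX; case: (x \in Bad j).
have leX (X : {set V}) : #|X :\: Bad j| <= #|X| by apply: subset_leq_card; apply: subsetDl.
have finish S M : [/\ pmatch S M, subrel M [rel w v | R w v && ~~ used w v], S \subset (A :|: B) :\: Bad j,
      #|S| <= om1 & #|A :\: Bad j :\: S| = #|B :\: Bad j :\: S|] ->
    exists2 x, P j x & forall k, k \in s -> C (F k) x /\ C x (F k).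
  case=> pm MR SN cS eqS; exists (S, M); first by split=> // w v /MR /andP[].
  by move=> k ks; split=> w v h1 h2; [have h3 := h2|have h3 := h1];
    have /andP[_ /negP[]] := MR _ _ h3; apply/existsP; exists k; rewrite ks.
have [leBA|/ltnW leAB] := leqP #|B :\: Bad j| #|A :\: Bad j|.
  pose k := (#|A :\: Bad j| - #|B :\: Bad j|)./2.
  have kE : #|A :\: Bad j| = #|B :\: Bad j| + 2 * k.
    rewrite -[LHS](subnKC leBA); congr (_ + _); rewrite mul2n even_halfK //.
    by rewrite oddB // -oddD.
  have [|S [M SM]] := half_step A B k dis erefl EA kE; last by apply: finish SM.
  have := leq_trans (leX A) (leq_trans dA (leq_add (leD B) (leqnn _))); rewrite kE /om1; lia.
pose k := (#|B :\: Bad j| - #|A :\: Bad j|)./2.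
have kE : #|B :\: Bad j| = #|A :\: Bad j| + 2 * k.
  rewrite -[LHS](subnKC leAB); congr (_ + _); rewrite mul2n even_halfK //.
  by rewrite oddB // -oddD addnC.
have [||S [M [pm MR SN cS eqS]]] := half_step B A k _ (setUC _ _) EB kE.
- by rewrite disjoint_sym.
- have := leq_trans (leX B) (leq_trans dB (leq_add (leD A) (leqnn _))); rewrite kE /om1; lia.
- by apply: (finish S M); split=> //; rewrite setUC.
Qed.

End PrivStage.

Section PairStage.
Variables (V : finType) (R : rel V) (A B : {set V}) (K : nat) (BP : 'I_K -> {set V}).
Variables (lam mu Y : nat).

(* The uncovered edges inside [A] are paired with those inside [B]; giving both
   members of a pair the same colour keeps the two sides balanced. *)
Lemma pair_stage : symmetric R -> irreflexive R -> [disjoint A & B] ->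
    inner R A = inner R B ->
    (forall w, #|[set v | R w v]| <= lam) -> (forall w, #|[set j | w \in BP j]| <= mu) ->
    #|V| * lam <= (K - (4 * lam + 4 * mu)) * Y ->
  exists (Q : 'I_K -> {set V}) (MQ : 'I_K -> rel V),
    [/\ forall j, pmatch (Q j) (MQ j), forall j, subrel (MQ j) R,
        forall j, Q j \subset (A :|: B) :\: BP j,
        forall j, #|Q j :&: A| = #|Q j :&: B| /\ #|Q j :&: A| <= 2 * Y &
        (forall j k w v, MQ j w v -> MQ k w v -> j = k) /\
        forall w v, same_side A B w v -> R w v -> exists j, MQ j w v].
Proof.
move=> Rs Ri dis inAB degR degBP cardK.
have AB x : x \in A -> x \in B = false by move=> xA; rewrite (disjointFr dis xA).
have BA x : x \in B -> x \in A = false by move=> xA; rewrite (disjointFl dis xA).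
pose EA := half R A; pose EB := half R B.
have cAB : #|EA| = #|EB| by have := inAB; rewrite !inner_half // => /eqP; rewrite eqn_pmul2l // => /eqP.
have [f [fB fI]] : exists f : V * V -> V * V, {in EA, forall p, (f p \in EB) && true} /\ {in EA &, injective f}.
  apply: (@inj_choice _ (fun _ _ => true)) => p _; rewrite cAB.
  by apply: subset_leq_card; apply/subsetP => q; rewrite inE => ->.
have EAP p : p \in EA -> [/\ p.1 \in A, p.2 \in A, R p.1 p.2 & enum_rank p.1 < enum_rank p.2].
  by rewrite inE => /and4P[].
have EBP p : p \in EA -> [/\ (f p).1 \in B, (f p).2 \in B, R (f p).1 (f p).2 & enum_rank (f p).1 < enum_rank (f p).2].
  by move/fB; rewrite andbT inE => /and4P[].
pose quad (p : V * V) := [:: p.1; p.2; (f p).1; (f p).2].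
have degQ x : #|[set p in EA | x \in quad p]| <= lam.
  apply: leq_trans (degR x).
  apply: (@card_le_rel _ _ _ _ (fun v p => [&& p \in EA, R x v & if x \in A then (p == (x, v)) || (p == (v, x))
      else (f p == (x, v)) || (f p == (v, x))])).
    move=> p; rewrite inE => /andP[pEA]; rewrite pEA !inE.
    have [p1 p2 pR _] := EAP p pEA; have [q1 q2 qR _] := EBP p pEA.
    case/or4P=> /eqP->.
    + by exists p.2; rewrite ?inE // p1 pR -surjective_pairing eqxx.
    + by exists p.1; rewrite ?inE 1?Rs // p2 pR -surjective_pairing eqxx orbT.
    + by exists (f p).2; rewrite ?inE // (BA _ q1) qR -surjective_pairing eqxx.
    + by exists (f p).1; rewrite ?inE 1?Rs // (BA _ q2) qR -surjective_pairing eqxx orbT.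
  move=> v p p' /and3P[pE _ h] /and3P[pE' _ h'].
  have [_ _ _ r1] := EAP p pE; have [_ _ _ r1'] := EAP p' pE'.
  have [_ _ _ r2] := EBP p pE; have [_ _ _ r2'] := EBP p' pE'.
  have anti (a b : V) : enum_rank a < enum_rank b -> enum_rank b < enum_rank a -> False.
    by move=> h1 h2; move: h1; rewrite ltnNge ltnW.
  case: ifP h h' => _ /orP[]/eqP h /orP[]/eqP h'.
  - by rewrite h h'.
  - by rewrite h h' /= in r1 r1'; case: (anti _ _ r1 r1').
  - by rewrite h h' /= in r1 r1'; case: (anti _ _ r1 r1').
  - by rewrite h h'.
  - by apply: fI; rewrite // h h'.
  - by rewrite h h' /= in r2 r2'; case: (anti _ _ r2 r2').
  - by rewrite h h' /= in r2 r2'; case: (anti _ _ r2 r2').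
  - by apply: fI; rewrite // h h'.
pose cf : rel (V * V) := fun p h => has (mem (quad p)) (quad h).
pose forb (p : V * V) (i : nat) := has (fun x => [exists j : 'I_K, (val j == i) && (x \in BP j)]) (quad p).
have [p pE||p h|c [cK cC cY]] := @greedy_coloring (V * V)%type EA cf forb K Y (4 * lam + 4 * mu).
- apply: leq_add.
    have -> : [set h in EA | cf p h] = [set h | has (fun x => (h \in EA) && (x \in quad h)) (quad p)].
      apply/setP => h; rewrite !inE /cf has_sym; apply/andP/hasP => [[hE /hasP[x xp xh]]|[x xp /andP[hE xh]]].
        by exists x => //; rewrite hE xh.
      by split=> //; apply/hasP; exists x.
    by apply: (@card_has _ _ (fun x h => (h \in EA) && (x \in quad h)) lam (quad p)) => x; apply: degQ.
  apply: (@card_has _ _ (fun x (i : 'I_K) => [exists j : 'I_K, (val j == i) && (x \in BP j)]) mu (quad p)) => x.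
  apply: leq_trans (degBP x); apply: subset_leq_card; apply/subsetP => i; rewrite !inE.
  by case/existsP=> j /andP[/eqP/ord_inj->].
- apply: leq_trans cardK; apply: leq_trans (_ : 2 * #|EA| <= _); first by rewrite leq_pmull.
  rewrite -inner_half // /inner -[#|V|]cardsT; have degS := fun w => degR w.
  apply: leq_trans (_ : \sum_(w in [set: V]) #|[set v | R w v]| <= _); last first.
    by rewrite -sum_nat_const; apply: leq_sum.
  have -> : \sum_(w in [set: V]) #|[set v | R w v]| = \sum_(p : V * V) R p.1 p.2.
    rewrite -(pair_bigA _ (fun w v => R w v : nat)) /=; apply: eq_big => [w|w _]; first by rewrite inE.
    by rewrite -sum1_card big_mkcond; apply: eq_bigr => v _; rewrite inE; case: (R w v).
  rewrite -sum1_card big_mkcond; apply: leq_sum => q _; rewrite inE.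
  by case: (R q.1 q.2); rewrite ?andbF //; case: ifP.
- by rewrite /cf has_sym.
have dj p h x : p \in EA -> h \in EA -> c p = c h -> x \in quad p -> x \in quad h -> p = h.
  move=> pE hE cc xp xh; apply/eqP; apply: contraT => ph.
  have := cC p h pE hE ph; rewrite cc eqxx => H; apply/H/hasP; by exists x.
pose MQ (j : 'I_K) : rel V := fun w v => [exists p in EA, (c p == j) &&
   [|| (w, v) == p, (v, w) == p, (w, v) == f p | (v, w) == f p]].
pose Q (j : 'I_K) := [set x | [exists p in EA, (c p == j) && (x \in quad p)]].
have QP (j : 'I_K) x : reflect (exists2 p, p \in EA & c p = j /\ x \in quad p) (x \in Q j).
  rewrite inE; apply: (iffP existsP) => [[p /and3P[pE /eqP cp xp]]|[p pE [cp xp]]]; exists p => //.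
  by rewrite pE cp eqxx.
have MQP (j : 'I_K) w v : MQ j w v -> exists p, [/\ p \in EA, c p = j, w \in quad p, v \in quad p &
    [|| (w, v) == p, (v, w) == p, (w, v) == f p | (v, w) == f p]].
  case/existsP=> p /and3P[pE /eqP cp h]; exists p; split=> //; rewrite /quad !inE.
    by case/or4P: h => /eqP <-; rewrite eqxx ?orbT.
  by case/or4P: h => /eqP <-; rewrite eqxx ?orbT.
have MQE p : p \in EA -> forall w v, [|| (w, v) == p, (v, w) == p, (w, v) == f p | (v, w) == f p] ->
    R w v && same_side A B w v.
  move=> pE w v h; have [p1 p2 pR _] := EAP p pE; have [q1 q2 qR _] := EBP p pE.
  rewrite /same_side; case/or4P: h => /eqP h; rewrite -h /= in p1 p2 pR q1 q2 qR.
  - by rewrite pR p1 p2.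
  - by rewrite Rs pR p1 p2.
  - by rewrite qR q1 q2 orbT.
  - by rewrite Rs qR q1 q2 orbT.
have MQs j : symmetric (MQ j).
  move=> w v; apply: eq_existsb => p; congr [&& _, _ & _].
  by case: ((w, v) == p); case: ((v, w) == p); case: ((w, v) == f p); case: ((v, w) == f p).
exists Q, MQ; split.
- move=> j; split.
  + exact: MQs.
  + by move=> w v /MQP[p [pE cp wp _ _]]; apply/QP; exists p.
  + move=> w v v' /MQP[p [pE cp wp _ h]] /MQP[p' [pE' cp' wp' _ h']].
    have pp : p = p' by apply: dj pE pE' _ wp wp'; rewrite cp cp'.
    rewrite -pp in h'; have [p1 p2 pR pr] := EAP p pE; have [q1 q2 qR qr] := EBP p pE.
    have ne1 : p.1 != p.2 by apply/eqP => h1; rewrite h1 ltnn in pr.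
    have ne2 : (f p).1 != (f p).2 by apply/eqP => h1; rewrite h1 ltnn in qr.
    move: p1 p2 q1 q2 ne1 ne2 h h'; case: (p) (f p) => a b [a' b'] /= aA bA a'B b'B.
    move=> ne1 ne2; rewrite !xpair_eqE.
    case/or4P=> /andP[/eqP e1 /eqP e2] /or4P[]/andP[/eqP e3 /eqP e4]; subst; rewrite ?eqxx // in ne1 ne2 *.
    all: try by rewrite (AB _ aA) in a'B.
    all: try by rewrite (AB _ aA) in b'B.
    all: try by rewrite (AB _ bA) in a'B.
    all: try by rewrite (AB _ bA) in b'B.
  + move=> w /QP[p pE [cp]]; rewrite !inE => h.
    have ex v : [|| (w, v) == p, (v, w) == p, (w, v) == f p | (v, w) == f p] -> exists v, MQ j w v.
      by move=> h'; exists v; apply/existsP; exists p; rewrite pE cp eqxx.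
    case/or4P: h => /eqP wE.
    * by apply: (ex p.2); rewrite wE -surjective_pairing eqxx.
    * by apply: (ex p.1); rewrite wE -surjective_pairing eqxx orbT.
    * by apply: (ex (f p).2); rewrite wE -surjective_pairing eqxx !orbT.
    * by apply: (ex (f p).1); rewrite wE -surjective_pairing eqxx !orbT.
- by move=> j w v /MQP[p [pE _ _ _ h]]; have /andP[] := MQE p pE w v h.
- move=> j; apply/subsetP => x /QP[p pE [cp xp]]; rewrite in_setD in_setU.
  have [_ /hasPn no] := cK p pE; apply/andP; split.
    by have := no x xp; apply: contra => xB; apply/existsP; exists j; rewrite cp eqxx.
  have [p1 p2 _ _] := EAP p pE; have [q1 q2 _ _] := EBP p pE.
  by move: xp; rewrite !inE => /or4P[]/eqP->; rewrite ?p1 ?p2 ?q1 ?q2 ?orbT.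
- move=> j; pose Ej := [set p in EA | c p == j].
  have EjP p : p \in Ej -> (p \in EA) /\ c p = j by rewrite inE => /andP[? /eqP].
  have cnt (g : V * V -> V * V) : (forall p, p \in EA -> ((g p).1 \in quad p) /\ ((g p).2 \in quad p)) ->
      (forall p, p \in EA -> (g p).1 != (g p).2) ->
      #|[set (g p).1 | p in Ej] :|: [set (g p).2 | p in Ej]| = 2 * #|Ej|.
    move=> gq gne; rewrite card_disjointU; last first.
      apply: disjointI => x /imsetP[p /EjP[pE cp] xp] /imsetP[h /EjP[hE ch] xh].
      have [g1 g2] := gq p pE; have [g3 g4] := gq h hE.
      have ph : p = h by apply: (dj _ _ x pE hE); rewrite ?cp ?ch // ?xh // -?xh xp.
      by have := gne p pE; rewrite -xp {1}ph -xh eqxx.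
    rewrite !card_in_imset ?mul2n ?addnn // => p h /EjP[pE cp] /EjP[hE ch] xx;
      have [g1 g2] := gq p pE; have [g3 g4] := gq h hE.
      by apply: (dj _ _ (g p).2 pE hE); rewrite ?cp ?ch // xx.
    by apply: (dj _ _ (g p).1 pE hE); rewrite ?cp ?ch // xx.
  have QA : Q j :&: A = [set p.1 | p in Ej] :|: [set p.2 | p in Ej].
    apply/setP => x; rewrite in_setI in_setU; apply/andP/orP.
      case=> /QP[p pE [cp xp]] xA; have pEj : p \in Ej by rewrite inE pE cp eqxx.
      have [q1 q2 _ _] := EBP p pE; move: xp; rewrite !inE => /or4P[]/eqP xp.
      + by left; rewrite xp imset_f.
      + by right; rewrite xp imset_f.
      + by rewrite xp (BA _ q1) in xA.
      + by rewrite xp (BA _ q2) in xA.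
    case=> /imsetP[p /EjP[pE cp] ->]; have [p1 p2 _ _] := EAP p pE; split=> //; apply/QP; exists p; rewrite // !inE eqxx ?orbT //.
  have QB : Q j :&: B = [set (f p).1 | p in Ej] :|: [set (f p).2 | p in Ej].
    apply/setP => x; rewrite in_setI in_setU; apply/andP/orP.
      case=> /QP[p pE [cp xp]] xA; have pEj : p \in Ej by rewrite inE pE cp eqxx.
      have [q1 q2 _ _] := EAP p pE; move: xp; rewrite !inE => /or4P[]/eqP xp.
      + by rewrite xp (AB _ q1) in xA.
      + by rewrite xp (AB _ q2) in xA.
      + by left; rewrite xp; apply/imsetP; exists p.
      + by right; rewrite xp; apply/imsetP; exists p.
    case=> /imsetP[p /EjP[pE cp] ->]; have [p1 p2 _ _] := EBP p pE; split=> //; apply/QP; exists p; rewrite // !inE eqxx ?orbT //.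
  rewrite QA QB (cnt id) ?(cnt f); last 1 first.
  + by move=> p pE; have [_ _ _ lt] := EAP p pE; apply/eqP => h; rewrite h ltnn in lt.
  + by split=> //; rewrite leq_mul2l cY.
  + by move=> p pE; rewrite !inE !eqxx !orbT.
  + by move=> p pE; have [_ _ _ lt] := EBP p pE; apply/eqP => h; rewrite h ltnn in lt.
  + by move=> p pE; rewrite !inE !eqxx !orbT.
- have fS q : q \in EB -> exists2 p, p \in EA & f p = q.
    have fE : f @: EA = EB.
      apply/eqP; rewrite eqEcard card_in_imset // cAB leqnn andbT.
      by apply/subsetP => _ /imsetP[p /fB/andP[h _] ->].
    by rewrite -fE => /imsetP[p pE ->]; exists p.
  have own w v : same_side A B w v -> R w v -> exists p, p \in EA /\
      [|| (w, v) == p, (v, w) == p, (w, v) == f p | (v, w) == f p].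
    have wv : R w v -> w != v by apply: contraTneq => ->; rewrite Ri.
    have ltN : R w v -> ~~ (enum_rank w < enum_rank v) -> enum_rank v < enum_rank w.
      move=> Rwv; rewrite -leqNgt leq_eqVlt => /orP[/eqP/ord_inj/enum_rank_inj vw|//].
      by have := wv Rwv; rewrite vw eqxx.
    move=> + Rwv; case/orP=> /andP[h1 h2]; have [lt|/(ltN Rwv) lt] := boolP (enum_rank w < enum_rank v).
    + by exists (w, v); rewrite inE /= h1 h2 Rwv lt eqxx.
    + by exists (v, w); rewrite inE /= h1 h2 Rs Rwv lt eqxx orbT.
    + have [|p pE fp] := fS (w, v); first by rewrite inE /= h1 h2 Rwv lt.
      by exists p; rewrite pE fp eqxx !orbT.
    + have [|p pE fp] := fS (v, w); first by rewrite inE /= h1 h2 Rs Rwv lt.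
      by exists p; rewrite pE fp eqxx !orbT.
  have uniqP p p' w v : p \in EA -> p' \in EA -> [|| (w, v) == p, (v, w) == p, (w, v) == f p | (v, w) == f p] ->
      [|| (w, v) == p', (v, w) == p', (w, v) == f p' | (v, w) == f p'] -> p = p'.
    move=> pE pE'; have [p1 p2 _ r1] := EAP p pE; have [p1' p2' _ r1'] := EAP p' pE'.
    have [q1 q2 _ r2] := EBP p pE; have [q1' q2' _ r2'] := EBP p' pE'.
    have anti (a b : V) : enum_rank a < enum_rank b -> enum_rank b < enum_rank a -> False.
      by move=> h1 h2; move: h1; rewrite ltnNge ltnW.
    case/or4P=> /eqP e1 /or4P[]/eqP e2; rewrite -?e1 -?e2 /= in p1 p2 r1 p1' p2' r1' q1 q2 r2 q1' q2' r2';
    first [by rewrite -e1 -e2 | by case: (anti _ _ r1 r1') | by case: (anti _ _ r2 r2')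
      | by apply: fI => //; rewrite -e1 -e2 | by rewrite (AB _ p1) in q1' | by rewrite (AB _ p2) in q1'
      | by rewrite (AB _ p1') in q1 | by rewrite (AB _ p2') in q1].
  split=> [j k w v /MQP[p [pE cp _ _ h]] /MQP[p' [pE' cp' _ _ h']]|w v sm Rwv].
    by apply: ord_inj; rewrite -cp -cp' (uniqP _ _ _ _ pE pE' h h').
  have [p [pE h]] := own w v sm Rwv; have [cp _] := cK p pE.
  by exists (Ordinal cp); apply/existsP; exists p; rewrite pE eqxx.
Qed.

End PairStage.

(** * Colouring everything that is left inside the halves *)

Section FinalStage.
Variables (V I : finType) (e Qh : rel V) (A B : {set V}) (M : I -> rel V) (Bad : I -> {set V}).
Variables (K : nat) (BadJ : 'I_K -> {set V}).
Variables (dAB kap kapv E1 lam Y q1 del : nat).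
Let om1 := dAB + kap.
Hypotheses (es : symmetric e) (ei : irreflexive e) (dis : [disjoint A & B]) (V0 : 0 < #|V|).
Hypothesis QhE : forall w v, Qh w v -> [&& w \in A, v \in B & e w v].
Hypotheses (pmM : forall i, pmatch ((A :|: B) :\: Bad i) (M i)) (Me : forall i, subrel (M i) e)
  (Md : forall i j w v, M i w v -> M j w v -> i = j).
Hypothesis left : forall w, #|[set v | [&& same_side A B w v, e w v & ~~ [exists i, M i w v]]]| <= lam.
Hypotheses (E1A : E1 <= inner [rel w v | e w v && ~~ [exists i, M i w v]] A)
  (E1B : E1 <= inner [rel w v | e w v && ~~ [exists i, M i w v]] B).
Hypothesis QMA : forall x, x \in A -> #|[set y in B | Qh x y && [exists i, M i x y]]| <= q1.
Hypothesis QMB : forall y, y \in B -> #|[set x in A | Qh x y && [exists i, M i x y]]| <= q1.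
Hypotheses (badk : forall j, #|BadJ j| <= kap) (badv : forall w, #|[set j | w \in BadJ j]| <= kapv).
Hypothesis par : forall j, ~~ odd #|(A :|: B) :\: BadJ j|.
Hypotheses (dA : #|A| <= #|B| + dAB) (dB : #|B| <= #|A| + dAB).
Hypothesis identity : inner e A + (\sum_i #|B :\: Bad i| + \sum_j #|B :\: BadJ j|) =
  inner e B + (\sum_i #|A :\: Bad i| + \sum_j #|A :\: BadJ j|).
Hypothesis E1P : om1 * (4 * #|V|) + kap * (2 * #|V|) + K * om1 <= E1.
Hypothesis cardK : #|V| * lam <= (K - (4 * lam + 4 * (kapv + lam))) * Y.
Hypothesis delP : kap + om1 + 2 * Y <= del.
Hypothesis hallG : forall used : rel V, symmetric used ->
  (forall x, x \in A -> #|[set y in B | Qh x y && used x y]| <= q1 + K) ->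
  (forall y, y \in B -> #|[set x in A | Qh x y && used x y]| <= q1 + K) ->
  forall A' B' : {set V}, A' \subset A -> B' \subset B -> #|A'| = #|B'| ->
  #|A :\: A'| <= del -> #|B :\: B'| <= del -> exists f : V -> V,
  [/\ {in A' &, injective f}, f @: A' = B' & {in A', forall x, Qh x (f x) && ~~ used x (f x)}].

(** Adding up [pmatch_balance] over all colours and comparing with [identity] shows that the edges
    left after [priv_stage] are equally many inside [A] and inside [B]. They are coloured in pairs,
    and each of the [K] colours is then completed by a matching in [Qh] between the remaining parts
    of the halves. *)
Lemma final_stage : exists MJ : 'I_K -> rel V,
  [/\ forall j, pmatch ((A :|: B) :\: BadJ j) (MJ j), forall j, subrel (MJ j) e,
      forall j k w v, MJ j w v -> MJ k w v -> j = k,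
      forall i j w v, M i w v -> MJ j w v -> False &
      forall w v, same_side A B w v -> e w v -> (exists i, M i w v) \/ (exists j, MJ j w v)].
Proof.
have AB x : x \in A -> x \in B = false by move=> xA; rewrite (disjointFr dis xA).
have BA x : x \in B -> x \in A = false by move=> xA; rewrite (disjointFl dis xA).
have ssC w v : same_side A B w v = same_side A B v w.
  by rewrite /same_side [(v \in A) && _]andbC [(v \in B) && _]andbC.
have exMs w v : [exists i, M i w v] = [exists i, M i v w].
  by apply: eq_existsb => i; have [sy _ _ _] := pmM i; apply: sy.
pose R : rel V := fun w v => [&& same_side A B w v, e w v & ~~ [exists i, M i w v]].
have Rs : symmetric R by move=> w v; rewrite /R ssC es exMs.
have Ri : irreflexive R by move=> w; rewrite /R ei andbF.
have E1R X : X = A \/ X = B -> inner [rel w v | e w v && ~~ [exists i, M i w v]] X <= inner R X.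
  move=> XAB; apply: subset_leq_card; apply/subsetP => -[w v]; rewrite !inE /= /R /same_side.
  by case: XAB => -> /and4P[-> -> -> ->]; rewrite ?orbT.
have [PS [MP [pmP MPR PSN PSc MPd]]] := @priv_stage V R A B K BadJ dAB kap E1 Rs Ri dis V0 par badk dA dB
  (leq_trans E1A (E1R A (or_introl erefl))) (leq_trans E1B (E1R B (or_intror erefl))) E1P.
have exMPs w v : [exists j, MP j w v] = [exists j, MP j v w].
  by apply: eq_existsb => i; have [sy _ _ _] := pmP i; apply: sy.
pose R' : rel V := fun w v => R w v && ~~ [exists j, MP j w v].
have R's : symmetric R' by move=> w v; rewrite /R' Rs exMPs.
have R'i : irreflexive R' by move=> w; rewrite /R' Ri.
pose N (h : I + 'I_K) : rel V := match h with inl i => M i | inr j => MP j end.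
have Ne h : subrel (N h) e.
  by case: h => [i|j] w v; [apply: Me|move=> /MPR/and3P[]].
have Nd h k w v : N h w v -> N k w v -> h = k.
  case: h k => [i|j] [i'|j'] /= h1 h2.
  - by rewrite (Md h1 h2).
  - by have /and3P[_ _ /existsPn/(_ i)] := MPR _ _ _ h2; rewrite h1.
  - by have /and3P[_ _ /existsPn/(_ i')] := MPR _ _ _ h1; rewrite h2.
  - by rewrite (MPd _ _ _ _ h1 h2).
have decomp X : X = A \/ X = B -> inner e X = inner R' X + (\sum_i inner (M i) X + \sum_j inner (MP j) X).
  move=> XAB; rewrite (inner_decomp X Ne Nd) big_sumType /=; congr (_ + _).
  apply: eq_card => -[w v]; rewrite !inE /= /R' /R.
  have sm : w \in X -> v \in X -> same_side A B w v.
    by rewrite /same_side; case: XAB => -> -> ->; rewrite ?orbT.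
  have [wX|//] := boolP (w \in X); have [vX|//] := boolP (v \in X); rewrite sm //=.
  rewrite -andbA; congr (_ && _); rewrite -negb_or; congr (~~ _); apply/existsP/orP.
    by case=> -[i|j] h; [left|right]; apply/existsP; [exists i|exists j].
  by case=> /existsP[i h]; [exists (inl i)|exists (inr i)].
have NCA D : ((A :|: B) :\: D) :&: A = A :\: D by apply/setP => x; rewrite !inE; case: (x \in A); rewrite ?andbT ?andbF.
have NCB D : ((A :|: B) :\: D) :&: B = B :\: D by apply/setP => x; rewrite !inE; case: (x \in B); rewrite ?orbT ?andbT ?andbF.
have balM i : inner (M i) A + #|B :\: Bad i| = inner (M i) B + #|A :\: Bad i|.
  by have := pmatch_balance (pmM i) dis (subsetDl _ _); rewrite NCA NCB.
have splitP (X : {set V}) j : X = A \/ X = B -> #|X :\: BadJ j| = #|PS j :&: X| + #|X :\: BadJ j :\: PS j|.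
  move=> XAB; rewrite (_ : PS j :&: X = PS j :&: (X :\: BadJ j)).
    by rewrite setIC cardsID.
  apply/setP => x; rewrite !inE; case xP: (x \in PS j) => //=.
  by move/subsetP: (PSN j) => /(_ x xP); rewrite !inE => /andP[-> _].
have balP j : inner (MP j) A + #|B :\: BadJ j| = inner (MP j) B + #|A :\: BadJ j|.
  have h1 : PS j \subset A :|: B by apply: subset_trans (PSN j) (subsetDl _ _).
  have := pmatch_balance (pmP j) dis h1; have [_ h2] := PSc j.
  rewrite (splitP A j (or_introl erefl)) (splitP B j (or_intror erefl)) h2 !addnA => ->; exact: erefl.
have R'AB : inner R' A = inner R' B.
  have sM : \sum_i inner (M i) A + \sum_i #|B :\: Bad i| = \sum_i inner (M i) B + \sum_i #|A :\: Bad i|.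
    by rewrite -!big_split /=; apply: eq_bigr.
  have sP : \sum_j inner (MP j) A + \sum_j #|B :\: BadJ j| = \sum_j inner (MP j) B + \sum_j #|A :\: BadJ j|.
    by rewrite -!big_split /=; apply: eq_bigr.
  move: identity; rewrite (decomp A (or_introl erefl)) (decomp B (or_intror erefl)); move: sM sP.
  move: (inner R' A) (inner R' B) (\sum_i inner (M i) A) (\sum_i inner (M i) B) (\sum_i #|A :\: Bad i|).
  move: (\sum_i #|B :\: Bad i|) (\sum_j inner (MP j) A) (\sum_j inner (MP j) B) (\sum_j #|A :\: BadJ j|) (\sum_j #|B :\: BadJ j|).
  by move=> a b c d a' b' x y z w; lia.
have degR w : #|[set v | R w v]| <= lam by apply: left.
have degR' w : #|[set v | R' w v]| <= lam.
  by apply: leq_trans (degR w); apply: subset_leq_card; apply/subsetP => v; rewrite !inE => /andP[].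
pose BP j := BadJ j :|: PS j.
(* Each colour with [w] in [PS j] takes a different one of the at most [lam] edges left at [w]. *)
have degBP w : #|[set j | w \in BP j]| <= kapv + lam.
  apply: leq_trans (_ : #|[set j | w \in BadJ j] :|: [set j | w \in PS j]| <= _).
    by apply: subset_leq_card; apply/subsetP => j; rewrite !inE.
  apply: leq_trans (leq_card_setU _ _) (leq_add (badv w) _).
  apply: leq_trans (degR w); apply: (@card_le_rel _ _ _ _ (fun v j => MP j w v)).
    move=> j; rewrite inE => wP; have [_ _ _ /(_ w wP)[v Mv]] := pmP j.
    by exists v; rewrite ?inE; first apply: MPR Mv.
  by move=> v j k; apply: MPd.
have [Q [MQ [pmQ MQR QN Qc [MQd MQall]]]] := pair_stage R's R'i dis R'AB degR' degBP cardK.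
pose A' j := A :\: BP j :\: Q j; pose B' j := B :\: BP j :\: Q j.
have A'A j : A' j \subset A by apply/subsetP => x; rewrite !in_setD => /and3P[].
have B'B j : B' j \subset B by apply/subsetP => x; rewrite !in_setD => /and3P[].
have splitQ (X : {set V}) j : X = A \/ X = B -> #|X :\: BP j| = #|Q j :&: X| + #|X :\: BP j :\: Q j|.
  move=> XAB; rewrite (_ : Q j :&: X = Q j :&: (X :\: BP j)).
    by rewrite setIC cardsID.
  apply/setP => x; rewrite !in_setI in_setD; case xP: (x \in Q j) => //=.
  by move/subsetP: (QN j) => /(_ x xP); rewrite !in_setD => /andP[-> _].
have BPD X j : X :\: BP j = X :\: BadJ j :\: PS j by rewrite /BP setDDl.
have cA'B' j : #|A' j| = #|B' j|.
  have := splitQ A j (or_introl erefl); have := splitQ B j (or_intror erefl).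
  rewrite !BPD; have [_ ->] := PSc j; have [-> _] := Qc j; rewrite /A' /B' !BPD; lia.
have defA j : #|A :\: A' j| <= del.
  apply: leq_trans delP; apply: leq_trans (_ : #|BadJ j :|: PS j :|: (Q j :&: A)| <= _).
    apply: subset_leq_card; apply/subsetP => x; rewrite !inE => /andP[+ xA]; rewrite xA.
    by case: (x \in Q j); rewrite ?orbT //; case: (x \in BadJ j) => //; case: (x \in PS j).
  apply: leq_trans (leq_card_setU _ _) (leq_add _ _); last by have [_ ->] := Qc j.
  by apply: leq_trans (leq_card_setU _ _) (leq_add (badk j) _); have [] := PSc j.
have defB j : #|B :\: B' j| <= del.
  apply: leq_trans delP; apply: leq_trans (_ : #|BadJ j :|: PS j :|: (Q j :&: B)| <= _).
    apply: subset_leq_card; apply/subsetP => x; rewrite !inE => /andP[+ xA]; rewrite xA.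
    by case: (x \in Q j); rewrite ?orbT //; case: (x \in BadJ j) => //; case: (x \in PS j).
  apply: leq_trans (leq_card_setU _ _) (leq_add _ _); last by have [<- ->] := Qc j.
  by apply: leq_trans (leq_card_setU _ _) (leq_add (badk j) _); have [] := PSc j.
pose P (j : 'I_K) (m : rel V) := pmatch (A' j :|: B' j) m /\
  forall w v, m w v -> (Qh w v || Qh v w) && ~~ [exists i, M i w v].
pose C (x y : rel V) := forall w v, x w v -> y w v -> False.
have [|MH [MHP MHd]] := @sequential 'I_K (rel V) (fun _ _ => false) P C.
  move=> j s F us js FP FC.
  pose used : rel V := fun w v => [exists i, M i w v] || [exists k, (k \in s) && F k w v].
  have usym : symmetric used.
    move=> w v; rewrite /used exMs; congr (_ || _); apply: eq_existsb => k; case ks: (k \in s) => //=.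
    by case: (FP k ks) => -[sy _ _ _] _; exact: sy.
  have cs : #|[set k | k \in s]| <= K by rewrite -[X in _ <= X]card_ord max_card.
  have [||f [fI fB fQ]] := hallG usym _ _ (A'A j) (B'B j) (cA'B' j) (defA j) (defB j).
  - move=> x xA; apply: leq_trans (_ : #|[set y in B | Qh x y && [exists i, M i x y]] :|:
       [set y | [exists k, (k \in s) && F k x y]]| <= _).
      apply: subset_leq_card; apply/subsetP => y; rewrite !inE => /and3P[-> -> /orP[->//|->]].
      by rewrite orbT.
    apply: leq_trans (leq_card_setU _ _) (leq_add (QMA xA) _); apply: leq_trans cs.
    apply: (@card_le_rel _ _ _ _ (fun k y => (k \in s) && F k x y)).
      by move=> y; rewrite inE => /existsP[k /andP[ks h]]; exists k; rewrite ?inE // ks.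
    by move=> k y y' /andP[ks h] /andP[_ h']; case: (FP k ks) => -[_ _ fu _] _; apply: fu h h'.
  - move=> x xA; apply: leq_trans (_ : #|[set y in A | Qh y x && [exists i, M i y x]] :|:
       [set y | [exists k, (k \in s) && F k y x]]| <= _).
      apply: subset_leq_card; apply/subsetP => y; rewrite !inE => /and3P[-> -> /orP[->//|->]].
      by rewrite orbT.
    apply: leq_trans (leq_card_setU _ _) (leq_add (QMB xA) _); apply: leq_trans cs.
    apply: (@card_le_rel _ _ _ _ (fun k y => (k \in s) && F k y x)).
      by move=> y; rewrite inE => /existsP[k /andP[ks h]]; exists k; rewrite ?inE // ks.
    by move=> k y y' /andP[ks h] /andP[_ h']; case: (FP k ks) => -[sy _ fu _] _; apply: (fu x); rewrite sy.
  pose m : rel V := fun w v => (w \in A' j) && (v == f w) || (v \in A' j) && (w == f v).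
  have mu w v : m w v -> ~~ used w v && (Qh w v || Qh v w).
    case/orP=> /andP[h /eqP->]; have /andP[-> /=] := fQ _ h; first by rewrite andbT.
    by rewrite usym => ->; rewrite orbT.
  exists m.
    split; first by rewrite -fB; apply: (pmatch_inj fI); rewrite fB; apply: disjointI => x /(subsetP (A'A j)) xA
        /(subsetP (B'B j)); rewrite AB.
    by move=> w v /mu; rewrite /used negb_or => /andP[/andP[-> _] ->].
  move=> k ks; split=> w v h1 h2; [have /mu := h2|have /mu := h1]; rewrite /used negb_or => /andP[/andP[_ /existsPn/(_ k) h3] _];
    by rewrite ks ?h1 ?h2 in h3.
have MHcr j w v : MH j w v -> same_side A B w v -> False.
  have [_ /[apply]] := MHP j; rewrite /same_side => /andP[/orP[]/QhE/and3P[h1 h2 _] _];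
  by rewrite (AB _ h1) (BA _ h2) ?andbF.
have Qh_e j w v : MH j w v -> e w v.
  have [_ /[apply]] := MHP j; case/andP=> /orP[]/QhE/and3P[_ _] //; by rewrite es.
have MPM j w v : MP j w v -> ~~ [exists i, M i w v] by move=> /MPR/and3P[].
have MPs j w v : MP j w v -> same_side A B w v by move=> /MPR/and3P[].
have MQP j k w v : MQ j w v -> MP k w v -> False.
  by move=> /MQR/andP[_ /existsPn/(_ k)/negP].
have MQs j w v : MQ j w v -> same_side A B w v by move=> /MQR/andP[/and3P[]].
exists (fun j w v => [|| MP j w v, MQ j w v | MH j w v]); split.
- move=> j; have [pmH _] := MHP j.
  have d1 : [disjoint PS j & Q j].
    by apply: disjointI => x xP /(subsetP (QN j)); rewrite !inE xP orbT.
  have d2 : [disjoint PS j :|: Q j & A' j :|: B' j].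
    by apply: disjointI => x; rewrite in_setU /A' /B' /BP !inE; case: (x \in Q j); case: (x \in PS j); rewrite ?orbT ?andbF.
  apply: (pmatch_eq _ _ (pmatchU (pmatchU (pmP j) (pmQ j) d1) pmH d2)) => [|w v /=]; last by rewrite orbA.
  apply/setP => x; have := subsetP (PSN j) x; have := subsetP (QN j) x; rewrite !inE.
  case: (x \in PS j) => /= [_ /(_ isT)/andP[-> ->] //|+ _]; case: (x \in Q j) => /= [/(_ isT)/andP[]|_].
    by rewrite orbF => -> ->.
  by rewrite orbF; case: (x \in BadJ j); case: (x \in A); case: (x \in B).
- by move=> j w v /or3P[/MPR/and3P[]|/MQR/andP[/and3P[]]|/Qh_e].
- move=> j k w v /or3P[]h /or3P[]h'.
  + exact: MPd h h'.
  + by case: (MQP _ _ _ _ h' h).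
  + by case: (MHcr _ _ _ h' (MPs _ _ _ h)).
  + by case: (MQP _ _ _ _ h h').
  + exact: MQd h h'.
  + by case: (MHcr _ _ _ h' (MQs _ _ _ h)).
  + by case: (MHcr _ _ _ h (MPs _ _ _ h')).
  + by case: (MHcr _ _ _ h (MQs _ _ _ h')).
  + by apply/eqP; apply: contraT => jk; case: (MHd _ _ jk _ _ h h').
- move=> i j w v Mi /or3P[/MPM/existsPn/(_ i)|/MQR/andP[/and3P[_ _ /existsPn/(_ i)]]|]; rewrite ?Mi //.
  by have [_ /[apply]] := MHP j; case/andP=> _ /existsPn/(_ i); rewrite Mi.
- move=> w v sm ewv; have [/existsP h|noM] := boolP [exists i, M i w v]; [by left|right].
  have [/existsP[j h]|noP] := boolP [exists j, MP j w v]; first by exists j; rewrite h.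
  by have [|j h] := MQall w v sm; [rewrite /R' /R sm ewv noM|exists j; rewrite h orbT].
Qed.

End FinalStage.

(** * Colouring the tokens *)

Section Tokens.
Variables (E X Y : finType) (a : E -> X) (b : E -> Y) (H : {set E}).

Definition clash g h := (a g == a h) || (b g == b h).
Definition proper_on (c : E -> nat) := {in H &, forall g h, c g = c h -> clash g h -> g = h}.
Definition cls (c : E -> nat) i := [set h in H | c h == i].

Lemma clash_bound c i h : proper_on c -> #|[set g in cls c i | clash g h]| <= 2.
Proof.
move=> pc; have -> : 2 = #|[set: bool]| by rewrite cardsT card_bool.
apply: (@card_le_rel _ _ _ _ (fun (x : bool) g => (g \in cls c i) && if x then a g == a h else b g == b h)).
  move=> g; rewrite in_set => /andP[gc /orP[h1|h1]]; [exists true|exists false]; by rewrite ?in_setT // gc h1.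
move=> x g g' /andP[]; rewrite inE => /andP[gH /eqP cg] h1 /andP[]; rewrite inE => /andP[gH' /eqP cg'] h2.
by apply: pc; rewrite ?cg ?cg' // /clash; case: x h1 h2 => /eqP-> /eqP->; rewrite eqxx ?orbT.
Qed.

(** Among proper colourings one with the least sum of squared class sizes is taken. A token of class
    [i] clashing with nothing in class [j] could be moved there, and each token of class [j] clashes
    with at most two of class [i]; hence the alternative. Balance up to a factor two is enough, so
    no swaps along chains are made. *)
Lemma balanced k : 0 < k ->
    (forall x, #|[set g in H | a g == x]| <= k) -> (forall y, #|[set g in H | b g == y]| <= k) ->
  exists c : E -> nat, [/\ forall h, h \in H -> c h < k, proper_on c &
    forall i j, i < k -> j < k -> #|cls c i| <= 2 * #|cls c j| \/ #|cls c i| <= #|cls c j| + 1].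
Proof.
case: k => // k _ da db; have [c0 [c0k ca cb]] := konig da db.
pose pr (c : {ffun E -> 'I_k.+1}) := [forall g in H, forall h in H, (c g == c h) ==> clash g h ==> (g == h)].
pose nf (c : {ffun E -> 'I_k.+1}) : E -> nat := fun h => c h.
have prP (c : {ffun E -> 'I_k.+1}) : reflect (proper_on (nf c)) (pr c).
  apply: (iffP forall_inP) => [pc g h gH hH /ord_inj cc cl|pc g gH].
    by have /forall_inP/(_ h hH) := pc g gH; rewrite cc eqxx cl /= => /eqP.
  by apply/forall_inP => h hH; apply/implyP => /eqP cc; apply/implyP => cl; apply/eqP; apply: pc; rewrite // /nf cc.
pose f0 : {ffun E -> 'I_k.+1} := [ffun h => inord (c0 h)].
have f0E h : h \in H -> f0 h = c0 h :> nat by move=> hH; rewrite ffunE inordK // c0k.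
have pf0 : pr f0.
  by apply/prP => g h gH hH; rewrite /nf !f0E // => cc /orP[]/eqP; [apply: ca|apply: cb].
pose sq (c : {ffun E -> 'I_k.+1}) := \sum_(l < k.+1) #|cls (nf c) l| ^ 2.
case: (arg_minnP sq pf0) => c /prP pc cmin; exists (nf c); split=> [h _||i j ik jk]; [exact: ltn_ord|exact: pc|].
have [|lt1] := leqP #|cls (nf c) i| (2 * #|cls (nf c) j|); first by left.
have [|lt2] := leqP #|cls (nf c) i| (#|cls (nf c) j| + 1); first by right.
have [h hi no] : exists2 h, h \in cls (nf c) i & forall g, g \in cls (nf c) j -> ~~ clash h g.
  pose bad := [set h in cls (nf c) i | [exists g in cls (nf c) j, clash h g]].
  have lebad : #|bad| <= 2 * #|cls (nf c) j|.
    have -> : 2 * #|cls (nf c) j| = #|setX [set: bool] (cls (nf c) j)| by rewrite cardsX cardsT card_bool.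
    apply: (@card_le_rel _ _ _ _ (fun (x : bool * E) h => (h \in cls (nf c) i) && if x.1 then a h == a x.2 else b h == b x.2)).
      move=> h; rewrite in_set => /andP[hi /existsP[g /andP[gj /orP[h1|h1]]]].
        by exists (true, g); rewrite ?in_setX ?in_setT /= ?hi.
      by exists (false, g); rewrite ?in_setX ?in_setT /= ?hi.
    move=> [x g0] g g' /= /andP[]; rewrite inE => /andP[gH /eqP cg] h1 /andP[]; rewrite inE => /andP[gH' /eqP cg'] h2.
    by apply: pc; rewrite ?cg ?cg' // /clash; case: x h1 h2 => /eqP-> /eqP->; rewrite eqxx ?orbT.
  have /subsetPn[h hi hb] : ~~ (cls (nf c) i \subset bad).
    by apply/negP => /subset_leq_card/leq_trans/(_ lebad); rewrite leqNgt lt1.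
  exists h => // g gj; move: hb; rewrite inE hi /= => /existsPn/(_ g); by rewrite gj.
have ij : i != j by apply: contraTneq lt1 => ->; rewrite -leqNgt leq_pmull.
pose c' : {ffun E -> 'I_k.+1} := [ffun g => if g == h then Ordinal jk else c g].
have hH : h \in H by move: hi; rewrite inE => /andP[].
have ch : c h = i :> nat by move: hi; rewrite inE => /andP[_ /eqP].
have pc' : pr c'.
  apply/prP => g g' gH gH'; rewrite /nf !ffunE.
  case: (eqVneq g h) => [->|gh]; case: (eqVneq g' h) => [->//|gh'] cc cl.
  - by have := no g'; rewrite inE gH' /nf -cc eqxx cl => /(_ isT).
  - have := no g; rewrite inE gH /nf cc eqxx => /(_ isT); move: cl; rewrite /clash.
    by rewrite [a g == _]eq_sym [b g == _]eq_sym => ->.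
  - by apply: pc.
have c'l l : l != i -> l != j -> cls (nf c') l = cls (nf c) l.
  move=> li lj; apply/setP => g; rewrite !inE /nf ffunE; case: (eqVneq g h) => [->|//].
  by rewrite ch /= eq_sym (negPf lj) eq_sym (negPf li).
have c'i : cls (nf c') i = cls (nf c) i :\ h.
  apply/setP => g; rewrite !inE /nf ffunE; case: (eqVneq g h) => [->|//] /=.
  by rewrite eq_sym (negPf ij) andbF.
have c'j : cls (nf c') j = h |: cls (nf c) j.
  apply/setP => g; rewrite !inE /nf ffunE; case: (eqVneq g h) => [->|//] /=.
  by rewrite eqxx hH.
have hj : h \notin cls (nf c) j by rewrite inE /nf ch (negPf ij) andbF.
have := cmin c' pc'; rewrite /sq (bigD1 (Ordinal ik)) //= (bigD1 (Ordinal jk)) /=; last by rewrite eq_sym.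
rewrite [X in _ <= X](bigD1 (Ordinal ik)) //= [X in _ <= _ + X](bigD1 (Ordinal jk)) /=; last by rewrite eq_sym.
have -> : \sum_(l < k.+1 | (l != Ordinal ik) && (l != Ordinal jk)) #|cls (nf c') l| ^ 2 =
    \sum_(l < k.+1 | (l != Ordinal ik) && (l != Ordinal jk)) #|cls (nf c) l| ^ 2.
  by apply: eq_bigr => l /andP[li lj]; rewrite c'l.
rewrite !addnA leq_add2r c'i c'j cardsU1 hj; have := cardsD1 h (cls (nf c) i); rewrite hi.
move: lt2; move: #|cls (nf c) i| #|cls (nf c) i :\ h| #|cls (nf c) j| => x y z; rewrite !expnS !expn0; nia.
Qed.

Lemma size_cls c k : (forall h, h \in H -> c h < k) -> #|H| = \sum_(i < k) #|cls c i|.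
Proof.
move=> ck; rewrite -sum1_card; under [RHS]eq_bigr do rewrite /cls card_set_sum.
rewrite [RHS]exchange_big /=; apply: eq_bigr => h hH.
by rewrite (bigD1 (Ordinal (ck h hH))) //= eqxx big1 // => i ne; apply/eqP; rewrite eqb0; apply: contraNneq ne => ci; apply/eqP; apply: ord_inj.
Qed.

(** If one class had at most one token, every other would have at most two, fewer than [2 * k]
    tokens in all. The upper bound is the average of [2 * #|cls c l| + 1] over all classes. *)
Lemma balanced_sizes c k : (forall h, h \in H -> c h < k) -> 2 * k <= #|H| ->
    (forall i j, i < k -> j < k -> #|cls c i| <= 2 * #|cls c j| \/ #|cls c i| <= #|cls c j| + 1) ->
  forall i, i < k -> 2 <= #|cls c i| /\ #|cls c i| * k <= 2 * #|H| + k.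
Proof.
move=> ck kH bal i ik; have sz := size_cls ck; split.
  rewrite ltnNge; apply/negP => si; have : #|H| < 2 * k; last by rewrite ltnNge kH.
  rewrite sz (bigD1 (Ordinal ik)) //=.
  have : \sum_(l < k | l != Ordinal ik) #|cls c l| <= \sum_(l < k | l != Ordinal ik) 2.
    by apply: leq_sum => l _; have [] := bal l i (ltn_ord l) ik; move: si; move: #|_| #|_| => x y; lia.
  rewrite sum_nat_const cardC1 card_ord => h; apply: leq_ltn_trans (leq_add si h) _; lia.
have : \sum_(l < k) #|cls c i| <= \sum_(l < k) (2 * #|cls c l| + 1).
  by apply: leq_sum => l _; have [] := bal i l ik (ltn_ord l); move: #|_| #|_| => x y; lia.
by rewrite sum_nat_const card_ord big_split /= -big_distrr /= -sz sum_nat_const card_ord muln1 mulnC.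
Qed.

Lemma recolour c K g : proper_on c -> (forall h, h \in H -> c h < K) -> g \in H ->
  let c' := fun h => if h == g then K else c h in
  [/\ proper_on c', forall h, h \in H -> c' h < K.+1,
      forall l, l < K -> cls c' l = cls c l :\ g & cls c' K = [set g]].
Proof.
move=> pc ck gH c'; have ckN h : h \in H -> (K == c h) = false by move=> /ck; rewrite eq_sym; case: ltngtP.
split.
- move=> h h' hH hH'; rewrite /c'; case: (eqVneq h g) => [->|_]; case: (eqVneq h' g) => [->//|_] cc.
  + by have := ckN h' hH'; rewrite cc eqxx.
  + by have := ckN h hH; rewrite cc eqxx.
  + exact: pc.
- by move=> h hH; rewrite /c'; case: eqP => // _; apply: ltnW; rewrite ltnS ck.
- move=> l lK; apply/setP => h; rewrite !inE /c'; case: (eqVneq h g) => [->|//] /=.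
  by case: ltngtP lK; rewrite ?andbF.
- apply/setP => h; rewrite !inE /c'; case: (eqVneq h g) => [->|_]; first by rewrite gH eqxx.
  by case hH: (h \in H) => //=; rewrite eq_sym ckN.
Qed.

(** The odd classes are even in number and are treated two at a time: each gives up one token, and
    the two tokens form a new class. They can be chosen without a clash, since an odd class with at
    least two tokens has three, of which at most two clash with a given token. At most [k./2]
    colours are added. *)
Lemma even_classes k : ~~ odd #|H| -> 2 * k <= #|H| ->
    (forall x, #|[set g in H | a g == x]| <= k) -> (forall y, #|[set g in H | b g == y]| <= k) ->
  exists c : E -> nat, [/\ forall h, h \in H -> c h < k + k./2, proper_on c,
    forall i, ~~ odd #|cls c i| & forall i, #|cls c i| * k <= 2 * #|H| + k].
Proof.
have [->|k0] := posnP k.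
  move=> _ _ da _; exists (fun=> 0); have H0 h : h \in H = false.
    by apply/negP => hH; have := da (a h); rewrite leqn0 cards_eq0 => /eqP/setP/(_ h); rewrite !inE hH eqxx.
  by split=> [h|g h|i|i]; rewrite ?H0 ?muln0 // eq_card0 // => h; rewrite inE H0.
move=> Hev kH da db; have [c [ck pc bal]] := balanced k0 da db.
have sz := balanced_sizes ck kH bal; have szH := size_cls ck.
suff pairup m : forall K c, (forall h, h \in H -> c h < K) -> proper_on c ->
    (forall i, i < K -> 2 <= #|cls c i| /\ #|cls c i| * k <= 2 * #|H| + k) ->
    \sum_(i < K) odd #|cls c i| = 2 * m ->
    exists c : E -> nat, [/\ forall h, h \in H -> c h < K + m, proper_on c,
    forall i, ~~ odd #|cls c i| & forall i, #|cls c i| * k <= 2 * #|H| + k].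
  pose od := \sum_(i < k) odd #|cls c i|.
  have ode : od = 2 * od./2.
    rewrite mul2n even_halfK //; have : odd od = odd #|H|; last by move=> ->.
    rewrite szH /od; elim/big_rec2: _ => // i y1 y2 _; by rewrite !oddD => ->; rewrite ?oddb //; case: (odd #|_|).
  have [c' [ck' pc' ev' sz']] := pairup _ k c ck pc sz ode; exists c'; split=> // h hH.
  apply: leq_trans (ck' h hH) _; rewrite leq_add2l half_leq //.
  rewrite /od; apply: leq_trans (_ : \sum_(i < k) 1 <= _); last by rewrite sum_nat_const card_ord muln1.
  by apply: leq_sum => i _; case: (odd _).
clear c ck pc bal sz szH; elim: m => [|m IHm] K c ck pc sz odE.
  have ev0 (i : 'I_K) : ~~ odd #|cls c i|.
    by move: odE => /eqP; rewrite muln0 sum_nat_eq0 => /forallP/(_ i); case: (odd _).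
  have c0 i : K <= i -> #|cls c i| = 0.
    move=> Ki; rewrite eq_card0 // => h; rewrite inE; apply/negP => /andP[/ck + /eqP ci].
    by rewrite ci ltnNge Ki.
  exists c; split=> // [h hH|i|i]; first by rewrite addn0 ck.
    by have [iK|/c0->] := ltnP i K; [apply: (ev0 (Ordinal iK))|].
  by have [iK|/c0->] := ltnP i K; [have [] := sz i iK|].
have [i oi] : exists i : 'I_K, odd #|cls c i|.
  apply/existsP; apply: contraT => /existsPn no; move: odE; rewrite big1 // => i _.
  by rewrite (negPf (no i)).
have [j oj ij] : exists2 j : 'I_K, odd #|cls c j| & j != i.
  apply/exists_inP; apply: contraT; rewrite negb_exists_in => /forall_inP no; move: odE.
  rewrite (bigD1 i) //= oi big1 => [|j ji]; first by lia.
  by case oj: (odd _) => //; have := no j oj; rewrite ji.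
have si : 3 <= #|cls c i| by have [h _] := sz i (ltn_ord i); move: oi h; case: #|_| => [|[|[|x]]].
have sj : 3 <= #|cls c j| by have [h _] := sz j (ltn_ord j); move: oj h; case: #|_| => [|[|[|x]]].
have [g gi] : exists g, g \in cls c i by apply/card_gt0P; apply: leq_trans si.
have [h hj cl] : exists2 h, h \in cls c j & ~~ clash h g.
  have /subsetPn[h hj hb] : ~~ (cls c j \subset [set h in cls c j | clash h g]).
    by apply/negP => /subset_leq_card; rewrite leqNgt (leq_ltn_trans (clash_bound _ _ pc)) //.
  by exists h => //; move: hb; rewrite inE hj.
have gH : g \in H by move: gi; rewrite inE => /andP[].
have hH : h \in H by move: hj; rewrite inE => /andP[].
have cg : c g = i by move: gi; rewrite inE => /andP[_ /eqP].
have ch : c h = j by move: hj; rewrite inE => /andP[_ /eqP].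
have ijn : (j == i :> nat) = false by apply: negPf.
have gh : (h == g) = false by apply: contraNF ij => /eqP hg; rewrite -val_eqE /= -cg -ch hg.
have ckK x : x \in H -> (K == c x) = false by move=> /ck; rewrite eq_sym; case: ltngtP.
pose c' x := if (x == g) || (x == h) then K else c x.
have pc' : proper_on c'.
  have cK z : z \in H -> (c' z == K) = (z == g) || (z == h).
    by move=> zH; rewrite /c'; case: ifP => _; rewrite ?eqxx // eq_sym ckK.
  move=> x y xH yH cc cxy; have := cK y yH; rewrite -cc cK //.
  have [xgh /esym ygh|xn /esym yn] := boolP ((x == g) || (x == h)).
    case/orP: xgh => /eqP xe; case/orP: ygh => /eqP ye; rewrite xe ye // in cxy *.
      by move: cl; rewrite /clash [a h == _]eq_sym [b h == _]eq_sym -/(clash g h) cxy.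
    by move: cl; rewrite cxy.
  by apply: pc => //; move: cc; rewrite /c' (negPf xn) yn.
have c'l l : l < K -> cls c' l = cls c l :\ g :\ h.
  move=> lK; apply/setP => x; rewrite !inE /c'; case: (eqVneq x g) => [->|xg] /=.
    by rewrite andbF; case: ltngtP lK; rewrite ?andbF.
  case: (eqVneq x h) => [->|xh] //=.
  by case: ltngtP lK; rewrite ?andbF.
have c'K : cls c' K = [set g; h].
  apply/setP => x; rewrite !inE /c'; case: (eqVneq x g) => [->|xg] /=; first by rewrite gH eqxx.
  case: (eqVneq x h) => [->|xh] /=; first by rewrite hH eqxx.
  by case xH: (x \in H) => //=; rewrite eq_sym ckK.
have s'l l : l < K -> #|cls c' l| = #|cls c l| - (l == i) - (l == j).
  move=> lK; rewrite c'l //; have := cardsD1 g (cls c l); have := cardsD1 h (cls c l :\ g).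
  rewrite !inE gh gH hH cg ch /= ![_ == l]eq_sym; move: #|_| #|_| #|_| => x y z; lia.
rewrite addnS -addSn; apply: (IHm K.+1 c') => //.
- by move=> x xH; rewrite /c'; case: ifP => // _; apply: ltnW; rewrite ltnS ck.
- move=> l; rewrite ltnS leq_eqVlt => /orP[/eqP->|lK].
    by rewrite c'K cards2 eq_sym gh /=; lia.
  have [h1 h2] := sz l lK; rewrite s'l //; split.
    case: (eqVneq l i) => [->|li]; first by rewrite eq_sym ijn; move: si; move: #|_| => x; lia.
    by case: (eqVneq l j) => [->|lj]; [move: sj; move: #|_| => x; lia|rewrite !subn0].
  by apply: leq_trans h2; rewrite leq_mul2r -subnDA leq_subr orbT.
- rewrite big_ord_recr /= c'K cards2 eq_sym gh /= addn0.
  move: odE; rewrite (bigD1 i) //= (bigD1 j) //= oi oj [RHS]mulnS => odE.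
  have e1 : #|cls c' i| = #|cls c i| - 1 by rewrite s'l // eqxx (_ : (val i == j) = false) ?subn0 // eq_sym.
  have e2 : #|cls c' j| = #|cls c j| - 1 by rewrite s'l // eqxx ijn subn0.
  rewrite (bigD1 i) //= (bigD1 j) //= e1 e2 !oddB ?oi ?oj /=; try by apply: leq_trans si || apply: leq_trans sj.
  rewrite (eq_bigr (fun l : 'I_K => odd #|cls c l| : nat)) => [|l /andP[li lj]]; first by lia.
  by rewrite s'l // !val_eqE (negPf li) (negPf lj) !subn0.
Qed.

(** Tokens are split off into singleton classes until there are [D] classes, all odd. The invariant
    is that the number of classes plus the number of even ones is at most [D]. Splitting an even
    class keeps this sum. Splitting an odd one raises it by two, which is done only when no even
    class is left, and then parity provides the room. *)
Lemma odd_classes k D : odd #|H| = odd D -> D <= #|H| -> 2 * k <= D -> 0 < k ->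
    (forall x, #|[set g in H | a g == x]| <= k) -> (forall y, #|[set g in H | b g == y]| <= k) ->
  exists c : E -> nat, [/\ forall h, h \in H -> c h < D, proper_on c,
    forall i, i < D -> odd #|cls c i|, forall i, k <= i -> #|cls c i| <= 1 &
    forall i, #|cls c i| * k <= 2 * #|H| + k].
Proof.
move=> par DH kD k0 da db; have [c [ck pc bal]] := balanced k0 da db.
have sz := balanced_sizes ck (leq_trans kD DH) bal.
pose ev c K := \sum_(i < K) ~~ odd #|cls c i|.
have evpar c1 K : (forall h, h \in H -> c1 h < K) -> odd (K + ev c1 K) = odd #|H|.
  move=> ck1; rewrite (size_cls ck1) /ev -{1}[K]muln1 -{1}[K]card_ord -sum_nat_const -big_split /=.
  elim/big_rec2: _ => // i y1 y2 _; by rewrite !oddD => ->; rewrite ?oddb //; case: (odd #|_|).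
suff split m : forall K c, m = D - K -> (forall h, h \in H -> c h < K) -> proper_on c -> k <= K -> K + ev c K <= D ->
    (forall i, i < K -> 0 < #|cls c i|) -> (forall i, k <= i -> #|cls c i| <= 1) ->
    (forall i, #|cls c i| * k <= 2 * #|H| + k) ->
    exists c : E -> nat, [/\ forall h, h \in H -> c h < D, proper_on c,
    forall i, i < D -> odd #|cls c i|, forall i, k <= i -> #|cls c i| <= 1 &
    forall i, #|cls c i| * k <= 2 * #|H| + k].
  have c0 i : k <= i -> #|cls c i| = 0.
    move=> Ki; rewrite eq_card0 // => h; rewrite inE; apply/negP => /andP[/ck + /eqP ci].
    by rewrite ci ltnNge Ki.
  apply: (split _ k c erefl) => // [|i ik|i /c0->//|i].
  - apply: leq_trans kD; rewrite mul2n -addnn leq_add2l /ev.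
    apply: leq_trans (_ : \sum_(i < k) 1 <= _); last by rewrite sum_nat_const card_ord muln1.
    by apply: leq_sum => i _; case: (odd _).
  - by have [+ _] := sz i ik; apply: ltnW.
  - by have [iK|/c0->] := ltnP i k; [have [] := sz i iK|].
clear c ck pc bal sz; elim: m => [|m IHm] K c mE ck pc kK evD pos sing sz.
  have KD : K = D.
    by apply/eqP; rewrite eqn_leq (leq_trans (leq_addr _ _) evD) -subn_eq0 -mE.
  exists c; split=> // [h hH|i iD]; first by rewrite -KD ck.
  have : ev c K = 0 by move: evD; rewrite KD; lia.
  move/eqP; rewrite /ev sum_nat_eq0 KD => /forallP/(_ (Ordinal iD)) /=; by case: (odd _).
have [i [iK si evi]] : exists i, [/\ i < K, 2 <= #|cls c i| & odd #|cls c i| -> K + ev c K + 2 <= D].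
  have [/existsP[i oi]|/existsPn no] := boolP [exists i : 'I_K, ~~ odd #|cls c i|].
    exists i; split=> //; last by rewrite (negPf oi).
    by have := pos i (ltn_ord i); move: oi; case: #|_| => [|[|x]].
  have ev0 : ev c K = 0 by rewrite /ev big1 // => i _; have := no i; rewrite negbK => ->.
  have KD : K + 2 <= D.
    have := evpar c K ck; rewrite par ev0 addn0 => oK; have lt : K < D by lia.
    by rewrite addn2 ltn_neqAle lt andbT; apply/eqP => KD; move: oK; rewrite -KD /=; case: (odd K).
  have [i si] : exists i : 'I_K, 2 <= #|cls c i|.
    apply/existsP; apply: contraT => /existsPn small; have := leq_trans KD DH; rewrite (size_cls ck).
    have : \sum_(i < K) #|cls c i| <= \sum_(i < K) 1.
      by apply: leq_sum => i _; have := small i; rewrite -ltnNge.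
    by rewrite sum_nat_const card_ord muln1; move: (\sum_(_ < _) _) => x; lia.
  by exists i; split=> // _; rewrite ev0 addn0.
have ik : i < k by rewrite ltnNge; apply/negP => /sing; rewrite leqNgt si.
have [g gi] : exists g, g \in cls c i by apply/card_gt0P; apply: leq_trans si.
have gH : g \in H by move: gi; rewrite inE => /andP[].
have cg : c g = i by move: gi; rewrite inE => /andP[_ /eqP].
have [pc' ck' c'l c'K] := recolour pc ck gH; set c' := (fun h => _) in pc' ck' c'l c'K.
have s'l l : l < K -> #|cls c' l| = #|cls c l| - (l == i).
  move=> lK; rewrite c'l //; have := cardsD1 g (cls c l).
  rewrite !inE gH cg /= [_ == l]eq_sym; move: #|_| #|_| => x y; lia.
have c'0 l : K < l -> #|cls c' l| = 0.
  move=> Kl; rewrite eq_card0 // => h; rewrite inE; apply/negP => /andP[hH /eqP ci].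
  by have : c' h < K.+1 := ck' h hH; rewrite ci ltnNge Kl.
apply: (IHm K.+1 c') => //.
- by rewrite subnS -mE.
- exact: leqW.
- have e1 : \sum_(l < K | l != Ordinal iK) ~~ odd #|cls c' l| = \sum_(l < K | l != Ordinal iK) ~~ odd #|cls c l|.
    by apply: eq_bigr => l li; rewrite s'l // (_ : (val l == i) = false) ?subn0 //; apply: negPf.
  rewrite /ev big_ord_recr /= c'K cards1 addn0 (bigD1 (Ordinal iK)) //= s'l // eqxx oddB ?(ltnW si) // e1.
  move: evD evi; rewrite /ev (bigD1 (Ordinal iK)) //=.
  by move: (\sum_(_ < _ | _) _) => x; case: (odd #|_|) => /= h1; [move/(_ isT)|move=> _]; move: h1; clear; lia.
- move=> l; rewrite ltnS leq_eqVlt => /orP[/eqP->|lK]; first by rewrite c'K cards1.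
  rewrite s'l //; have := pos l lK; case: eqP => [->|_]; last by rewrite subn0.
  by move: si; move: #|_| => x; lia.
- move=> l kl; have [lK|] := ltnP l K; first by rewrite s'l // (leq_trans (leq_subr _ _)) // sing.
  by rewrite leq_eqVlt => /orP[/eqP<-|/c'0->//]; rewrite c'K cards1.
- move=> l; have [lK|] := ltnP l K.
    by apply: leq_trans (sz l); rewrite s'l // leq_mul2r leq_subr orbT.
  by rewrite leq_eqVlt => /orP[/eqP<-|/c'0->//]; rewrite c'K cards1 mul1n leq_addl.
Qed.

End Tokens.

(** * From designed colours to an edge colouring *)

Lemma sub_card (V : finType) (S : {set V}) k : k <= #|S| -> exists2 L : {set V}, L \subset S & #|L| = k.
Proof.
move=> kS; have [f [fI fS]] : exists f : 'I_k -> V, injective f /\ forall x, f x \in S.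
  by apply: inj_into; rewrite card_ord.
exists (f @: setT); first by apply/subsetP => _ /imsetP[i _ ->].
by rewrite card_imset // cardsT card_ord.
Qed.

(** A set of more than [kap] vertices sees all of [B], since an element of [B] is rejected by at
    most [kap]; a smaller non-empty set sees [#|A| - mu >= kap] elements through any one of its
    members. *)
Lemma dense_hall (V Y : finType) (q : V -> Y -> bool) (y0 : Y) (A : {set V}) (B : {set Y}) mu kap :
    #|A| = #|B| -> (forall w, w \in A -> #|[set i | ~~ q w i]| <= mu) ->
    (forall i, i \in B -> #|[set w | ~~ q w i]| <= kap) -> mu + kap <= #|A| ->
  exists f : V -> Y, [/\ {in A &, injective f}, f @: A = B & {in A, forall w, q w (f w)}].
Proof.
move=> cAB qA qB le.
have [|f [fB fI]] := @hall V Y q y0 A B.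
  move=> X XA; have [->|[w wX]] := set_0Vmem X; first by rewrite cards0.
  have [le1|lt1] := leqP #|X| kap.
    apply: leq_trans le1 _; have wA := subsetP XA w wX.
    have : B \subset [set y in B | [exists x in X, q x y]] :|: [set i | ~~ q w i].
      apply/subsetP => i iB; rewrite !inE iB /=; case qi: (q w i); rewrite ?orbT // orbF.
      by apply/existsP; exists w; rewrite wX.
    move/subset_leq_card/leq_trans/(_ (leq_card_setU _ _)); rewrite -cAB.
    move: (qA w wA) le; move: #|_| #|_| #|_| => x y z; lia.
  apply: leq_trans (subset_leq_card XA) _; rewrite cAB; apply: subset_leq_card; apply/subsetP => i iB.
  rewrite inE iB /=; apply: contraT; rewrite negb_exists_in => /forall_inP no.
  suff : #|X| <= kap by rewrite leqNgt lt1.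
  by apply: leq_trans (qB i iB); apply: subset_leq_card; apply/subsetP => x /no; rewrite inE.
exists f; split=> // [|w /fB/andP[]//].
apply/eqP; rewrite eqEcard card_in_imset // cAB leqnn andbT.
by apply/subsetP => _ /imsetP[w /fB/andP[fw _] ->].
Qed.

(** The vertices of [X] are treated in turn by [dense_hall]. Those treated before exclude at most
    [#|X|] further colours at a vertex and at most [#|X|] further vertices for a colour, which the
    bounds [mu] and [kap] include. *)
Lemma x_precolour (V Y : finType) (y0 : Y) (X : {set V}) (Fx : V -> {set V}) (Cx : V -> {set Y})
    (tok : V -> Y -> bool) mu kap :
    (forall x, x \in X -> #|Fx x| = #|Cx x|) ->
    (forall x w, x \in X -> w \in Fx x -> #|[set i | tok w i]| + #|X| <= mu) -> (forall i, #|[set w | tok w i]| + #|X| <= kap) ->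
    (forall x, x \in X -> mu + kap <= #|Fx x|) ->
  exists f : V -> V -> Y,
    [/\ forall x, x \in X -> {in Fx x &, injective (f x)},
        forall x, x \in X -> f x @: Fx x = Cx x,
        forall x w, x \in X -> w \in Fx x -> ~~ tok w (f x w) &
        forall x x' w, x \in X -> x' \in X -> w \in Fx x -> w \in Fx x' -> f x w = f x' w -> x = x'].
Proof.
move=> cF tw ti big.
pose P x (y : {set V} * (V -> Y)) := y.1 = (if x \in X then Fx x else set0) /\ (x \in X ->
  [/\ {in Fx x &, injective y.2}, y.2 @: Fx x = Cx x & forall w, w \in Fx x -> ~~ tok w (y.2 w)]).
pose C (y y' : {set V} * (V -> Y)) := forall w, w \in y.1 -> w \in y'.1 -> y.2 w <> y'.2 w.
have [|F [FP FC]] := @sequential V _ (set0, fun=> y0) P C; last first.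
  exists (fun x => (F x).2); split=> [x xX|x xX|x w xX wF|x x' w xX xX' wF wF'].
  - by have [_ /(_ xX)[]] := FP x.
  - by have [_ /(_ xX)[]] := FP x.
  - by have [_ /(_ xX)[_ _ ->]] := FP x.
  - move=> ff; apply/eqP; apply: contraT => xx; case: (FC _ _ xx w) => //.
      by have [-> _] := FP x; rewrite xX.
    by have [-> _] := FP x'; rewrite xX'.
move=> x s F us xs FP FC; have [xX|xX] := boolP (x \in X); last first.
  exists (set0, fun=> y0); first by rewrite /P (negPf xX).
  by move=> k _; split=> w; rewrite inE.
pose used w i := [exists k, [&& k \in s, w \in (F k).1 & (F k).2 w == i]].
have FX k w : k \in s -> w \in (F k).1 -> (k \in X) && (w \in Fx k).
  by move=> /FP[-> _]; case: (k \in X) => //; rewrite inE.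
have [|i _||f [fI fC fq]] := @dense_hall V Y (fun w i => ~~ (tok w i || used w i)) y0 (Fx x) (Cx x) mu kap (cF x xX).
- move=> w wF; apply: leq_trans (tw x w xX wF).
  apply: leq_trans (_ : #|[set i | tok w i] :|: [set i | used w i]| <= _).
    by apply: subset_leq_card; apply/subsetP => i; rewrite !inE negbK.
  apply: leq_trans (leq_card_setU _ _) (leq_add (leqnn _) _).
  apply: (@card_le_rel _ _ _ _ (fun k i => (F k).2 w == i)).
    move=> i; rewrite inE => /existsP[k /and3P[ks wk ik]]; exists k => //.
    by have /andP[] := FX k w ks wk.
  by move=> k i i' /eqP<- /eqP<-.
- apply: leq_trans (ti i).
  apply: leq_trans (_ : #|[set w | tok w i] :|: [set w | used w i]| <= _).
    by apply: subset_leq_card; apply/subsetP => w; rewrite !inE negbK.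
  apply: leq_trans (leq_card_setU _ _) (leq_add (leqnn _) _).
  apply: (@card_le_rel _ _ _ _ (fun k w => [&& k \in s, w \in (F k).1 & (F k).2 w == i])).
    move=> w; rewrite inE => /existsP[k h]; exists k => //.
    by have /and3P[ks wk _] := h; have /andP[] := FX k w ks wk.
  move=> k w w' /and3P[ks wk /eqP e1] /and3P[_ wk' /eqP e2].
  have /andP[kX wF] := FX k w ks wk; have /andP[_ wF'] := FX k w' ks wk'.
  by have [_ /(_ kX)[inj _ _]] := FP k ks; apply: inj; rewrite ?e1.
- exact: big.
exists (Fx x, f).
  split; first by rewrite xX.
  by move=> _; split=> // w wF; have := fq w wF; rewrite negb_or => /andP[].
move=> k ks; split=> w /= w1 w2 ff.
- have := fq w w2; rewrite negb_or => /andP[_ /existsPn/(_ k)]; by rewrite ks w1 ff eqxx.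
- have := fq w w1; rewrite negb_or => /andP[_ /existsPn/(_ k)]; by rewrite ks w2 ff eqxx.
Qed.

(** The greedy colouring of the edges inside [X], each meeting at most [2 * #|X|] edges; the cap on
    class sizes is set to the number of all these edges and so does not bind. *)
Lemma xx_colouring (V : finType) (e : rel V) (X : {set V}) D (forb : V -> nat -> bool) :
    symmetric e -> irreflexive e ->
    (forall x x', x \in X -> x' \in X -> e x x' ->
       #|[set i : 'I_D | forb x i || forb x' i]| + 2 * #|X| < D) ->
  exists cx : V -> V -> nat,
    (forall x x', x \in X -> x' \in X -> e x x' -> [/\ cx x x' = cx x' x, cx x x' < D & ~~ forb x (cx x x')]) /\
    (forall x x' x'', x \in X -> x' \in X -> x'' \in X -> e x x' -> e x x'' -> cx x x' = cx x x'' -> x' = x'').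
Proof.
move=> es ei free; pose F := half e X.
have FP p : p \in F -> [/\ p.1 \in X, p.2 \in X, e p.1 p.2 & enum_rank p.1 < enum_rank p.2].
  by rewrite inE => /and4P[].
pose quad (p : V * V) := [:: p.1; p.2].
pose cf : rel (V * V) := fun p h => has (mem (quad p)) (quad h).
pose fb (p : V * V) i := forb p.1 i || forb p.2 i.
have degX x : x \in X -> #|[set h in F | x \in quad h]| <= #|X|.
  move=> xX; apply: (@card_le_rel _ _ _ _ (fun v h => (h \in F) && ((h == (x, v)) || (h == (v, x))))).
    move=> h; rewrite in_set => /andP[hF]; rewrite hF !inE; have [h1 h2 _ _] := FP h hF.
    by case/orP=> /eqP->; [exists h.2|exists h.1]; rewrite // -surjective_pairing eqxx ?orbT.
  move=> v h h' /andP[hF e1] /andP[hF' e2]; have [_ _ _ r1] := FP h hF; have [_ _ _ r2] := FP h' hF'.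
  case/orP: e1 => /eqP e1; case/orP: e2 => /eqP e2; rewrite e1 e2 /= in r1 r2 *; rewrite // ltnNge ltnW // in r1.
have [p pF||p h|c [cD cC _]] := @greedy_coloring (V * V)%type F cf fb D #|F| D.-1.
- have [p1 p2 ep _] := FP p pF; have := free _ _ p1 p2 ep; set n := #|[set i | _]|.
  have : #|[set h in F | cf p h]| <= 2 * #|X|.
    apply: leq_trans (_ : #|[set h in F | p.1 \in quad h] :|: [set h in F | p.2 \in quad h]| <= _).
      apply: subset_leq_card; apply/subsetP => h; rewrite in_setU !in_set /cf has_sym => /andP[-> /hasP[x xp xh]] /=.
      by rewrite !inE in xp; case/orP: xp => /eqP xE; rewrite -xE xh ?orbT.
    by apply: leq_trans (leq_card_setU _ _) _; rewrite mul2n -addnn leq_add ?degX.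
  by rewrite /n /fb; move: #|_| #|_| #|_| => a b d; lia.
- have [->|[p pF]] := set_0Vmem F; first by rewrite cards0.
  have [p1 p2 ep _] := FP p pF; have := free _ _ p1 p2 ep; case: D {free} => // D _.
  by rewrite subSnn mul1n.
- by rewrite /cf has_sym.
pose cx x x' := if enum_rank x < enum_rank x' then c (x, x') else c (x', x).
have cxP x x' : x \in X -> x' \in X -> e x x' -> exists2 p, p \in F & [/\ cx x x' = c p, cx x' x = c p & (p = (x, x')) \/ (p = (x', x))].
  move=> xX xX' exx; rewrite /cx; case: ltngtP => h.
  - by exists (x, x'); [rewrite inE /= xX xX' exx|split=> //; left].
  - by exists (x', x); [rewrite inE /= xX xX' es exx|split=> //; right].
  - by move: exx; rewrite (enum_rank_inj (ord_inj h)) ei.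
exists cx; split=> [x x' xX xX' exx|x x' x'' xX xX' xX'' e1 e2 cc].
  have [p pF [c1 c2 pE]] := cxP x x' xX xX' exx; have [cpD nf] := cD p pF; rewrite c1 c2; split=> //.
  by move: nf; rewrite /fb negb_or; case: pE => -> /= /andP[].
have [p pF [c1 _ pE]] := cxP x x' xX xX' e1; have [h hF [c2 _ hE]] := cxP x x'' xX xX'' e2.
have ph : p = h.
  apply/eqP; apply: contraT => ph; have := cC p h pF hF ph; rewrite -c1 -c2 cc eqxx => H; apply/H/hasP.
  by exists x; [case: hE => ->|case: pE => ->]; rewrite /= !inE eqxx ?orbT.
by rewrite ph in pE; case: pE hE => -> [] [] // -> ->.
Qed.

Lemma card_ltn_ord D m : m <= D -> #|[set k : 'I_D | k < m]| = m.
Proof.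
move=> mD; have inj : injective (widen_ord mD) by move=> i j /(congr1 val) /= /ord_inj.
rewrite -[RHS](card_ord m) -cardsT -(card_imset _ inj).
apply: eq_card => k; rewrite inE; apply/idP/imsetP => [km|[i _ ->]]; last by apply: (ltn_ord i).
by exists (Ordinal km); rewrite ?inE //; apply: ord_inj.
Qed.

Lemma sum_card_exchange (X Y : finType) (S : {set X}) (Z : {set Y}) (P : X -> Y -> bool) :
  \sum_(x in S) #|[set y in Z | P x y]| = \sum_(y in Z) #|[set x in S | P x y]|.
Proof.
under eq_bigr do rewrite card_set_sum; under [RHS]eq_bigr do rewrite card_set_sum.
exact: exchange_big.
Qed.

Lemma inner_sum (V : finType) (e : rel V) (A : {set V}) :
  inner e A = \sum_(w in A) #|[set v in A | e w v]|.
Proof.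
rewrite /inner -sum1_card; under [RHS]eq_bigr do rewrite card_set_sum.
rewrite pair_big_dep /= big_mkcond [RHS]big_mkcond; apply: eq_bigr => -[w v] _; rewrite inE /=.
by case: (w \in A); case: (v \in A); case: (e w v).
Qed.

(** The two-sided companion of [card_le_rel]. *)
Lemma card_image_eq (X Y : finType) (S : {set X}) (Z : {set Y}) (F : X -> Y -> bool) :
    (forall x, x \in S -> exists2 y, y \in Z & F x y) -> (forall y, y \in Z -> exists2 x, x \in S & F x y) ->
    {in S &, forall x x', forall y, y \in Z -> F x y -> F x' y -> x = x'} ->
    {in Z &, forall y y', forall x, x \in S -> F x y -> F x y' -> y = y'} -> #|S| = #|Z|.
Proof.
move=> SZ ZS inS inZ; apply/eqP; rewrite eqn_leq; apply/andP; split.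
  apply: (@card_le_rel _ _ _ _ (fun y x => [&& x \in S, y \in Z & F x y])).
    by move=> x xS; have [y yZ Fxy] := SZ x xS; exists y; rewrite // xS yZ.
  by move=> y x x' /and3P[h1 h2 h3] /and3P[h4 h5 h6]; apply: inS h3 h6.
apply: (@card_le_rel _ _ _ _ (fun x y => [&& x \in S, y \in Z & F x y])).
  by move=> x xS; have [y yZ Fxy] := ZS x xS; exists y; rewrite // xS yZ.
by move=> y x x' /and3P[h1 h2 h3] /and3P[h4 h5 h6]; apply: inZ h3 h6.
Qed.

(** * Putting designed colours, tokens and the final bipartite colouring together *)

Section Assembly.
Variables (V Ic : finType) (e : rel V) (D r g kap mu : nat) (U X A B : {set V}).
Let E := (V * (V + 'I_D))%type.
Variables (c : E -> nat) (S : {set 'I_D}).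

Definition nb w := [set v | e w v].
Variables (N W : {set V}) (H : {set E}).

(* [inl u] stands for the edge to [u], the [inr k] for the missing edges. *)
Definition tokens (W0 : {set V}) : {set E} := [set h : E | (h.1 \in W0) && match h.2 with
  inl u => (u \in U) && e h.1 u | inr k => k < D - #|nb h.1| end].
Lemma tokens_at (W0 : {set V}) w : #|nb w| <= D -> w \in W0 ->
  #|[set h in tokens W0 | h.1 == w]| = #|nb w :&: U| + (D - #|nb w|).
Proof.
move=> dw wW.
have -> : [set h in tokens W0 | h.1 == w] = [set (w, inl u : V + 'I_D) | u in nb w :&: U] :|:
    [set (w, inr k : V + 'I_D) | k in [set k : 'I_D | k < D - #|nb w|]].
  apply/setP => -[w' x]; rewrite in_set in_setU; apply/andP/orP => [[+ /eqP/= wE]|].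
    rewrite wE inE /= wW /=; case: x => [u /andP[uU ewu]|k kD]; [left|right].
      by apply/imsetP; exists u; rewrite // !inE ewu.
    by apply/imsetP; exists k; rewrite ?inE.
  case=> /imsetP[x'] + [-> ->]; rewrite !inE => h.
    by rewrite /= wW eqxx /= andbC.
  by rewrite /= wW eqxx /= h.
rewrite card_disjointU; last first.
  by apply: disjointI => h /imsetP[u _ ->] /imsetP[k _].
by rewrite !card_imset ?card_ltn_ord ?leq_subr // => ? ? [->].
Qed.

(* Tokens of missing edges have private second ends and so never clash there. *)
Definition token_end (h : E) : V + E := match h.2 with inl u => inl u | inr _ => inr h end.
Definition tk (H0 : {set E}) w (i : 'I_D) := [exists h in H0, (h.1 == w) && (c h == i)].
Let tkH := tk H.
Hypotheses (NE : N = A :|: B) (WE : W = N :|: X) (HE : H = tokens W).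

Hypotheses (es : symmetric e) (ei : irreflexive e).
Hypotheses (dAB : [disjoint A & B]) (dNX : [disjoint N & X]) (dWU : [disjoint W & U]) (WU : W :|: U = setT).
Hypothesis dD : forall w, #|nb w| <= D.
Hypothesis Uind : forall u v, u \in U -> v \in U -> ~~ e u v.
Hypotheses (cD : forall h, h \in H -> c h < D) (cp : proper_on fst token_end H c).
Hypothesis par : forall i : 'I_D, i \notin S -> ~~ odd (#|W| + #|cls H c i|).
Hypotheses (cS : #|S| = r) (cIc : D = r + #|Ic|).
Hypothesis res : forall h i, h \in H -> i \in S -> c h = i -> h.1 \in A :|: X.
Hypothesis cres : #|[set h in H | [exists i in S, c h == i]]| = r * g.
Hypothesis cAB : #|A| + #|X| = #|B| + g.
Hypothesis free : forall x x', x \in X -> x' \in X -> e x x' ->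
  #|[set i | [|| i \in S, tkH x i | tkH x' i]]| + 2 * #|X| < D.
Hypothesis rB : forall x, x \in X -> r <= #|nb x :&: B|.
Hypothesis big : forall x, x \in X -> mu + kap + r <= #|nb x :&: N|.
Hypothesis muP : forall w, w \in N -> #|[set i | tkH w i]| + #|X| <= mu.
Hypothesis kapP : forall i : 'I_D, #|cls H c i| + #|X| <= kap.
Hypothesis core : forall Bad : Ic -> {set V}, (forall j, #|Bad j| <= kap) ->
  (forall w, #|[set j | w \in Bad j]| <= mu) -> (forall j, ~~ odd #|N :\: Bad j|) ->
  inner e A + \sum_j #|B :\: Bad j| = inner e B + \sum_j #|A :\: Bad j| ->
  exists M : Ic -> rel V, [/\ forall j, pmatch (N :\: Bad j) (M j), forall j, subrel (M j) e,
    forall j k w v, M j w v -> M k w v -> j = k &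
    forall w v, same_side A B w v -> e w v -> exists j, M j w v].

Let tkP w (i : 'I_D) : reflect (exists2 h, h \in H & h.1 = w /\ c h = i) (tkH w i).
Proof.
apply: (iffP existsP) => [[h /and3P[hH /eqP h1 /eqP ch]]|[h hH [h1 ch]]]; exists h => //.
by rewrite hH h1 ch !eqxx.
Qed.

Let t w := #|[set i | tkH w i]|.
Let s w := #|[set i in S | tkH w i]|.

Let WP w : (w \in W) = [|| w \in A, w \in B | w \in X].
Proof. by rewrite WE NE !inE orbA. Qed.

Let nAB x : x \in A -> x \in B = false. Proof. by move=> xA; rewrite (disjointFr dAB xA). Qed.
Let nNX x : x \in N -> x \in X = false. Proof. by move=> xA; rewrite (disjointFr dNX xA). Qed.
Let nWU x : x \in W -> x \in U = false. Proof. by move=> xA; rewrite (disjointFr dWU xA). Qed.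
Let NW x : x \in N -> x \in W. Proof. by move=> xN; rewrite WE inE xN. Qed.
Let XW x : x \in X -> x \in W. Proof. by move=> xN; rewrite WE inE xN orbT. Qed.
Let AN x : x \in A -> x \in N. Proof. by move=> xN; rewrite NE inE xN. Qed.
Let BN x : x \in B -> x \in N. Proof. by move=> xN; rewrite NE inE xN orbT. Qed.
Let nW_U x : x \notin W -> x \in U.
Proof. by move/setP: WU => /(_ x); rewrite inE [RHS]inE => /orP[->|]. Qed.

Let tok_inj h h' : h \in H -> h' \in H -> h.1 = h'.1 -> c h = c h' -> h = h'.
Proof. by move=> hH hH' h1 cc; apply: cp => //; rewrite /clash h1 eqxx. Qed.

Let Uc x : (x \in U) = ~~ ((x \in N) || (x \in X)).
Proof.
have -> : (x \in N) || (x \in X) = (x \in W) by rewrite WE in_setU.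
by case xW: (x \in W) => /=; [rewrite nWU|apply: nW_U; rewrite xW].
Qed.

Let HW h : h \in H -> h.1 \in W. Proof. by rewrite HE in_set => /andP[]. Qed.

Let degree w : w \in W -> t w + (#|nb w :&: N| + #|nb w :&: X|) = D.
Proof.
move=> wW; have dw := dD w.
have -> : t w = #|nb w :&: U| + (D - #|nb w|).
  have -> : t w = #|[set h in H | h.1 == w]|.
    apply: (@card_image_eq _ _ _ _ (fun (i : 'I_D) (h : E) => c h == i)).
    - move=> i; rewrite inE => /tkP[h hH [h1 ch]]; exists h; last exact/eqP.
      by rewrite inE hH h1 eqxx.
    - move=> h; rewrite inE => /andP[hH /eqP h1]; exists (Ordinal (cD hH)); last by rewrite /=.
      by rewrite inE; apply/tkP; exists h.
    - by move=> i i' _ _ h _ /eqP h1 /eqP h2; apply: ord_inj; rewrite -h1.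
    - move=> h h'; rewrite !inE => /andP[hH /eqP h1] /andP[hH' /eqP h2] i _ /eqP c1 /eqP c2.
      by apply: tok_inj; rewrite ?h1 ?h2 ?c1 ?c2.
  by rewrite HE tokens_at.
have : #|nb w| = #|nb w :&: U| + (#|nb w :&: N| + #|nb w :&: X|).
  rewrite -(cardsID U) -(cardsID N (nb w :\: U)); congr (_ + (_ + _)); apply: eq_card => x;
    rewrite !(in_setI, in_setD) Uc negbK; case: (x \in nb w); rewrite ?andbF ?andbT //=.
    by case: (x \in N); rewrite ?andbT ?andbF.
  by case xN: (x \in N); rewrite //= nNX.
lia.
Qed.

Let s_le x : s x <= r.
Proof. by rewrite -cS; apply: subset_leq_card; apply/subsetP => i; rewrite inE => /andP[]. Qed.

Let sB w : w \in B -> s w = 0.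
Proof.
move=> wB; apply: eq_card0 => i; rewrite inE; apply/negP => /andP[iS /tkP[h hH [h1 ch]]].
have := res hH iS ch; rewrite h1 in_setU (nNX (BN wB)) orbF => wA.
by rewrite (nAB wA) in wB.
Qed.

Let s_total : \sum_(w in A) s w + \sum_(x in X) s x = r * g.
Proof.
rewrite -cres; move HSE : [set h in H | _] => HS.
have HSP h : h \in HS -> [/\ h \in H, h.1 \in W & exists2 i, i \in S & c h = i].
  rewrite -HSE in_set => /andP[hH /existsP[i /andP[iS /eqP ch]]]; split=> //; last by exists i.
  exact: HW.
have sE w : s w = #|[set h in HS | h.1 == w]|.
  apply: (@card_image_eq _ _ _ _ (fun (i : 'I_D) (h : E) => c h == i)).
  - move=> i; rewrite inE => /andP[iS /tkP[h hH [h1 ch]]]; exists h; last exact/eqP.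
    by rewrite in_set -HSE in_set hH h1 eqxx andbT /=; apply/existsP; exists i; rewrite iS ch eqxx.
  - move=> h; rewrite in_set => /andP[/HSP[hH _ [i iS ch]] /eqP h1]; exists i; last exact/eqP.
    by rewrite inE iS; apply/tkP; exists h.
  - by move=> i i' _ _ h _ /eqP h1 /eqP h2; apply: ord_inj; rewrite -h1.
  - move=> h h'; rewrite !in_set => /andP[/HSP[hH _ _] /eqP h1] /andP[/HSP[hH' _ _] /eqP h2] i _ /eqP c1 /eqP c2.
    by apply: tok_inj; rewrite ?h1 ?h2 ?c1 ?c2.
have -> : \sum_(w in A) s w + \sum_(x in X) s x = \sum_(w in A :|: X) s w.
  rewrite [RHS](bigID (fun w => w \in A)) /=; congr (_ + _); apply: eq_bigl => w; rewrite in_setU.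
    by case: (w \in A); rewrite ?andbT ?andbF.
  by case wA: (w \in A) => //=; rewrite ?andbF ?andbT // (nNX (AN wA)).
under eq_bigr do rewrite sE card_set_sum; rewrite exchange_big /= -sum1_card; apply: eq_bigr => h.
move=> /HSP[hH hW [i iS ch]]; have h1 := res hH iS ch.
by rewrite (bigD1 h.1) //= eqxx big1 // => w /andP[_ /negPf]; rewrite eq_sym => ->.
Qed.

(** [S] is the set of colours kept for Koenig's theorem, [Ic] indexes the designed ones. In the
    designed colours the tokens, the edges inside [X] and most edges from [X] to [N] are coloured
    first; the vertices of [N] they occupy form the sets [Bad j], and [core] supplies the rest of
    each colour. The edges still uncovered join [A :|: X] to [B :|: U], with at most [r] at each
    vertex. *)
Theorem assembly : exists K : 'I_D -> rel V,
  [/\ forall i, symmetric (K i), forall i w v v', K i w v -> K i w v' -> v = v' &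
      forall w v, e w v -> exists i, K i w v].
Proof.
have [D0|y0] := posnP D.
  exists (fun _ _ _ => false); split=> // w v ewv; have := dD w; rewrite D0 leqn0 cards_eq0.
  by move/eqP/setP/(_ v); rewrite !inE ewv.
pose i0 := Ordinal y0.
pose forbx x k := [exists i : 'I_D, (val i == k) && ((i \in S) || tkH x i)].
have [|cx [cxP cxI]] := @xx_colouring V e X D forbx es ei.
  move=> x x' xX xX' exx; apply: leq_ltn_trans (free xX xX' exx); rewrite leq_add2r.
  apply: subset_leq_card; apply/subsetP => i; rewrite !inE.
  case/orP=> /existsP[j /andP[/eqP/ord_inj-> /orP[->|->]]]; by rewrite ?orbT.
(* The edges to [L x] are left for the colours of [S]. Together with the [s x] tokens of these
   colours they fill all [r] of them at [x], so the other edges from [x] to [N] are exactly as many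
   as the designed colours still free at [x] ([cardFC]). *)
have /fin_all_exists[L LP] : forall x, exists L : {set V}, x \in X -> L \subset nb x :&: B /\ #|L| = r - s x.
  move=> x; have [xX|xX] := boolP (x \in X); last by exists set0.
  have [L LB cL] : exists2 L : {set V}, L \subset nb x :&: B & #|L| = r - s x.
    by apply: sub_card; apply: leq_trans (rB xX); apply: leq_subr.
  by exists L.
have LN x : x \in X -> L x \subset nb x :&: N.
  by move=> /LP[sub _]; apply: subset_trans sub _; apply: setIS; rewrite NE; apply: subsetUr.
have [Fx FxE] : exists F : V -> {set V}, forall x, F x = (nb x :&: N) :\: L x by exists (fun x => (nb x :&: N) :\: L x).
pose xxc x (i : 'I_D) := [exists x' in X, e x x' && (cx x x' == i)].
have [Cx CxE] : exists F : V -> {set 'I_D}, forall x, F x = [set i | [&& i \notin S, ~~ tkH x i & ~~ xxc x i]].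
  by exists (fun x => [set i | [&& i \notin S, ~~ tkH x i & ~~ xxc x i]]).
have CxP x i : (i \in Cx x) = [&& i \notin S, ~~ tkH x i & ~~ xxc x i] by rewrite CxE in_set.
have FxP x w : x \in X -> w \in Fx x -> [/\ w \in N, e x w & w \notin L x].
  by move=> xX; rewrite FxE in_setD in_setI in_set => /and3P[h1 h2 h3]; split.
have cardFx x : x \in X -> #|Fx x| + (r - s x) = #|nb x :&: N|.
  by move=> xX; have [_ <-] := LP x xX; rewrite [RHS](card_split (LN x xX)) addnC FxE.
have xxcP x i : x \in X -> xxc x i -> (i \notin S) && ~~ tkH x i.
  move=> xX /existsP[x' /and3P[xX' exx /eqP ci]]; have [_ _ /existsPn/(_ i)] := cxP x x' xX xX' exx.
  by rewrite ci eqxx /= negb_or.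
have cxx x : x \in X -> #|[set i | xxc x i]| = #|nb x :&: X|.
  move=> xX; apply: (@card_image_eq _ _ _ _ (fun (i : 'I_D) x' => cx x x' == i)).
  - by move=> i; rewrite in_set => /existsP[x' /and3P[xX' exx ci]]; exists x'; rewrite // !inE exx.
  - move=> x'; rewrite !inE => /andP[exx xX']; have [_ cD' _] := cxP x x' xX xX' exx.
    by exists (Ordinal cD') => //; rewrite in_set; apply/existsP; exists x'; rewrite xX' exx /=.
  - by move=> i i' _ _ h _ /eqP h1 /eqP h2; apply: ord_inj; rewrite -h1.
  - move=> x' x''; rewrite !inE => /andP[e1 x1] /andP[e2 x2] i _ /eqP c1 /eqP c2.
    by apply: (cxI x) => //; rewrite c1 c2.
have cardFC x : x \in X -> #|Fx x| = #|Cx x|.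
  move=> xX; have := degree (XW xX); rewrite -(cxx x xX) -(cardFx x xX).
  have : #|~: Cx x| + #|Cx x| = D by rewrite addnC cardsC card_ord.
  have -> : ~: Cx x = S :|: [set i | tkH x i] :|: [set i | xxc x i].
    by apply/setP => i; rewrite !inE CxP !negb_and !negbK orbA.
  rewrite card_disjointU; last first.
    apply: disjointI => i; rewrite in_setU in_set => + h; rewrite in_set in h.
    by have /andP[/negPf-> /negPf->] := xxcP x i xX h.
  rewrite cardsU cS (_ : #|[set i | tkH x i]| = t x) //; have -> : #|S :&: [set i | tkH x i]| = s x.
    by apply: eq_card => i; rewrite !inE.
  have : s x <= t x by apply: subset_leq_card; apply/subsetP => i; rewrite !inE => /andP[].
  have := s_le x; move: (t x) (s x) #|Fx x| #|Cx x| #|[set i | xxc x i]| => y1 y2 y3 y4 y5; lia.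
have [|||f [fI fC ftk fX]] := @x_precolour V 'I_D i0 X Fx Cx tkH mu kap cardFC.
- by move=> x w xX /(FxP x w xX)[wN _ _]; apply: muP.
- move=> i; apply: leq_trans (kapP i); rewrite leq_add2r.
  apply: (@card_le_rel _ _ _ _ (fun (h : E) w => h.1 == w)).
    by move=> w; rewrite in_set => /tkP[h hH [h1 ch]]; exists h; rewrite ?h1 // inE hH ch eqxx.
  by move=> h w w' /eqP<- /eqP<-.
- by move=> x xX; have := big xX; rewrite -(cardFx x xX); have := s_le x; move: #|_| => y; lia.
have cSc : #|~: S| = #|Ic|.
  by have := cardsC S; rewrite card_ord cS => h; apply/eqP; rewrite -(eqn_add2l r) h -cIc.
have [io [ioI ioS]] : exists io : Ic -> 'I_D, injective io /\ forall j, io j \in ~: S.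
  by apply: inj_into; rewrite cSc.
have ioE i : i \notin S -> exists j, io j = i.
  move=> iS; have : io @: setT = ~: S.
    apply/eqP; rewrite eqEcard card_imset // cardsT; apply/andP; split.
      by apply/subsetP => _ /imsetP[j _ ->].
    by rewrite cSc.
  by move/setP/(_ i); rewrite [RHS]inE iS => /imsetP[j _ ->]; exists j.
have ioN j : io j \notin S by have := ioS j; rewrite inE.
pose ff w i := [exists x in X, (w \in Fx x) && (f x w == i)].
have ffP w i : ff w i -> exists x, [/\ x \in X, w \in Fx x & f x w = i].
  by case/existsP=> x /and3P[xX wF /eqP fi]; exists x.
have fCx x w : x \in X -> w \in Fx x -> f x w \in Cx x.
  by move=> xX wF; rewrite -(fC x xX) imset_f.
have [Bad BadE] : exists F : Ic -> {set V}, forall j, F j = [set w in N | tkH w (io j) || ff w (io j)].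
  by exists (fun j => [set w in N | tkH w (io j) || ff w (io j)]).
have BadP j w : w \in N -> (w \in Bad j) = tkH w (io j) || ff w (io j).
  by move=> wN; rewrite BadE in_set wN.
have cff w : w \in N -> #|[set j | ff w (io j)]| = #|[set x in X | w \in Fx x]|.
  move=> wN; apply: (@card_image_eq _ _ _ _ (fun j x => f x w == io j)).
  - by move=> j; rewrite in_set => /ffP[x [xX wF fi]]; exists x; rewrite ?inE ?xX //; apply/eqP.
  - move=> x; rewrite inE => /andP[xX wF]; have := fCx x w xX wF; rewrite CxP => /andP[/ioE[j jE] _].
    by exists j; rewrite ?jE // in_set; apply/existsP; exists x; rewrite xX wF jE eqxx.
  - by move=> j j' _ _ x _ /eqP h1 /eqP h2; apply: ioI; rewrite -h1.
  - move=> x x'; rewrite !inE => /andP[xX wF] /andP[xX' wF'] j _ /eqP h1 /eqP h2.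
    by apply: (fX x x' w) => //; rewrite h1.
have ctk w : #|[set j | tkH w (io j)]| + s w = t w.
  rewrite -(card_imset _ ioI) /s /t -card_disjointU; last first.
    by apply: disjointI => _ /imsetP[j _ ->]; rewrite inE (negPf (ioN j)).
  apply: eq_card => i; rewrite in_setU !in_set; apply/orP/idP => [[/imsetP[j + ->]|/andP[]//]|tki].
    by rewrite inE.
  have [iS|/ioE[j jE]] := boolP (i \in S); [by right|left].
  by apply/imsetP; exists j; rewrite ?inE jE.
have bad_count w : w \in N -> #|[set j | w \in Bad j]| + s w = t w + #|[set x in X | w \in Fx x]|.
  move=> wN; rewrite -(ctk w) -(cff w wN).
  have -> : [set j | w \in Bad j] = [set j | tkH w (io j)] :|: [set j | ff w (io j)].
    by apply/setP => j; rewrite in_setU !in_set BadP.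
  rewrite card_disjointU; last first.
    apply: disjointI => j; rewrite !in_set => h /ffP[x [xX wF fi]].
    by have := ftk x w xX wF; rewrite fi h.
  by rewrite addnAC.
have BadN w j : w \notin N -> (w \in Bad j) = false by move=> /negPf wN; rewrite BadE in_set wN.
have [||||M [pmM Me Md Mall]] := core (Bad := Bad).
- move=> j; apply: leq_trans (kapP (io j)); apply: leq_trans (_ : #|[set w | tkH w (io j)] :|: [set w | ff w (io j)]| <= _).
    by apply: subset_leq_card; apply/subsetP => w; rewrite BadE in_setU !in_set => /andP[_].
  apply: leq_trans (leq_card_setU _ _) (leq_add _ _).
    apply: (@card_le_rel _ _ _ _ (fun (h : E) w => h.1 == w)).
      by move=> w; rewrite in_set => /tkP[h hH [h1 ch]]; exists h; rewrite ?h1 // inE hH ch eqxx.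
    by move=> h w w' /eqP<- /eqP<-.
  apply: (@card_le_rel _ _ _ _ (fun x w => [&& x \in X, w \in Fx x & f x w == io j])).
    by move=> w; rewrite in_set => /ffP[x [xX wF fi]]; exists x; rewrite // xX wF fi eqxx.
  by move=> x w w' /and3P[xX wF /eqP h1] /and3P[_ wF' /eqP h2]; apply: (fI x) => //; rewrite h1.
- move=> w; have [wN|wN] := boolP (w \in N); last by rewrite eq_card0 // => j; rewrite inE BadN.
  apply: leq_trans (muP wN); rewrite -/(t w); apply: leq_trans (leq_addr (s w) _) _; rewrite bad_count //.
  by rewrite leq_add2l; apply: subset_leq_card; apply/subsetP => x; rewrite inE => /andP[].
(* Parity comes from [par]: the vertices of [X] without a token of colour [i] are either matched
   among themselves ([XQ], even) or in bijection with the vertices of [N] that [ff] puts into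
   [Bad j] ([XF]). *)
- move=> j; move iE : (io j) => i; move TWE : [set w | tkH w i] => TW.
  have TWW : TW \subset W.
    by apply/subsetP => w; rewrite -TWE in_set => /tkP[h /HW hW [<- _]].
  have cTW : #|TW| = #|cls H c i|.
    apply: (@card_image_eq _ _ _ _ (fun w (h : E) => h.1 == w)).
    - by move=> w; rewrite -TWE in_set => /tkP[h hH [h1 ch]]; exists h; rewrite ?h1 // inE hH ch eqxx.
    - move=> h; rewrite inE => /andP[hH /eqP ch]; exists h.1 => //.
      by rewrite -TWE in_set; apply/tkP; exists h.
    - by move=> w w' _ _ h _ /eqP<- /eqP<-.
    - move=> h h'; rewrite !inE => /andP[hH /eqP c1] /andP[hH' /eqP c2] w _ /eqP h1 /eqP h2.
      by apply: tok_inj; rewrite ?h1 ?h2 ?c1 ?c2.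
  move XQE : [set x in X | xxc x i] => XQ; move XFE : [set x in X | i \in Cx x] => XF.
  have ev1 : ~~ odd #|XQ|.
    pose MX : rel V := fun x x' => [&& x \in X, x' \in X, e x x' & cx x x' == i].
    apply: (@pmatch_even _ XQ MX); last by move=> x; rewrite /MX ei !andbF.
    split.
    - move=> x x'; rewrite /MX; case xX: (x \in X); case xX': (x' \in X); rewrite //= es.
      by case exx: (e x' x) => //=; have [-> _ _] := cxP x' x xX' xX exx.
    - move=> x x' /and4P[xX xX' exx ci]; rewrite -XQE in_set xX; apply/existsP; exists x'; by rewrite xX' exx.
    - move=> x x1 x2 /and4P[xX x1X e1 /eqP c1] /and4P[_ x2X e2 /eqP c2].
      by apply: (cxI x) => //; rewrite c1 c2.
    - move=> x; rewrite -XQE in_set => /andP[xX /existsP[x' /and3P[xX' exx ci]]]; exists x'.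
      by rewrite /MX xX xX' exx.
  have cXF : #|XF| = #|[set w in N | ff w i]|.
    apply: (@card_image_eq _ _ _ _ (fun x w => (w \in Fx x) && (f x w == i))).
    - move=> x; rewrite -XFE in_set => /andP[xX]; rewrite -(fC x xX) => /imsetP[w wF iw]; exists w; last by rewrite wF -iw /=.
      rewrite in_set; have [-> _ _] := FxP x w xX wF; apply/existsP; exists x; by rewrite xX wF -iw /=.
    - move=> w; rewrite in_set => /andP[wN /ffP[x [xX wF fi]]]; exists x; last by rewrite wF fi eqxx.
      by rewrite -XFE in_set xX -fi fCx.
    - move=> x x'; rewrite -XFE !in_set => /andP[xX _] /andP[xX' _] w _ /andP[wF /eqP h1] /andP[wF' /eqP h2].
      by apply: (fX x x' w) => //; rewrite h1.
    - move=> w w' _ _ x; rewrite -XFE in_set => /andP[xX _] /andP[wF /eqP h1] /andP[wF' /eqP h2].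
      by apply: (fI x) => //; rewrite h1.
  have cNT : #|N :\: TW| = #|N :\: Bad j| + #|[set w in N | ff w i]|.
    rewrite -card_disjointU; last first.
      apply: disjointI => w; rewrite in_setD => /andP[+ wN]; rewrite BadP // negb_or => /andP[_ /negPf h].
      by rewrite in_set iE in h * => /andP[_]; rewrite h.
    apply: eq_card => w; rewrite in_setU !in_setD [_ \in [set w in N | _]]in_set -TWE [_ \in [set w | tkH w i]]in_set.
    have [wN|//] := boolP (w \in N); rewrite ?andbF // !andbT BadP // negb_or /= iE.
    case h: (ff w i); rewrite ?andbT ?andbF ?orbT ?orbF //=.
    by have [x [xX wF <-]] := ffP w i h; apply: ftk.
  have cWT : #|W :\: TW| = #|N :\: TW| + (#|XQ| + #|XF|).
    rewrite -!card_disjointU; last first.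
    + by apply: disjointI => x; rewrite -XQE -XFE !in_set CxP => /andP[_ h] /andP[_ /and3P[_ _]]; rewrite h.
    + apply: disjointI => x; rewrite in_setD in_setU => /andP[_ xN]; rewrite -XQE -XFE !in_set.
      by rewrite (nNX xN).
    apply: eq_card => x; rewrite in_setU !in_setD WE !in_setU -TWE -XQE -XFE ![x \in [set _ | _]]in_set CxP.
    have [xN|xN] := boolP (x \in N); first by rewrite (nNX xN) /= ?orbF ?andbT.
    rewrite andbF /=; have [xX|//] := boolP (x \in X); rewrite /= ?andbF // andbT.
    have := xxcP x i xX; rewrite -iE (ioN j) iE /=; case: (xxc x i) => //= [/(_ isT)->//|_].
    by rewrite andbT.
  have := par (ioN j); rewrite iE -cTW (card_split TWW) addnAC oddD addnn odd_double /= cWT cNT !oddD cXF.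
  by rewrite (negPf ev1); case: (odd #|N :\: Bad j|) => //; case: (odd _).
(* The identity is the difference of the sums of [yE] over [A] and over [B]. Cross edges cancel, [L]
   contributes only on [B], tokens with colours in [S] only at [A] and [X], and [lB], [s_total] and
   [cAB] make the remaining multiples of [r] agree. *)
- pose y w := #|[set j | w \notin Bad j]|; pose l w := #|[set x in X | w \in L x]|.
  have yE w : w \in N -> y w + r = #|nb w :&: N| + l w + s w.
    move=> wN; have := degree (NW wN); have := bad_count w wN.
    have : #|[set j | w \in Bad j]| + y w = #|Ic|.
      rewrite -(cardsC [set j | w \in Bad j]); congr (_ + _); apply: eq_card => j; by rewrite !inE.
    have -> : #|nb w :&: X| = #|[set x in X | w \in Fx x]| + l w.
      rewrite /l -card_disjointU; last first.
        by apply: disjointI => x; rewrite in_set => /andP[xX wF]; rewrite in_set => /andP[_]; have [_ _ /negPf->] := FxP x w xX wF.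
      apply: eq_card => x; rewrite in_setU [X in _ = X || _]in_set [X in _ = _ || X]in_set in_setI in_set andbC.
      have [xX|//] := boolP (x \in X); rewrite /= FxE in_setD in_setI in_set wN andbT es.
      case wL: (w \in L x); rewrite /= ?orbF //.
      by have /subsetP/(_ w wL) := LN x xX; rewrite in_setI in_set => /andP[->].
    rewrite cIc; move: #|_| #|_| #|_| #|_| (t w) (s w) (l w) (y w) => a1 a2 a3 a4 a5 a6 a7 a8; lia.
  have sumy (Z : {set V}) : Z \subset N -> \sum_j #|Z :\: Bad j| = \sum_(w in Z) y w.
    move=> ZN; have := @sum_card_exchange _ _ Z [set: Ic] (fun w j => w \notin Bad j).
    rewrite (eq_bigr y) => [->|w _]; last by apply: eq_card => j; rewrite !inE.
    by apply: eq_big => [j|j _]; rewrite ?inE //; apply: eq_card => w; rewrite !in_set andbC.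
  have AsN : A \subset N by rewrite NE; apply: subsetUl.
  have BsN : B \subset N by rewrite NE; apply: subsetUr.
  have sumr (Z : {set V}) : Z \subset N -> \sum_(w in Z) y w + r * #|Z| =
      \sum_(w in Z) #|nb w :&: N| + \sum_(w in Z) l w + \sum_(w in Z) s w.
    move=> ZN; rewrite mulnC -sum_nat_const -!big_split /=; apply: eq_bigr => w wZ.
    by apply: yE; apply: (subsetP ZN).
  have nbN w : #|nb w :&: N| = #|[set v in A | e w v]| + #|[set v in B | e w v]|.
    rewrite -card_disjointU; last by apply: disjointI => v; rewrite !in_set => /andP[vA _] /andP[]; rewrite (nAB vA).
    by apply: eq_card => v; rewrite NE !inE; case: (e w v); rewrite ?andbT ?andbF.
  have sumN (Z : {set V}) : \sum_(w in Z) #|nb w :&: N| =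
      \sum_(w in Z) #|[set v in A | e w v]| + \sum_(w in Z) #|[set v in B | e w v]|.
    by rewrite -big_split /=; apply: eq_bigr => w _; apply: nbN.
  have cross : \sum_(w in A) #|[set v in B | e w v]| = \sum_(w in B) #|[set v in A | e w v]|.
    by rewrite sum_card_exchange; apply: eq_bigr => w _; apply: eq_card => v; rewrite !in_set es.
  have lA : \sum_(w in A) l w = 0.
    rewrite big1 // => w wA; apply: eq_card0 => x; rewrite in_set; apply/negP => /andP[xX wL].
    have [/subsetP/(_ w wL)] := LP x xX; by rewrite in_setI (nAB wA) andbF.
  have lB : \sum_(w in B) l w + \sum_(x in X) s x = r * #|X|.
    rewrite /l sum_card_exchange mulnC -sum_nat_const -big_split /=; apply: eq_bigr => x xX.
    have [LB cL] := LP x xX; rewrite (_ : [set w in B | w \in L x] = L x) ?cL ?subnK //.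
    apply/setP => w; rewrite in_set; case wL: (w \in L x); rewrite ?andbF // andbT.
    by have /subsetP/(_ w wL) := LB; rewrite in_setI => /andP[_ ->].
  have sB0 : \sum_(w in B) s w = 0 by rewrite big1.
  have := sumr A AsN; have := sumr B BsN; rewrite !sumy // !sumN !inner_sum lA sB0 cross.
  have := congr1 (fun z => r * z) cAB; rewrite !mulnDr => h1; have := s_total; move: lB h1.
  move: (r * #|A|) (r * #|B|) (r * #|X|) (r * g) (\sum_(w in A) s w) (\sum_(w in X) s w) (\sum_(w in B) l w).
  move: (\sum_(w in A) y w) (\sum_(w in B) y w) (\sum_(w in B) #|[set v in A | e w v]|).
  move: (\sum_(w in A) #|[set v in A | e w v]|) (\sum_(w in B) #|[set v in B | e w v]|).
  by move=> a1 a2 a3 a4 a5 a6 a7 a8 a9 b1 b2 b3; lia.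
pose TOKd (i : 'I_D) w u := ((w, inl u) \in H) && (c (w, inl u) == i).
pose FFd (i : 'I_D) x w := [&& x \in X, w \in Fx x & f x w == i].
pose XXr (i : 'I_D) : rel V := fun x x' => [&& x \in X, x' \in X, e x x' & cx x x' == i].
pose Kd j : rel V := fun w v => [|| M j w v, TOKd (io j) w v || TOKd (io j) v w, XXr (io j) w v |
  FFd (io j) w v || FFd (io j) v w].
have TOKP i w u : TOKd i w u -> [/\ w \in W, u \in U, e w u & tkH w i].
  case/andP=> h ch; have wW := HW h; split=> //.
  - by move: h; rewrite HE in_set /= => /and3P[].
  - by move: h; rewrite HE in_set /= => /and3P[].
  - by apply/tkP; exists (w, inl u); rewrite //=; split=> //; apply/eqP.
have FFP i x w : FFd i x w -> [/\ x \in X, w \in N, e x w & [/\ ff w i, i \in Cx x & ~~ tkH w i]].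
  case/and3P=> xX wF /eqP fi; have [wN exw _] := FxP x w xX wF; split=> //; split.
  - by apply/existsP; exists x; rewrite xX wF fi eqxx.
  - by rewrite -fi fCx.
  - by rewrite -fi; apply: ftk.
have MP j w v : M j w v -> [/\ w \in N, v \in N, e w v, ~~ tkH w (io j) & ~~ ff w (io j)].
  move=> h; have [sy in1 _ _] := pmM j; have h' := h; rewrite sy in h'.
  have := in1 _ _ h; rewrite in_setD => /andP[+ wN]; rewrite BadP // negb_or => /andP[h1 h2].
  by have := in1 _ _ h'; rewrite in_setD => /andP[_ vN]; split=> //; apply: Me h.
have XXP i w v : XXr i w v -> [/\ w \in X, v \in X, e w v & xxc w i].
  by case/and4P=> wX vX ewv ci; split=> //; apply/existsP; exists v; rewrite vX ewv.
have Ks j : symmetric (Kd j).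
  move=> w v; rewrite /Kd; have [sy _ _ _] := pmM j; rewrite sy [TOKd _ w v || _]orbC [FFd _ w v || _]orbC.
  congr [|| _, _, _ | _]; rewrite /XXr; case wX: (w \in X); case vX: (v \in X); rewrite //= es.
  by case evw: (e v w) => //=; have [-> _ _] := cxP v w vX wX evw.
have Ke j : subrel (Kd j) e.
  move=> w v /or4P[/MP[]//|/orP[/TOKP[]//|/TOKP[_ _]]|/XXP[]//|/orP[/FFP[]//|/FFP[_ _]]]; by rewrite es.
have XN x : x \in X -> x \in N = false by move=> xX; apply/negP => /nNX; rewrite xX.
have UW u : u \in U -> u \in W = false by move=> uU; apply/negP => /nWU; rewrite uU.
have UN u : u \in U -> u \in N = false by move=> /UW uW; apply/negP => /NW; rewrite uW.
have UX u : u \in U -> u \in X = false by move=> /UW uW; apply/negP => /XW; rewrite uW.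
have CxX x i : x \in X -> i \in Cx x -> tkH x i || xxc x i -> False.
  by move=> xX; rewrite CxP => /and3P[_ /negPf-> /negPf->].
have Kf j w v v' : Kd j w v -> Kd j w v' -> v = v'.
  have [_ _ fu _] := pmM j.
  case/or4P=> [h|/orP[]h|h|/orP[]h] /or4P[h'|/orP[]h'|h'|/orP[]h'].
  - exact: fu h h'.
  - by have [_ _ _ /negP[]] := MP _ _ _ h; have [] := TOKP _ _ _ h'.
  - by have [wN _ _ _ _] := MP _ _ _ h; have [_ wU _ _] := TOKP _ _ _ h'; rewrite UN in wN.
  - by have [wN _ _ _ _] := MP _ _ _ h; have [wX _ _ _] := XXP _ _ _ h'; rewrite XN in wN.
  - by have [wN _ _ _ _] := MP _ _ _ h; have [wX _ _ _] := FFP _ _ _ h'; rewrite XN in wN.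
  - by have [_ _ _ _ /negP[]] := MP _ _ _ h; have [_ _ _ []] := FFP _ _ _ h'.
  - by have [_ _ _ /negP[]] := MP _ _ _ h'; have [] := TOKP _ _ _ h.
  - case/andP: h => h1 /eqP c1; case/andP: h' => h2 /eqP c2.
    by have [] : (w, inl v : V + 'I_D) = (w, inl v') by apply: tok_inj; rewrite // c1 c2.
  - by have [wW _ _ _] := TOKP _ _ _ h; have [_ wU _ _] := TOKP _ _ _ h'; rewrite UW in wW.
  - have [_ _ _ h1] := TOKP _ _ _ h; have [wX _ _ h2] := XXP _ _ _ h'.
    by have := xxcP w _ wX h2; rewrite h1 andbF.
  - have [_ _ _ h1] := TOKP _ _ _ h; have [wX _ _ [_ h2 _]] := FFP _ _ _ h'.
    by case: (CxX _ _ wX h2); rewrite h1.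
  - have [_ _ _ h1] := TOKP _ _ _ h; have [_ _ _ [_ _ h2]] := FFP _ _ _ h'; by rewrite h1 in h2.
  - by have [wN _ _ _ _] := MP _ _ _ h'; have [_ wU _ _] := TOKP _ _ _ h; rewrite UN in wN.
  - by have [wW _ _ _] := TOKP _ _ _ h'; have [_ wU _ _] := TOKP _ _ _ h; rewrite UW in wW.
  - case/andP: h => h1 /eqP c1; case/andP: h' => h2 /eqP c2.
    by have [] : (v, inl w : V + 'I_D) = (v', inl w) by apply: cp; rewrite ?c1 ?c2 // /clash /token_end /= eqxx orbT.
  - by have [_ wU _ _] := TOKP _ _ _ h; have [wX _ _ _] := XXP _ _ _ h'; rewrite UX in wX.
  - by have [_ wU _ _] := TOKP _ _ _ h; have [wX _ _ _] := FFP _ _ _ h'; rewrite UX in wX.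
  - by have [_ wU _ _] := TOKP _ _ _ h; have [_ wN _ _] := FFP _ _ _ h'; rewrite UN in wN.
  - by have [wN _ _ _ _] := MP _ _ _ h'; have [wX _ _ _] := XXP _ _ _ h; rewrite XN in wN.
  - have [_ _ _ h1] := TOKP _ _ _ h'; have [wX _ _ h2] := XXP _ _ _ h.
    by have := xxcP w _ wX h2; rewrite h1 andbF.
  - by have [_ wU _ _] := TOKP _ _ _ h'; have [wX _ _ _] := XXP _ _ _ h; rewrite UX in wX.
  - case/and4P: h => wX vX e1 /eqP c1; case/and4P: h' => _ v'X e2 /eqP c2.
    by apply: (cxI w); rewrite ?c1 ?c2.
  - have [wX _ _ h1] := XXP _ _ _ h; have [_ _ _ [_ h2 _]] := FFP _ _ _ h'.
    by case: (CxX _ _ wX h2); rewrite h1 orbT.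
  - by have [wX _ _ _] := XXP _ _ _ h; have [_ wN _ _] := FFP _ _ _ h'; rewrite XN in wN.
  - by have [wN _ _ _ _] := MP _ _ _ h'; have [wX _ _ _] := FFP _ _ _ h; rewrite XN in wN.
  - have [_ _ _ h1] := TOKP _ _ _ h'; have [wX _ _ [_ h2 _]] := FFP _ _ _ h.
    by case: (CxX _ _ wX h2); rewrite h1.
  - by have [_ wU _ _] := TOKP _ _ _ h'; have [wX _ _ _] := FFP _ _ _ h; rewrite UX in wX.
  - have [wX _ _ h1] := XXP _ _ _ h'; have [_ _ _ [_ h2 _]] := FFP _ _ _ h.
    by case: (CxX _ _ wX h2); rewrite h1 orbT.
  - case/and3P: h => wX h1 /eqP f1; case/and3P: h' => _ h2 /eqP f2.
    by apply: (fI w wX); rewrite ?f1 ?f2.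
  - by have [wX _ _ _] := FFP _ _ _ h; have [_ wN _ _] := FFP _ _ _ h'; rewrite XN in wN.
  - by have [_ _ _ _ /negP[]] := MP _ _ _ h'; have [_ _ _ []] := FFP _ _ _ h.
  - have [_ _ _ h1] := TOKP _ _ _ h'; have [_ _ _ [_ _ h2]] := FFP _ _ _ h; by rewrite h1 in h2.
  - by have [_ wU _ _] := TOKP _ _ _ h'; have [_ wN _ _] := FFP _ _ _ h; rewrite UN in wN.
  - by have [wX _ _ _] := XXP _ _ _ h'; have [_ wN _ _] := FFP _ _ _ h; rewrite XN in wN.
  - by have [wX _ _ _] := FFP _ _ _ h'; have [_ wN _ _] := FFP _ _ _ h; rewrite XN in wN.
  - case/and3P: h => vX h1 /eqP f1; case/and3P: h' => v'X h2 /eqP f2.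
    by apply: (fX v v' w) => //; rewrite f1.
have Kdis j k w v : Kd j w v -> Kd k w v -> j = k.
  case/or4P=> [h|/orP[]h|h|/orP[]h] /or4P[h'|/orP[]h'|h'|/orP[]h'].
  1: exact: Md h h'.
  all: try (have [h1 h2 _ _ _] := MP _ _ _ h; have [_ h4 _ _] := TOKP _ _ _ h'; first [by rewrite UN in h1 | by rewrite UN in h2]).
  all: try (have [h1 h2 _ _ _] := MP _ _ _ h'; have [_ h4 _ _] := TOKP _ _ _ h; first [by rewrite UN in h1 | by rewrite UN in h2]).
  all: try (by have [h1 _ _ _ _] := MP _ _ _ h; have [h4 _ _ _] := XXP _ _ _ h'; rewrite XN in h1).
  all: try (by have [h1 _ _ _ _] := MP _ _ _ h'; have [h4 _ _ _] := XXP _ _ _ h; rewrite XN in h1).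
  all: try (have [h1 h2 _ _ _] := MP _ _ _ h; have [h4 _ _ _] := FFP _ _ _ h'; first [by rewrite XN in h1 | by rewrite XN in h2]).
  all: try (have [h1 h2 _ _ _] := MP _ _ _ h'; have [h4 _ _ _] := FFP _ _ _ h; first [by rewrite XN in h1 | by rewrite XN in h2]).
  all: try (have [_ h4 _ _] := TOKP _ _ _ h; have [h1 h2 _ _] := XXP _ _ _ h'; first [by rewrite UX in h1 | by rewrite UX in h2]).
  all: try (have [_ h4 _ _] := TOKP _ _ _ h'; have [h1 h2 _ _] := XXP _ _ _ h; first [by rewrite UX in h1 | by rewrite UX in h2]).
  all: try (have [_ h4 _ _] := TOKP _ _ _ h; have [h1 h2 _ _] := FFP _ _ _ h'; first [by rewrite UX in h1 | by rewrite UN in h2]).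
  all: try (have [_ h4 _ _] := TOKP _ _ _ h'; have [h1 h2 _ _] := FFP _ _ _ h; first [by rewrite UX in h1 | by rewrite UN in h2]).
  all: try (by have [h1 h2 _ _] := XXP _ _ _ h; have [_ h4 _ _] := FFP _ _ _ h'; rewrite XN in h4).
  all: try (by have [h1 h2 _ _] := XXP _ _ _ h'; have [_ h4 _ _] := FFP _ _ _ h; rewrite XN in h4).
  all: try (have [h1 h2 _ _] := TOKP _ _ _ h; have [h3 h4 _ _] := TOKP _ _ _ h'; first [by rewrite UW in h1 | by rewrite UW in h3]).
  all: try (have [h1 h2 _ _] := FFP _ _ _ h; have [h3 h4 _ _] := FFP _ _ _ h'; first [by rewrite XN in h2 | by rewrite XN in h4]).
  - by case/andP: h => _ /eqP c1; case/andP: h' => _ /eqP c2; apply: ioI; apply: ord_inj; rewrite -c1 -c2.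
  - by case/andP: h => _ /eqP c1; case/andP: h' => _ /eqP c2; apply: ioI; apply: ord_inj; rewrite -c1 -c2.
  - by case/and4P: h => _ _ _ /eqP c1; case/and4P: h' => _ _ _ /eqP c2; apply: ioI; apply: ord_inj; rewrite -c1 -c2.
  - by case/and3P: h => _ _ /eqP c1; case/and3P: h' => _ _ /eqP c2; apply: ioI; rewrite -c1 -c2.
  - by case/and3P: h => _ _ /eqP c1; case/and3P: h' => _ _ /eqP c2; apply: ioI; rewrite -c1 -c2.
(* A designed colour absent at [w] is the colour of one of its missing edges. So at most
   [D - #|nb w|] designed colours are absent, and at most [r] edges at [w] stay uncovered. *)
have hit w j : w \in W -> ~~ [exists v, Kd j w v] -> exists2 k : 'I_D, (w, inr k) \in H & c (w, inr k) = io j.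
  move=> wW /existsPn no.
  have tok_null : tkH w (io j) -> exists2 k : 'I_D, (w, inr k) \in H & c (w, inr k) = io j.
    case/tkP=> -[w' [u|k]] hH [/= h1 ch]; last by exists k; rewrite -h1.
    by have := no u; rewrite /Kd -h1 /TOKd hH ch eqxx !orbT.
  move: wW; rewrite WE in_setU => /orP[wN|wX].
    have [/tok_null//|/negPf ntk] := boolP (tkH w (io j)).
    have [_ _ _ tot] := pmM j; have [wB|wB] := boolP (w \in Bad j).
      move: wB; rewrite BadP // ntk /= => /ffP[x [xX wF fi]].
      by have := no x; rewrite /Kd /FFd xX wF fi eqxx !orbT.
    by have [|v Mv] := tot w; [rewrite in_setD wB wN|have := no v; rewrite /Kd Mv].
  have [|iC] := boolP (io j \in Cx w).
    rewrite -(fC w wX) => /imsetP[v vF iv]; have := no v; by rewrite /Kd /FFd wX vF -iv eqxx !orbT.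
  move: iC; rewrite CxP (ioN j) /= negb_and !negbK => /orP[//|/existsP[x' /and3P[xX' exx ci]]].
  by have := no x'; rewrite /Kd /XXr wX xX' exx ci !orbT.
pose unc : rel V := fun w v => e w v && ~~ [exists j, Kd j w v].
have unc_s : symmetric unc.
  by move=> w v; rewrite /unc es; congr (_ && ~~ _); apply: eq_existsb => j; apply: Ks.
have uncW w : w \in W -> #|[set v | unc w v]| <= r.
  move=> wW; pose hitj := [set j | [exists v, Kd j w v]].
  have h1 : #|[set v | e w v && [exists j, Kd j w v]]| = #|hitj|.
    apply: (@card_image_eq _ _ _ _ (fun v j => Kd j w v)).
    - by move=> v; rewrite inE => /andP[_ /existsP[j h]]; exists j => //; rewrite inE; apply/existsP; exists v.
    - move=> j; rewrite inE => /existsP[v h]; exists v => //; rewrite inE (Ke _ _ _ h).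
      by apply/existsP; exists j.
    - by move=> v v' _ _ j _; apply: Kf.
    - by move=> j k _ _ v _; apply: Kdis.
  have h2 : #|nb w| = #|[set v | e w v && [exists j, Kd j w v]]| + #|[set v | unc w v]|.
    rewrite -card_disjointU; last by apply: disjointI => v; rewrite in_set => /andP[_ h]; rewrite in_set /unc h andbF.
    by apply: eq_card => v; rewrite in_setU !in_set /unc; case: (e w v) => //=; rewrite orbN.
  have h3 : #|~: hitj| <= D - #|nb w|.
    rewrite -(card_ltn_ord (leq_subr #|nb w| D)).
    apply: (@card_le_rel _ _ _ _ (fun (k : 'I_D) j => ((w, inr k) \in H) && (c (w, inr k) == io j))).
      move=> j; rewrite !inE => /(hit w j wW)[k kH ck]; exists k; last by rewrite kH ck eqxx.
      by move: kH; rewrite HE inE /= inE => /andP[].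
    by move=> k j j' /andP[_ /eqP c1] /andP[_ /eqP c2]; apply: ioI; apply: ord_inj; rewrite -c1 -c2.
  have := cardsC hitj; have := dD w; rewrite h2 h1 in h3 *; rewrite cIc in h3 *.
  move: h3; move: #|hitj| #|_| #|_| #|_| => a1 a2 a3 a4; lia.
have tokU w u : w \in W -> u \in U -> e w u -> (w, inl u) \in H.
  by move=> wW uU ewu; rewrite HE in_set /= wW uU.
have uncU u : u \in U -> #|[set w | unc u w]| <= r.
  move=> uU; rewrite -cS; apply: (@card_le_rel _ _ _ _ (fun i w => TOKd i w u)).
    move=> w; rewrite in_set /unc => /andP[euw /existsPn no].
    have wW : w \in W by apply: contraT => /nW_U wU; have := Uind uU wU; rewrite euw.
    have hH := tokU w u wW uU; rewrite es in euw; have {}hH := hH euw.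
    have cD' := cD hH; exists (Ordinal cD'); last by rewrite /TOKd hH /=.
    apply: contraT => /ioE[j jE]; have := no j; by rewrite /Kd /TOKd hH jE /= eqxx !orbT.
  move=> i w w' /andP[h1 /eqP c1] /andP[h2 /eqP c2].
  by have [] : (w, inl u : V + 'I_D) = (w', inl u) by apply: cp; rewrite ?c1 ?c2 // /clash /token_end /= eqxx orbT.
have AXW w : w \in A :|: X -> w \in W.
  by rewrite in_setU => /orP[/AN/NW|/XW].
(* The graph for Koenig's theorem. The case analysis at the end shows that each uncovered edge lies
   in it in one direction: the other positions are excluded by [nosame], [noXA], [noBU], [noXX] and
   the independence of [U]. *)
pose F := [set q : V * V | [&& q.1 \in A :|: X, q.2 \in B :|: U & unc q.1 q.2]].
have [||k [kr ka kb]] := @konig _ _ _ (fun q : V * V => q.1) (fun q => q.2) r F.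
- move=> w; have [wAX|wAX] := boolP (w \in A :|: X); last first.
    by rewrite eq_card0 // => q; rewrite !in_set; case: eqP => [->|_]; rewrite ?andbF // andbT -in_setU (negPf wAX).
  apply: leq_trans (uncW w (AXW w wAX)); apply: (@card_le_rel _ _ _ _ (fun v q => q == (w, v))).
    move=> [w' v]; rewrite !in_set /= => /andP[/and3P[_ _ h] /eqP<-]; exists v => //; by rewrite in_set.
  by move=> v q q' /eqP-> /eqP->.
- move=> v; have [vBU|vBU] := boolP (v \in B :|: U); last first.
    by rewrite eq_card0 // => q; rewrite !in_set; case: eqP => [->|_]; rewrite ?andbF // andbT -!in_setU (negPf vBU) andbF.
  apply: leq_trans (_ : #|[set w | unc v w]| <= _).
    apply: (@card_le_rel _ _ _ _ (fun w q => q == (w, v))).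
      move=> [w v']; rewrite !in_set /= => /andP[/and3P[_ _ h] /eqP<-]; exists w => //; by rewrite in_set unc_s.
    by move=> w q q' /eqP-> /eqP->.
  by move: vBU; rewrite in_setU => /orP[/BN/NW/uncW|/uncU].
have [sg [sgI sgS]] : exists sg : 'I_r -> 'I_D, injective sg /\ forall x, sg x \in S.
  by apply: inj_into; rewrite card_ord cS.
pose Kf' (i : 'I_D) w v := ((w, v) \in F) && [exists x : 'I_r, (val x == k (w, v)) && (sg x == i)].
have Kf'k i w v : Kf' i w v -> exists x : 'I_r, [/\ (w, v) \in F, val x = k (w, v) & sg x = i].
  by case/andP=> wF /existsP[x /andP[/eqP xk /eqP sx]]; exists x.
have disAB w : w \in A :|: X -> w \in B :|: U -> False.
  move=> h; rewrite in_setU => /orP[wB|wU]; last by have := AXW w h; rewrite UW.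
  move: h; rewrite in_setU => /orP[wA|wX]; first by rewrite (nAB wA) in wB.
  by have := BN wB; rewrite XN.
have FP w v : (w, v) \in F -> [/\ w \in A :|: X, v \in B :|: U & unc w v].
  by rewrite in_set => /and3P[].
exists (fun i w v => [exists j, (io j == i) && Kd j w v] || (Kf' i w v || Kf' i v w)).
have KfS i w v : Kf' i w v -> i \in S by case/Kf'k=> x [_ _ <-].
split.
- move=> i w v; rewrite [Kf' i w v || _]orbC; congr (_ || _); apply: eq_existsb => j; by rewrite Ks.
- move=> i w v v' /orP[/existsP[j /andP[/eqP ji h]]|h] /orP[/existsP[j' /andP[/eqP ji' h']]|h'].
  + have jj : j = j' by apply: ioI; rewrite ji ji'.
    by rewrite -jj in h'; apply: Kf h h'.
  + by have := ioN j; rewrite ji; case/orP: h' => /KfS->.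
  + by have := ioN j'; rewrite ji'; case/orP: h => /KfS->.
  + case/orP: h => /Kf'k[x [h1 k1 s1]]; case/orP: h' => /Kf'k[x' [h2 k2 s2]].
    * have [] // : (w, v) = (w, v') by apply: ka => //; rewrite -k1 -k2 (sgI x x') // s1.
    * by have [wA _ _] := FP _ _ h1; have [_ wB _] := FP _ _ h2; case: (disAB w).
    * by have [wA _ _] := FP _ _ h2; have [_ wB _] := FP _ _ h1; case: (disAB w).
    * have [] // : (v, w) = (v', w) by apply: kb => //; rewrite -k1 -k2 (sgI x x') // s1.
- move=> w v ewv; have [/existsP[j h]|noK] := boolP [exists j, Kd j w v].
    by exists (io j); apply/orP; left; apply/existsP; exists j; rewrite eqxx.
  have uwv : unc w v by rewrite /unc ewv.
  have fin x y : (x, y) \in F -> exists i : 'I_D, Kf' i x y.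
    move=> h; exists (sg (Ordinal (kr _ h))); rewrite /Kf' h; apply/existsP; exists (Ordinal (kr _ h)); by rewrite /= !eqxx.
  suff : (w, v) \in F \/ (v, w) \in F.
    by case=> /fin[i h]; exists i; rewrite h ?orbT.
  have noXA x y : unc x y -> x \in X -> y \in A -> False.
    case/andP=> exy /existsPn no xX yA; have yF : y \in Fx x.
      rewrite FxE in_setD in_setI in_set exy (AN yA) /= andbT; apply/negP => yL.
      have [/subsetP/(_ y yL)] := LP x xX; by rewrite in_setI (nAB yA) andbF.
    have := fCx x y xX yF; rewrite CxP => /andP[/ioE[j jE] _]; have := no j.
    by rewrite /Kd /FFd xX yF jE eqxx !orbT.
  have noBU x u : unc x u -> x \in B -> u \in U -> False.
    case/andP=> exu /existsPn no xB uU; have hH := tokU x u (NW (BN xB)) uU exu.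
    have [iS|/ioE[j jE]] := boolP (Ordinal (cD hH) \in S).
      have := res hH iS erefl; rewrite /= => xAX; apply: (disAB x xAX); by rewrite in_setU xB.
    have := no j; by rewrite /Kd /TOKd hH jE /= eqxx !orbT.
  have noXX x y : unc x y -> x \in X -> y \in X -> False.
    case/andP=> exy /existsPn no xX yX; have [_ cD' nf] := cxP x y xX yX exy.
    have xxi : xxc x (Ordinal cD') by apply/existsP; exists y; rewrite yX exy /=.
    have /andP[/ioE[j jE] _] := xxcP x _ xX xxi; have := no j.
    by rewrite /Kd /XXr xX yX exy jE /= eqxx !orbT.
  have nosame x y : unc x y -> same_side A B x y -> False.
    by case/andP=> exy /existsPn no sm; have [j Mj] := Mall x y sm exy; have := no j; rewrite /Kd Mj.
  have uvw : unc v w by rewrite unc_s.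
  have cases x : [\/ x \in A, x \in B, x \in X | x \in U].
    have [|/nW_U] := boolP (x \in W); [rewrite WP => /or3P[]|]; by [constructor 1|constructor 2|constructor 3|constructor 4].
  rewrite !in_set /= uwv uvw !andbT.
  case: (cases w) => hw; case: (cases v) => hv; rewrite ?hw ?hv ?orbT ?andbT /=; try by [left|right].
  + by case: (nosame w v uwv); rewrite /same_side hw hv.
  + by case: (noXA v w uvw).
  + by case: (nosame w v uwv); rewrite /same_side hw hv orbT.
  + by case: (noBU w v uwv).
  + by case: (noXA w v uwv).
  + by case: (noXX w v uwv).
  + by case: (noBU v w uvw).
  + by have := Uind hw hv; rewrite ewv.
Qed.

End Assembly.

(** * Expansion in random subgraphs *)

Definition pairs (V : finType) (e : rel V) (S T : {set V}) :=
  #|[set p : V * V | [&& p.1 \in S, p.2 \in T & e p.1 p.2]]|.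

Lemma pairs_sub (V : finType) (e : rel V) (S T S' T' : {set V}) :
  S \subset S' -> T \subset T' -> pairs e S T <= pairs e S' T'.
Proof.
move=> sS sT; apply: subset_leq_card; apply/subsetP => p; rewrite !inE.
by case/and3P=> /(subsetP sS)-> /(subsetP sT)->.
Qed.

Lemma pairs_sum (V : finType) (e : rel V) (S T : {set V}) :
  pairs e S T = \sum_(x in S) #|[set y in T | e x y]|.
Proof.
rewrite /pairs -sum1_card; under [RHS]eq_bigr do rewrite card_set_sum.
rewrite pair_big_dep /= big_mkcond [RHS]big_mkcond; apply: eq_bigr => -[w v] _; rewrite inE /=.
by case: (w \in S); case: (v \in T); case: (e w v).
Qed.

Lemma pairs_sum_r (V : finType) (e : rel V) (S T : {set V}) :
  pairs e S T = \sum_(y in T) #|[set x in S | e x y]|.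
Proof.
rewrite pairs_sum; under eq_bigr do rewrite card_set_sum; under [RHS]eq_bigr do rewrite card_set_sum.
exact: exchange_big.
Qed.

(** If [X] violates Hall's condition and [T] is the part of [B'] that it misses, then every edge of
    [H] from [X] to [T] is used, so there are at most [q * #|X|] of them, against the hypothesis on
    [pairs]. The degree conditions at a vertex of [X] and at one of [T] bring [#|X|] into the range
    of that hypothesis. *)
Lemma robust_hall (V : finType) (P1 P2 : {set V}) (H used : rel V) q del s0 :
    (forall x, x \in P1 -> #|[set y in P2 | H x y && used x y]| <= q) ->
    (forall y, y \in P2 -> #|[set x in P1 | H x y && used x y]| <= q) ->
    (forall x, x \in P1 -> s0 + q + del <= #|[set y in P2 | H x y]|) ->
    (forall y, y \in P2 -> s0 + q + del <= #|[set x in P1 | H x y]|) ->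
    (forall S T : {set V}, S \subset P1 -> T \subset P2 -> s0 <= #|S| -> s0 + #|S| <= #|P1| ->
       #|P1| <= #|S| + #|T| + del -> q * #|S| < pairs H S T) ->
  forall A' B' : {set V}, A' \subset P1 -> B' \subset P2 -> #|A'| = #|B'| ->
    #|P1 :\: A'| <= del -> #|P2 :\: B'| <= del -> exists f : V -> V,
    [/\ {in A' &, injective f}, f @: A' = B' & {in A', forall x, H x (f x) && ~~ used x (f x)}].
Proof.
move=> u1 u2 d1 d2 ex A' B' sA sB cAB dA dB.
have [A0|[a0 a0A]] := set_0Vmem A'.
  exists id; split=> [x y|| x]; rewrite A0 ?inE // imset0; apply/esym/eqP.
  by rewrite -cards_eq0 -cAB A0 cards0.
have degA x : x \in A' -> s0 <= #|[set y in B' | H x y && ~~ used x y]|.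
  move=> xA; have xP := subsetP sA x xA.
  apply: (@card_cover3 _ [set y in P2 | H x y] _ [set y in P2 | H x y && used x y] (P2 :\: B') s0 q del).
  - apply/subsetP => y; rewrite !inE => /andP[yP Hxy]; rewrite yP Hxy /=.
    by case: (y \in B') => /=; rewrite ?orbT // orbF; case: (used x y).
  - exact: u1.
  - exact: dB.
  - exact: d1.
have degB y : y \in B' -> s0 <= #|[set x in A' | H x y && ~~ used x y]|.
  move=> yB; have yP := subsetP sB y yB.
  apply: (@card_cover3 _ [set x in P1 | H x y] _ [set x in P1 | H x y && used x y] (P1 :\: A') s0 q del).
  - apply/subsetP => x; rewrite !inE => /andP[xP Hxy]; rewrite xP Hxy /=.
    by case: (x \in A') => /=; rewrite ?orbT // orbF; case: (used x y).
  - exact: u2.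
  - exact: dA.
  - exact: d2.
have [|f [fB fI]] := @hall V V (fun x y => H x y && ~~ used x y) a0 A' B'.
  move=> X XA; rewrite leqNgt; apply/negP => lt; set NX := [set y in B' | _] in lt.
  have [X0|[x xX]] := set_0Vmem X; first by rewrite X0 cards0 in lt.
  have NXs : #|[set y in B' | H x y && ~~ used x y]| <= #|NX|.
    apply: subset_leq_card; apply/subsetP => y; rewrite !inE => /andP[-> h].
    by apply/existsP; exists x; rewrite xX.
  have sX : s0 <= #|X|.
    by apply: leq_trans (degA x (subsetP XA x xX)) (leq_trans NXs (ltnW lt)).
  have NXB : NX \subset B' by apply/subsetP => y; rewrite inE => /andP[].
  pose T := B' :\: NX; have cT := card_split NXB; rewrite -/T in cT.
  have [y yT] : exists y, y \in T.
    apply/card_gt0P; have := subset_leq_card XA; move: lt cT; rewrite cAB.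
    by move: #|X| #|NX| #|T| #|B'| => a b c d; lia.
  have noT z w : z \in X -> w \in T -> H z w -> used z w.
    move=> zX; rewrite !inE => /andP[+ wB] Hzw; rewrite wB /= => no; apply: contraT => nu.
    by case/negP: no; apply/existsP; exists z; rewrite zX Hzw.
  have yB : y \in B' by move: yT; rewrite inE => /andP[].
  have sXA : s0 + #|X| <= #|A'|.
    rewrite (card_split XA) addnC leq_add2l; apply: leq_trans (degB y yB) _.
    apply: subset_leq_card; apply/subsetP => z; rewrite !inE => /and3P[-> Hzy nu]; rewrite andbT.
    by apply: contra nu => zX; apply: noT zX yT Hzy.
  have TP : T \subset P2 by apply: subset_trans sB; apply: subsetDl.
  have XP : X \subset P1 by apply: subset_trans sA.
  have := ex X T XP TP sX (leq_trans sXA (subset_leq_card sA)); rewrite ltnNge pairs_sum => /(_ _)/negP[].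
    rewrite (card_split sA) cAB cT; move: lt dA; move: #|X| #|NX| #|T| #|P1 :\: A'| => a b c d; clear; lia.
  rewrite mulnC -sum_nat_const; apply: leq_sum => z zX; apply: leq_trans (u1 z (subsetP XP z zX)).
  apply: subset_leq_card; apply/subsetP => w; rewrite in_set => /andP[wT Hzw].
  by rewrite in_set (subsetP TP w wT) Hzw (noT z w zX wT Hzw).
exists f; split=> // [|x /fB/andP[]//].
apply/eqP; rewrite eqEcard card_in_imset // cAB leqnn andbT.
by apply/subsetP => _ /imsetP[x /fB/andP[fx _] ->].
Qed.

(** With truncated subtraction the last sum is the distance between [#|A0|] and [a]: as few vertices
    as possible change sides, and none of [Y0]. *)
Lemma adjust (V : finType) (N A0 Y0 : {set V}) a : Y0 \subset A0 -> A0 \subset N -> #|Y0| <= a -> a <= #|N| ->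
  exists2 A : {set V}, [/\ Y0 \subset A, A \subset N & #|A| = a] & #|A :\: A0| + #|A0 :\: A| = (#|A0| - a) + (a - #|A0|).
Proof.
move=> YA AN Ya aN; have [le|/ltnW le] := leqP a #|A0|.
  have [L LA cL] : exists2 L : {set V}, L \subset A0 :\: Y0 & #|L| = a - #|Y0|.
    by apply: sub_card; have := card_split YA; lia.
  have LA0 : L \subset A0 by apply: subset_trans LA (subsetDl _ _).
  have dYL : [disjoint Y0 & L].
    by apply: disjointI => x xY /(subsetP LA); rewrite inE xY.
  have YL : Y0 :|: L \subset A0 by rewrite subUset YA LA0.
  have cYL : #|Y0 :|: L| = a by rewrite card_disjointU // cL subnKC.
  exists (Y0 :|: L); first by split=> //; [apply: subsetUl|apply: subset_trans YL AN].
  have := card_split YL; have -> : (Y0 :|: L) :\: A0 = set0 by apply/eqP; rewrite setD_eq0.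
  by rewrite cards0 cYL; lia.
have [L LA cL] : exists2 L : {set V}, L \subset N :\: A0 & #|L| = a - #|A0|.
  by apply: sub_card; have := card_split AN; lia.
have dAL : [disjoint A0 & L].
  by apply: disjointI => x xY /(subsetP LA); rewrite inE xY.
have cAL : #|A0 :|: L| = a by rewrite card_disjointU // cL subnKC.
exists (A0 :|: L).
  split=> //; first by apply: subset_trans YA (subsetUl _ _).
  by rewrite subUset AN; apply: subset_trans LA (subsetDl _ _).
have := card_split (subsetUl A0 L); rewrite cAL; have -> : A0 :\: (A0 :|: L) = set0.
  by apply/eqP; rewrite setD_eq0 subsetUl.
by rewrite cards0; lia.
Qed.

(** Each cell keeps at most an [h]-th of its vertices in [S], so that a copy [h] times as large fits
    into the cell. The loss per cell is at most [w], the deviation allowed by the hypothesis, plus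
    one for rounding. *)
Lemma scale_up (V Cl : finType) (cell : V -> Cl) (S0 : {set V}) h w : 0 < h ->
    (forall a, h * #|[set x in S0 | cell x == a]| <= #|[set x | cell x == a]| + h * w) ->
  exists S S' : {set V}, [/\ S \subset S0, forall a, #|[set x in S' | cell x == a]| = h * #|[set x in S | cell x == a]|,
    #|S'| = h * #|S| & #|S0| <= #|S| + #|Cl| * (w + 1)].
Proof.
move=> h0 hw; pose k a := minn #|[set x in S0 | cell x == a]| (#|[set x | cell x == a]| %/ h).
have /fin_all_exists[L LP] : forall a, exists L : {set V}, L \subset [set x in S0 | cell x == a] /\ #|L| = k a.
  by move=> a; have [|L LS cL] := @sub_card _ [set x in S0 | cell x == a] (k a); [exact: geq_minl|exists L].
have /fin_all_exists[L' LP'] : forall a, exists L : {set V}, L \subset [set x | cell x == a] /\ #|L| = h * k a.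
  move=> a; have [|Z LS cL] := @sub_card _ [set x | cell x == a] (h * k a); last by exists Z.
    rewrite mulnC; apply: leq_trans (_ : #|[set x | cell x == a]| %/ h * h <= _).
      by rewrite leq_mul2r geq_minr orbT.
    exact: leq_trunc_div.
have fib (Z : Cl -> {set V}) a : (forall b, Z b \subset [set x | cell x == b]) ->
    [set x in \bigcup_b Z b | cell x == a] = Z a.
  move=> sub; apply/setP => x; rewrite inE; apply/andP/idP => [[/bigcupP[b _ xb] /eqP xa]|xa].
    by have := subsetP (sub b) x xb; rewrite inE xa => /eqP->.
  by split; [apply/bigcupP; exists a|have := subsetP (sub a) x xa; rewrite inE].
have cardU (Z : {set V}) : #|Z| = \sum_a #|[set x in Z | cell x == a]|.
  under eq_bigr do rewrite card_set_sum; rewrite exchange_big /= -sum1_card; apply: eq_bigr => x xZ.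
  by rewrite (bigD1 (cell x)) //= eqxx big1 // => b; rewrite eq_sym => /negPf->.
have subL b : L b \subset [set x | cell x == b].
  have [sub _] := LP b; apply: subset_trans sub _; by apply/subsetP => x; rewrite !inE => /andP[].
have subL' b : L' b \subset [set x | cell x == b] by have [] := LP' b.
exists (\bigcup_b L b), (\bigcup_b L' b); split.
- apply/bigcupsP => b _; have [sub _] := LP b; apply: subset_trans sub _.
  by apply/subsetP => x; rewrite inE => /andP[].
- by move=> a; rewrite !fib //; have [_ ->] := LP a; have [_ ->] := LP' a.
- rewrite !cardU big_distrr /=; apply: eq_bigr => a _; rewrite !fib //.
  by have [_ ->] := LP a; have [_ ->] := LP' a.
- rewrite !cardU -sum_nat_const -big_split /=; apply: leq_sum => a _; rewrite fib //.
  have [_ ->] := LP a; rewrite /k; have := hw a; set x := #|_|; set y := #|_|; move: x y => x y le.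
  rewrite /minn; case: ifP => _; first exact: leq_addr.
  have := divn_eq y h; have := ltn_pmod y h0; move: (y %/ h) (y %% h) => c r lt yE; nia.
Qed.

Section CutNorm.
Import Order.TTheory GRing.Theory Num.Theory.
Local Open Scope ring_scope.

Section Expansion.
Variables (R : realType) (V : finType) (e : rel V).
Let n : R := #|V|%:R.

Lemma cut_sum_pairs (S T : {set V}) :
  cut_sum (fun x y => (e x y)%:R : R) S T = (pairs e S T)%:R.
Proof.
rewrite /cut_sum pairs_sum natr_sum; apply: eq_bigr => x _.
by rewrite card_set_sum natr_sum; apply: eq_bigr => y _.
Qed.

(** The cells are the atoms of the sides of the rectangles in a weakly regular approximation. The
    rectangle sum depends only on how many vertices of [S] and [T] lie in each atom, hence is
    multiplied by exactly [h ^ 2]; only the two approximation errors remain. *)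
Lemma regular_cells (eps : R) k : 0 < eps -> 1 <= k%:R * eps ^+ 2 ->
  exists cell : V -> {ffun 'I_k -> bool * bool}, forall h (S T S' T' : {set V}),
    (forall a, #|[set x in S' | cell x == a]| = h * #|[set x in S | cell x == a]|)%N ->
    (forall a, #|[set x in T' | cell x == a]| = h * #|[set x in T | cell x == a]|)%N ->
    (pairs e S' T')%:R <= h%:R ^+ 2 * (pairs e S T)%:R + (h%:R ^+ 2 + 1) * eps * n ^+ 2.
Proof.
move=> eps0 keps; pose W (x y : V) : R := (e x y)%:R.
have [|s sk sP] := @weak_regularity R V eps k W eps0.
  apply: le_trans (_ : n ^+ 2 <= _); last first.
    by rewrite -[X in X <= _]mul1r ler_wpM2r // sqr_ge0.
  apply: le_trans (_ : \sum_(x : V) \sum_(y : V) 1 <= _).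
    by apply: ler_sum => x _; apply: ler_sum => y _; rewrite /W; case: (e x y); rewrite /= ?expr1n ?expr0n.
  by rewrite !sumr_const -mulrnA -[X in X <= _]mulr_natr mul1r natrM expr2 cardT -cardE.
pose d0 : R * ({set V} * {set V}) := (0, (set0, set0)).
pose rect (i : 'I_k) := nth d0 s i.
pose cell x : {ffun 'I_k -> bool * bool} := [ffun i => (x \in (rect i).2.1, x \in (rect i).2.2)].
exists cell => h S T S' T' hS hT.
have part (Z Z' Y : {set V}) (q : pred {ffun 'I_k -> bool * bool}) :
    (forall a, #|[set x in Z' | cell x == a]| = h * #|[set x in Z | cell x == a]|)%N ->
    (forall x, (x \in Y) = q (cell x)) -> #|Z' :&: Y| = (h * #|Z :&: Y|)%N.
  move=> hZ qY; have cardU (Z0 : {set V}) : #|Z0 :&: Y| = (\sum_(a | q a) #|[set x in Z0 | cell x == a]|)%N.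
    under eq_bigr do rewrite card_set_sum; rewrite exchange_big /= -sum1_card big_mkcond [RHS]big_mkcond.
    apply: eq_bigr => x _; rewrite inE qY; case: (x \in Z0) => //=; case qx: (q (cell x)).
      by rewrite (bigD1 (cell x)) //= eqxx big1 // => b /andP[_]; rewrite eq_sym => /negPf->.
    by rewrite big1 // => b qb; case: eqP => // xb; rewrite xb qb in qx.
  by rewrite !cardU big_distrr /=; apply: eq_bigr => a _.
have sumE : \sum_(p <- s) p.1 * (#|S' :&: p.2.1|%:R * #|T' :&: p.2.2|%:R) =
    h%:R ^+ 2 * \sum_(p <- s) p.1 * (#|S :&: p.2.1|%:R * #|T :&: p.2.2|%:R).
  rewrite mulr_sumr !(big_nth d0) !big_mkord; apply: eq_bigr => i _.
  have ik : (i < k)%N by apply: leq_trans sk.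
  have -> : #|S' :&: (nth d0 s i).2.1| = (h * #|S :&: (nth d0 s i).2.1|)%N.
    by apply: (part _ _ _ (fun a => (a (Ordinal ik)).1) hS) => x; rewrite ffunE.
  have -> : #|T' :&: (nth d0 s i).2.2| = (h * #|T :&: (nth d0 s i).2.2|)%N.
    by apply: (part _ _ _ (fun a => (a (Ordinal ik)).2) hT) => x; rewrite ffunE.
  by rewrite !natrM; ring.
have := sP S' T'; have := sP S T; rewrite !cut_sum_pairs sumE !ler_norml -/n.
move: (\sum_(p <- s) _) => X /andP[h1 h2] /andP[h3 h4].
have h5 : h%:R ^+ 2 * X <= h%:R ^+ 2 * ((pairs e S T)%:R + eps * n ^+ 2).
  by apply: ler_wpM2l; [apply: sqr_ge0|lra].
nra.
Qed.

(** At least [#|S| + nu * n] vertices have [nu * n] neighbours in [S], and a set [T] with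
    [#|S| + #|T|] at least [n - nu / 2 * n] contains [nu / 2 * n] of them. *)
Lemma expander_pairs (nu tau : R) (S T : {set V}) : 0 < nu ->
    (forall S : {set V}, tau * n <= #|S|%:R <= (1 - tau) * n ->
       #|S|%:R + nu * n <= #|[set v | nu * n <= #|[set w in S | e v w]|%:R]|%:R) -> symmetric e ->
    tau * n <= #|S|%:R -> #|S|%:R <= (1 - tau) * n -> n <= #|S|%:R + #|T|%:R + nu / 2 * n ->
  nu ^+ 2 / 2 * n ^+ 2 <= (pairs e S T)%:R.
Proof.
move=> nu0 rob es S1 S2 ST; have := rob S; rewrite S1 S2 => /(_ isT).
set RN := [set v | _] => RNS; have n0 : 0 <= n by exact: ler0n.
have cT : #|T|%:R + #|RN|%:R <= n + #|T :&: RN|%:R.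
  by rewrite /n -!natrD ler_nat -cardsUI leq_add2r max_card.
have TRN : nu / 2 * n <= #|T :&: RN|%:R by lra.
apply: le_trans (_ : #|T :&: RN|%:R * (nu * n) <= _).
  have : nu / 2 * n * (nu * n) <= #|T :&: RN|%:R * (nu * n).
    by apply: ler_wpM2r => //; rewrite mulr_ge0 // ltW.
  by apply: le_trans; rewrite le_eqVlt; apply/orP; left; apply/eqP; field.
apply: le_trans (_ : (pairs e S (T :&: RN))%:R <= _); last first.
  by rewrite ler_nat pairs_sub // subsetIl.
rewrite pairs_sum_r natr_sum mulr_natl -sumr_const; apply: ler_sum => y.
rewrite inE => /andP[_]; rewrite inE => /le_trans; apply; rewrite ler_nat.
by apply: subset_leq_card; apply/subsetP => x; rewrite !inE es.
Qed.

End Expansion.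

End CutNorm.

Section RandomLabels.
Import Order.TTheory GRing.Theory Num.Theory.
Local Open Scope ring_scope.

Lemma card_set_type (X : finType) : #|{: {set X}}| = (2 ^ #|X|)%N.
Proof.
have := card_powerset [set: X]; rewrite cardsT => <-; rewrite -cardsT; apply: eq_card => A.
by rewrite !inE subsetT.
Qed.

Section Labels.
Variables (R : realType) (V : finType) (e : rel V).
Let n : R := #|V|%:R.

(* [S] and [T] are enlarged [h] times cell by cell, up to the [loss], which does
   not change the edge density by weak regularity. *)
Lemma cell_expansion (Cl : finType) (cell : V -> Cl) (nu tau : R) (P1 P2 Mv S T : {set V}) (h w : nat) :
    0 < nu -> symmetric e -> (0 < h)%N ->
    (forall S : {set V}, tau * n <= #|S|%:R <= (1 - tau) * n ->
       #|S|%:R + nu * n <= #|[set v | nu * n <= #|[set w in S | e v w]|%:R]|%:R) ->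
    (forall (S T S' T' : {set V}),
      (forall a, #|[set x in S' | cell x == a]| = h * #|[set x in S | cell x == a]|)%N ->
      (forall a, #|[set x in T' | cell x == a]| = h * #|[set x in T | cell x == a]|)%N ->
      (pairs e S' T')%:R <= h%:R ^+ 2 * (pairs e S T)%:R + (h%:R ^+ 2 + 1) * (nu ^+ 2 / (16 * h%:R ^+ 2)) * n ^+ 2) ->
    (forall a, h * #|[set x in P1 :\: Mv | cell x == a]| <= #|[set x | cell x == a]| + h * w)%N ->
    (forall a, h * #|[set x in P2 :\: Mv | cell x == a]| <= #|[set x | cell x == a]| + h * w)%N ->
    S \subset P1 -> T \subset P2 ->
    let loss : R := (h * (#|Mv| + #|Cl| * (w + 1)))%:R in
    tau * n + loss <= h%:R * #|S|%:R -> h%:R * #|S|%:R <= (1 - tau) * n ->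
    n + 2 * loss <= h%:R * (#|S|%:R + #|T|%:R) + nu / 2 * n ->
  3 / 8 * nu ^+ 2 * n ^+ 2 <= h%:R ^+ 2 * (pairs e S T)%:R.
Proof.
move=> nu0 es h0 rob cellP w1 w2 SP TP loss l1 l2 l3.
have sub (X P : {set V}) a : X \subset P -> (#|[set x in X :\: Mv | cell x == a]| <= #|[set x in P :\: Mv | cell x == a]|)%N.
  move=> XP; apply: subset_leq_card; apply/subsetP => x; rewrite !inE => /andP[/andP[-> xX] ->].
  by rewrite (subsetP XP).
have [|S1 [S' [S1S S'S cS' cS]]] := @scale_up V Cl cell (S :\: Mv) h w h0.
  by move=> a; apply: leq_trans (w1 a); rewrite leq_mul2l sub ?orbT.
have [|T1 [T' [T1T T'T cT' cT]]] := @scale_up V Cl cell (T :\: Mv) h w h0.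
  by move=> a; apply: leq_trans (w2 a); rewrite leq_mul2l sub ?orbT.
have h0R : 0 < (h%:R : R) by rewrite ltr0n.
have leD (X : {set V}) : (#|X| <= #|X :\: Mv| + #|Mv|)%N.
  by rewrite -(cardsID Mv X) addnC leq_add2l subset_leq_card // subsetIr.
have loseE (X X1 : {set V}) : (#|X :\: Mv| <= #|X1| + #|Cl| * (w + 1))%N -> h%:R * #|X|%:R <= h%:R * #|X1|%:R + loss :> R.
  move=> le; rewrite /loss -!natrM -natrD ler_nat -mulnDr leq_mul2l; apply/orP; right.
  by apply: leq_trans (leD X) _; rewrite addnC addnCA leq_add2l.
have cS'R : #|S'|%:R = h%:R * #|S1|%:R :> R by rewrite cS' natrM.
have cT'R : #|T'|%:R = h%:R * #|T1|%:R :> R by rewrite cT' natrM.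
have s1 := loseE S S1 cS; have t1 := loseE T T1 cT.
have S1le : h%:R * #|S1|%:R <= h%:R * #|S|%:R :> R.
  rewrite ler_pM2l // ler_nat subset_leq_card //; apply: subset_trans S1S (subsetDl _ _).
have big : nu ^+ 2 / 2 * n ^+ 2 <= (pairs e S' T')%:R.
  apply: (expander_pairs nu0 rob es); rewrite ?cS'R ?cT'R; [lra|lra|].
  by move: s1 t1 l3; rewrite mulrDr -/n; move: (h%:R * _) (h%:R * _) (h%:R * _) (h%:R * _) => a b c d; lra.
have := cellP S1 T1 S' T' S'S T'T.
have le : h%:R ^+ 2 * (pairs e S1 T1)%:R <= h%:R ^+ 2 * (pairs e S T)%:R :> R.
  rewrite ler_wpM2l ?sqr_ge0 // ler_nat; apply: pairs_sub.
    by apply: subset_trans S1S (subsetDl _ _).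
  by apply: subset_trans T1T (subsetDl _ _).
(* This error takes [1 / 8] from the constant [1 / 2] of [expander_pairs] and leaves [3 / 8]. *)
have epsle : (h%:R ^+ 2 + 1) * (nu ^+ 2 / (16 * h%:R ^+ 2)) * n ^+ 2 <= nu ^+ 2 / 8 * n ^+ 2.
  apply: ler_wpM2r; first exact: sqr_ge0.
  have h1 : 1 <= (h%:R ^+ 2 : R) by rewrite -natrX ler1n expn_gt0 h0.
  rewrite mulrA ler_pdivrMr; last by rewrite mulr_gt0 // exprn_gt0.
  have nn : 0 <= nu ^+ 2 by exact: sqr_ge0.
  by move: h1 nn; move: (h%:R ^+ 2) (nu ^+ 2) => a b h1 nn; nra.
move: big; rewrite -/n => big h3; lra.
Qed.

(** A label consists of a block and a half. Control over all sets of labels at once covers both a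
    single block of a half (one label) and a whole half (all labels with the same second
    component). *)
Lemma vertex_labels (xi : R) (N : {set V}) (Cl T : finType) (cell : V -> Cl) :
    0 < xi <= 1 -> (0 < #|T|)%N ->
    #|{: ((V + Cl) + unit) * {set (T * bool)}}|%:R * (2 * expR (- (xi ^+ 2 / 8 * n))) < 1 ->
  exists lab : V -> T * bool, forall Lb : {set (T * bool)},
    [/\ forall v, `|#|[set w in N | e v w && (lab w \in Lb)]|%:R
          - #|[set w in N | e v w]|%:R * (#|Lb|%:R / #|{: T * bool}|%:R)| <= xi * n,
        forall a, `|#|[set w in N | (cell w == a) && (lab w \in Lb)]|%:R
          - #|[set w in N | cell w == a]|%:R * (#|Lb|%:R / #|{: T * bool}|%:R)| <= xi * n &
        `|#|[set w in N | lab w \in Lb]|%:R - #|N|%:R * (#|Lb|%:R / #|{: T * bool}|%:R)| <= xi * n].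
Proof.
move=> xi01 T0 small.
pose Is (j : (((V + Cl) + unit) * {set (T * bool)})%type) : {set V} := match j.1 with
  | inl (inl v) => [set w in N | e v w] | inl (inr a) => [set w in N | cell w == a] | inr _ => N end.
have [|j||lab labP] := @select R V (T * bool)%type (((V + Cl) + unit) * {set (T * bool)})%type Is (fun j => j.2)
    (fun=> #|V|) xi xi01.
- by rewrite card_prod card_bool muln_gt0 T0.
- exact: max_card.
- by rewrite sumr_const -[X in X < _]mulr_natl.
exists lab => Lb; split=> [v|a|].
- have := labP (inl (inl v), Lb); rewrite /Is /=.
  by rewrite (_ : [set i in [set w in N | e v w] | lab i \in Lb] = [set w in N | e v w && (lab w \in Lb)]) //;
    apply/setP => w; rewrite !inE andbA.
- have := labP (inl (inr a), Lb); rewrite /Is /=.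
  by rewrite (_ : [set i in [set w in N | cell w == a] | lab i \in Lb] = [set w in N | (cell w == a) && (lab w \in Lb)]) //;
    apply/setP => w; rewrite !inE andbA.
- exact: (labP (inr tt, Lb)).
Qed.

(** Labels on ordered pairs split the edges between the halves into reserved graphs. The [4 ^ n]
    pairs of sets [S], [T] are affordable because their deviation is measured against [n ^+ 2]. *)
Lemma pair_labels (xi : R) (g : nat) (A B : {set V}) (T : finType) (blk : V -> T) :
    0 < xi <= 1 -> (0 < g)%N ->
    (2 * #|V| * #|T| * 2 ^ g)%:R * (2 * expR (- (xi ^+ 2 / 8 * n))) +
      (4 ^ #|V| * 2 ^ g)%:R * (2 * expR (- (xi ^+ 2 / 8 * n ^+ 2))) < 1 ->
  exists ql : V -> V -> 'I_g, forall Lq : {set 'I_g},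
    [/\ forall w d, `|#|[set y in [set y in B | blk y == d] | e w y && (ql w y \in Lq)]|%:R
          - #|[set y in [set y in B | blk y == d] | e w y]|%:R * (#|Lq|%:R / g%:R)| <= xi * n,
        forall y c, `|#|[set w in [set w in A | blk w == c] | e w y && (ql w y \in Lq)]|%:R
          - #|[set w in [set w in A | blk w == c] | e w y]|%:R * (#|Lq|%:R / g%:R)| <= xi * n &
        forall S T, `|(pairs [rel x y | e x y && (ql x y \in Lq)] S T)%:R
          - (pairs e S T)%:R * (#|Lq|%:R / g%:R)| <= xi * n ^+ 2].
Proof.
move=> xi01 g0 small.
pose Is (j : (((V * T + V * T) + {set V} * {set V}) * {set 'I_g})%type) : {set V * V} := match j.1 with
  | inl (inl p) => [set q | [&& q.1 == p.1, (q.2 \in B) && (blk q.2 == p.2) & e q.1 q.2]]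
  | inl (inr p) => [set q | [&& q.2 == p.1, (q.1 \in A) && (blk q.1 == p.2) & e q.1 q.2]]
  | inr p => [set q | [&& q.1 \in p.1, q.2 \in p.2 & e q.1 q.2]] end.
pose M (j : (((V * T + V * T) + {set V} * {set V}) * {set 'I_g})%type) := match j.1 with
  | inl _ => #|V| | inr _ => (#|V| * #|V|)%N end.
have cl w (S : {set V}) (q : rel V) : #|[set p : V * V | [&& p.1 == w, p.2 \in S & q p.1 p.2]]| = #|[set y in S | q w y]|.
  have I : injective (fun y : V => (w, y)) by move=> y y' [].
  rewrite -(card_imset _ I); apply: eq_card => -[w' y]; rewrite inE /=; apply/idP/imsetP => [/and3P[/eqP-> yS qy]|[y' + [-> ->]]].
    by exists y; rewrite // inE yS.
  by rewrite inE eqxx => /andP[-> ->].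
have cr y (S : {set V}) (q : rel V) : #|[set p : V * V | [&& p.2 == y, p.1 \in S & q p.1 p.2]]| = #|[set w in S | q w y]|.
  have I : injective (fun w : V => (w, y)) by move=> w w' [].
  rewrite -(card_imset _ I); apply: eq_card => -[w y']; rewrite inE /=; apply/idP/imsetP => [/and3P[/eqP-> yS qy]|[w' + [-> ->]]].
    by exists w; rewrite // inE yS.
  by rewrite inE eqxx => /andP[-> ->].
have [|j||ql qlP] := @select R (V * V)%type 'I_g (((V * T + V * T) + {set V} * {set V}) * {set 'I_g})%type Is (fun j => j.2)
    M xi xi01.
- by rewrite card_ord.
- rewrite /Is /M; case: j => -[[[w d]|[y c]]|[S S']] Lq /=.
  + apply: leq_trans (_ : #|[set p : V * V | [&& p.1 == w, p.2 \in [set y in B | blk y == d] & e p.1 p.2]]| <= _)%N.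
      by apply: subset_leq_card; apply/subsetP => p; rewrite !inE.
    by rewrite cl max_card.
  + apply: leq_trans (_ : #|[set p : V * V | [&& p.2 == y, p.1 \in [set y in A | blk y == c] & e p.1 p.2]]| <= _)%N.
      by apply: subset_leq_card; apply/subsetP => p; rewrite !inE.
    by rewrite cr max_card.
  + by apply: leq_trans (max_card _) _; rewrite card_prod.
- apply: le_lt_trans small; rewrite (eq_bigr (fun j : ((V * T + V * T) + {set V} * {set V}) * {set 'I_g} =>
      (fun a (_ : {set 'I_g}) => match a with inl _ => 2 * expR (- (xi ^+ 2 / 8 * n)) | inr _ => 2 * expR (- (xi ^+ 2 / 8 * n ^+ 2)) end) j.1 j.2)); last first.
    by move=> [[a|a] b] _; rewrite /M //= natrM -expr2.
  rewrite -(pair_bigA _ (fun a (_ : {set 'I_g}) => match a with inl _ => 2 * expR (- (xi ^+ 2 / 8 * n)) | inr _ => 2 * expR (- (xi ^+ 2 / 8 * n ^+ 2)) end)) /=.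
  rewrite exchange_big /= sumr_const big_sumType /= !sumr_const.
  rewrite !cardT -!cardE !card_set_type !card_prod card_ord fintype.card_sum !card_prod !card_set_type.
  move: (2 * expR _) (2 * expR _) => p1 p2.
  rewrite mulrnDl -!mulrnA -[p1 *+ _]mulr_natl -[p2 *+ _]mulr_natl.
  have -> : ((#|V| * #|T| + #|V| * #|T|) * 2 ^ g = 2 * #|V| * #|T| * 2 ^ g)%N by rewrite addnn -mul2n mulnA.
  have -> : (2 ^ #|V| * 2 ^ #|V| * 2 ^ g = 4 ^ #|V| * 2 ^ g)%N by rewrite -expnMn.
  exact: lexx.
exists (fun x y => ql (x, y)) => Lq; split=> [w d|y c|S S'].
- have := qlP (inl (inl (w, d)), Lq); rewrite /Is /M /= card_ord.
  rewrite -(cl w [set y in B | blk y == d] (fun x y => e x y && (ql (x, y) \in Lq))).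
  rewrite -(cl w [set y in B | blk y == d] e).
  rewrite (_ : [set i in _ | _] = [set p | [&& p.1 == w, p.2 \in [set y in B | blk y == d] & e p.1 p.2 && (ql (p.1, p.2) \in Lq)]]).
    have -> : [set q : V * V | [&& q.1 == w, (q.2 \in B) && (blk q.2 == d) & e q.1 q.2]] =
      [set p | [&& p.1 == w, p.2 \in [set y in B | blk y == d] & e p.1 p.2]] by apply/setP => p; rewrite !inE.
    exact: id.
  by apply/setP => -[x y]; rewrite !inE /= !andbA.
- have := qlP (inl (inr (y, c)), Lq); rewrite /Is /M /= card_ord.
  rewrite -(cr y [set w in A | blk w == c] (fun x y => e x y && (ql (x, y) \in Lq))).
  rewrite -(cr y [set w in A | blk w == c] e).
  rewrite (_ : [set i in _ | _] = [set p | [&& p.2 == y, p.1 \in [set w in A | blk w == c] & e p.1 p.2 && (ql (p.1, p.2) \in Lq)]]).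
    have -> : [set q : V * V | [&& q.2 == y, (q.1 \in A) && (blk q.1 == c) & e q.1 q.2]] =
      [set p | [&& p.2 == y, p.1 \in [set w in A | blk w == c] & e p.1 p.2]] by apply/setP => p; rewrite !inE.
    exact: id.
  by apply/setP => -[x y']; rewrite !inE /= !andbA.
- have := qlP (inr (S, S'), Lq); rewrite /Is /M /= card_ord /pairs natrM expr2.
  rewrite (_ : [set i in _ | _] = [set p | [&& p.1 \in S, p.2 \in S' & e p.1 p.2 && (ql (p.1, p.2) \in Lq)]]) //.
  by apply/setP => -[x y']; rewrite !inE /= !andbA.
Qed.

End Labels.

End RandomLabels.

(** * Low degrees and tokens *)

Section VertexClasses.
Variables (V : finType) (e : rel V) (D l : nat).
Hypotheses (es : symmetric e) (ei : irreflexive e) (dD : forall w, #|nb e w| <= D).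
Hypothesis ore : forall u v, e u v -> D + 2 <= #|nb e u| + #|nb e v|.
Hypothesis sparse : forall Z : {set V}, inner e Z <= 2 * (D * #|Z|./2).
Let d w := #|nb e w|.

(* If the vertices of degree at least [9 D / 20] are odd in number, one of them
   of degree at most [11 D / 20] is moved to [U] whenever there is one. *)
Lemma vertex_classes : exists U : {set V},
  [/\ forall u v, u \in U -> v \in U -> ~~ e u v,
      forall u, u \in U -> 20 * d u <= 11 * D &
      (~~ odd #|~: U| /\ forall w, w \notin U -> 9 * D <= 20 * d w) \/
      (odd #|~: U| /\ (forall w, w \notin U -> 11 * D < 20 * d w) /\ forall u, u \in U -> 20 * d u < 9 * D)].
Proof.
pose U0 := [set v | 20 * d v < 9 * D].
(* The bound says that the degree sum is less than [D + 2], multiplied by 20. *)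
have ind u v : 20 * (d u + d v) <= 20 * D + 39 -> ~~ e u v.
  by move=> h; apply/negP => /ore; rewrite -/(d u) -/(d v); lia.
have [ev|od] := boolP (~~ odd #|~: U0|).
  exists U0; split=> [u v|u|]; rewrite ?inE.
  - by move=> h1 h2; apply: ind; lia.
  - by move=> h1; lia.
  - by left; split=> // w; rewrite inE -leqNgt.
have [/existsP[v /andP[vU vm]]|/existsPn no] := boolP [exists v, (v \notin U0) && (20 * d v <= 11 * D)].
  exists (v |: U0); split.
  - move=> u w; rewrite !inE => /orP[/eqP->|h1] /orP[/eqP->|h2].
    + by rewrite ei.
    + by apply: ind; lia.
    + by apply: ind; lia.
    + by apply: ind; lia.
  - by move=> u; rewrite !inE => /orP[/eqP->//|h]; lia.
  - left; split.
      have h : #|~: U0| = #|~: (v |: U0)|.+1.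
        rewrite (cardsD1 v) in_setC vU add1n; congr _.+1; apply: eq_card => x.
        by rewrite !inE negb_or.
      by move: od; rewrite negbK h.
    by move=> w; rewrite !inE negb_or => /andP[_]; rewrite -leqNgt.
exists U0; split=> [u v|u|]; rewrite ?inE.
- by move=> h1 h2; apply: ind; lia.
- by move=> h1; lia.
- right; split; first by rewrite -[odd _]negbK.
  split=> [w wU|u]; last by rewrite inE.
  by have := no w; rewrite wU /= -ltnNge.
Qed.

Section Tokens.
Variable U : {set V}.
Let W := ~: U.
Let E := (V * (V + 'I_D))%type.
Let H : {set E} := tokens e D U W.
Let bt := @token_end V D.
Hypothesis Uind : forall u v, u \in U -> v \in U -> ~~ e u v.
Hypothesis Ud : forall u, u \in U -> 20 * d u <= 11 * D.
Hypothesis cases : (~~ odd #|W| /\ forall w, w \in W -> 9 * D <= 20 * d w) \/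
      (odd #|W| /\ (forall w, w \in W -> 11 * D < 20 * d w) /\ forall u, u \in U -> 20 * d u < 9 * D).
Hypotheses (Ul : #|U| <= l) (lD : 400 * l <= D) (D1 : 100 <= D).

Let t w := #|[set h in H | h.1 == w]|.
Let tE w : w \in W -> t w = #|nb e w :&: U| + (D - d w). Proof. exact: tokens_at. Qed.
Let tW w : w \in W -> t w + #|nb e w :&: W| = D.
Proof.
move=> wW; rewrite tE //; have := dD w; rewrite -/(d w).
have : d w = #|nb e w :&: U| + #|nb e w :&: W|.
  by rewrite /d -(cardsID U) setDE.
lia.
Qed.
Let t_le w : w \in W -> t w + d w <= D + l.
Proof.
move=> wW; rewrite tE //; have := dD w; rewrite -/(d w).
have : #|nb e w :&: U| <= l by apply: leq_trans Ul; apply: subset_leq_card; apply: subsetIr.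
lia.
Qed.
Let tN w : w \notin W -> t w = 0.
Proof.
move=> wW; rewrite /t eq_card0 // => h; rewrite !inE; apply/negP => /andP[/andP[hW _] /eqP hw].
by move: wW; rewrite -hw inE hW.
Qed.
Let T_total : #|H| = \sum_(w in W) t w.
Proof.
have -> : \sum_(w in W) t w = \sum_w t w.
  by rewrite [LHS]big_mkcond; apply: eq_bigr => w _; case: ifP => // /negbT /tN->.
rewrite /t; under [RHS]eq_bigr do rewrite card_set_sum.
rewrite exchange_big /= -sum1_card; apply: eq_bigr => h hH.
by rewrite (bigD1 h.1) //= eqxx big1 // => w; rewrite eq_sym => /negPf->.
Qed.
Let nbZ (Z : {set V}) w : [set v in Z | e w v] = nb e w :&: Z.
Proof. by apply/setP => v; rewrite !inE andbC. Qed.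
(** Through this count the absence of overfull subgraphs, an upper bound on [inner], becomes a lower
    bound on the number of tokens. *)
Let T_inner : #|H| + inner e W = D * #|W|.
Proof.
rewrite T_total inner_sum -big_split /= mulnC -sum_nat_const; apply: eq_bigr => w wW.
by rewrite nbZ tW.
Qed.
Let innerD1 w (Z : {set V}) : w \in Z -> inner e Z = inner e (Z :\ w) + 2 * #|nb e w :&: Z|.
Proof.
move=> wZ; rewrite !inner_sum (big_setD1 w) //=.
have -> : \sum_(x in Z :\ w) #|[set v in Z | e x v]| = \sum_(x in Z :\ w) (#|[set v in Z :\ w | e x v]| + e x w).
  apply: eq_bigr => x _; rewrite [LHS](cardsD1 w) !inE wZ /= addnC; congr (_ + _).
  by apply: eq_card => v; rewrite !inE; case: (v == w).
rewrite big_split /= nbZ.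
have -> : \sum_(x in Z :\ w) e x w = #|nb e w :&: Z|.
  rewrite -card_set_sum; apply: eq_card => x; rewrite !inE es.
  by case: (eqVneq x w) => [->|_] /=; [rewrite ei|rewrite andbC].
lia.
Qed.
Let even_inner Z : ~~ odd (inner e Z).
Proof. by rewrite inner_half // mul2n odd_double. Qed.
Let bfib_u u : #|[set h in H | bt h == inl u]| <= if u \in U then d u else 0.
Proof.
case: ifP => uU; last first.
  rewrite leqn0 cards_eq0; apply/eqP/setP => -[w [v|k]]; rewrite !inE /bt /token_end /= ?andbF //.
  by apply/negP => /andP[/and3P[_ vU _] /eqP[vu]]; rewrite vu uU in vU.
apply: (@card_le_rel _ _ _ _ (fun w h => h == (w, inl u))).
  move=> [w [v|k]]; rewrite !inE /bt /token_end /= ?andbF // => /andP[/and3P[_ _ ewv] /eqP[vu]].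
  by exists w; rewrite -?vu // inE es.
by move=> w h h' /eqP-> /eqP->.
Qed.
Let bfib_r x : #|[set h in H | bt h == inr x]| <= 1.
Proof.
rewrite -(cards1 x); apply: subset_leq_card; apply/subsetP => -[w [v|k]]; rewrite !inE /bt /token_end /= ?andbF //.
by case/andP=> _ /eqP[<-].
Qed.
Let sum_single (k0 : nat) : (forall w, t w <= k0) -> (forall u, u \in U -> d u <= k0) -> 1 <= k0 ->
  forall y, #|[set h in H | bt h == y]| <= k0.
Proof.
move=> _ dk k1 [u|x]; last exact: leq_trans (bfib_r x) k1.
by apply: leq_trans (bfib_u u) _; case: ifP => // /dk.
Qed.

(** If [#|W|] is even, sparseness of [W] with one vertex removed or added shows that no vertex holds
    more than half of the tokens, as [even_classes] requires; if it is odd, sparseness of [W] itself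
    gives the [D] tokens required by [odd_classes]. The set [I1] of colours with the fewest tokens
    is the supply for the colours left to Koenig's theorem, and the last clause leaves room for the
    edges between other vertices of small degree. *)
Lemma tokens_exist : exists c : E -> nat,
  [/\ [/\ forall h, h \in H -> c h < D, proper_on fst bt H c & forall i, ~~ odd (#|W| + #|cls H c i|) || (D <= i)],
      forall i, #|cls H c i| <= 5 \/ (#|cls H c i| - 1) * (D %/ 4) <= 2 * #|H|,
      exists I1 : {set 'I_D}, D <= 6 * #|I1| /\ forall i : 'I_D, i \in I1 -> #|cls H c i| = odd #|W| &
      forall x x', x \in W -> x' \in W -> #|[set i | tk c H x i || tk c H x' i]| * 100 <= 93 * D].
Proof.
pose mw := \max_(w in W) t w; pose mu := \max_(u in U) d u.
have tw w : t w <= mw.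
  have [wW|/tN->//] := boolP (w \in W); exact: (@leq_bigmax_cond _ (mem W) t w).
have du u : u \in U -> d u <= mu by move=> uU; exact: (@leq_bigmax_cond _ (mem U) d u).
have mwP k : (forall w, w \in W -> t w <= k) -> mw <= k by move=> h; apply/bigmax_leqP.
have muP k : (forall u, u \in U -> d u <= k) -> mu <= k by move=> h; apply/bigmax_leqP.
have tkt x c : proper_on fst bt H c -> #|[set i | tk c H x i]| <= t x.
  move=> _; apply: (@card_le_rel _ _ _ _ (fun (h : E) (i : 'I_D) => c h == i)).
    move=> i; rewrite inE => /existsP[h /and3P[hH /eqP h1 ch]]; exists h => //.
    by rewrite inE hH h1 eqxx.
  by move=> h i i' /eqP h1 /eqP h2; apply: ord_inj; rewrite -h1.
have c0 c k i : (forall h, h \in H -> c h < k) -> k <= i -> #|cls H c i| = 0.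
  move=> ck ki; apply: eq_card0 => h; rewrite inE; apply/negP => /andP[/ck + /eqP ci].
  by rewrite ci ltnNge ki.
case: cases => [[Wev dW]|[Wod [dW dU]]].
  have Tev : ~~ odd #|H|.
    have := congr1 odd T_inner; rewrite oddD oddM (negPf Wev) andbF (negPf (even_inner _)).
    by case: (odd #|H|).
  have half_W : 2 * (D * #|W|./2) = D * #|W| by rewrite mulnCA mul2n even_halfK.
  have T2t w : w \in W -> 2 * t w <= #|H|.
    move=> wW; have cW : #|W| = 2 * #|W :\ w|./2 + 2.
      have cW : #|W| = #|W :\ w|.+1 by rewrite (cardsD1 w) wW.
      have od : odd #|W :\ w| by move: Wev; rewrite cW /= negbK.
      by have := odd_double_half #|W :\ w|; rewrite od cW -mul2n; move: #|_| #|_|./2 => x y; lia.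
    have := sparse (W :\ w); have := innerD1 wW; have := T_inner; have := tW wW.
    have : D * #|W| = 2 * (D * #|W :\ w|./2) + 2 * D by rewrite [in LHS]cW mulnDr mulnCA [D * 2]mulnC.
    move: (inner e W) (inner e (W :\ w)) #|nb e w :&: W| (D * #|W|) (D * _./2) #|H| (t w) => a b c x y z u; lia.
  have T2d u : u \in U -> 2 * d u <= #|H|.
    move=> uU; have uW : u \notin W by rewrite inE negbK.
    have := sparse (u |: W); have uZ : u \in u |: W by rewrite setU11.
    rewrite (innerD1 uZ) setU1K // cardsU1 uW add1n.
    have -> : (#|W|.+1)./2 = #|W|./2 by rewrite -uphalfE uphalf_half (negPf Wev).
    have -> : #|nb e u :&: (u |: W)| = d u.
      apply: eq_card => v; rewrite !inE; case euv: (e u v) => //=; apply/orP; right.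
      by apply/negP => vU; have := Uind uU vU; rewrite euv.
    have := T_inner; rewrite half_W; move: (inner e W) (D * #|W|) (d u) #|H| => a b c x; lia.
  (* The fibres need only the first maximum. Classes have about [2 * #|H| / k] tokens at most, so
     [k] is raised to keep them small, as far as [2 * k <= #|H|] allows. *)
  pose k := maxn (maxn mw mu) (minn #|H|./2 (D %/ 4)).
  have Th : 2 * #|H|./2 = #|H| by rewrite mul2n even_halfK.
  have kT : 2 * k <= #|H|.
    have h1 : mw <= #|H|./2 by apply: mwP => w /T2t; rewrite -{1}Th leq_pmul2l.
    have h2 : mu <= #|H|./2 by apply: muP => w /T2d; rewrite -{1}Th leq_pmul2l.
    by rewrite -Th leq_pmul2l // /k !geq_max h1 h2 geq_minl.
  have kD : 20 * k <= 11 * D + 20 * l.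
    have h1 : mw <= (11 * D + 20 * l) %/ 20.
      by apply: mwP => w wW; rewrite leq_divRL //; have := t_le wW; have := dW w wW; lia.
    have h2 : mu <= (11 * D + 20 * l) %/ 20.
      by apply: muP => u uU; rewrite leq_divRL //; have := Ud uU; lia.
    have h3 : minn #|H|./2 (D %/ 4) <= (11 * D + 20 * l) %/ 20.
      by apply: leq_trans (geq_minr _ _) _; rewrite leq_divRL //; have := leq_trunc_div D 4; lia.
    rewrite mulnC -leq_divRL // /k !geq_max h1 h2 h3 //.
  have k0H : k = 0 -> #|H| = 0.
    move=> k0; have := leq_maxr (maxn mw mu) (minn #|H|./2 (D %/ 4)); rewrite -/k k0.
    have D4 : 0 < D %/ 4 by rewrite divn_gt0 //; lia.
    by move: Th D4; move: (D %/ 4) #|H| #|H|./2 => x y z; lia.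
  have [||c [ck pc cev csz]] := even_classes Tev kT (a := fst) (b := bt).
  - by move=> w; apply: leq_trans (tw w) _; rewrite /k !leq_max leqnn.
  - have [/k0H H0 y|kpos] := posnP k.
      apply: leq_trans (_ : #|H| <= _); last by rewrite H0.
      by apply: subset_leq_card; apply/subsetP => h; rewrite inE => /andP[].
    apply: sum_single => // [w|u uU].
      by apply: leq_trans (tw w) _; rewrite /k !leq_max leqnn.
    by apply: leq_trans (du u uU) _; rewrite /k !leq_max leqnn !orbT.
  have kkD : 100 * (k + k./2) <= 83 * D by have := half_leq (leqnn k); have := odd_double_half k; lia.
  have kkD' : k + k./2 <= D by lia.
  exists c; split.
  - split=> // [h hH|i]; first by apply: leq_trans (ck h hH) _; lia.
    by rewrite oddD (negPf Wev) (negPf (cev i)).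
  - move=> i; have [/k0H H0|kpos] := posnP k.
      left; apply: leq_trans (_ : #|H| <= _); last by rewrite H0.
      by apply: subset_leq_card; apply/subsetP => h; rewrite inE => /andP[].
    have := csz i; have : minn #|H|./2 (D %/ 4) <= k := leq_maxr _ _.
    move: kpos Th; move: #|cls H c i| #|H| #|H|./2 (D %/ 4) => sz T T2 D4 kp Th mn le.
    have [le4|lt4] := leqP D4 k; first by right; nia.
    left; have T2k : T2 <= k by lia.
    by rewrite leqNgt; apply/negP => h; nia.
  - exists (~: [set i : 'I_D | i < k + k./2]); split.
      by have := cardsC [set i : 'I_D | i < k + k./2]; rewrite card_ltn_ord // card_ord; move: #|_| => x; lia.
    by move=> i; rewrite !inE -leqNgt (negPf Wev) => /(c0 _ _ _ ck)->.
  - move=> x x' _ _; apply: leq_trans (_ : (k + k./2) * 100 <= _); last by lia.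
    rewrite leq_mul2r -(card_ltn_ord kkD') /=; apply: subset_leq_card; apply/subsetP => i; rewrite !inE.
    by case/orP=> /existsP[h /and3P[hH _ /eqP<-]]; apply: ck.
have Wh : #|W| = (2 * #|W|./2).+1.
  by rewrite mul2n -[LHS]odd_double_half Wod.
have DH : D <= #|H|.
  have := sparse W; have := T_inner; rewrite [X in D * X]Wh mulnS.
  by rewrite [D * (2 * _)]mulnCA; move: (2 * _) (inner e W) #|H| => x y z; lia.
have par : odd #|H| = odd D.
  have := congr1 odd T_inner; rewrite oddD oddM Wod andbT (negPf (even_inner _)).
  by case: (odd #|H|).
pose k := maxn (maxn mw mu) (D %/ 4).
(* Here the lower bound [11 / 20] for degrees in [W] enters: two vertices together hold tokens of at
   most [93 / 100] of the colours. *)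
have tD w : w \in W -> 20 * t w <= 9 * D + 20 * l.
  by move=> wW; have := t_le wW; have := dW w wW; lia.
have kD : 2 * k <= D.
  have h1 : mw <= D %/ 2.
    by apply: mwP => w wW; rewrite leq_divRL //; have := tD w wW; lia.
  have h2 : mu <= D %/ 2.
    by apply: muP => u uU; rewrite leq_divRL //; have := dU u uU; lia.
  have h3 : D %/ 4 <= D %/ 2 by rewrite leq_divRL //; have := leq_trunc_div D 4; lia.
  by rewrite mulnC -leq_divRL // /k !geq_max h1 h2 h3.
have D4 : 0 < D %/ 4 by rewrite divn_gt0 //; lia.
have kpos : 0 < k by rewrite /k leq_max D4 orbT.
have [||c [ck pc cod csing csz]] := odd_classes par DH kD kpos (a := fst) (b := bt).
- by move=> w; apply: leq_trans (tw w) _; rewrite /k !leq_max leqnn.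
- apply: sum_single => // [w|u uU].
    by apply: leq_trans (tw w) _; rewrite /k !leq_max leqnn.
  by apply: leq_trans (du u uU) _; rewrite /k !leq_max leqnn !orbT.
exists c; split.
- split=> // i; have [iD|] := ltnP i D; last by rewrite orbT.
  by rewrite oddD Wod cod.
- move=> i; right; have := csz i; have : D %/ 4 <= k := leq_maxr _ _.
  by move: #|cls H c i| #|H| (D %/ 4) => sz T D4' h1 h2; nia.
- exists (~: [set i : 'I_D | i < k]); split.
    have kD' : k <= D by lia.
    by have := cardsC [set i : 'I_D | i < k]; rewrite card_ltn_ord // card_ord; move: #|_| => x; lia.
  move=> i; rewrite !inE -leqNgt => ki; rewrite Wod.
  by have := csing i ki; have := cod i (ltn_ord i); case: #|_| => [|[|x]].
- move=> x x' xW xW'; apply: leq_trans (_ : (t x + t x') * 100 <= _).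
    rewrite leq_mul2r; apply/orP; right.
    apply: leq_trans (leq_add (tkt x c pc) (tkt x' c pc)); apply: leq_trans (leq_card_setU _ _).
    by apply: subset_leq_card; apply/subsetP => i; rewrite !inE.
  by have := tD x xW; have := tD x' xW'; lia.
Qed.

End Tokens.
End VertexClasses.

(** * Designed colours *)

Section Core.
Variables (R : realType) (V T : finType) (e Rs Qa Qb Qh : rel V) (A B : {set V}) (blk : V -> T) (mid : T -> T -> T).
Variables (D1 D2 sg s z qi qc kap mu b L dblk dAB K Y s0b s0g : nat).
Let bA := blkA A blk.
Let bB := blkB B blk.
Let G := (T * T * ('I_qi + 'I_qc))%type.
Let u0 := 2 * z + kap.
Let om0 := dblk + u0 + kap.
Let om1 := dAB + kap.
Let zeta := 2 * #|T| * sg + (L + b).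
Let lam := D1 + #|T| * (D1 - #|T| * qi) + (mu + (L + b)).
Let E1 := om1 * (4 * #|V|) + kap * (2 * #|V|) + K * om1.
Let E0 := om0 * (4 * #|V|) + kap * (2 * #|V|) + #|{: G}| * (2 * om0) + E1.
Let del1 := kap + 2 * om0 + u0.
Let del2 := kap + om1 + 2 * Y.
Let q1 := #|T| * (qi + qc).

Hypotheses (es : symmetric e) (ei : irreflexive e) (dis : [disjoint A & B]) (V0 : 0 < #|V|) (T0 : 0 < #|T|).
Hypothesis Qab : forall w v, Qa w v || Qb w v || Qh w v -> [&& w \in A, v \in B & e w v].
Hypothesis Qex : forall w v, [&& ~~ (Qa w v && Qb w v), ~~ (Qa w v && Qh w v) & ~~ (Qb w v && Qh w v)].
Hypotheses (Rss : symmetric Rs).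
Hypothesis Rcr : forall w v, Rs w v -> ((w \in A) && (v \in B) || (w \in B) && (v \in A)) && e w v.
Hypothesis RQ : forall w v, Rs w v -> ~~ (Qa w v || Qb w v || Qh w v).
Hypotheses (mC : forall a b, mid a b = mid b a) (mx : forall a, mid a a = a)
  (mI : forall a, injective (mid a)).
Hypothesis degA : forall w c, w \in A -> D1 - sg <= #|[set v in bA c | e w v]| <= D1.
Hypothesis degB : forall w c, w \in B -> D1 - sg <= #|[set v in bB c | e w v]| <= D1.
Hypothesis degRA : forall w c, w \in A -> D2 - sg <= #|[set v in bB c | Rs w v]| <= D2.
Hypothesis degRB : forall w c, w \in B -> D2 - sg <= #|[set v in bA c | Rs w v]| <= D2.
Hypotheses (Dsz : #|A :|: B| * sg <= s * z) (leD : #|T| * qi + s <= D1) (leD' : #|T| * qc + s <= D2).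
Hypothesis small : (#|V|%:R * expR (#|{: G}|%:R * (kap%:R / b%:R)) < expR ((L.+1)%:R / 2) :> R)%R.
Hypothesis b0 : 0 < b.
Hypothesis blks : forall c d, #|bA c| <= #|bB d| + dblk /\ #|bB d| <= #|bA c| + dblk.
Hypotheses (EA : forall c, E0 <= inner e (bA c)) (EB : forall d, E0 <= inner e (bB d)).
Hypothesis qa : forall w d, w \in A -> u0 + 2 * om0 + kap + zeta <= #|[set y in bB d | Qa w y]|.
Hypothesis qb : forall y c, y \in B -> u0 + 2 * om0 + kap + zeta <= #|[set w in bA c | Qb w y]|.
Hypothesis hdA : forall x d, x \in A -> s0b + (qi + qc) + del1 <= #|[set y in bB d | Qh x y]|.
Hypothesis hdB : forall y c, y \in B -> s0b + (qi + qc) + del1 <= #|[set x in bA c | Qh x y]|.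
Hypothesis hex : forall c d (S T : {set V}), S \subset bA c -> T \subset bB d -> s0b <= #|S| ->
  s0b + #|S| <= #|bA c| -> #|bA c| <= #|S| + #|T| + del1 -> (qi + qc) * #|S| < pairs Qh S T.
Hypothesis gdA : forall x, x \in A -> s0g + (q1 + K) + del2 <= #|[set y in B | Qh x y]|.
Hypothesis gdB : forall y, y \in B -> s0g + (q1 + K) + del2 <= #|[set x in A | Qh x y]|.
Hypothesis gex : forall S T : {set V}, S \subset A -> T \subset B -> s0g <= #|S| ->
  s0g + #|S| <= #|A| -> #|A| <= #|S| + #|T| + del2 -> (q1 + K) * #|S| < pairs Qh S T.
Hypotheses (dA : #|A| <= #|B| + dAB) (dB : #|B| <= #|A| + dAB).
Hypothesis cardK : #|V| * lam <= (K - (4 * lam + 4 * (mu + lam))) * Y.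

(** [group_matchings] handles the colours of the rounds and [final_stage] the other [K]. [E0]
    includes [E1], so that enough edges inside the halves survive the first stage to equalise the
    sides in the second. *)
Lemma core_lemma (Bad : G + 'I_K -> {set V}) :
    (forall j, #|Bad j| <= kap) -> (forall w, #|[set j | w \in Bad j]| <= mu) ->
    (forall j, ~~ odd #|(A :|: B) :\: Bad j|) ->
    inner e A + \sum_j #|B :\: Bad j| = inner e B + \sum_j #|A :\: Bad j| ->
  exists M : G + 'I_K -> rel V, [/\ forall j, pmatch ((A :|: B) :\: Bad j) (M j), forall j, subrel (M j) e,
    forall j k w v, M j w v -> M k w v -> j = k &
    forall w v, same_side A B w v -> e w v -> exists j, M j w v].
Proof.
move=> badk badv par identity.
have E0P : om0 * (4 * #|V|) + kap * (2 * #|V|) + #|{: G}| * (2 * om0) <= E0 by apply: leq_addr.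
have bvI w : #|[set i : G | w \in Bad (inl i)]| <= mu.
  have I : injective (@inl G 'I_K) by move=> x y [].
  rewrite -(card_imset _ I); apply: leq_trans (badv w); apply: subset_leq_card.
  by apply/subsetP => _ /imsetP[i + ->]; rewrite !inE.
have bvJ w : #|[set i : 'I_K | w \in Bad (inr i)]| <= mu.
  have I : injective (@inr G 'I_K) by move=> x y [].
  rewrite -(card_imset _ I); apply: leq_trans (badv w); apply: subset_leq_card.
  by apply/subsetP => _ /imsetP[i + ->]; rewrite !inE.
have hallH c d (used : rel V) : symmetric used ->
    (forall x, x \in bA c -> #|[set y in bB d | Qh x y && used x y]| <= qi + qc) ->
    (forall y, y \in bB d -> #|[set x in bA c | Qh x y && used x y]| <= qi + qc) ->
    forall A' B' : {set V}, A' \subset bA c -> B' \subset bB d -> #|A'| = #|B'| ->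
    #|bA c :\: A'| <= del1 -> #|bB d :\: B'| <= del1 -> exists f : V -> V,
    [/\ {in A' &, injective f}, f @: A' = B' & {in A', forall x, Qh x (f x) && ~~ used x (f x)}].
  move=> _ u1 u2; apply: (robust_hall u1 u2) => [x|y|]; [rewrite inE => /andP[xA _]|rewrite inE => /andP[yB _]|].
  - exact: hdA.
  - exact: hdB.
  - exact: hex.
have [M [pmM Me Md left [EA' EB' QA QB]]] := @group_matchings R V T e Rs Qa Qb Qh A B blk mid D1 D2 sg s z qi qc kap mu b L
  dblk del1 E0 (u0 + 2 * om0 + kap + zeta) (fun i => Bad (inl i)) es ei dis V0 Qab Qex Rss Rcr RQ mC mx mI
  degA degB degRA degRB Dsz leD leD' (fun i => badk (inl i)) bvI (fun i => par (inl i)) small b0 blks EA EB E0P qa qb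
  (leqnn _) hallH (leqnn _).
have /card_gt0P[c0 _] := T0.
have E1A : E1 <= inner [rel w v | e w v && ~~ [exists i, M i w v]] A.
  have := EA' c0; have : inner [rel w v | e w v && ~~ [exists i, M i w v]] (bA c0) <=
     inner [rel w v | e w v && ~~ [exists i, M i w v]] A.
    by apply: inner_sub; apply/subsetP => x; rewrite inE => /andP[].
  rewrite /E0 -/u0 -/om0 -/bA; move: (inner _ _) (inner _ _) (#|{: G}| * _) => x y z0; clear; lia.
have E1B : E1 <= inner [rel w v | e w v && ~~ [exists i, M i w v]] B.
  have := EB' c0; have : inner [rel w v | e w v && ~~ [exists i, M i w v]] (bB c0) <=
     inner [rel w v | e w v && ~~ [exists i, M i w v]] B.
    by apply: inner_sub; apply/subsetP => x; rewrite inE => /andP[].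
  rewrite /E0 -/u0 -/om0 -/bB; move: (inner _ _) (inner _ _) (#|{: G}| * _) => x y z0; clear; lia.
have QhE w v : Qh w v -> [&& w \in A, v \in B & e w v] by move=> h; apply: Qab; rewrite h orbT.
have identity' : inner e A + (\sum_i #|B :\: Bad (inl i)| + \sum_j #|B :\: Bad (inr j)|) =
    inner e B + (\sum_i #|A :\: Bad (inl i)| + \sum_j #|A :\: Bad (inr j)|).
  by move: identity; rewrite !big_sumType.
have hallG (used : rel V) : symmetric used ->
    (forall x, x \in A -> #|[set y in B | Qh x y && used x y]| <= q1 + K) ->
    (forall y, y \in B -> #|[set x in A | Qh x y && used x y]| <= q1 + K) ->
    forall A' B' : {set V}, A' \subset A -> B' \subset B -> #|A'| = #|B'| ->
    #|A :\: A'| <= del2 -> #|B :\: B'| <= del2 -> exists f : V -> V,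
    [/\ {in A' &, injective f}, f @: A' = B' & {in A', forall x, Qh x (f x) && ~~ used x (f x)}].
  by move=> _ u1 u2; apply: (robust_hall u1 u2); [exact: gdA|exact: gdB|exact: gex].
have [MJ [pmJ MJe MJd MJM MJall]] := @final_stage V _ e Qh A B M (fun i => Bad (inl i)) K (fun j => Bad (inr j))
  dAB kap mu E1 lam Y q1 del2 es ei dis V0 QhE pmM Me Md left E1A E1B QA QB (fun j => badk (inr j)) bvJ
  (fun j => par (inr j)) dA dB identity' (leqnn _) cardK (leqnn _) hallG.
exists (fun j => match j with inl i => M i | inr j => MJ j end); split.
- by case.
- by case.
- case=> [i|j] [i'|j'] w v h h'.
  + by rewrite (Md _ _ _ _ h h').
  + by case: (MJM _ _ _ _ h h').
  + by case: (MJM _ _ _ _ h' h).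
  + by rewrite (MJd _ _ _ _ h h').
- move=> w v sm ewv; have [[i h]|[j h]] := MJall w v sm ewv; [by exists (inl i)|by exists (inr j)].
Qed.

End Core.

(** * Edge colourings of graphs *)

Section Graph.
Variable G : sgraph.

Lemma edgesP (E : {set G}) : reflect (exists2 p : G * G, adj p.1 p.2 & E = [set p.1; p.2]) (E \in edges G).
Proof.
apply: (iffP imsetP) => -[p]; last by exists p; rewrite ?inE.
by rewrite inE; exists p.
Qed.

Lemma edge_val (E : {set G}) : E \in edges G -> exists E' : edge G, val E' = E.
Proof. by move=> EE; exists (exist (fun E => E \in edges G) E EE). Qed.

Lemma set2_eq (a b u v : G) : [set a; b] = [set u; v] -> (a = u /\ b = v) \/ (a = v /\ b = u).
Proof.
move/setP => h; have := h a; have := h b; have := h u; have := h v; rewrite !inE !eqxx ?orbT /=.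
do !case: eqP => //=; intuition congruence.
Qed.

Lemma edge_colorable_matchings k (K : 'I_k -> rel G) :
  (forall i, symmetric (K i)) -> (forall i w v v', K i w v -> K i w v' -> v = v') ->
  (forall w v : G, adj w v -> exists i, K i w v) -> edge_colorable G k.
Proof.
move=> Ks Kf Kc.
have /fin_all_exists[c cP] : forall E : edge G, exists i, forall u v, val E = [set u; v] -> K i u v.
  move=> [E /= EE]; have /edgesP[[a b] /= ab ->] := EE; have [i Kab] := Kc _ _ ab; exists i => u v.
  by case/set2_eq => -[<- <-]; rewrite // Ks.
apply/existsP; exists (finfun c); apply/forallP => E1; apply/forallP => E2; apply/implyP => /andP[ne].
case/set0Pn => x; rewrite inE !ffunE => /andP[x1 x2]; apply: contra ne => /eqP cc.
have other (E : edge G) : x \in val E -> exists y, val E = [set x; y].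
  case: E => E /= /edgesP[[a b] /= ab ->]; rewrite !inE => /orP[]/eqP->; [by exists b|].
  by exists a; rewrite setUC.
have [[y1 e1] [y2 e2]] := (other _ x1, other _ x2); apply/eqP/val_inj; rewrite e1 e2.
by rewrite (Kf (c E1) x y1 y2) //; [apply: cP|rewrite cc; apply: cP].
Qed.

Lemma edge_colorable_max_deg k : edge_colorable G k -> max_deg G <= k.
Proof.
move/existsP => [c /forallP cP]; apply/bigmax_leqP => v _; rewrite -[k]card_ord -cardsT.
apply: (@card_le_rel _ _ _ _ (fun (i : 'I_k) (w : G) => [exists E : edge G, (val E == [set v; w]) && (c E == i)])).
  move=> w; rewrite inE => vw; have vwE : [set v; w] \in edges G by apply/edgesP; exists (v, w).
  have [E EE] := edge_val vwE; exists (c E) => //.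
  by apply/existsP; exists E; rewrite EE !eqxx.
move=> i w w' /existsP[E1 /andP[/eqP e1 /eqP c1]] /existsP[E2 /andP[/eqP e2 /eqP c2]].
have /forallP/(_ E2) := cP E1; rewrite c1 c2 eqxx implybF negb_and !negbK => /orP[/eqP E12|]; last first.
  by rewrite e1 e2 => /eqP/setP/(_ v); rewrite !inE eqxx.
by move: e2; rewrite -E12 e1 => /set2_eq[[_ //]|[<- ->]].
Qed.

Lemma edge_card (E : {set G}) : E \in edges G -> #|E| = 2.
Proof. by case/edgesP => -[a b] /= ab ->; rewrite cards2; case: eqP ab => // ->; rewrite adj_irrefl. Qed.

Lemma edge_colorable_not_overfull k : edge_colorable G k -> ~ has_overfull_subgraph G k.
Proof.
move/existsP => [c /forallP cP] [W [F [/andP[/subsetP FE /forallP FW]]]]; rewrite /overfull ltnNge => /negP; apply.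
pose F' := [set E : edge G | val E \in F].
have FF : #|F| = #|F'|.
  have -> : F = [set val E | E in F'].
    apply/setP => E; apply/idP/imsetP => [EF|[E' + ->]]; last by rewrite inE.
    by have [E' EE] := edge_val (FE _ EF); exists E'; rewrite ?inE EE.
  by rewrite card_imset //; apply: val_inj.
have -> : #|F| = \sum_(i < k) #|[set E in F' | c E == i]|.
  under eq_bigr do rewrite card_set_sum; rewrite exchange_big /= FF -sum1_card.
  by apply: eq_bigr => E _; rewrite (bigD1 (c E)) //= eqxx big1 // => i; rewrite eq_sym => /negPf->.
rewrite -[k in k * _]card_ord -sum_nat_const; apply: leq_sum => i _.
rewrite -leq_double -!muln2 -[X in X <= _]/(#|_| * 2).
pose P := [set val E | E in [set E in F' | c E == i]].
have PE E : E \in P -> E \in F by case/imsetP => E' + ->; rewrite !inE => /andP[].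
have tP : trivIset P.
  apply/trivIsetP => _ _ /imsetP[E1 + ->] /imsetP[E2 + ->]; rewrite !inE => /andP[_ /eqP c1] /andP[_ /eqP c2] ne.
  have /forallP/(_ E2) := cP E1; rewrite c1 c2 eqxx implybF negb_and !negbK => /orP[/eqP E12|].
    by rewrite E12 eqxx in ne.
  by rewrite setI_eq0.
have cov : #|cover P| <= #|W|.
  apply: subset_leq_card; apply/bigcupsP => E /PE EF; by have := FW E; rewrite EF.
have <- : #|P| = #|[set E in F' | c E == i]| by rewrite card_imset //; apply: val_inj.
have : #|P| * 2 <= #|W|.
  rewrite -sum_nat_const (eq_bigr (fun E : {set G} => #|E|)); last by move=> E /PE/FE/edge_card.
  by move: tP; rewrite /trivIset => /eqP->.
have := odd_double_half #|W|; move: #|P| #|W| => p w; lia.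
Qed.

(** The hypothesis is applied to the subgraph induced by [Z]; the factor 2 comes from counting
    ordered pairs. *)
Lemma not_overfull_sparse k (Z : {set G}) : ~ has_overfull_subgraph G k -> inner (@adj G) Z <= 2 * (k * #|Z|./2).
Proof.
move=> no; pose F := [set E in edges G | E \subset Z].
have [lt|le] := ltnP (k * #|Z|./2) #|F|.
  case: no; exists Z, F; split=> //; apply/andP; split.
    by apply/subsetP => E; rewrite inE => /andP[].
  by apply/forallP => E; apply/implyP; rewrite inE => /andP[].
apply: leq_trans (leq_mul (leqnn 2) le); rewrite mulnC -sum_nat_const /inner -sum1_card.
rewrite (partition_big (fun p : G * G => [set p.1; p.2]) (fun E => E \in F)) /=; last first.
  move=> [a b]; rewrite !inE /= => /and3P[aZ bZ ab]; rewrite subUset !sub1set aZ bZ !andbT.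
  by apply/edgesP; exists (a, b).
apply: leq_sum => E; rewrite inE => /andP[/edgesP[[a b] /= ab ->] _]; rewrite sum1dep_card.
apply: leq_trans (_ : #|[set (a, b); (b, a)]| <= 2); last by rewrite cards2; case: eqP.
apply: subset_leq_card; apply/subsetP => -[u v]; rewrite !inE /= => /andP[_ /eqP/set2_eq[]] [-> ->]; rewrite eqxx ?orbT //.
Qed.

Lemma chromatic_index_max_deg : edge_colorable G (max_deg G) -> chromatic_index G = max_deg G.
Proof.
rewrite /chromatic_index; case: ex_minnP => m col min ok; apply/eqP.
by rewrite eqn_leq min // edge_colorable_max_deg.
Qed.

Lemma chromatic_index_colorable k : chromatic_index G = k -> edge_colorable G k.
Proof. by rewrite /chromatic_index; case: ex_minnP => m col _ <-. Qed.

End Graph.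

(** * Choice of the parameters *)

Section LargeSize.
Import Order.TTheory GRing.Theory Num.Theory.
Local Open Scope ring_scope.

(* [x] differs from the fraction [k / M] of [y] by at most [w]. *)
Definition fair (M k w x y : nat) : bool := ((x * M <= y * k + M * w) && (y * k <= x * M + M * w))%N.

Lemma fair_real (R : realType) (M k w x y : nat) : (0 < M)%N ->
  `|x%:R - y%:R * (k%:R / M%:R)| <= w%:R :> R -> fair M k w x y.
Proof.
move=> M0; have M0R : 0 < (M%:R : R) by rewrite ltr0n.
have -> : x%:R - y%:R * (k%:R / M%:R) = (x * M)%:R / M%:R - (y * k)%:R / M%:R :> R.
  by rewrite !natrM mulfK ?gt_eqF // mulrA.
rewrite ler_norml -mulrBl => /andP[h1 h2]; apply/andP; split; rewrite -(ler_nat R) natrD ![(M * w)%:R]natrM.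
  by move: h2; rewrite ler_pdivrMr //; lra.
by move: h1; rewrite ler_pdivlMr //; lra.
Qed.

Lemma lt_nat (R : realType) (x : R) : exists k : nat, forall n : nat, (k <= n)%N -> x < n%:R.
Proof.
exists (Num.bound `|x|) => n le; apply: le_lt_trans (ler_norm _) _.
by apply: lt_le_trans (archi_boundP _) _; rewrite ?normr_ge0 // ler_nat.
Qed.

Lemma linear_lt_exp (R : realType) (c C : R) : 0 < c ->
  exists n1 : nat, forall n : nat, (n1 <= n)%N -> C * n%:R < expR (c * n%:R).
Proof.
move=> c0; have [k kP] := lt_nat (4 * C / c ^+ 2); exists k.+1 => n le.
have n0 : 0 < (n%:R : R) by rewrite ltr0n; apply: leq_ltn_trans le.
have c2 : 0 < c ^+ 2 by rewrite exprn_gt0.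
have h : 4 * C < c ^+ 2 * n%:R.
  by rewrite [X in _ < X]mulrC -ltr_pdivrMr //; apply: kP; apply: ltnW.
have ge : (1 + c * n%:R / 2) ^+ 2 <= expR (c * n%:R).
  have -> : expR (c * n%:R) = expR (c * n%:R / 2) ^+ 2 by rewrite -expRM_natl; congr expR; field.
  rewrite lerXn2r ?nnegrE ?expR_ge0 ?expR_ge1Dx //.
  by rewrite addr_ge0 // divr_ge0 // mulr_ge0 // ltW.
apply: lt_le_trans ge; have cn : 0 < c * n%:R by rewrite mulr_gt0.
have : C * n%:R * 4 < (c * n%:R) ^+ 2.
  by rewrite exprMn [n%:R ^+ 2]expr2 mulrA mulrAC [C * 4]mulrC ltr_pM2r.
by move: cn; move: (c * _) (C * _) => x z; nra.
Qed.

Lemma power_lt_exp (R : realType) (c C : R) : 0 < c ->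
  exists n1 : nat, forall n : nat, (n1 <= n)%N -> C * (4 ^ n)%:R < expR (c * n%:R ^+ 2).
Proof.
move=> c0; have [[k1 k1P] [k2 k2P]] := (lt_nat (3 / c), lt_nat C); exists (k1 + k2)%N => n le.
have b1 : 3 < c * n%:R.
  by rewrite mulrC -ltr_pdivrMr //; apply: k1P; apply: leq_trans le; apply: leq_addr.
have b2 : C < n%:R by apply: k2P; apply: leq_trans le; apply: leq_addl.
have n0 : 0 < (n%:R : R) by rewrite -(pmulr_rgt0 _ c0); lra.
apply: lt_le_trans (_ : expR (n%:R * 3) <= _); last first.
  by rewrite ler_expR expr2 mulrA [X in _ <= X]mulrC ler_pM2l // ltW.
have -> : expR (n%:R * 3) = expR 1 ^+ 2 ^+ n * expR n%:R :> R.
  by rewrite -!expRM_natl -expRD; congr expR; ring.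
have e2 : 2 <= expR 1 :> R by apply: le_trans (expR_ge1Dx 1); lra.
have e4 : 4 <= expR 1 ^+ 2 :> R by nra.
have p4 : (4 ^ n)%:R <= expR 1 ^+ 2 ^+ n :> R by rewrite natrX lerXn2r // nnegrE ?exprn_ge0 ?expR_ge0.
have en : C < expR n%:R by apply: lt_le_trans (expR_ge1Dx _); lra.
have p0 : 0 < ((4 ^ n)%:R : R) by rewrite ltr0n expn_gt0.
rewrite mulrC; apply: lt_le_trans (_ : (4 ^ n)%:R * expR n%:R <= _).
  by rewrite ltr_pM2l.
by rewrite ler_wpM2r ?expR_ge0.
Qed.

(** [vertex_labels] with [xi = 1 / M] and the integer error [w]. The threshold depends on the
    numbers [M], [C] and [t] only, so it can be fixed before the graph is given. *)
Lemma vertex_labels_nat (R : realType) (M C t : nat) : (0 < M)%N -> (0 < t)%N ->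
  exists n1 : nat, forall (V Cl T : finType) (e : rel V) (N : {set V}) (cell : V -> Cl) (w : nat),
    #|Cl| = C -> #|T| = t -> (n1 <= #|V|)%N -> (#|V| <= M * w)%N ->
  exists lab : V -> T * bool, forall Lb : {set (T * bool)},
    [/\ forall v, fair (t * 2) #|Lb| w #|[set x in N | e v x && (lab x \in Lb)]| #|[set x in N | e v x]|,
        forall a, fair (t * 2) #|Lb| w #|[set x in N | (cell x == a) && (lab x \in Lb)]| #|[set x in N | cell x == a]| &
        fair (t * 2) #|Lb| w #|[set x in N | lab x \in Lb]| #|N|].
Proof.
move=> M0 t0; pose xi : R := M%:R^-1.
have MR : 0 < (M%:R : R) by rewrite ltr0n.
have xi01 : 0 < xi <= 1 by rewrite invr_gt0 MR invf_le1 // ler1n.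
have c0 : 0 < xi ^+ 2 / 8 by rewrite divr_gt0 // exprn_gt0 //; case/andP: xi01.
have [n1 n1P] := linear_lt_exp (((C + 2) * 2 ^ (t * 2))%:R * 2) c0.
exists n1.+1 => V Cl T e N cell w cC cT ge le.
have cTb : #|{: T * bool}| = (t * 2)%N by rewrite card_prod card_bool cT.
have [||lab labP] := @vertex_labels R V e xi N Cl T cell xi01.
- by rewrite cT.
- rewrite mulrA expRN ltr_pdivrMr ?expR_gt0 // mul1r.
  apply: le_lt_trans (n1P _ (ltnW ge)).
  rewrite card_prod !fintype.card_sum card_unit card_set_type cTb cC mulrAC ler_wpM2r //.
  rewrite -natrM ler_nat mulnAC leq_mul2r; apply/orP; right.
  have : (0 < #|V|)%N by apply: leq_ltn_trans ge.
  move: #|V| => x x0; nia.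
have wn : xi * #|V|%:R <= w%:R by rewrite /xi mulrC ler_pdivrMr // -natrM ler_nat mulnC.
have tr (x y k : nat) : `|x%:R - y%:R * (k%:R / #|{: T * bool}|%:R)| <= xi * #|V|%:R -> fair (t * 2) k w x y.
  by rewrite cTb => h; apply: (@fair_real R); [rewrite muln_gt0 t0|apply: le_trans h wn].
exists lab => Lb; have [h1 h2 h3] := labP Lb.
by split=> [v|a|]; apply: tr; [apply: h1|apply: h2|apply: h3].
Qed.

Lemma pair_labels_nat (R : realType) (M g t : nat) : (0 < M)%N -> (0 < g)%N ->
  exists n1 : nat, forall (V T : finType) (e : rel V) (A B : {set V}) (blk : V -> T) (w : nat),
    #|T| = t -> (n1 <= #|V|)%N -> (#|V| <= M * w)%N ->
  exists ql : V -> V -> 'I_g, forall Lq : {set 'I_g},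
    [/\ forall x d, fair g #|Lq| w #|[set y in [set y in B | blk y == d] | e x y && (ql x y \in Lq)]|
          #|[set y in [set y in B | blk y == d] | e x y]|,
        forall y c, fair g #|Lq| w #|[set x in [set x in A | blk x == c] | e x y && (ql x y \in Lq)]|
          #|[set x in [set x in A | blk x == c] | e x y]| &
        forall S T, fair g #|Lq| (w * #|V|) (pairs [rel x y | e x y && (ql x y \in Lq)] S T) (pairs e S T)].
Proof.
move=> M0 g0; pose xi : R := M%:R^-1.
have MR : 0 < (M%:R : R) by rewrite ltr0n.
have xi01 : 0 < xi <= 1 by rewrite invr_gt0 MR invf_le1 // ler1n.
have c0 : 0 < xi ^+ 2 / 8 by rewrite divr_gt0 // exprn_gt0 //; case/andP: xi01.
have [n1 n1P] := linear_lt_exp (2 * ((2 * t * 2 ^ g)%:R * 2)) c0.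
have [n2 n2P] := power_lt_exp (2 * ((2 ^ g)%:R * 2)) c0.
exists (n1 + n2)%N => V T e A B blk w cT ge le.
have [|ql qlP] := @pair_labels R V e xi g A B T blk xi01 g0.
  have := n1P _ (leq_trans (leq_addr _ _) ge); have := n2P _ (leq_trans (leq_addl _ _) ge).
  rewrite !expRN cT !natrM; set E1 := expR _; set E2 := expR _ => h2 h1.
  have p1 : 0 < E1 by apply: expR_gt0.
  have p2 : 0 < E2 by apply: expR_gt0.
  have -> : 2%:R * #|V|%:R * t%:R * (2 ^ g)%:R * (2 / E2) = 2%:R * t%:R * (2 ^ g)%:R * 2 * #|V|%:R / E2 :> R.
    by field; rewrite gt_eqF.
  have -> : (4 ^ #|V|)%:R * (2 ^ g)%:R * (2 / E1) = (2 ^ g)%:R * 2 * (4 ^ #|V|)%:R / E1 :> R.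
    by field; rewrite gt_eqF.
  apply: lt_le_trans (_ : 2^-1 + 2^-1 <= 1); last lra.
  by apply: ltrD; rewrite ltr_pdivrMr //; lra.
have wn : xi * #|V|%:R <= w%:R by rewrite /xi mulrC ler_pdivrMr // -natrM ler_nat mulnC.
have tr (x y k : nat) : `|x%:R - y%:R * (k%:R / g%:R)| <= xi * #|V|%:R -> fair g k w x y.
  by move=> h; apply: (@fair_real R); rewrite //; apply: le_trans h wn.
exists ql => Lq; have [h1 h2 h3] := qlP Lq.
split=> [v d|y c|S S']; [exact/tr/h1|exact/tr/h2|].
apply: (@fair_real R) => //; apply: le_trans (h3 S S') _.
by rewrite natrM expr2 mulrA ler_wpM2r.
Qed.

(** The integer form of [cell_expansion]. The regularity error is chosen for the largest scale [t],
    so a single partition into cells serves every [h <= t], in particular both the halves and the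
    blocks. *)
Lemma expansion_nat (R : realType) (nu tau : R) (k t m D u : nat) (V : finType) (e : rel V) :
    0 < nu -> (0 < t)%N -> 1 <= k%:R * (nu ^+ 2 / (16 * t%:R ^+ 2)) ^+ 2 -> 1000 <= 3 / 8 * nu ^+ 2 * m%:R ->
    symmetric e -> 1000 * (tau * #|V|%:R) <= D%:R -> u%:R <= nu / 2 * #|V|%:R ->
    (forall S : {set V}, tau * #|V|%:R <= #|S|%:R <= (1 - tau) * #|V|%:R ->
       #|S|%:R + nu * #|V|%:R <= #|[set v | nu * #|V|%:R <= #|[set w in S | e v w]|%:R]|%:R) ->
  exists cell : V -> {ffun 'I_k -> bool * bool}, forall h (P1 P2 Mv S T : {set V}) w, (0 < h <= t)%N ->
    (forall a, h * #|[set x in P1 :\: Mv | cell x == a]| <= #|[set x | cell x == a]| + h * w)%N ->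
    (forall a, h * #|[set x in P2 :\: Mv | cell x == a]| <= #|[set x | cell x == a]| + h * w)%N ->
    S \subset P1 -> T \subset P2 ->
    let loss := (h * (#|Mv| + #|{: {ffun 'I_k -> bool * bool}}| * (w + 1)))%N in
    (D + 1000 * loss <= 1000 * (h * #|S|))%N -> (1000 * (h * #|S|) + D <= 1000 * #|V|)%N ->
    (#|V| + 2 * loss <= h * (#|S| + #|T|) + u)%N ->
  (1000 * #|V| ^ 2 <= m * (h ^ 2 * pairs e S T))%N.
Proof.
move=> nu0 t0 keps mnu es tD unu rob.
have t0R : 0 < (t%:R : R) by rewrite ltr0n.
have nu2 : 0 < nu ^+ 2 by rewrite exprn_gt0.
have eps0 : 0 < nu ^+ 2 / (16 * t%:R ^+ 2) by rewrite divr_gt0 // mulr_gt0 // exprn_gt0.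
have [cell cellP] := regular_cells e eps0 keps.
exists cell => h P1 P2 Mv S T w /andP[h0 ht] w1 w2 SP TP loss l1 l2 l3.
have h0R : 0 < (h%:R : R) by rewrite ltr0n.
have main : 3 / 8 * nu ^+ 2 * #|V|%:R ^+ 2 <= h%:R ^+ 2 * (pairs e S T)%:R.
  apply: (@cell_expansion R V e _ cell nu tau P1 P2 Mv S T h w nu0 es h0 rob _ w1 w2 SP TP).
  - move=> S0 T0 S' T' hS hT; apply: le_trans (cellP h S0 T0 S' T' hS hT) _.
    rewrite lerD2l; apply: ler_wpM2r; first exact: sqr_ge0.
    apply: ler_wpM2l; first by rewrite addr_ge0 // sqr_ge0.
    rewrite ler_pM2l // lef_pV2 ?posrE ?mulr_gt0 ?exprn_gt0 // ler_pM2l //.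
    by rewrite lerXn2r ?nnegrE ?ler0n // ler_nat.
  - rewrite -/loss; have : (D + 1000 * loss)%:R <= (1000 * (h * #|S|))%:R :> R by rewrite ler_nat.
    by rewrite natrD !natrM; move: (h%:R * _) => x; clear -tD; lra.
  - have : (1000 * (h * #|S|) + D)%:R <= (1000 * #|V|)%:R :> R by rewrite ler_nat.
    by rewrite natrD !natrM; move: (h%:R * _) => x; clear -tD; lra.
  - rewrite -/loss; have : (#|V| + 2 * loss)%:R <= (h * (#|S| + #|T|) + u)%:R :> R by rewrite ler_nat.
    by rewrite !natrD !natrM natrD; move: (h%:R * _) => x; clear -unu; lra.
have eL : (1000 * #|V| ^ 2)%:R = 1000 * #|V|%:R ^+ 2 :> R by rewrite natrM natrX.
have eR : (m * (h ^ 2 * pairs e S T))%:R = m%:R * (h%:R ^+ 2 * (pairs e S T)%:R) :> R by rewrite natrM natrM natrX.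
rewrite -(ler_nat R) eL eR.
apply: le_trans (_ : m%:R * (3 / 8 * nu ^+ 2 * #|V|%:R ^+ 2) <= _); last by rewrite ler_wpM2l.
by rewrite [X in _ <= X]mulrA ler_wpM2r ?sqr_ge0 // mulrC.
Qed.

(** The smallness condition of [low_conflict] for [b = L = 4 * u], with [u] the geometric mean of
    [u26] and [u2]: the growth exponent is at most [u / 2] and [n] is below [expR u], while the
    right side exceeds [expR (2 * u)]. *)
Lemma exp_small (R : realType) (n G u u1 u2 u26 : nat) :
    (0 < u)%N -> (n <= 2 * u26)%N -> (G <= 2 * u26)%N -> (1000 * u1 <= u2)%N -> (u * u = u26 * u2)%N -> (0 < u1)%N ->
  n%:R * expR (G%:R * (u1%:R / (4 * u)%N%:R)) < expR ((4 * u)%N.+1%:R / 2) :> R.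
Proof.
move=> u0 nu Gu u12 uu u10.
have uR : 0 < (u%:R : R) by rewrite ltr0n.
have h1 : G%:R * (u1%:R / (4 * u)%N%:R) <= u%:R / 2 :> R.
  rewrite mulrA ler_pdivrMr; last by rewrite ltr0n muln_gt0.
  have : (1000 * (G * u1))%N%:R <= (2 * (u * u))%N%:R :> R.
    rewrite ler_nat uu; apply: (@leq_trans (G * u2)%N); first by rewrite mulnCA leq_mul2l u12 orbT.
    by rewrite mulnA leq_mul2r Gu orbT.
  by rewrite !natrM; move: uR; move: (G%:R * u1%:R) (u%:R) => x y; nra.
have h2 : n%:R < expR u%:R :> R.
  have ge : (1 + u%:R / 2) ^+ 2 <= expR u%:R :> R.
    have -> : expR u%:R = expR (u%:R / 2) ^+ 2 :> R by rewrite -expRM_natl; congr expR; field.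
    rewrite lerXn2r ?nnegrE ?expR_ge0 ?expR_ge1Dx //.
    by rewrite addr_ge0 // divr_ge0.
  apply: lt_le_trans ge; have : (500 * n)%N%:R <= (u * u)%N%:R :> R.
    rewrite ler_nat uu; apply: (@leq_trans (u26 * 1000)%N); first by clear -nu; lia.
    by rewrite leq_mul2l; apply/orP; right; move: u10 u12; clear; lia.
  by rewrite !natrM; move: uR; move: (u%:R) (n%:R) => x y; nra.
apply: (@le_lt_trans _ _ (n%:R * expR (u%:R / 2))).
  by rewrite ler_wpM2l // ler_expR.
apply: (@lt_le_trans _ _ (expR u%:R * expR (u%:R / 2))).
  by rewrite ltr_pM2r ?expR_gt0.
by rewrite -expRD ler_expR -[(4 * u)%N.+1%:R]natr1 natrM; lra.
Qed.

End LargeSize.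

Lemma card_blocks (V T : finType) (B : {set V}) (blk : V -> T) (P : pred V) :
  #|[set y in B | P y]| = \sum_(c : T) #|[set y in [set y in B | blk y == c] | P y]|.
Proof.
under eq_bigr do rewrite card_set_sum; rewrite card_set_sum.
under [RHS]eq_bigr do rewrite big_mkcond /=; rewrite exchange_big /= big_mkcond; apply: eq_bigr => y _.
rewrite (bigD1 (blk y)) //= big1 ?addn0 => [|c]; rewrite inE ?eqxx ?andbT //.
by rewrite eq_sym => /negPf->; rewrite andbF.
Qed.

(** * Arithmetic of the scales *)

Section Magnitudes.
Variables (m t q n D d d' be u1 u2 u14 u16 u20 u22 u23 u24 u25 u26 qi qc : nat).
(* [u_k] plays the role of [m ^ k * q], where the graph has about [m ^ 26 * q]
   vertices and the halves have [t] blocks each. *)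
Definition units := [/\ [/\ t = m * m, 0 < t, t * t <= q & 0 < m],
  [/\ 1000 * q <= u1, 1000 * u1 <= u2, 1000 * u2 <= u14, 1000 * u14 <= u16 & 1000 * u16 <= u20],
  [/\ 1000 * u20 <= u22, 1000 * u22 <= u23, 1000 * u23 <= u24, 1000 * u24 <= u25 & 1000 * u25 <= u26],
  [/\ t * u14 = u16, t * u20 = u22, t * u22 = u24, t * u23 = u25 & m * u25 = u26] &
  [/\ u14 * u14 = u26 * u2, u20 * u20 = u26 * u14, u25 * u25 = u26 * u24, m * u24 = u25 & t * q <= u14]].
(* [d] is the typical degree into a block, [d'] its share of unreserved edges,
   and [be] the typical size of a block. *)
Definition sizes := [/\ [/\ u26 <= n, n <= u26 + q, 4000 * u25 <= D & D <= n],
  [/\ 2 * (t * d) <= D, D < 2 * (t * d) + 2 * t, 64 * d' <= 61 * d & 61 * d < 64 * d' + 64],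
  [/\ 2 * (t * be) <= n & n < 2 * (t * be) + 2 * t],
  [/\ t * qi + 2 * u20 <= d + u14 & d + u14 < t * qi + 2 * u20 + t] &
  [/\ t * qc + 2 * u20 <= d' + 2 * u14 & d' + 2 * u14 < t * qc + 2 * u20 + t]].
Hypotheses (uH : units) (sH : sizes).

Let K := 2 * u25.

(** The rounds inside the halves take about [t * d], or [D / 2], colours and those between them
    about [61 / 64] of that; roughly [3 / 128] of [D] remain, safely below [D / 20]. *)
Lemma rest_small : t * t * (qi + qc) + K <= D /\ 20 * (D - (t * t * (qi + qc) + K)) <= D.
Proof.
case: uH => [[_ t0 tq _] [a1 a2 a3 a4 a5] [b1 b2 b3 b4 b5] [c1 c2 c3 c4 c5] [_ _ _ _ tq']].
case: sH => [[s1 s2 s3 s4] [e1 e2 e3 e4] _ [f1 f2] [g1 g2]].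
have h1 : t * (t * qi + 2 * u20) <= t * (d + u14) by rewrite leq_mul2l f1 orbT.
have h2 : t * (d + u14) <= t * (t * qi + 2 * u20 + t) by rewrite leq_mul2l (ltnW f2) orbT.
have h3 : t * (t * qc + 2 * u20) <= t * (d' + 2 * u14) by rewrite leq_mul2l g1 orbT.
have h4 : t * (d' + 2 * u14) <= t * (t * qc + 2 * u20 + t) by rewrite leq_mul2l (ltnW g2) orbT.
have h5 : t * (64 * d') <= t * (61 * d) by rewrite leq_mul2l e3 orbT.
have h6 : t * (61 * d) <= t * (64 * d' + 64) by rewrite leq_mul2l (ltnW e4) orbT.
have h7 : t <= t * t by rewrite leq_pmull.
rewrite /K; split; clear -h1 h2 h3 h4 h5 h6 h7 c1 c2 c3 c4 e1 e2 a1 a2 a3 a4 a5 b1 b2 b3 b4 b5 tq s3; lia.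
Qed.

Lemma t_le : t <= t * t /\ t <= q.
Proof.
case: uH => [[_ t0 tq _] _ _ _ _]; have h : t <= t * t by rewrite leq_pmull.
by split=> //; apply: leq_trans tq.
Qed.

Lemma d_bounds : [/\ 2 * d <= u24 + q, 1000 * u23 <= d, 2 * be <= u24 + q & 999 * u24 <= 2000 * be].
Proof.
case: uH => [[_ t0 tq _] [a1 a2 a3 a4 a5] [b1 b2 b3 b4 b5] [c1 c2 c3 c4 c5] [p1 p2 p3 p4 p5]].
case: sH => [[s1 s2 s3 s4] [e1 e2 e3 e4] [k1 k2] _ _]; have [h h'] := t_le.
have t26 : t * u24 = u26 by rewrite -c5 -p4; case: uH => -[-> _ _ _] _ _ _ _; rewrite mulnA.
have qt : q <= t * q by rewrite leq_pmull.
split; rewrite -(leq_pmul2l t0); clear -qt t26 s1 s2 s3 s4 e1 e2 k1 k2 c1 c2 c3 c4 h h' a1 a2 a3 a4 a5 b1 b2 b3 b4 b5; lia.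
Qed.

Lemma q_bounds : qi + qc <= 2 * u22 /\ t * (d + u14 - t * qi) <= 2 * u22 + q.
Proof.
case: uH => [[_ t0 tq _] [a1 a2 a3 a4 a5] [b1 b2 b3 b4 b5] [c1 c2 c3 c4 c5] [p1 p2 p3 p4 p5]].
case: sH => [[s1 s2 s3 s4] [e1 e2 e3 e4] [k1 k2] [f1 f2] [g1 g2]]; have [h h'] := t_le.
have [d1 d2 _ _] := d_bounds; split.
  by rewrite -(leq_pmul2l t0); clear -c1 c2 c3 c4 d1 d2 e3 f1 g1 a1 a2 a3 a4 a5 b1 b2 b3 b4 b5; lia.
apply: leq_trans (_ : t * (2 * u20 + t) <= _).
  by rewrite leq_mul2l; apply/orP; right; clear -f2; lia.
by clear -c2 tq; lia.
Qed.

(** Fewer than [u24] edges inside the halves are left at a vertex. The conflicts of the greedy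
    colouring cost at most half of the [2 * u25] colours, and the other half with [u25] pairs each
    suffices because [u25 * u25 = u26 * u24]. *)
Lemma lam_bound : n * (d + u14 + t * (d + u14 - t * qi) + (u1 + (4 * u14 + 4 * u14))) <=
  (K - (4 * (d + u14 + t * (d + u14 - t * qi) + (u1 + (4 * u14 + 4 * u14))) +
    4 * (u1 + (d + u14 + t * (d + u14 - t * qi) + (u1 + (4 * u14 + 4 * u14)))))) * u25.
Proof.
case: uH => [[_ t0 tq _] [a1 a2 a3 a4 a5] [b1 b2 b3 b4 b5] [c1 c2 c3 c4 c5] [p1 p2 p3 p4 p5]].
case: sH => [[s1 s2 s3 s4] _ _ _ _].
have [d1 d2 _ _] := d_bounds; have [_ q2] := q_bounds.
move E : (d + _ + _ + _) => lam.
have l1 : 5 * lam <= 3 * u24 by clear -E d1 q2 a1 a2 a3 a4 a5 b1 b2 b3 b4 b5; lia.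
have l2 : u25 <= K - (4 * lam + 4 * (u1 + lam)) by rewrite /K; clear -l1 a1 a2 a3 a4 a5 b1 b2 b3 b4 b5; lia.
apply: leq_trans (leq_mul l2 (leqnn _)); rewrite p3.
have h1 : 5 * (n * lam) <= (u26 + q) * (3 * u24) by rewrite mulnCA leq_mul.
have h2 : 100 * q * u24 <= u26 * u24 by rewrite leq_mul2r; apply/orP; right; clear -a1 a2 a3 a4 a5 b1 b2 b3 b4 b5; lia.
by clear -h1 h2; lia.
Qed.

(** The demand is of order [u20 * n], that is [u22 * u24]. The supply is of order [u24 * u23]: about
    [u24 / 2] vertices in a block, each with at least [900 * u23] neighbours in it. *)
Lemma inner_bound x : be <= x + 4 * q ->
  (u14 + (2 * (2 * u20) + u1) + u1) * (4 * n) + u1 * (2 * n) + t * t * (qi + qc) * (2 * (u14 + (2 * (2 * u20) + u1) + u1)) +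
   ((q + u1) * (4 * n) + u1 * (2 * n) + K * (q + u1)) <= x * (d - 4 * q).
Proof.
case: uH => [[_ t0 tq _] [a1 a2 a3 a4 a5] [b1 b2 b3 b4 b5] [c1 c2 c3 c4 c5] [p1 p2 p3 p4 p5]].
case: sH => [[s1 s2 s3 s4] _ _ _ _] xl.
have [d1 d2 _ d4] := d_bounds; have [q2 _] := q_bounds.
have t26 : t * u24 = u26 by rewrite -c5 -p4; case: uH => -[-> _ _ _] _ _ _ _; rewrite mulnA.
have x1 : u24 <= 3 * x by clear -xl d4 a1 a2 a3 a4 a5 b1 b2 b3 b4 b5; lia.
have G : t * t * (qi + qc) <= 2 * n.
  apply: leq_trans (leq_mul (leqnn _) q2) _.
  by rewrite mulnCA -mulnA c3 t26 leq_mul2l s1.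
have h1 : 900 * u23 <= d - 4 * q by clear -d2 a1 a2 a3 a4 a5 b1 b2 b3 b4 b5; lia.
apply: leq_trans (_ : 100 * u20 * n <= _).
  have g1 : t * t * (qi + qc) * (2 * (u14 + (2 * (2 * u20) + u1) + u1)) <= 2 * n * (10 * u20).
    by apply: leq_mul => //; clear -a1 a2 a3 a4 a5; lia.
  have g2 : (u14 + (2 * (2 * u20) + u1) + u1) * (4 * n) <= (5 * u20) * (4 * n).
    by rewrite leq_mul2r; apply/orP; right; clear -a1 a2 a3 a4 a5; lia.
  have g3 : u1 * (2 * n) <= u20 * (2 * n) by rewrite leq_mul2r; apply/orP; right; clear -a1 a2 a3 a4 a5; lia.
  have g4 : (q + u1) * (4 * n) <= u20 * (4 * n) by rewrite leq_mul2r; apply/orP; right; clear -a1 a2 a3 a4 a5; lia.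
  have g5 : K * (q + u1) <= n * u20 by apply: leq_mul; rewrite /K; clear -s1 a1 a2 a3 a4 a5 b5; lia.
  by clear -g1 g2 g3 g4 g5; lia.
apply: leq_trans (leq_mul (leqnn x) h1).
have n2 : n <= 2 * (t * u24) by rewrite t26; clear -s2 a1 a2 a3 a4 a5 b1 b2 b3 b4 b5; lia.
apply: leq_trans (leq_mul (leqnn _) n2) _.
have -> : 100 * u20 * (2 * (t * u24)) = 200 * (u22 * u24) by rewrite -c2; lia.
have : u22 * u24 <= u23 * (3 * x) by apply: leq_mul => //; clear -b2; lia.
by clear; lia.
Qed.

(** Scaled back to blocks, expansion gives edges of order [n ^ 2 / (m * t ^ 2)], that is
    [u23 * u24], while those already used number at most [2 * u22 * u24]. *)
Lemma block_hall P S : S <= u24 -> 1000 * n ^ 2 <= m * ((2 * t) ^ 2 * P) ->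
  forall Q, P <= 64 * Q + 64 * (q * n) -> (qi + qc) * S < Q.
Proof.
case: uH => [[tE t0 tq m0] [a1 a2 a3 a4 a5] [b1 b2 b3 b4 b5] [c1 c2 c3 c4 c5] [p1 p2 p3 p4 p5]].
case: sH => [[s1 s2 s3 s4] _ _ _ _] Su h Q PQ.
have [q2 _] := q_bounds; rewrite ltnNge; apply/negP => le.
have QB : Q <= 2 * u22 * u24 by apply: leq_trans le _; apply: leq_mul.
have e1 : m * ((2 * t) ^ 2 * P) <= m * (4 * (t * t) * (64 * (2 * u22 * u24) + 64 * (q * n))).
  rewrite expnMn (_ : 2 ^ 2 = 4) // -[t ^ 2]/(t * t) !leq_mul2l; apply/orP; right; apply/orP; right.
  by apply: leq_trans PQ _; rewrite leq_add2r leq_mul2l.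
have t26 : t * u24 = u26 by rewrite -c5 -p4 tE mulnA.
have e2 : m * (4 * (t * t) * (64 * (2 * u22 * u24) + 64 * (q * n))) = 512 * (u25 * u26) + 256 * (m * (t * (t * q)) * n).
  by rewrite -t26 -p4 -c3; lia.
have e3 : u25 * u26 <= n * n by apply: leq_mul; clear -s1 b5; lia.
have e4 : m * (t * (t * q)) <= n.
  apply: leq_trans (_ : m * (t * u14) <= _); first by rewrite !leq_mul2l p5 !orbT.
  rewrite c1; apply: leq_trans (_ : m * u25 <= _); last by rewrite c5.
  by rewrite leq_mul2l; apply/orP; right; clear -a1 a2 a3 a4 a5 b1 b2 b3 b4 b5; lia.
have e5 : m * (t * (t * q)) * n <= n * n by rewrite leq_mul2r e4 orbT.
have nn : 0 < n * n by rewrite muln_gt0 andbb; clear -s1 b5 b4 b3 b2 b1 a5 a4 a3 a2 a1 tq t0 t26 c2 p5 h le; lia.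
have e6 : 1000 * (n * n) <= 512 * (u25 * u26) + 256 * (m * (t * (t * q)) * n).
  by rewrite -e2; apply: leq_trans e1; rewrite mulnn.
by clear -e6 e3 e5 nn; lia.
Qed.

(** Here edges and losses have the same order [u25 * n], and the constant 1000 decides:
    [1000 / 4 / 64] is more than 3. *)
Lemma global_hall P S : S <= n -> 1000 * n ^ 2 <= m * (2 ^ 2 * P) ->
  forall Q, P <= 64 * Q + 64 * (q * n) -> (t * (qi + qc) + K) * S < Q.
Proof.
case: uH => [[tE t0 tq m0] [a1 a2 a3 a4 a5] [b1 b2 b3 b4 b5] [c1 c2 c3 c4 c5] [p1 p2 p3 p4 p5]].
case: sH => [[s1 s2 s3 s4] _ _ _ _] Su h Q PQ.
have [q2 _] := q_bounds; rewrite ltnNge; apply/negP => le.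
have q3 : t * (qi + qc) <= 2 * u24 by rewrite -c3 mulnCA leq_mul2l q2 orbT.
have QB : Q <= 3 * u25 * n.
  by apply: leq_trans le _; apply: leq_mul => //; rewrite /K; clear -q3 b4; lia.
have e1 : m * (2 ^ 2 * P) <= m * (4 * (64 * (3 * u25 * n) + 64 * (q * n))).
  rewrite (_ : 2 ^ 2 = 4) // !leq_mul2l; apply/orP; right; apply/orP; right.
  by apply: leq_trans PQ _; rewrite leq_add2r leq_mul2l.
have e2 : m * (4 * (64 * (3 * u25 * n) + 64 * (q * n))) = 768 * (u26 * n) + 256 * (m * q * n).
  by rewrite -c5; lia.
have e3 : u26 * n <= n * n by rewrite leq_mul2r s1 orbT.
have e4 : 1000 * (m * q) <= n.
  apply: leq_trans (_ : m * u25 <= _); last by rewrite c5.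
  by rewrite mulnCA leq_mul2l; apply/orP; right; clear -a1 a2 a3 a4 a5 b1 b2 b3 b4 b5; lia.
have e5 : 1000 * (m * q * n) <= n * n by rewrite mulnA leq_mul2r e4 orbT.
have nn : 0 < n * n by rewrite muln_gt0 andbb; have [_ +] := t_le; clear -t0 s1 b5 b4 b3 b2 b1 a5 a4 a3 a2 a1; lia.
have e6 : 1000 * (n * n) <= 768 * (u26 * n) + 256 * (m * q * n).
  by rewrite -e2; apply: leq_trans e1; rewrite mulnn.
by clear -e6 e3 e5 nn; lia.
Qed.

End Magnitudes.

(** * The designed colours for concrete parameters *)

Section CoreExists.
Variables (R : realType) (V : finType) (e : rel V) (m q D d d' be u1 u2 u14 u16 u20 u22 u23 u24 u25 u26 qi qc : nat).
Let T := ('I_m * 'I_m)%type.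
Variables (A B : {set V}) (blk : V -> T) (ql : V -> V -> 'I_64) (mid : T -> T -> T).
Let t := m * m.
Hypotheses (uH : units m t q u1 u2 u14 u16 u20 u22 u23 u24 u25 u26)
  (sH : sizes t q #|V| D d d' be u14 u20 u25 u26 qi qc).
Let bA := blkA A blk.
Let bB := blkB B blk.
Let G := (T * T * ('I_qi + 'I_qc))%type.
Let K := 2 * u25.

Hypotheses (es : symmetric e) (ei : irreflexive e) (dis : [disjoint A & B]).
Hypotheses (mC : forall a b, mid a b = mid b a) (mx : forall a, mid a a = a)
  (mI : forall a, injective (mid a)).
Hypothesis dgA : forall w c, w \in A :|: B ->
  d <= #|[set v in bA c | e w v]| + 4 * q /\ #|[set v in bA c | e w v]| <= d + 4 * q.
Hypothesis dgB : forall w c, w \in A :|: B ->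
  d <= #|[set v in bB c | e w v]| + 4 * q /\ #|[set v in bB c | e w v]| <= d + 4 * q.
Hypothesis szA : forall c, be <= #|bA c| + 4 * q /\ #|bA c| <= be + 4 * q.
Hypothesis szB : forall c, be <= #|bB c| + 4 * q /\ #|bB c| <= be + 4 * q.
Hypothesis lqB : forall (Lq : {set 'I_64}) w c, fair 64 #|Lq| q #|[set y in bB c | e w y && (ql w y \in Lq)]| #|[set y in bB c | e w y]|.
Hypothesis lqA : forall (Lq : {set 'I_64}) y c, fair 64 #|Lq| q #|[set x in bA c | e x y && (ql x y \in Lq)]| #|[set x in bA c | e x y]|.
Hypothesis lqP : forall (Lq : {set 'I_64}) S T, fair 64 #|Lq| (q * #|V|) (pairs [rel x y | e x y && (ql x y \in Lq)] S T) (pairs e S T).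
Hypotheses (dA : #|A| <= #|B| + q) (dB : #|B| <= #|A| + q) (cAB : #|A| + #|B| <= #|V|) (cAB' : #|V| <= #|A| + #|B| + q).
Hypothesis exG : forall S T : {set V}, S \subset A -> T \subset B ->
  D + 1000 * (2 * (4 * q)) <= 1000 * (2 * #|S|) -> 1000 * (2 * #|S|) + D <= 1000 * #|V| ->
  #|V| + 2 * (2 * (4 * q)) <= 2 * (#|S| + #|T|) + 5 * u25 -> 1000 * #|V| ^ 2 <= m * (2 ^ 2 * pairs e S T).
Hypothesis exB : forall c c' (S T : {set V}), S \subset bA c -> T \subset bB c' ->
  D + 1000 * (2 * t * (4 * q)) <= 1000 * (2 * t * #|S|) -> 1000 * (2 * t * #|S|) + D <= 1000 * #|V| ->
  #|V| + 2 * (2 * t * (4 * q)) <= 2 * t * (#|S| + #|T|) + 5 * u25 -> 1000 * #|V| ^ 2 <= m * ((2 * t) ^ 2 * pairs e S T).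

(** Label 0 gives the graph [Qh], label 1 [Qa] and label 2 [Qb]; the remaining 61 labels form the
    graph [Rs] of the rounds between the halves. *)
Let Ql (i : 'I_64) w v := [&& w \in A, v \in B & e w v && (ql w v == i)].
Let rest w v := [&& w \in A, v \in B & e w v && (2 < ql w v)].
Let Rs w v := rest w v || rest v w.

Lemma cross_label (i : 'I_64) : (forall w c, w \in A -> #|[set y in bB c | e w y]| <= 64 * #|[set y in bB c | Ql i w y]| + 64 * q) /\
  (forall y c, y \in B -> #|[set x in bA c | e x y]| <= 64 * #|[set x in bA c | Ql i x y]| + 64 * q) /\
  forall S T : {set V}, S \subset A -> T \subset B -> pairs e S T <= 64 * pairs (Ql i) S T + 64 * (q * #|V|).
Proof.
split; [|split] => [w c wA|y c yB|S T0 SA TB].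
- have := lqB [set i] w c; rewrite /fair cards1 muln1 => /andP[_].
  rewrite (_ : [set y in bB c | Ql i w y] = [set y in bB c | e w y && (ql w y \in [set i])]); first by rewrite mulnC.
  by apply/setP => y; rewrite !inE /Ql wA /=; case: (y \in B).
- have := lqA [set i] y c; rewrite /fair cards1 muln1 => /andP[_].
  rewrite (_ : [set x in bA c | Ql i x y] = [set x in bA c | e x y && (ql x y \in [set i])]); first by rewrite mulnC.
  by apply/setP => x; rewrite !inE /Ql yB /=; case: (x \in A).
- have := lqP [set i] S T0; rewrite /fair cards1 muln1 => /andP[_].
  rewrite (_ : pairs (Ql i) S T0 = pairs [rel x y | e x y && (ql x y \in [set i])] S T0); first by rewrite mulnC.
  apply: eq_card => -[x y]; rewrite !inE /Ql /=; case xS: (x \in S) => //=; case yT: (y \in T0) => //=.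
  by rewrite (subsetP SA x xS) (subsetP TB y yT) inE.
Qed.

Lemma rest_label : (forall w c, w \in A -> 64 * #|[set y in bB c | Rs w y]| <= 61 * #|[set y in bB c | e w y]| + 64 * q /\
    61 * #|[set y in bB c | e w y]| <= 64 * #|[set y in bB c | Rs w y]| + 64 * q) /\
  (forall y c, y \in B -> 64 * #|[set x in bA c | Rs y x]| <= 61 * #|[set x in bA c | e y x]| + 64 * q /\
    61 * #|[set x in bA c | e y x]| <= 64 * #|[set x in bA c | Rs y x]| + 64 * q).
Proof.
pose L := [set i : 'I_64 | 2 < i].
have cL : #|L| = 61.
  have cL : #|~: L| = 3.
    by apply: etrans (@card_ltn_ord 64 3 isT); apply: eq_card => i; rewrite !inE -leqNgt.
  by have := cardsC L; rewrite cL card_ord; lia.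
have nAB x : x \in A -> x \in B = false by move=> xA; rewrite (disjointFr dis xA).
have nBA x : x \in B -> x \in A = false by move=> xA; rewrite (disjointFl dis xA).
split=> [w c wA|y c yB].
- have := lqB L w c; rewrite /fair cL => /andP[].
  rewrite (_ : [set y in bB c | Rs w y] = [set y in bB c | e w y && (ql w y \in L)]).
    by rewrite ![_ * 64]mulnC ![_ * 61]mulnC.
  by apply/setP => y; rewrite !inE /Rs /rest wA (nAB _ wA) andbF orbF /=; case: (y \in B).
- have := lqA L y c; rewrite /fair cL => /andP[].
  rewrite (_ : [set x in bA c | Rs y x] = [set x in bA c | e x y && (ql x y \in L)]).
    rewrite (_ : [set x in bA c | e y x] = [set x in bA c | e x y]).
      by rewrite ![_ * 64]mulnC ![_ * 61]mulnC.
    by apply/setP => x; rewrite !inE es.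
  by apply/setP => x; rewrite !inE /Rs /rest yB (nBA _ yB) /=; case: (x \in A).
Qed.

Lemma core_exists (Bad : G + 'I_K -> {set V}) :
    (forall j, #|Bad j| <= u1) -> (forall w, #|[set j | w \in Bad j]| <= u1) ->
    (forall j, ~~ odd #|(A :|: B) :\: Bad j|) ->
    inner e A + \sum_j #|B :\: Bad j| = inner e B + \sum_j #|A :\: Bad j| ->
  exists M : G + 'I_K -> rel V, [/\ forall j, pmatch ((A :|: B) :\: Bad j) (M j), forall j, subrel (M j) e,
    forall j k w v, M j w v -> M k w v -> j = k &
    forall w v, same_side A B w v -> e w v -> exists j, M j w v].
Proof.
have tE : #|{: T}| = t by rewrite card_prod card_ord.
have cG : #|{: G}| = t * t * (qi + qc) by rewrite !card_prod fintype.card_sum !card_ord.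
have UH := uH; have SH := sH.
case: UH => [[_ t0 tq m0] [a1 a2 a3 a4 a5] [b1 b2 b3 b4 b5] [c1 c2 c3 c4 c5] [p1 p2 p3 p4 p5]].
case: SH => [[s1 s2 s3 s4] [e1 e2 e3 e4] [k1 k2] [f1 f2] [g1 g2]].
have [d1 d2 d3 d4] := d_bounds uH sH; have [q1 q2] := q_bounds uH sH; have [t1 t2] := t_le uH.
have q0 : 0 < q by apply: leq_trans t2.
have u10 : 0 < u1 by clear -q0 a1; lia.
have V0 : 0 < #|V| by clear -s1 b5 b4 b3 b2 b1 a5 a4 a3 a2 a1 q0; lia.
pose i0 : 'I_64 := inord 0; pose i1 : 'I_64 := inord 1; pose i2 : 'I_64 := inord 2.
have n0 : val i0 = 0 by rewrite /= inordK.
have n1 : val i1 = 1 by rewrite /= inordK.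
have n2 : val i2 = 2 by rewrite /= inordK.
have [qhA [qhB qhP]] := cross_label i0; have [qaA _] := cross_label i1; have [_ [qbB _]] := cross_label i2.
have [rA rB] := rest_label.
have sumc x : t * x = \sum_(c : T) x by rewrite sum_nat_const cardT -cardE tE.
have sA w : w \in A -> w \in A :|: B by rewrite in_setU => ->.
have sB w : w \in B -> w \in A :|: B by rewrite in_setU orbC => ->.
have eE w c : #|[set x in bA c | e x w]| = #|[set x in bA c | e w x]| by apply: eq_card => x; rewrite !inE es.
have ch a b c : a <= b -> b <= c -> a <= c by apply: leq_trans.
(* Degrees into blocks vary by a few [q], far less than [sg = 3 * u14]. Both [s] and [z] are
   [2 * u20] because [u20] is the geometric mean of [u26] and [u14]; [b = L = 4 * u14] is the choice
   of [exp_small], and [K = 2 * u25], [Y = u25] that of [lam_bound]. *)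
apply: (@core_lemma R V T e Rs (Ql i1) (Ql i2) (Ql i0) A B blk mid (d + u14) (d' + 2 * u14) (3 * u14) (2 * u20) (2 * u20)
  qi qc u1 u1 (4 * u14) (4 * u14) u14 q K u25 (d %/ 128) (D %/ 256) es ei dis V0 _ _ _ _ _ _ mC mx mI).
- by rewrite tE.
- by move=> w v; rewrite /Ql; case/orP => [/orP[]|] /and3P[-> -> /andP[->]].
- by move=> w v; rewrite /Ql -!(inj_eq val_inj) n0 n1 n2; case: (val (ql w v)) => [|[|[|k]]]; rewrite ?andbF.
- by move=> w v; rewrite /Rs orbC.
- by move=> w v; rewrite /Rs /rest => /orP[]/and3P[-> -> /andP[]]; rewrite 1?es => -> /=; rewrite ?orbT.
- move=> w v; rewrite /Rs /rest /Ql -!(inj_eq val_inj) n0 n1 n2 => /orP[]/and3P[wA vB /andP[ewv h]].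
    by have {h}: 2 < val (ql w v) by []; case: (val (ql w v)) => [|[|[|k]]] //= _; rewrite !andbF.
  by rewrite (disjointFr dis wA) !andbF.
- by move=> w c wA; have [h1 h2] := dgA c (sA w wA); rewrite -/bA; clear -h1 h2 a1 a2 a3; lia.
- by move=> w c wB; have [h1 h2] := dgB c (sB w wB); rewrite -/bB; clear -h1 h2 a1 a2 a3; lia.
- move=> w c wA; have [h1 h2] := dgB c (sA w wA); have [h3 h4] := rA w c wA.
  by rewrite -/bB; clear -h1 h2 h3 h4 e3 e4 a1 a2 a3 q0; lia.
- move=> w c wB; have [h1 h2] := dgA c (sB w wB); have [h3 h4] := rB w c wB.
  by rewrite -/bA; clear -h1 h2 h3 h4 e3 e4 a1 a2 a3 q0; lia.
- have h : #|A :|: B| <= u26 + q by apply: leq_trans s2; apply: max_card.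
  apply: leq_trans (leq_mul h (leqnn _)) _; rewrite mulnACA p2.
  have : 100 * q * u14 <= u26 * u14 by rewrite leq_mul2r; apply/orP; right; clear -a1 a2 a3 a4 a5 b1 b2 b3 b4 b5; lia.
  by clear; lia.
- by rewrite tE.
- by rewrite tE.
- apply: (@exp_small R _ _ u14 u1 u2 u26) => //.
  + by clear -u10 a2 a3; lia.
  + by clear -s2 a1 a2 a3 a4 a5 b1 b2 b3 b4 b5; lia.
  + rewrite cG; apply: leq_trans (leq_mul (leqnn _) q1) _.
    by rewrite mulnCA -mulnA c3 leq_mul2l -c5 -p4 mulnA leqnn.
- by clear -u10 a2 a3; lia.
- by move=> c c'; have [h1 h2] := szA c; have [h3 h4] := szB c'; rewrite -/bA -/bB; clear -h1 h2 h3 h4 a1 a2 a3; lia.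
- move=> c; have [h1 h2] := szA c; rewrite cG -/K -/bA inner_sum.
  apply: leq_trans (inner_bound uH sH h1) _; rewrite -sum_nat_const; apply: leq_sum => w wc.
  have wA : w \in A by move: wc; rewrite inE => /andP[].
  by have [h3 h4] := dgA c (sA w wA); clear -h3; lia.
- move=> c; have [h1 h2] := szB c; rewrite cG -/K -/bB inner_sum.
  apply: leq_trans (inner_bound uH sH h1) _; rewrite -sum_nat_const; apply: leq_sum => w wc.
  have wB : w \in B by move: wc; rewrite inE => /andP[].
  by have [h3 h4] := dgB c (sB w wB); clear -h3; lia.
- move=> w c wA; rewrite tE -/bB; have := qaA w c wA; have [h1 h2] := dgB c (sA w wA).
  have -> : 2 * t * (3 * u14) = 6 * u16 by rewrite -c1; lia.
  by clear -h1 d2 a1 a2 a3 a4 a5 b1 b2 b3 b4 b5; lia.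
- move=> w c wB; rewrite tE -/bA; have := qbB w c wB; rewrite eE; have [h1 h2] := dgA c (sB w wB).
  have -> : 2 * t * (3 * u14) = 6 * u16 by rewrite -c1; lia.
  by clear -h1 d2 a1 a2 a3 a4 a5 b1 b2 b3 b4 b5; lia.
- move=> w c wA; rewrite -/bB; have := qhA w c wA; have [h1 h2] := dgB c (sA w wA).
  by clear -h1 q1 d2 a1 a2 a3 a4 a5 b1 b2 b3 b4 b5; lia.
- move=> w c wB; rewrite -/bA; have := qhB w c wB; rewrite eE; have [h1 h2] := dgA c (sB w wB).
  by clear -h1 q1 d2 a1 a2 a3 a4 a5 b1 b2 b3 b4 b5; lia.
- move=> c c' S T0 Sc Tc h1 h2 h3; have [z1 z2] := szA c; rewrite -/bA -/bB in Sc Tc h2 h3.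
  have Su : #|S| <= u24 by have := subset_leq_card Sc; clear -z2 d3 a1 a2 a3 a4 a5 b1 b2 b3; lia.
  have SA : S \subset A by apply: subset_trans Sc _; apply/subsetP => x; rewrite inE => /andP[].
  have TB : T0 \subset B by apply: subset_trans Tc _; apply/subsetP => x; rewrite inE => /andP[].
  apply: (block_hall uH sH Su (exB Sc Tc _ _ _)); last exact: qhP.
  + have : t * d <= t * (128 * #|S| + 128) by rewrite leq_mul2l; apply/orP; right; clear -h1; lia.
    have : 1000 * (t * q) <= t * d.
      by rewrite mulnCA leq_mul2l; apply/orP; right; clear -d2 a1 a2 a3 a4 a5 b1 b2 b3; lia.
    have : 1000 * t <= t * d by rewrite mulnC leq_mul2l; apply/orP; right; clear -d2 q0 a1 a2 a3 a4 a5 b1 b2 b3; lia.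
    by clear -e2; lia.
  + have : t * #|S| + t * (d %/ 128) <= t * (be + 4 * q).
      by rewrite -mulnDr leq_mul2l; apply/orP; right; clear -h2 z2; lia.
    have : t * d <= t * (128 * (d %/ 128) + 128) by rewrite leq_mul2l; apply/orP; right; clear; lia.
    have : 1000 * (t * q) <= t * d.
      by rewrite mulnCA leq_mul2l; apply/orP; right; clear -d2 a1 a2 a3 a4 a5 b1 b2 b3; lia.
    have : 1000 * t <= t * d by rewrite mulnC leq_mul2l; apply/orP; right; clear -d2 q0 a1 a2 a3 a4 a5 b1 b2 b3; lia.
    by move: (d %/ 128) => s; clear -e2 k1; lia.
  + have : t * be <= t * (#|S| + #|T0| + (u1 + 2 * (u14 + (2 * (2 * u20) + u1) + u1) + (2 * (2 * u20) + u1)) + 4 * q).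
      by rewrite leq_mul2l; apply/orP; right; clear -h3 z1; lia.
    have : t * u1 <= t * u20 by rewrite leq_mul2l; apply/orP; right; clear -a1 a2 a3 a4 a5; lia.
    have : t * q <= t * u20 by rewrite leq_mul2l; apply/orP; right; clear -a1 a2 a3 a4 a5; lia.
    by clear -k2 c1 c2 t2 a1 a2 a3 a4 a5 b1 b2 b3 b4; lia.
- move=> w wA; rewrite tE (card_blocks B blk).
  have : t * d <= 64 * (\sum_c #|[set y in bB c | Ql i0 w y]|) + 68 * (t * q).
    rewrite (sumc d) [68 * _]mulnCA (sumc (68 * q)) big_distrr -big_split /=.
    apply: leq_sum => c _; have := qhA w c wA; have [h1 h2] := dgB c (sA w wA).
    by clear -h1; lia.
  have h4 : t * (qi + qc) <= 2 * u24 by rewrite -c3 mulnCA leq_mul2l q1 orbT.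
  by move: (\sum_c _) => z; clear -h4 e2 s3 p5 t2 a1 a2 a3 a4 a5 b1 b2 b3 b4 b5; lia.
- move=> w wB; rewrite tE (card_blocks A blk).
  have : t * d <= 64 * (\sum_c #|[set x in bA c | Ql i0 x w]|) + 68 * (t * q).
    rewrite (sumc d) [68 * _]mulnCA (sumc (68 * q)) big_distrr -big_split /=.
    apply: leq_sum => c _; have := qhB w c wB; rewrite eE; have [h1 h2] := dgA c (sB w wB).
    by clear -h1; lia.
  have h4 : t * (qi + qc) <= 2 * u24 by rewrite -c3 mulnCA leq_mul2l q1 orbT.
  by move: (\sum_c _) => z; clear -h4 e2 s3 p5 t2 a1 a2 a3 a4 a5 b1 b2 b3 b4 b5; lia.
- move=> S T0 SA TB h1 h2 h3; rewrite tE.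
  apply: (global_hall uH sH (max_card _) (exG SA TB _ _ _)); last exact: qhP.
  + by clear -h1 s3 q0 a1 a2 a3 a4 a5 b1 b2 b3 b4; lia.
  + by move: (D %/ 256) (ltn_ceil D (isT : 0 < 256)) h2 => z zP h2; clear -zP h2 dA cAB s3 q0 a1 a2 a3 a4 a5 b1 b2 b3 b4; lia.
  + by clear -h3 dB cAB' s2 a1 a2 a3 a4 a5 b1 b2 b3 b4; lia.
- exact: dA.
- exact: dB.
- by rewrite tE; apply: lam_bound uH sH.
Qed.

End CoreExists.

(** For odd [m] the number [m.+1./2] is the inverse of 2 modulo [m]; both coordinates are treated
    alike. *)
Lemma midpoint m : odd m -> exists mid : 'I_m * 'I_m -> 'I_m * 'I_m -> 'I_m * 'I_m,
  [/\ forall a b, mid a b = mid b a, forall a, mid a a = a & forall a, injective (mid a)].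
Proof.
move=> om; have m0 : 0 < m by case: m om.
have half_m : m.+1./2 * 2 = m.+1 by have := odd_double_half m.+1; rewrite /= om /= -muln2.
have [md [mdC mdx mdI]] : exists md : 'I_m -> 'I_m -> 'I_m,
    [/\ forall a b, md a b = md b a, forall a, md a a = a & forall a, injective (md a)].
  exists (fun a b => Ordinal (ltn_pmod ((a + b) * m.+1./2) m0)); split=> [a b|a|a b b' /(congr1 val)/= E]; apply: val_inj => /=.
  - by rewrite addnC.
  - by rewrite addnn -muln2 -mulnA [2 * _]mulnC half_m mulnS addnC modnMDl modn_small.
  - have : (a + b) * m.+1./2 * 2 = (a + b') * m.+1./2 * 2 %[mod m] by rewrite -modnMml E modnMml.
    rewrite -!mulnA half_m !mulnS ![_ + _ * m]addnC !modnMDl => /eqP.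
    by rewrite eqn_modDl !modn_small // => /eqP.
exists (fun x y => (md x.1 y.1, md x.2 y.2)); split=> [x y|[x y]|x [y y'] [z z'] /= [/mdI-> /mdI->]] //=.
- by rewrite mdC [md x.2 _]mdC.
- by rewrite !mdx.
Qed.

Definition unit_pow m q k := m ^ k * q.

Lemma unit_powM m q k j : m ^ j * unit_pow m q k = unit_pow m q (j + k).
Proof. by rewrite /unit_pow mulnA -expnD. Qed.

Lemma unit_pow_prod m q k j k' j' : k + j = k' + j' -> unit_pow m q k * unit_pow m q j = unit_pow m q k' * unit_pow m q j'.
Proof. by move=> E; rewrite /unit_pow mulnACA -expnD E expnD mulnACA. Qed.

Lemma unit_pow_lt m q k j : 1000 <= m -> k < j -> 1000 * unit_pow m q k <= unit_pow m q j.
Proof.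
move=> m1 kj; have m0 : 0 < m by apply: leq_trans m1.
have -> : j = (j - k.+1).+1 + k by rewrite addSnnS subnK.
rewrite -unit_powM leq_mul2r expnS; apply/orP; right; apply: leq_trans m1 _.
by rewrite leq_pmulr // expn_gt0 m0.
Qed.

Section Concrete.
Variables (m q n D : nat).
Hypotheses (m1 : 1000 <= m) (mq : m ^ 4 <= q).
Let u := unit_pow m q.
Let t := m * m.

Lemma units_pow : units m t q (u 1) (u 2) (u 14) (u 16) (u 20) (u 22) (u 23) (u 24) (u 25) (u 26).
Proof.
have m0 : 0 < m by apply: leq_trans m1.
have lt k j : k < j -> 1000 * u k <= u j by apply: unit_pow_lt.
have u0 : u 0 = q by rewrite /u /unit_pow mul1n.
have tm k : t * u k = u (2 + k) by rewrite /u -unit_powM /t mulnn.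
have mm k : m * u k = u k.+1 by rewrite /u -add1n -unit_powM expn1.
split.
- split=> //; first by rewrite /t muln_gt0 m0.
  by apply: leq_trans mq; rewrite /t !mulnn -expnM.
- by rewrite -u0; split; apply: lt.
- by split; apply: lt.
- by rewrite !tm mm.
- split; try exact: unit_pow_prod; first by rewrite mm.
  by rewrite -u0 tm; apply: leq_trans (lt 2 14 isT); rewrite leq_pmull.
Qed.

Lemma sizes_pow : u 26 <= n -> n <= u 26 + q -> 4000 * u 25 <= D -> D <= n ->
  exists d d' be qi qc, sizes t q n D d d' be (u 14) (u 20) (u 25) (u 26) qi qc.
Proof.
move=> s1 s2 s3 s4; have m0 : 0 < m by apply: leq_trans m1.
have t0 : 0 < t by rewrite /t muln_gt0 m0.
have tm k : t * u k = u (2 + k) by rewrite /u -unit_powM /t mulnn.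
have lt k j : k < j -> 1000 * u k <= u j by apply: unit_pow_lt.
pose d := D %/ (2 * t); pose d' := 61 * d %/ 64; pose be := n %/ (2 * t).
have fl a b : 0 < b -> b * (a %/ b) <= a /\ a < b * (a %/ b) + b.
  by move=> b0; rewrite {3}(divn_eq a b) mulnC ltn_add2l ltn_pmod // leq_divM.
have t2 : 0 < 2 * t by rewrite muln_gt0 t0.
have [dl dr] := fl D _ t2; have [bl br] := fl n _ t2; have [d'l d'r] := fl (61 * d) 64 isT.
have dbig : 2 * u 20 <= d'.
  have h : 1000 * u 20 <= u 23 by apply: lt.
  have h2 : u 23 <= d.
    rewrite /d leq_divRL // mulnCA [u 23 * t]mulnC tm; apply: leq_trans s3.
    by rewrite leq_mul2r orbT.
  by move: d'r; rewrite -/d'; clear -h h2; lia.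
have dd : d' <= d by move: d'l; rewrite -/d'; clear; lia.
have [q1 q2] := fl (d + u 14 - 2 * u 20) t t0; have [q3 q4] := fl (d' + 2 * u 14 - 2 * u 20) t t0.
exists d, d', be, ((d + u 14 - 2 * u 20) %/ t), ((d' + 2 * u 14 - 2 * u 20) %/ t).
split; first by split.
- by rewrite !(mulnA 2 t); split.
- by rewrite !(mulnA 2 t); split.
- by move: q1 q2; move: (t * _) => x; clear -dbig dd; lia.
- by move: q3 q4; move: (t * _) => x; clear -dbig; lia.
Qed.

End Concrete.

(** * Construction of the colouring *)

Lemma near_card (V : finType) (Z Z0 Mv : {set V}) (P : pred V) k : #|Mv| <= k ->
  (forall x, x \in Z -> x \notin Mv -> x \in Z0) -> #|[set x in Z | P x]| <= #|[set x in Z0 | P x]| + k.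
Proof.
move=> Mk sub; apply: (@leq_trans (#|[set x in Z0 | P x]| + #|Mv|)); last by rewrite leq_add2l.
apply: leq_trans (leq_card_setU [set x in Z0 | P x] Mv); apply: subset_leq_card.
apply/subsetP => x; rewrite !inE => /andP[xZ Px]; rewrite Px andbT.
by have [xM|xM] := boolP (x \in Mv); rewrite ?orbT // (sub x xZ xM).
Qed.

(** A class with at most one token lies on one side, so at least half of the colours in [I1] agree
    on a side. That side becomes [A], as the colours left to Koenig's theorem may have no token in
    [B]. *)
Lemma choose_side (E : finType) (D : nat) (H : {set E}) (c : E -> nat) (side : E -> bool) (I1 : {set 'I_D}) k :
    (forall i, i \in I1 -> #|cls H c i| <= 1) -> 2 * k <= #|I1| ->
  exists b (S : {set 'I_D}), [/\ S \subset I1, #|S| = k & forall h (i : 'I_D), h \in H -> i \in S -> c h = i -> side h = b].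
Proof.
move=> one kI; pose J b := [set i : 'I_D in I1 | [forall h in H, (c h == i) ==> (side h == b)]].
have sub : I1 \subset J true :|: J false.
  apply/subsetP => i iI; rewrite !inE iI /=; apply: contraT.
  rewrite negb_or => /andP[/forall_inPn/=[h hH h1] /forall_inPn/=[h' hH' h2]].
  move: h1 h2; rewrite !negb_imply => /andP[/eqP ch s1] /andP[/eqP ch' s2].
  have /card_le1_eqP/(_ h h') := one i iI; rewrite !inE hH hH' ch ch' !eqxx => /(_ isT isT) hh.
  by move: s1 s2; rewrite hh; case: (side h).
have [b kb] : exists b, k <= #|J b|.
  have := leq_trans (subset_leq_card sub) (leq_card_setU _ _); have [h1|h1] := leqP k #|J true|; first by exists true.
  by move=> h2; exists false; move: kI h1 h2; move: #|J true| #|J false| #|I1| => x y z; lia.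
have [S SJ cS] := sub_card kb; exists b, S; split=> //.
  by apply: subset_trans SJ _; apply/subsetP => i; rewrite inE => /andP[].
move=> h i hH iS ch; have := subsetP SJ i iS; rewrite inE => /andP[_ /forall_inP/(_ h hH)].
by rewrite ch eqxx => /eqP.
Qed.

Section Construct.
Variables (R : realType) (V Cl : finType) (e : rel V) (cell : V -> Cl).
Variables (m q w D d d' be u1 u2 u14 u16 u20 u22 u23 u24 u25 u26 qi qc : nat).
Let T := ('I_m * 'I_m)%type.
Let t := m * m.
Hypotheses (om : odd m) (uH : units m t q u1 u2 u14 u16 u20 u22 u23 u24 u25 u26)
  (sH : sizes t q #|V| D d d' be u14 u20 u25 u26 qi qc).
Hypotheses (wq : w <= q) (Clw : #|Cl| * (w + 1) <= 2 * q).
Hypotheses (es : symmetric e) (ei : irreflexive e) (dD : forall v, #|nb e v| <= D).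
Hypothesis PL : forall (A B : {set V}) (blk : V -> T),
  exists ql : V -> V -> 'I_64, forall Lq : {set 'I_64},
    [/\ forall x d, fair 64 #|Lq| q #|[set y in [set y in B | blk y == d] | e x y && (ql x y \in Lq)]|
          #|[set y in [set y in B | blk y == d] | e x y]|,
        forall y c, fair 64 #|Lq| q #|[set x in [set x in A | blk x == c] | e x y && (ql x y \in Lq)]|
          #|[set x in [set x in A | blk x == c] | e x y]| &
        forall S T, fair 64 #|Lq| (q * #|V|) (pairs [rel x y | e x y && (ql x y \in Lq)] S T) (pairs e S T)].
Hypothesis EX : forall h (P1 P2 Mv S T : {set V}) w, (0 < h <= 2 * t)%N ->
    (forall a, h * #|[set x in P1 :\: Mv | cell x == a]| <= #|[set x | cell x == a]| + h * w)%N ->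
    (forall a, h * #|[set x in P2 :\: Mv | cell x == a]| <= #|[set x | cell x == a]| + h * w)%N ->
    S \subset P1 -> T \subset P2 ->
    let loss := (h * (#|Mv| + #|Cl| * (w + 1)))%N in
    (D + 1000 * loss <= 1000 * (h * #|S|))%N -> (1000 * (h * #|S|) + D <= 1000 * #|V|)%N ->
    (#|V| + 2 * loss <= h * (#|S| + #|T|) + 5 * u25)%N ->
  (1000 * #|V| ^ 2 <= m * (h ^ 2 * pairs e S T))%N.

Section Halves.
Variables (N : {set V}) (lab : V -> T * bool).
Hypothesis labP : forall Lb : {set (T * bool)},
    [/\ forall v, fair (t * 2) #|Lb| w #|[set x in N | e v x && (lab x \in Lb)]| #|[set x in N | e v x]|,
        forall a, fair (t * 2) #|Lb| w #|[set x in N | (cell x == a) && (lab x \in Lb)]| #|[set x in N | cell x == a]| &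
        fair (t * 2) #|Lb| w #|[set x in N | lab x \in Lb]| #|N|].
Hypothesis degN : forall v, v \in N -> D <= #|[set x in N | e v x]| + 2 * q.
Hypothesis cardN : #|V| <= #|N| + q.
Let blk v := (lab v).1.

Section Side.
Variables (Z Mv : {set V}) (s : bool).
Hypotheses (ZN : Z \subset N) (ZP : forall x, x \in N -> x \notin Mv -> (x \in Z) = ((lab x).2 == s)) (cMv : #|Mv| <= 2 * q).
Let bZ c := [set v in Z | blk v == c].

(** The half [Z] agrees with the labels except on [Mv], the vertices moved when the sizes of the
    halves are corrected, so counts over a block change by at most [#|Mv|]. *)
Lemma block_near (P : pred V) c : #|[set v in bZ c | P v]| <= #|[set x in N | P x && (lab x \in [set (c, s)])]| + 2 * q /\
  #|[set x in N | P x && (lab x \in [set (c, s)])]| <= #|[set v in bZ c | P v]| + 2 * q.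
Proof.
pose Z0 := [set x in N | lab x \in [set (c, s)]].
have eqZ0 : [set x in N | P x && (lab x \in [set (c, s)])] = [set x in Z0 | P x].
  by apply/setP => x; rewrite !inE -andbA [P x && _]andbC.
have labE x : (lab x == (c, s)) = ((lab x).1 == c) && ((lab x).2 == s) by [].
rewrite eqZ0; split; apply: (near_card _ cMv) => x; rewrite !inE labE.
- by move=> /andP[xZ xc] xM; have xN := subsetP ZN x xZ; rewrite xN -ZP // xZ andbT.
- by move=> /andP[xN /andP[xc xs]] xM; rewrite ZP // xs.
Qed.

Let t0 : 0 < t. Proof. by case: uH => -[]. Qed.
Let qt : q <= t * q. Proof. by rewrite leq_pmull. Qed.
Let wt : t * w <= t * q. Proof. by rewrite leq_mul2l wq orbT. Qed.

Lemma side_deg v c : v \in N -> d <= #|[set x in bZ c | e v x]| + 4 * q /\ #|[set x in bZ c | e v x]| <= d + 4 * q.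
Proof.
move=> vN; have [/(_ v) + _ _] := labP [set (c, s)]; rewrite /fair cards1 !muln1.
have [n1 n2] := block_near (e v) c; have := degN vN.
have : #|[set x in N | e v x]| <= D.
  by apply: leq_trans (dD v); apply: subset_leq_card; apply/subsetP => x; rewrite !inE => /andP[].
case: sH => [_ [e1 e2 _ _] _ _ _]; have [_ tq] := t_le uH.
move: n1 n2; move: #|[set x in bZ c | e v x]| #|[set x in N | e v x && _]| #|[set x in N | e v x]| => a b0 f n1 n2 h1 h2 /andP[h3 h4].
have n1' : t * a <= t * (b0 + 2 * q) by rewrite leq_mul2l n1 orbT.
have n2' : t * b0 <= t * (a + 2 * q) by rewrite leq_mul2l n2 orbT.
split; rewrite -(leq_pmul2l t0); clear -n1' n2' h1 h2 h3 h4 e1 e2 tq qt wt; lia.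
Qed.

Lemma side_size c : be <= #|bZ c| + 4 * q /\ #|bZ c| <= be + 4 * q.
Proof.
have [_ _ +] := labP [set (c, s)]; rewrite /fair cards1 !muln1.
have [n1 n2] := block_near predT c; have cN : #|N| <= #|V| by apply: max_card.
have bE : [set x in bZ c | predT x] = bZ c by apply/setP => x; rewrite inE andbT.
rewrite bE /= in n1 n2.
case: sH => [_ _ [k1 k2] _ _]; have [_ tq] := t_le uH.
move: n1 n2 cN cardN; move: #|bZ c| #|[set x in N | _]| #|N| => a b0 f n1 n2 h1 h2 /andP[h3 h4].
have n1' : t * a <= t * (b0 + 2 * q) by rewrite leq_mul2l n1 orbT.
have n2' : t * b0 <= t * (a + 2 * q) by rewrite leq_mul2l n2 orbT.
split; rewrite -(leq_pmul2l t0); clear -n1' n2' h1 h2 h3 h4 k1 k2 tq qt wt; lia.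
Qed.

Lemma block_cell c a : 2 * t * #|[set x in bZ c :\: Mv | cell x == a]| <= #|[set x | cell x == a]| + 2 * t * w.
Proof.
have [_ /(_ a) + _] := labP [set (c, s)]; rewrite /fair cards1 !muln1 => /andP[h _].
have cN : #|[set x in N | cell x == a]| <= #|[set x | cell x == a]|.
  by apply: subset_leq_card; apply/subsetP => x; rewrite !inE => /andP[].
have le : #|[set x in bZ c :\: Mv | cell x == a]| <= #|[set x in N | (cell x == a) && (lab x \in [set (c, s)])]|.
  apply: subset_leq_card; apply/subsetP => x; rewrite !inE => /andP[/andP[xM /andP[xZ xc]] ->].
  have xN := subsetP ZN x xZ; rewrite xN /= -[lab x == _]/(((lab x).1 == c) && ((lab x).2 == s)).
  by rewrite -[(lab x).1]/(blk x) xc -ZP.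
rewrite mulnC; apply: leq_trans (leq_mul le (leqnn _)) _; rewrite [2 * t]mulnC.
by apply: leq_trans h _; rewrite leq_add2r.
Qed.

Let half_card : #|[set p : T * bool | p.2 == s]| = t.
Proof.
have I : injective (fun c : T => (c, s)) by move=> x y [].
have <- : #|{: T}| = t by rewrite card_prod card_ord.
rewrite -[RHS]cardsT -(card_imset _ I); apply: eq_card => -[c s']; rewrite inE /=.
apply/eqP/imsetP => [->|[c' _ [_ //]]]; by exists c.
Qed.

Lemma half_cell a : 2 * #|[set x in Z :\: Mv | cell x == a]| <= #|[set x | cell x == a]| + 2 * w.
Proof.
have [_ /(_ a) + _] := labP [set p | p.2 == s]; rewrite /fair half_card => /andP[h _].
have cN : #|[set x in N | cell x == a]| <= #|[set x | cell x == a]|.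
  by apply: subset_leq_card; apply/subsetP => x; rewrite !inE => /andP[].
have le : #|[set x in Z :\: Mv | cell x == a]| <= #|[set x in N | (cell x == a) && (lab x \in [set p | p.2 == s])]|.
  apply: subset_leq_card; apply/subsetP => x; rewrite !inE => /andP[/andP[xM xZ] ->].
  by have xN := subsetP ZN x xZ; rewrite xN /= -ZP.
move: h cN le; move: #|_| #|_| #|_| #|_| => x y z z' h cN le.
have h' : t * x <= t * z' by rewrite leq_mul2l le orbT.
have h'' : t * z <= t * y by rewrite leq_mul2l cN orbT.
by rewrite -(leq_pmul2l t0); clear -h h' h''; lia.
Qed.

Lemma half_deg v : #|[set x in N | e v x]| <= 2 * #|[set x in Z | e v x]| + 6 * q.
Proof.
have [/(_ v) + _ _] := labP [set p | p.2 == s]; rewrite /fair half_card => /andP[_ h].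
have le : #|[set x in N | e v x && (lab x \in [set p | p.2 == s])]| <= #|[set x in Z | e v x]| + 2 * q.
  rewrite (_ : [set x in N | _] = [set x in [set x in N | (lab x).2 == s] | e v x]).
    by apply: (near_card _ cMv) => x; rewrite !inE => /andP[xN xs] xM; rewrite ZP.
  by apply/setP => x; rewrite !inE -andbA [e v x && _]andbC.
move: h le; move: #|_| #|_| #|_| => x y z h le.
have h' : t * y <= t * (x + 2 * q) by rewrite leq_mul2l le orbT.
by rewrite -(leq_pmul2l t0); clear -h h' wt; lia.
Qed.

Lemma half_size : 2 * #|[set x in N | (lab x).2 == s]| <= #|N| + 2 * w /\ #|N| <= 2 * #|[set x in N | (lab x).2 == s]| + 2 * w.
Proof.
have [_ _ +] := labP [set p | p.2 == s]; rewrite /fair half_card => /andP[].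
rewrite (_ : [set x in N | lab x \in _] = [set x in N | (lab x).2 == s]); last by apply/setP => x; rewrite !inE.
by move: #|_| #|_| => x y h1 h2; split; rewrite -(leq_pmul2l t0); clear -h1 h2; lia.
Qed.

End Side.

Variables (A B Mv : {set V}) (b : bool).
Hypotheses (NE : N = A :|: B) (dis : [disjoint A & B]) (cMv : #|Mv| <= 2 * q).
Hypothesis AP : forall x, x \in N -> x \notin Mv -> (x \in A) = ((lab x).2 == b).
Hypotheses (dA : #|A| <= #|B| + q) (dB : #|B| <= #|A| + q).

Let AN : A \subset N. Proof. by rewrite NE subsetUl. Qed.
Let BN : B \subset N. Proof. by rewrite NE subsetUr. Qed.
Let BP : forall x, x \in N -> x \notin Mv -> (x \in B) = ((lab x).2 == ~~ b).
Proof.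
move=> x xN xM; have -> : (x \in B) = (x \notin A).
  move: xN; rewrite NE in_setU => /orP[xA|xB]; first by rewrite xA (disjointFr dis xA).
  by rewrite xB (disjointFl dis xB).
by rewrite AP //; case: (lab x).2; case: b.
Qed.

Lemma core_halves (Bad : T * T * ('I_qi + 'I_qc) + 'I_(2 * u25) -> {set V}) :
    (forall j, #|Bad j| <= u1) -> (forall w, #|[set j | w \in Bad j]| <= u1) ->
    (forall j, ~~ odd #|N :\: Bad j|) ->
    inner e A + \sum_j #|B :\: Bad j| = inner e B + \sum_j #|A :\: Bad j| ->
  exists M : T * T * ('I_qi + 'I_qc) + 'I_(2 * u25) -> rel V, [/\ forall j, pmatch (N :\: Bad j) (M j), forall j, subrel (M j) e,
    forall j k w v, M j w v -> M k w v -> j = k &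
    forall w v, same_side A B w v -> e w v -> exists j, M j w v].
Proof.
have [mid [mC mx mI]] := midpoint om.
have [ql qlP] := PL A B blk; rewrite NE.
have t0 : 0 < t by case: uH => -[].
have cN : #|N| = #|A| + #|B| by rewrite NE card_disjointU.
have lossle h : h * (#|Mv| + #|Cl| * (w + 1)) <= h * (4 * q).
  by rewrite leq_mul2l; apply/orP; right; clear -cMv Clw; lia.
apply: (core_exists R (blk := blk) (ql := ql) uH sH es ei dis mC mx mI).
- by move=> v c; rewrite -NE => vN; apply: (side_deg AN AP cMv).
- by move=> v c; rewrite -NE => vN; apply: (side_deg BN BP cMv).
- by move=> c; apply: (side_size AN AP cMv).
- by move=> c; apply: (side_size BN BP cMv).
- by move=> Lq v c; have [h _ _] := qlP Lq; apply: h.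
- by move=> Lq v c; have [_ h _] := qlP Lq; apply: h.
- by move=> Lq; have [_ _ h] := qlP Lq.
- exact: dA.
- exact: dB.
- by rewrite -cN max_card.
- by rewrite -cN.
- move=> S S' SA SB h1 h2 h3; apply: (@EX 2 A B Mv S S' w) => //.
  + by rewrite /= leq_pmulr.
  + by move=> a; apply: (half_cell AN AP).
  + by move=> a; apply: (half_cell BN BP).
  + by apply: leq_trans h1; rewrite leq_add2l leq_mul2l lossle orbT.
  + by apply: leq_trans h3; rewrite leq_add2l leq_mul2l lossle orbT.
- move=> c c' S S' SA SB h1 h2 h3; apply: (@EX (2 * t) (blkA A blk c) (blkB B blk c') Mv S S' w) => //.
  + by rewrite leqnn muln_gt0 t0.
  + by move=> a; apply: (block_cell AN AP).
  + by move=> a; apply: (block_cell BN BP).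
  + by apply: leq_trans h1; rewrite leq_add2l leq_mul2l lossle orbT.
  + by apply: leq_trans h3; rewrite leq_add2l leq_mul2l lossle orbT.
Qed.

End Halves.

Hypothesis ore : forall u v, e u v -> D + 2 <= #|nb e u| + #|nb e v|.
Hypothesis sparse : forall Z : {set V}, inner e Z <= 2 * (D * #|Z|./2).
Hypothesis u1E : u1 = m * q.
Variable Lo : {set V}.
Hypothesis LoP : forall v, (v \in Lo) = (q < D - #|nb e v|).
Hypothesis cLo : 1000 * #|Lo| <= q.
Hypothesis VL : forall N : {set V}, exists lab : V -> T * bool, forall Lb : {set (T * bool)},
    [/\ forall v, fair (t * 2) #|Lb| w #|[set x in N | e v x && (lab x \in Lb)]| #|[set x in N | e v x]|,
        forall a, fair (t * 2) #|Lb| w #|[set x in N | (cell x == a) && (lab x \in Lb)]| #|[set x in N | cell x == a]| &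
        fair (t * 2) #|Lb| w #|[set x in N | lab x \in Lb]| #|N|].

(** A vertex of [N] has at most [2 * q] tokens; one of [X] may have about [#|V|], but [X] has fewer
    than [q] vertices. *)
Lemma sum_tokens (U W N X : {set V}) : W = N :|: X -> U \subset Lo -> X \subset Lo -> (forall x, x \in N -> x \notin Lo) ->
  #|tokens e D U W| <= 4 * (q * #|V|).
Proof.
move=> WE UL XL NL.
have cl (Z : {set V}) : Z \subset Lo -> #|Z| <= #|Lo| by apply: subset_leq_card.
have -> : #|tokens e D U W| = \sum_(v in W) #|[set h in tokens e D U W | h.1 == v]|.
  rewrite -sum1_card (partition_big fst (mem W)) /=; last by move=> h; rewrite inE => /andP[].
  by apply: eq_bigr => v _; rewrite sum1dep_card; apply: eq_card => h; rewrite !inE.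
have UB v : #|nb e v :&: U| <= #|Lo| by apply: leq_trans (cl _ UL); apply: subset_leq_card; apply: subsetIr.
have Dn : D <= #|V| by case: sH => -[].
apply: leq_trans (_ : \sum_(v in N) (2 * q) + \sum_(v in X) (q + #|V|) <= _).
  rewrite (bigID (mem N)) /=; apply: leq_add.
    rewrite [X in _ <= X]big_mkcond [X in X <= _]big_mkcond; apply: leq_sum => v _.
    case: ifP => [/andP[vW vN]|_]; last by case: ifP.
    rewrite vN tokens_at //; have := UB v; have := NL v vN; rewrite LoP -leqNgt; move: cLo; clear; lia.
  rewrite [X in _ <= X]big_mkcond [X in X <= _]big_mkcond; apply: leq_sum => v _.
  case: ifP => [/andP[vW vN]|_]; last by case: ifP.
  have vX : v \in X by move: vW; rewrite WE in_setU (negPf vN).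
  rewrite vX tokens_at //; apply: leq_add; last by apply: leq_trans (leq_subr _ _) Dn.
  by apply: leq_trans (UB v) _; move: cLo; clear; lia.
rewrite !sum_nat_const; have := max_card (mem N); have := cl _ XL; have := max_card (mem X).
move: (#|N|) (#|X|) => x y y1 y2 x1.
have h1 : x * (2 * q) <= #|V| * (2 * q) by rewrite leq_mul2r x1 orbT.
have h2 : y * q <= #|V| * q by rewrite leq_mul2r y1 orbT.
have h3 : y * #|V| <= q * #|V| by rewrite leq_mul2r; apply/orP; right; move: cLo y2; clear; lia.
clear -h1 h2 h3; lia.
Qed.

Lemma card_tk (H : {set V * (V + 'I_D)}) (c : V * (V + 'I_D) -> nat) v :
  #|[set i : 'I_D | tk c H v i]| <= #|[set h in H | h.1 == v]|.
Proof.
apply: (@card_le_rel _ _ _ _ (fun (h : V * (V + 'I_D)) (i : 'I_D) => c h == i)).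
  move=> i; rewrite inE => /existsP[h /and3P[hH h1 ch]]; exists h => //.
  by rewrite inE hH.
by move=> h i i' /eqP h1 /eqP h2; apply: ord_inj; rewrite -h1.
Qed.

Lemma construct : exists K : 'I_D -> rel V,
  [/\ forall i, symmetric (K i), forall i w v v', K i w v -> K i w v' -> v = v' &
      forall w v, e w v -> exists i, K i w v].
Proof.
have UH := uH; have SH := sH.
case: UH => [[_ t0 tq m0] [a1 a2 a3 a4 a5] [b1 b2 b3 b4 b5] [c1 c2 c3 c4 c5] [p1 p2 p3 p4 p5]].
case: SH => [[s1 s2 s3 s4] _ _ _ _]; have [_ t2] := t_le uH.
have q0 : 0 < q by apply: leq_trans t2.
have D25 : 1000 * (1000 * (1000 * q)) <= D by clear -s3 a1 a2 a3 a4 a5 b1 b2 b3 b4; lia.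
have [rs1 rs2] := rest_small uH sH.
have [U [Uind Ud cases]] := vertex_classes ei ore.
have UL : U \subset Lo.
  by apply/subsetP => u uU; rewrite LoP; have := Ud u uU; move: D25 q0; clear; lia.
have [N NP] : exists N : {set V}, forall x, (x \in N) = (x \notin Lo) by exists (~: Lo) => x; rewrite inE.
have [X XP] : exists X : {set V}, forall x, (x \in X) = (x \in Lo) && (x \notin U).
  by exists (Lo :\: U) => x; rewrite !inE andbC.
have XL : X \subset Lo by apply/subsetP => x; rewrite XP => /andP[].
have cU : #|U| <= #|Lo| by apply: subset_leq_card.
have cX : #|X| <= #|Lo| by apply: subset_leq_card.
have WE : ~: U = N :|: X.
  apply/setP => x; rewrite in_setC in_setU NP XP; case xL: (x \in Lo) => //=.
  by apply/negP => xU; rewrite (subsetP UL x xU) in xL.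
have dNX : [disjoint N & X] by apply: disjointI => x; rewrite NP XP => /negPf->.
have cN : #|V| <= #|N| + q.
  have : #|N| + #|Lo| = #|V|.
    by rewrite -(cardsC Lo) addnC; congr (_ + _); apply: eq_card => x; rewrite NP inE.
  by move: cLo; clear; lia.
have cN' : #|N| <= #|V| by apply: max_card.
have degN v : v \in N -> D <= #|[set x in N | e v x]| + 2 * q.
  rewrite NP LoP -leqNgt => h.
  have : #|nb e v| <= #|[set x in N | e v x]| + #|Lo|.
    apply: leq_trans (leq_card_setU _ _); apply: subset_leq_card; apply/subsetP => x.
    by rewrite !in_set NP => ->; case: (x \in Lo).
  by move: h cLo; clear; lia.
have degX v : v \in X -> D <= 3 * #|[set x in N | e v x]|.
  rewrite XP => /andP[_ vU].
  have : #|nb e v| <= #|[set x in N | e v x]| + #|Lo|.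
    apply: leq_trans (leq_card_setU _ _); apply: subset_leq_card; apply/subsetP => x.
    by rewrite !in_set NP => ->; case: (x \in Lo).
  have : 9 * D <= 20 * #|nb e v|.
    by case: cases => [[_ h]|[_ [h _]]]; [apply: h|apply: leq_trans (ltnW (h v vU)); rewrite leq_mul2r orbT].
  by move: cLo D25; clear; lia.
move EH : (tokens e D U (~: U)) => H.
have [|||c [[cD cp cpar] csz [I1 [I1s I1P]] cfree]] := @tokens_exist V e D #|Lo| es ei dD sparse U Uind Ud _ cU.
- case: cases => [[h h']|[h [h' h'']]]; [left|right]; (split; first exact: h).
    by move=> v; rewrite inE; apply: h'.
  by split=> // v; rewrite inE; apply: h'.
- by move: cLo D25; clear; lia.
- by move: q0 D25; clear; lia.
rewrite EH in cD cp cpar csz I1P cfree.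
have [lab labP] := VL N.
move Eg : (nat_of_bool (odd #|~: U|)) => g; rewrite Eg in I1P.
have g1 : g <= 1 by rewrite -Eg; case: odd.
pose Ic := (T * T * ('I_qi + 'I_qc) + 'I_(2 * u25))%type.
have cIc : #|{: Ic}| = t * t * (qi + qc) + 2 * u25.
  by rewrite fintype.card_sum !card_prod fintype.card_sum !card_ord.
move Er : (D - #|{: Ic}|) => r; have rE : D = r + #|{: Ic}| by rewrite -Er subnK // cIc.
have r20 : 20 * r <= D by rewrite -Er cIc.
(* The labels are fixed before the colours for Koenig's theorem, so these can be chosen with all
   their tokens on one side. *)
have [||b [S [SI cS sideP]]] := @choose_side _ D H c (fun h => (lab h.1).2) I1 r.
- by move=> i /I1P->.
- by move: r20 I1s; clear; lia.
have clsS i : i \in S -> #|cls H c i| = g by move=> iS; apply/I1P/(subsetP SI).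
pose A0 := [set x in N | (lab x).2 == b].
(* These vertices hold tokens with colours in [S], so they must stay in [A] when its size is
   corrected. *)
have [Y0 Y0P] : exists Y0 : {set V}, forall x, (x \in Y0) = (x \in A0) && [exists h in H, (h.1 == x) && [exists i in S, c h == i]].
  by exists [set x in A0 | [exists h in H, (h.1 == x) && [exists i in S, c h == i]]] => x; rewrite in_set.
have Y0A : Y0 \subset A0 by apply/subsetP => x; rewrite Y0P => /andP[].
have A0N : A0 \subset N by apply/subsetP => x; rewrite in_set => /andP[].
have cY0 : #|Y0| <= r.
  rewrite -cS; apply: (@card_le_rel _ _ _ _ (fun (i : 'I_D) (x : V) => (i \in S) && [exists h in H, (h.1 == x) && (c h == i)])).
    move=> x; rewrite Y0P => /andP[_ /existsP[h /and3P[hH hx /existsP[i /andP[iS ch]]]]]; exists i => //.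
    by rewrite iS; apply/existsP; exists h; rewrite hH hx ch.
  move=> i x x' /andP[iS /existsP[h /and3P[hH /eqP<- /eqP ch]]] /andP[_ /existsP[h' /and3P[hH' /eqP<- /eqP ch']]].
  have /card_le1_eqP/(_ h h') : #|cls H c i| <= 1 by rewrite clsS.
  by rewrite !in_set hH hH' ch ch' !eqxx => /(_ isT isT)->.
have cUW : #|~: U| = #|N| + #|X| by rewrite WE card_disjointU.
(* The size of [A] forced by [#|A| + #|X| = #|B| + g]; it is an integer because [g] is the parity of
   [#|N| + #|X|]. *)
have [a aE] : exists a, 2 * a + #|X| = #|N| + g.
  exists ((#|N| + #|X|)./2 + g - #|X|); have := odd_double_half (#|N| + #|X|); rewrite -cUW Eg cUW -muln2.
  by move: cX cLo cN s1 q0 a1 a2 a3 a4 a5 b1 b2 b3 b4 b5; move: (_./2) => x; clear; lia.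
have cXq : 1000 * #|X| <= q by move: cX cLo; clear; lia.
have [||A [YA AN cA] dA0] := @adjust V N A0 Y0 a Y0A A0N.
- by apply: leq_trans cY0 _; move: aE cXq cN r20 s4 D25 q0; clear; lia.
- by move: aE cXq cN s4 D25 q0 g1; clear; lia.
have [B BP] : exists B : {set V}, forall x, (x \in B) = (x \in N) && (x \notin A).
  by exists (N :\: A) => x; rewrite in_setD andbC.
have dis : [disjoint A & B] by apply: disjointI => x xA; rewrite BP xA andbF.
have NE : N = A :|: B.
  apply/setP => x; rewrite in_setU BP; case xA: (x \in A) => /=; last by rewrite andbT.
  exact: (subsetP AN).
have cNAB : #|N| = #|A| + #|B| by rewrite NE card_disjointU.
pose Mv := (A :\: A0) :|: (A0 :\: A).
have [hs1 hs2] := half_size labP b.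
have cMv : #|Mv| <= 2 * q.
  apply: leq_trans (leq_card_setU _ _) _; rewrite dA0; move: hs1 hs2 aE cXq wq g1 q0; rewrite -/A0.
  by move: #|A0| #|N| => x y; clear; lia.
have AP x : x \in N -> x \notin Mv -> (x \in A) = ((lab x).2 == b).
  move=> xN; rewrite in_setU !in_setD in_set xN /=.
  by case: (x \in A); case: ((lab x).2 == b).
have cAB : #|A| + #|X| = #|B| + g by move: aE cNAB cA; clear; lia.
have [dA dB] : #|A| <= #|B| + q /\ #|B| <= #|A| + q by move: cAB cXq g1 q0; clear; lia.
have BPs x : x \in N -> x \notin Mv -> (x \in B) = ((lab x).2 == ~~ b).
  by move=> xN xM; rewrite BP xN (AP x xN xM); case: (lab x).2; case: (b).
have u1q : 1000 * q <= u1 by [].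
have u1D : 1000 * u1 <= D by clear -s3 a1 a2 a3 a4 a5 b1 b2 b3 b4; lia.
have nbI (Z : {set V}) v : #|nb e v :&: Z| = #|[set x in Z | e v x]|.
  by apply: eq_card => x; rewrite !in_set andbC.
have tkq v : v \in N -> #|[set i | tk c H v i]| <= 2 * q.
  move=> vN; apply: leq_trans (card_tk H c v) _; have vW : v \in ~: U by rewrite WE in_setU vN.
  rewrite -EH tokens_at //; have := vN; rewrite NP LoP -leqNgt.
  have : #|nb e v :&: U| <= #|Lo| by apply: leq_trans cU; apply: subset_leq_card; apply: subsetIr.
  by move: cLo; clear; lia.
apply: (@assembly V _ e D r g u1 u1 U X A B c S N (~: U) H NE WE (esym EH) es ei dis dNX _ _ dD Uind cD cp _ cS rE _ _ cAB).
- by rewrite disjoints_subset.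
- by rewrite setUC setUCr.
- by move=> i _; have := cpar i; rewrite leqNgt ltn_ord orbF.
- move=> h i hH iS ch; have := hH; rewrite -EH inE => /andP[hW _]; move: hW; rewrite WE !in_setU => /orP[hN|->]; last by rewrite orbT.
  have hA0 : h.1 \in A0 by rewrite in_set hN (sideP h i hH iS ch) eqxx.
  rewrite (subsetP YA) // Y0P hA0 /=; apply/existsP; exists h; rewrite hH eqxx /=.
  by apply/existsP; exists i; rewrite iS ch eqxx.
- rewrite -cS -sum_nat_const -(eq_bigr _ clsS) /cls sum_card_exchange -sum1_card big_mkcond [RHS]big_mkcond.
  apply: eq_bigr => h _; rewrite in_set; case hH: (h \in H) => //=.
  case: ifP => [/existsP[i /andP[iS /eqP ch]]|/negbT/existsPn no]; apply/esym.
    rewrite (_ : [set x in S | _] = [set i]) ?cards1 //; apply/setP => i'; rewrite in_set in_set1 ch.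
    by apply/andP/eqP => [[_ /eqP/ord_inj->//]|->]; first by split.
  by apply: eq_card0 => i; rewrite in_set; have := no i; case: (i \in S) => //= /negPf->.
- move=> x x' xX x'X _.
  have xW y : y \in X -> y \in ~: U by rewrite WE in_setU orbC => ->.
  have := cfree x x' (xW _ xX) (xW _ x'X).
  have : #|[set i | [|| i \in S, tk c H x i | tk c H x' i]]| <= r + #|[set i | tk c H x i || tk c H x' i]|.
    rewrite -cS; apply: leq_trans (leq_card_setU _ _); apply: subset_leq_card; apply/subsetP => i.
    by rewrite !in_set.
  by move: r20 cXq D25 q0; clear; lia.
- move=> x xX; have := degX x xX; rewrite nbI.
  have := half_deg labP BPs cMv x.
  by move: r20 D25 q0; clear; lia.
- move=> x xX; have := degX x xX; rewrite nbI; move: r20 u1D D25 q0; clear; lia.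
- by move=> v vN; have := tkq v vN; move: cXq u1q; clear; lia.
(* A larger class would need more than the [4 * (q * #|V|)] tokens available, since
   [u1 * u25 = q * u26]. *)
- move=> i; suff : #|cls H c i| + q <= u1 by move: cXq; clear; lia.
  have [h|h] := csz i; first by move: h u1q q0; clear; lia.
  have NL x : x \in N -> x \notin Lo by rewrite NP.
  have := sum_tokens WE UL XL NL; rewrite EH => tn.
  rewrite leqNgt; apply/negP => lt.
  have h1 : u1 <= 2 * (#|cls H c i| - 1) by move: lt u1q q0; clear; lia.
  have h2 : 500 * u25 <= D %/ 4 by move: s3; clear; lia.
  have h3 : u1 * (500 * u25) <= 2 * (#|cls H c i| - 1) * (D %/ 4) by apply: leq_mul.
  have h4 : u1 * (500 * u25) = 500 * (q * u26) by rewrite u1E -c5; clear; lia.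
  have h5 : q * #|V| <= q * (2 * u26).
    by rewrite leq_mul2l; apply/orP; right; move: s2; clear -a1 a2 a3 a4 a5 b1 b2 b3 b4 b5; lia.
  have h6 : 0 < q * u26 by rewrite muln_gt0 q0; clear -q0 a1 a2 a3 a4 a5 b1 b2 b3 b4 b5; lia.
  move: h; rewrite -mulnA in h3; move: (_ * (D %/ 4)) h3 => x; rewrite h4; clear -h5 h6 tn; lia.
- exact: (core_halves labP degN cN NE dis cMv AP dA dB).
Qed.

End Construct.

Import Order.TTheory GRing.Theory Num.Theory.
Local Open Scope ring_scope.

(* Odd, so that midpoints exist modulo this number. *)
Definition mesh (R : realType) (x : R) : nat := (Num.truncn (4000 / x ^+ 2)).*2.+1.

Lemma mesh_gt (R : realType) (x : R) : 0 < x -> 4000 < x ^+ 2 * (mesh x)%:R.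
Proof.
move=> x0; have x2 : 0 < x ^+ 2 by rewrite exprn_gt0.
rewrite mulrC -ltr_pdivrMr //; apply: lt_le_trans (truncnS_gt _) _.
by rewrite ler_nat ltnS -addnn leq_addr.
Qed.

Lemma mesh_anti (R : realType) (x y : R) : 0 < x -> x <= y -> (mesh y <= mesh x)%N.
Proof.
move=> x0 xy; have y0 : 0 < y by apply: lt_le_trans xy.
rewrite /mesh ltnS leq_double; apply: le_truncn; rewrite ler_pM2l //.
by rewrite lef_pV2 ?posrE ?exprn_gt0 // lerXn2r ?nnegrE ?(ltW x0) ?(ltW y0).
Qed.

(** The 27th power of the mesh exceeds [n / q], which is about its 26th power. So [eta * n <= q],
    and the vertices whose degree falls short of the maximum by more than [q] number at most
    [q / 1000]. *)
Definition tolerance (R : realType) (x : R) : R := (mesh x)%:R^-1 ^+ 27.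

Lemma tolerance_itv (R : realType) (x : R) : 0 < tolerance x <= 1.
Proof.
have m0 : 0 < (mesh x)%:R^-1 :> R by rewrite invr_gt0 ltr0n.
rewrite /tolerance exprn_gt0 //=; apply: exprn_ile1; first exact: ltW.
by rewrite invf_le1 ?ler1n ?ltr0n.
Qed.

Lemma tolerance_mono (R : realType) (x y : R) : 0 < x -> x <= y -> tolerance x <= tolerance y.
Proof.
move=> x0 xy; have m0 z : 0 <= (mesh z)%:R^-1 :> R by rewrite invr_ge0 ler0n.
rewrite /tolerance lerXn2r ?nnegrE // lef_pV2 ?posrE ?ltr0n //.
by rewrite ler_nat; apply: mesh_anti.
Qed.

Lemma low_deg_small (R : realType) (G : sgraph) (m q : nat) (eta : R) :
    (1000 <= m)%N -> (#|G| <= m ^ 27 * q)%N -> 0 < eta <= m%:R^-1 ^+ 27 ->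
    #|low_deg G eta|%:R < eta ^+ 2 * #|G|%:R ->
  (1000 * #|[set v : G | q < max_deg G - #|nb (@adj G) v|]| <= q)%N.
Proof.
move=> m1 nq /andP[eta0 etam] low; have mR : 1 <= (m%:R : R) by rewrite ler1n; apply: leq_trans m1.
have m27 : 0 < (m%:R : R) ^+ 27 by rewrite exprn_gt0 //; lra.
have em : eta * m%:R ^+ 27 <= 1 by move: etam; rewrite exprVn -ler_pdivlMr // mul1r.
have en : eta * #|G|%:R <= q%:R.
  apply: (@le_trans _ _ (eta * (m%:R ^+ 27 * q%:R))).
    by rewrite ler_pM2l // -natrX -natrM ler_nat.
  by rewrite mulrA -[X in _ <= X]mul1r ler_wpM2r.
have e1000 : 1000 * eta <= 1.
  apply: le_trans em; rewrite mulrC ler_pM2l //; apply: (@le_trans _ _ m%:R); first by rewrite ler_nat.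
  by rewrite -[X in X <= _]expr1 ler_weXn2l.
have sub : (#|[set v : G | q < max_deg G - #|nb (@adj G) v|]| <= #|low_deg G eta|)%N.
  apply: subset_leq_card; apply/subsetP => v; rewrite !inE => lt; apply: le_lt_trans en _.
  rewrite -natrB ?ltr_nat //; apply: ltnW; rewrite -subn_gt0; apply: leq_trans lt; exact: leq0n.
have : (1000 * #|[set v : G | q < max_deg G - #|nb (@adj G) v|]|)%N%:R <= q%:R :> R.
  rewrite natrM; apply: (@le_trans _ _ (1000 * #|low_deg G eta|%:R)).
    by rewrite ler_wpM2l // ler_nat.
  apply: (@le_trans _ _ (1000 * (eta ^+ 2 * #|G|%:R))); first by rewrite ler_wpM2l // ltW.
  rewrite expr2 -mulrA mulrA; apply: le_trans en.
  by rewrite -[X in _ <= X]mul1r ler_wpM2r // mulr_ge0 // ltW.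
by rewrite ler_nat.
Qed.

(** The order of the choices: [m] from [nu], then [k] and the number [C] of cells from [m] and [nu],
    then the thresholds of the random labellings. Given the graph, [q] is [n] divided by [m ^ 26],
    and labels deviate by at most [q %/ C], so that the losses over all cells add up to at most
    [2 * q]. *)
Lemma edge_colorable_of_sparse (R : realType) (alpha nu : R) : 0 < alpha ->
    0 < nu <= Num.min alpha 1 / 1000 ->
  exists n0 : nat, forall G : sgraph, (n0 <= #|G|)%N -> alpha * #|G|%:R <= (max_deg G)%:R ->
    (forall u v : G, adj u v -> (max_deg G + 2 <= deg u + deg v)%N) ->
    (exists eta : R, 0 < eta <= tolerance nu /\ #|low_deg G eta|%:R < eta ^+ 2 * #|G|%:R) ->
    robust_expander G nu (Num.min alpha 1 / 1000) ->
    (forall Z : {set G}, inner (@adj G) Z <= 2 * (max_deg G * #|Z|./2))%N ->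
  edge_colorable G (max_deg G).
Proof.
move=> alpha0 /andP[nu0 nutau]; set tau := Num.min alpha 1 / 1000 in nutau *.
have taua : 1000 * tau <= alpha by rewrite /tau mulrCA divff ?mulr1 ?ge_min ?lexx // pnatr_eq0.
have tau1 : 1000 * tau <= 1 by rewrite /tau mulrCA divff ?mulr1 ?ge_min ?lexx ?orbT // pnatr_eq0.
have mgt := mesh_gt nu0; have om : odd (mesh nu) by rewrite /mesh /= odd_double.
rewrite /tolerance; move: (mesh nu) mgt om => m mgt om.
have nu1 : 1000 * nu <= 1 by lra.
have numR : 1000 * 4000 < nu * m%:R.
  have : nu ^+ 2 * m%:R * 1000 <= nu * m%:R.
    by rewrite expr2 -!mulrA ler_pM2l // mulrC -mulrA ler_piMr // mulrC.
  by move: mgt; move: (nu ^+ 2 * _) (nu * _) => x y; lra.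
have m1 : (1000 <= m)%N.
  rewrite -(ler_nat R); apply: (@le_trans _ _ (nu * m%:R)); first by clear -numR; move: numR; move: (nu * _) => x; lra.
  by rewrite ler_piMl //; clear -nu0 nu1; lra.
have m0 : (0 < m)%N by apply: leq_trans m1.
have t0 : (0 < 2 * (m * m))%N by rewrite !muln_gt0 m0.
pose eps : R := (nu ^+ 2 / (16 * (2 * (m * m))%:R ^+ 2)) ^+ 2.
have eps0 : 0 < eps by rewrite exprn_gt0 // divr_gt0 ?exprn_gt0 // mulr_gt0 // exprn_gt0 // ltr0n.
have [k kP] : exists k : nat, 1 <= k%:R * eps.
  by have [k kP] := lt_nat eps^-1; exists k; rewrite -ler_pdivrMr // mul1r ltW // kP.
pose Cl := {ffun 'I_k -> bool * bool}; move EC : (#|{: Cl}|) => C.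
have C0 : (0 < C)%N by rewrite -EC; apply/card_gt0P; exists [ffun=> (true, true)].
have m26 : (0 < m ^ 26)%N by rewrite expn_gt0 m0.
have mm0 : (0 < m * m)%N by rewrite muln_gt0 m0.
have [|n1 VLP] := @vertex_labels_nat R (4 * C * m ^ 26) C (m * m) _ mm0.
  by rewrite muln_gt0 m26 muln_gt0 C0.
have [||n2 PLP] := @pair_labels_nat R (2 * m ^ 26) 64 (m * m); [by rewrite muln_gt0 m26|by []|].
(* A lower bound for [q]: [m ^ 26] absorbs the remainder of the division that defines [q], [2 * C]
   the rounding in [q %/ C], and [m ^ 4] is the square of the number of blocks in a half. *)
pose Q0 := (m ^ 26 + 2 * C + m ^ 4)%N.
exists (Q0 * m ^ 26 + n1 + n2)%N => G nG Dalpha ore' [eta [eta0 low]] rob sparse.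
pose n := #|G|; pose q := (n %/ m ^ 26)%N; pose D := max_deg G.
have qQ : (Q0 <= q)%N.
  by rewrite leq_divRL //; apply: leq_trans nG; rewrite -addnA leq_addr.
have qm26 : (m ^ 26 <= q)%N by apply: leq_trans qQ; rewrite /Q0 -addnA leq_addr.
have qm4 : (m ^ 4 <= q)%N by apply: leq_trans qQ; rewrite /Q0 leq_addl.
have qC : (2 * C <= q)%N by apply: leq_trans qQ; rewrite /Q0 addnAC leq_addl.
have n_lo : (unit_pow m q 26 <= n)%N by rewrite /unit_pow mulnC leq_divM.
have n_hi : (n <= unit_pow m q 26 + q)%N.
  rewrite {1}(divn_eq n (m ^ 26)) /unit_pow mulnC leq_add2l.
  by apply: leq_trans qm26; apply: ltnW; rewrite ltn_pmod.
have n_2 : (n <= 2 * m ^ 26 * q)%N.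
  apply: leq_trans n_hi _; rewrite /unit_pow -mulnA mul2n -addnn leq_add2l.
  by rewrite leq_pmull.
have dD (v : G) : (#|nb (@adj G) v| <= D)%N by rewrite /D /max_deg (bigD1 v) //= leq_maxl.
have Dn : (D <= n)%N by apply/bigmax_leqP => v _; apply: max_card.
have mm k' : (m * unit_pow m q k' = unit_pow m q k'.+1)%N by rewrite -add1n -unit_powM expn1.
have D25 : (4000 * unit_pow m q 25 <= D)%N.
  rewrite -(leq_pmul2l m0) mulnCA mm -(ler_nat R).
  apply: (@le_trans _ _ (4000 * n)%N%:R); first by rewrite ler_nat leq_mul2l n_lo orbT.
  rewrite !natrM; apply: (@le_trans _ _ (m%:R * (alpha * n%:R))); last by rewrite ler_wpM2l.
  rewrite mulrA ler_wpM2r // mulrC; apply: (@le_trans _ _ (nu * m%:R)); first by clear -numR; lra.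
  by rewrite ler_wpM2r //; clear -nu0 nutau taua; lra.
have [d [d' [be [qi [qc sH]]]]] := sizes_pow m1 n_lo n_hi D25 Dn.
have uH := units_pow m1 qm4.
have u5 : (5 * unit_pow m q 25)%N%:R <= nu / 2 * n%:R :> R.
  rewrite -(ler_pM2l (_ : 0 < m%:R)) ?ltr0n // -natrM mulnCA mm.
  apply: (@le_trans _ _ (5 * n)%N%:R); first by rewrite ler_nat leq_mul2l n_lo orbT.
  rewrite natrM [X in _ <= X]mulrA ler_wpM2r // mulrC mulrAC.
  by clear -numR; move: numR; move: (nu * m%:R) => x; lra.
have es : symmetric (@adj G) by exact: adj_sym.
have tauD : 1000 * (tau * #|G|%:R) <= D%:R.
  by rewrite mulrA; apply: le_trans Dalpha; rewrite ler_wpM2r.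
have nu38 : 1000 <= 3 / 8 * nu ^+ 2 * m%:R by rewrite -mulrA; clear -mgt; move: mgt; move: (nu ^+ 2 * _) => x; lra.
have [|cell EX] := expansion_nat nu0 t0 kP nu38 es tauD u5.
  move=> S /(rob S); rewrite (_ : robust_nbrs nu S = [set v | nu * #|G|%:R <= #|[set w in S | adj v w]|%:R]) //.
  apply/setP => v; rewrite !inE; congr (_ <= _%:R); apply: eq_card => w; by rewrite !inE andbC.
have wq : (q %/ C <= q)%N by apply: leq_div.
have Clw : (#|{: Cl}| * (q %/ C + 1) <= 2 * q)%N.
  by rewrite EC mulnDr muln1 mulnC mul2n -addnn leq_add ?leq_divM //; clear -qC; lia.
have w_n : (#|G| <= 4 * C * m ^ 26 * (q %/ C))%N.
  apply: leq_trans n_2 _; have : (q <= 2 * (C * (q %/ C)))%N.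
    by have := ltn_ceil q C0; have := qC; clear; move: (q %/ C)%N => x; lia.
  move: (q %/ C)%N (m ^ 26)%N => x y h; have := leq_mul (leqnn (2 * y)%N) h; clear; lia.
have [|||||K [Ks Kf Kc]] := @construct R G Cl (@adj G) cell m q (q %/ C) D d d' be _ _ _ _ _ _ _ _ _ _ qi qc om uH sH wq Clw es
  (@adj_irrefl G) dD _ EX ore' sparse _ [set v : G | q < max_deg G - #|nb (@adj G) v|]%N.
- move=> A B blk; apply: PLP.
  + by rewrite card_prod card_ord.
  + by apply: leq_trans nG; rewrite leq_addl.
  + exact: n_2.
- by rewrite /unit_pow expn1.
- by move=> v; rewrite inE.
- apply: (low_deg_small m1 _ eta0 low).
  apply: leq_trans n_2 _; rewrite expnS leq_mul2r; apply/orP; right.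
  by rewrite leq_mul2r; apply/orP; right; apply: leq_trans m1.
- move=> N; apply: VLP.
  + exact: EC.
  + by rewrite card_prod card_ord.
  + by apply: leq_trans nG; rewrite addnAC leq_addl.
  + exact: w_n.
exact: edge_colorable_matchings Ks Kf Kc.
Qed.

Theorem theorem1p3 (R : realType) :
  exists f : R -> R,
    (forall x : R, 0 < x <= 1 -> 0 < f x <= 1) /\
    (forall x y : R, 0 < x -> x <= y -> y <= 1 -> f x <= f y) /\
    forall alpha : R, 0 < alpha ->
    exists tau : R, 0 < tau < 1 /\
    forall nu : R, 0 < nu <= tau ->
    exists n0 : nat, forall G : sgraph, (n0 <= #|G|)%N ->
      alpha * #|G|%:R <= (max_deg G)%:R ->
      (forall u v : G, adj u v -> (max_deg G + 2 <= deg u + deg v)%N) ->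
      (exists eta : R, 0 < eta <= f nu /\
         #|low_deg G eta|%:R < eta ^+ 2 * #|G|%:R) ->
      robust_expander G nu tau ->
      (chromatic_index G = max_deg G <->
       ~ has_overfull_subgraph G (max_deg G)).
Proof.
exists (@tolerance R); split; [|split] => [x _|x y x0 xy _|alpha alpha0]; first exact: tolerance_itv.
  exact: tolerance_mono.
have a1 : 0 < Num.min alpha 1 <= 1 by rewrite lt_min alpha0 ltr01 ge_min lexx orbT.
exists (Num.min alpha 1 / 1000); split; first by move: a1; move: (Num.min _ _) => x; lra.
move=> nu nuP; have [n0 n0P] := edge_colorable_of_sparse alpha0 nuP; exists n0 => G h1 h2 h3 h4 h5; split.
  by move/chromatic_index_colorable; apply: edge_colorable_not_overfull.
move=> no; apply: chromatic_index_max_deg; apply: n0P => // Z.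
exact: not_overfull_sparse.
Qed.
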